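(* Let $f(z,t)$ be a smooth one-parametric family of conformal mappings onto exteriors of two rectilinear slits as described in the context, and let $a(t)=\log d_{-1}(t)$ (a smooth branch), where $$d_{-1}(t)=-c(t)e^{\gamma(t)z_0(t)}\frac{\prod_{k=1}^4\sigma(z_0(t)-z_k(t))}{\sigma^2(z_0(t)-\overline{z_0(t)})}$$ is the residue of $f(\cdot,t)$ at $z_0(t)$. Then the accessory parameters satisfy the following system of ODEs (argument $t$ omitted): (i) for $1\le l\le4$, $$\dot z_l=\dot z_0-\sum_{j=1,\,j\ne l}^4\gamma_j\bigl[\zeta(z_l-z_j)-\zeta(z_0-z_j)-\eta_1(z_l-z_0)\bigr]-\gamma_l\Bigl(\sum_{s=1,\,s\ne l}^4\zeta(z_l-z_s)+\gamma-\eta_1(z_l-z_0)-\zeta(z_l-z_0)-2\zeta(z_l-\overline z_0)\Bigr);$$ (ii) $$\dot a=\sum_{j=1}^4\gamma_j\bigl[\mathfrak P(z_0-z_j)+\eta_1\bigr];$$ (iii) with $\Delta=4\mathfrak P(z_0-\overline z_0)-\sum_{k=1}^4\mathfrak P(z_0-z_k)$, wherever $\Delta\ne0$, $$\dot y_0=-\sum_{k=1}^4\operatorname{Im}\Bigl[\frac{\mathfrak P(z_0-z_k)}{\Delta}\Bigr]\dot x_k+\operatorname{Re}\Biggl[\frac{4\frac{\partial\zeta(z_0-\overline z_0)}{\partial\omega_2}-\frac{4\beta}{\pi}\frac{\partial\zeta(1/2)}{\partial\omega_2}-2\sum_{k=1}^4\frac{\partial\zeta(z_0-z_k)}{\partial\omega_2}-\mathfrak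 P(z_0-z_3)+\mathfrak P(z_0-z_4)}{\Delta}\Biggr]\dot m.$$ Here $\gamma_k=\dot A_k/D_k$ with $$D_k=c\,e^{\gamma z_k}\,\frac{\prod_{j=1,\,j\ne k}^4\sigma(z_k-z_j)}{\sigma^2(z_k-z_0)\,\sigma^2(z_k-\overline{z}_0)},\qquad 1\le k\le4.$$
   Context: A dot is differentiation with respect to the real parameter $t$ (ranging over an interval), a prime is differentiation with respect to $z$. Weierstrass functions: for each $t$, $\omega_1(t)\equiv1$ and $\omega_2(t)=2m(t)i$ with $m(t)>0$; $\sigma(z)=\sigma(z;1,\omega_2(t))$, $\zeta(z)=\zeta(z;1,\omega_2(t))=\sigma'(z)/\sigma(z)$ and $\mathfrak P(z)=-\zeta'(z)$ are the Weierstrass functions of the lattice generated by the full periods $1,\omega_2(t)$, and $\eta_k(t)=2\zeta(\omega_k(t)/2)$, so $\zeta(z+\omega_k)=\zeta(z)+\eta_k$. The expression $\partial\zeta(u)/\partial\omega_2$ is the partial derivative of $\zeta(u;\omega_1,\omega_2)$ with respect to the period $\omega_2$ with $u$ and $\omega_1$ held fixed, evaluated at $\omega_1=1$, $\omega_2=\omega_2(t)$ and the indicated $u$. The family: $G(t)$ is the exterior (in $\overline{\mathbb C}$) of two disjoint slits (segments), the first on the ray $\{\arg w=\theta\}$, the second on the ray $\{\arg w=\theta+\beta\}$, with $\theta$ and $0<\beta<2\pi$ independent of $t$ (one may take $\theta=0$). For each $t$, $$f(z,t)= c(t)\int_{0}^z e^{\gamma(t)\xi}\frac{\prod_{k=1}^4\sigma(\xi-z_k(t))}{\sigma^2(\xi-z_0(t))\,\sigma^2(\xi-\overline{z_0(t)})}\,d\xi+c_1(t),\qquad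 c(t)\neq0,$$ where $c,c_1,m$, $x_k$ and $y_0$ are smooth functions of $t$, $$z_1=x_1,\quad z_2=x_2,\quad z_3=x_3+im,\quad z_4=x_4-im,\quad z_0=iy_0,$$ with $x_k,y_0$ real, $x_1<x_2<x_1+1$, $x_3<x_4<x_3+1$, $0<y_0<m$, and $$\gamma=\frac{\beta}{\pi}\eta_1,\qquad \sum_{k=1}^4x_k=\frac\beta\pi,\qquad \gamma+\sum_{k=1}^4\zeta(z_0-z_k)-2\zeta(z_0-\overline{z}_0)=0.$$ The function $f(\cdot,t)$ is $1$-periodic and maps the rectangle $\{0<\operatorname{Re}z<1,\ 0<\operatorname{Im}z<m(t)\}$ with identified vertical sides conformally onto $G(t)$, the side $\operatorname{Im}z=0$ corresponding to the first slit and $\operatorname{Im}z=m$ to the second; it is extended by reflection to a meromorphic function on $\mathbb C$ satisfying $f(z+1,t)=f(z,t)$, $f(z+\omega_2(t),t)=e^{2i\beta}f(z,t)$. The points $z_k$ are (modulo the lattice) the preimages of the endpoints of the slits, and $A_k(t):=f(z_k(t),t)$ for the extended function. Thus $A_1,A_2,A_3$ are endpoints of the slits, while for $z_4=(x_4+im)-\omega_2$ the value $A_4$ equals $e^{-2i\beta}$ times the corresponding endpoint. One has $D_k(t)=f''(z_k(t),t)\neq0$. The accessory parameters are $z_1,\dots,z_4$, $z_0=iy_0$, $m$ and $c$ (equivalently $a$). *)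

(* Defs.v *)
From Stdlib Require Import Reals ZArith List.
From Coquelicot Require Import Coquelicot.

Local Open Scope C_scope.

Definition csum {T : Type} (s : list T) (F : T -> C) : C :=
  fold_right Cplus (RtoC 0) (map F s).
Definition cprod {T : Type} (s : list T) (F : T -> C) : C :=
  fold_right Cmult (RtoC 1) (map F s).
Definition rsum {T : Type} (s : list T) (F : T -> R) : R :=
  fold_right Rplus 0%R (map F s).

Definition Cexp (z : C) : C :=
  ((exp (Re z) * cos (Im z))%R, (exp (Re z) * sin (Im z))%R).

Definition Clim_seq (u : nat -> C) : C :=
  (real (Lim_seq (fun n => Re (u n))), real (Lim_seq (fun n => Im (u n)))).

Definition Zrange (N : nat) : list Z :=
  map (fun i => (Z.of_nat i - Z.of_nat N)%Z) (seq 0 (2 * N + 1)).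

Definition lattice_box (N : nat) : list (Z * Z) :=
  filter (fun jk => negb (Z.eqb (fst jk) 0 && Z.eqb (snd jk) 0))
         (list_prod (Zrange N) (Zrange N)).

Definition lattice_point (w1 w2 : C) (jk : Z * Z) : C :=
  RtoC (IZR (fst jk)) * w1 + RtoC (IZR (snd jk)) * w2.

Definition sigma_factor (w z : C) : C :=
  (1 - z / w) * Cexp (z / w + (z / w) ^ 2 / 2).

(* [w1], [w2] are the full periods. The product over the nonzero lattice points converges absolutely when
   [w1], [w2] are linearly independent over the reals, so exhausting the
   lattice by square boxes gives the usual unordered product. *)
Definition wsigma (w1 w2 z : C) : C :=
  z * Clim_seq (fun N => cprod (lattice_box N)
                  (fun jk => sigma_factor (lattice_point w1 w2 jk) z)).

Definition wzeta (w1 w2 z : C) : C := C_derive (wsigma w1 w2) z / wsigma w1 w2 z.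

Definition wp (w1 w2 z : C) : C := - C_derive (wzeta w1 w2) z.

Definition dzeta_dw2 (w1 w2 u : C) : C := C_derive (fun w => wzeta w1 w u) w2.

Definition is_interval (I : R -> Prop) : Prop :=
  (forall a b x : R, I a -> I b -> (a <= x <= b)%R -> I x) /\
  (exists a b : R, I a /\ I b /\ (a < b)%R).

(* The derivative relative to [I]: one-sided at an endpoint belonging to [I]. *)
Definition is_derive_on {V : NormedModule R_AbsRing}
    (I : R -> Prop) (g : R -> V) (t : R) (l : V) : Prop :=
  filterdiff g (within I (locally t)) (fun h : R => scal h l).

Definition dot (V : CompleteNormedModule R_AbsRing)
    (I : R -> Prop) (g : R -> V) (t : R) : V :=
  iota (fun l : V => is_derive_on I g t l).

Definition dotR : (R -> Prop) -> (R -> R) -> R -> R :=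
  dot R_CompleteNormedModule.
Definition dotC : (R -> Prop) -> (R -> C) -> R -> C :=
  dot C_R_CompleteNormedModule.

(* [G n] is the n-th derivative of [g] on [I]. *)
Definition smooth_on (V : NormedModule R_AbsRing)
    (I : R -> Prop) (g : R -> V) : Prop :=
  exists G : nat -> R -> V,
    (forall t, I t -> G O t = g t) /\
    (forall n t, I t -> is_derive_on I (G n) t (G (S n) t)).

Definition smoothR : (R -> Prop) -> (R -> R) -> Prop :=
  smooth_on R_NormedModule.
Definition smoothC : (R -> Prop) -> (R -> C) -> Prop :=
  smooth_on C_R_NormedModule.

(* [None] is the point at infinity. *)
Definition sphere : Type := option C.

Definition chart0 (w : sphere) : C :=
  match w with Some u => u | None => 0 end.
Definition chart_inf (w : sphere) : C :=
  match w with Some u => / u | None => 0 end.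

Definition C_diff (g : C -> C) (z : C) : Prop :=
  @ex_derive C_AbsRing C_NormedModule g z.

Definition sphere_holomorphic (F : C -> sphere) (z : C) : Prop :=
  match F z with
  | Some _ => @locally C_UniformSpace z
      (fun u => F u <> None /\ C_diff (fun v => chart0 (F v)) u)
  | None => @locally C_UniformSpace z
      (fun u => F u <> Some (RtoC 0) /\ C_diff (fun v => chart_inf (F v)) u)
  end.

Definition C1_arc (Dom : C -> Prop) (p dp : R -> C) : Prop :=
  forall s : R, (0 <= s <= 1)%R ->
    Dom (p s) /\
    @is_derive R_AbsRing C_R_NormedModule p s (dp s) /\
    @continuous R_UniformSpace C_UniformSpace dp s.

(* [path_integral g Dom a b v]: [v] is the integral of [g] along some
   piecewise C^1 path in [Dom] from [a] to [b]. *)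
Inductive path_integral (g : C -> C) (Dom : C -> Prop) : C -> C -> C -> Prop :=
| path_nil (a : C) : path_integral g Dom a a 0
| path_arc (p dp : R -> C) (b v w : C) :
    C1_arc Dom p dp ->
    @is_RInt C_R_NormedModule (fun s => g (p s) * dp s) 0 1 v ->
    path_integral g Dom (p 1%R) b w ->
    path_integral g Dom (p 0%R) b (v + w).

(* The values at one instant of the parameters of the representation of [f];
   [px k] is used for k = 1, 2, 3, 4 only. *)
Record params := Params {
  pm : R;
  px : nat -> R;
  py0 : R;
  pc : C;
  pc1 : C
}.

Definition idx : list nat := 1%nat :: 2%nat :: 3%nat :: 4%nat :: nil.
Definition idx_but (l : nat) : list nat :=
  filter (fun j => negb (Nat.eqb j l)) idx.

Definition omega2 (P : params) : C := 2 * pm P * Ci.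

Definition zpt (P : params) (k : nat) : C :=
  match k with
  | 3%nat => px P 3%nat + Ci * pm P
  | 4%nat => px P 4%nat - Ci * pm P
  | _ => RtoC (px P k)
  end.

Definition zpole (P : params) : C := Ci * py0 P.

Definition psigma (P : params) (u : C) : C := wsigma 1 (omega2 P) u.
Definition pzeta (P : params) (u : C) : C := wzeta 1 (omega2 P) u.
Definition pwp (P : params) (u : C) : C := wp 1 (omega2 P) u.
Definition pdzeta (P : params) (u : C) : C := dzeta_dw2 1 (omega2 P) u.

Definition eta1 (P : params) : C := 2 * pzeta P (1 / 2).

Definition gamma0 (beta : R) (P : params) : C := (beta / PI)%R * eta1 P.

Definition integrand (beta : R) (P : params) (xi : C) : C :=
  Cexp (gamma0 beta P * xi) * cprod idx (fun k => psigma P (xi - zpt P k))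
  / (psigma P (xi - zpole P) ^ 2 * psigma P (xi - Cconj (zpole P)) ^ 2).

Definition is_pole (P : params) (z : C) : Prop :=
  exists jk : Z * Z,
    z = zpole P + lattice_point 1 (omega2 P) jk \/
    z = Cconj (zpole P) + lattice_point 1 (omega2 P) jk.

(* The residue d_{-1} of [f] at [zpole]. *)
Definition residue (beta : R) (P : params) : C :=
  - pc P * Cexp (gamma0 beta P * zpole P)
  * cprod idx (fun k => psigma P (zpole P - zpt P k))
  / psigma P (zpole P - Cconj (zpole P)) ^ 2.

Definition Dcoef (beta : R) (P : params) (k : nat) : C :=
  pc P * Cexp (gamma0 beta P * zpt P k)
  * (cprod (idx_but k) (fun j => psigma P (zpt P k - zpt P j))
     / (psigma P (zpt P k - zpole P) ^ 2
        * psigma P (zpt P k - Cconj (zpole P)) ^ 2)).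

Record params_ok (beta : R) (P : params) : Prop := {
  ok_m : (0 < pm P)%R;
  ok_c : pc P <> 0;
  ok_x12 : (px P 1 < px P 2 < px P 1 + 1)%R;
  ok_x34 : (px P 3 < px P 4 < px P 3 + 1)%R;
  ok_y0 : (0 < py0 P < pm P)%R;
  ok_sum : rsum idx (px P) = (beta / PI)%R;
  ok_res : gamma0 beta P + csum idx (fun k => pzeta P (zpole P - zpt P k))
           - 2 * pzeta P (zpole P - Cconj (zpole P)) = 0
}.

Record smooth_params (I : R -> Prop) (P : R -> params) : Prop := {
  sm_m : smoothR I (fun t => pm (P t));
  sm_x : forall k, In k idx -> smoothR I (fun t => px (P t) k);
  sm_y0 : smoothR I (fun t => py0 (P t));
  sm_c : smoothC I (fun t => pc (P t));
  sm_c1 : smoothC I (fun t => pc1 (P t))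
}.

(* The segment with endpoints [p e^(i th)], [q e^(i th)], on the ray
   {arg w = th} when [0 < p]. *)
Definition ray_point (th r : R) : C := r * Cexp (Ci * th).
Definition ray_segment (th p q : R) (w : C) : Prop :=
  exists r : R, (p <= r <= q)%R /\ w = ray_point th r.

Definition slit_exterior (S1 S2 : C -> Prop) (w : sphere) : Prop :=
  match w with Some u => ~ S1 u /\ ~ S2 u | None => True end.

(* The half-open rectangle is a fundamental domain of the strip modulo 1, i.e.
   the rectangle of width 1 and height [m] with identified vertical sides. *)
Definition in_rect (m : R) (z : C) : Prop :=
  (0 <= Re z < 1)%R /\ (0 < Im z < m)%R.

Record conformal_from_cylinder
    (m : R) (F : C -> sphere) (G : sphere -> Prop) : Prop := {
  cyl_periodic : forall z, F (z + 1) = F z;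
  cyl_holomorphic : forall z, (0 < Im z < m)%R -> sphere_holomorphic F z;
  cyl_injective : forall z z', in_rect m z -> in_rect m z' -> F z = F z' -> z = z';
  cyl_image : forall w, G w <-> exists z, in_rect m z /\ F z = w
}.

(* The value of the extended function at the k-th point; these points are
   never poles, so the value is finite. *)
Definition Aval (F : C -> sphere) (P : params) (k : nat) : C :=
  chart0 (F (zpt P k)).

(* [F] is the extended function at one instant. The slits have endpoint moduli
   [p1 < q1] and [p2 < q2]; they are disjoint since their rays are distinct. *)
Record slit_map (theta beta : R) (P : params) (F : C -> sphere)
    (p1 q1 p2 q2 : R) : Prop := {
  sl_1 : (0 < p1 < q1)%R;
  sl_2 : (0 < p2 < q2)%R;
  sl_conformal :
    conformal_from_cylinder (pm P) F
      (slit_exterior (ray_segment theta p1 q1) (ray_segment (theta + beta) p2 q2));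
  sl_side1 : forall w : C, ray_segment theta p1 q1 w <->
    exists x : R, F (RtoC x) = Some w;
  sl_side2 : forall w : C, ray_segment (theta + beta) p2 q2 w <->
    exists x : R, F (x + Ci * pm P) = Some w;
  sl_formula : forall z v : C, ~ is_pole P z ->
    path_integral (integrand beta P) (fun u => ~ is_pole P u) 0 z v ->
    F z = Some (pc P * v + pc1 P);
  sl_meromorphic : forall z, sphere_holomorphic F z;
  sl_reflection : forall z,
    F (Cconj z) = option_map (fun w => Cexp (Ci * (2 * theta)) * Cconj w) (F z);
  sl_omega2 : forall z,
    F (z + omega2 P) = option_map (fun w => Cexp (Ci * (2 * beta)) * w) (F z);
  sl_ends1 :
    (Aval F P 1 = ray_point theta p1 /\ Aval F P 2 = ray_point theta q1) \/
    (Aval F P 1 = ray_point theta q1 /\ Aval F P 2 = ray_point theta p1);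
  (* zpt P 4 lies on Im z = -m, hence the factor *)
  sl_ends2 :
    (Aval F P 3 = ray_point (theta + beta) p2 /\
     Aval F P 4 = Cexp (- (Ci * (2 * beta))) * ray_point (theta + beta) q2) \/
    (Aval F P 3 = ray_point (theta + beta) q2 /\
     Aval F P 4 = Cexp (- (Ci * (2 * beta))) * ray_point (theta + beta) p2)
}.

Definition gam (I : R -> Prop) (beta : R) (P : R -> params)
    (f : R -> C -> sphere) (k : nat) (t : R) : C :=
  dotC I (fun s => Aval (f s) (P s) k) t / Dcoef beta (P t) k.

Definition Delta_P (P : params) : C :=
  4 * pwp P (zpole P - Cconj (zpole P))
  - csum idx (fun k => pwp P (zpole P - zpt P k)).

(* Main.v *)
(* Along the family put h = (df/dt) / f'. Since f is 1-periodic and f(z + omega2) = e^(2 i beta) f(z),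
   h is 1-periodic and h(z + omega2) = h(z) - d omega2/dt. Its only singularities are simple poles at
   the z_k, where df/dt = dA_k/dt and f' vanishes to first order, so the residue there is gamma_k; at
   the double pole z0 of f' it is regular, with h(z0) = - dz0/dt and h'(z0) = - da/dt, and the
   conjugate pole is handled by reflection. Hence h(z) - sum_k gamma_k (zeta(z - z_k) - eta1 z) extends
   to an entire function whose shifts by periods change it by constants; as it is 1-periodic, an
   energy argument makes it constant. Comparing its values and derivatives at z0 and the constant term
   of h at z_l gives (i) and (ii); (iii) is the derivative in t of the condition that f' has no
   residue at z0. *)

Require Import Defs.
From Stdlib Require Import Reals List Lra Lia ZArith Classical ClassicalEpsilon Permutation.
From Coquelicot Require Import Coquelicot.
Local Open Scope C_scope.

(** * Limits and complex derivatives *)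

(** The existence of df/dt is itself to be proved: it is read off from the integral formula for f,
    along a route of four segments that avoids the poles at all nearby times. The time derivative
    [jd] is a limit taken jointly in z and in s -> t. Joint limits are what Weierstrass' theorem
    needs to exchange d/dt with d/dz, and they allow evaluation at moving points such as z_k and z0.
    Since the period depends on t as well, sigma is treated as a function of z and omega_2, analytic
    in both, starting from the convergence of its product. Laurent series do not occur. A zero or a
    pole is divided out as an explicit factor, and coefficients become values and derivatives of the
    regular quotient. The delicate point is z0, where f has no closed form: only d/dt of f' is
    explicit there, and it must be integrated back. This succeeds because the residue condition
    holds for all t, so that its time derivative removes the term in 1 / (z - z0). As h minus the
    zeta terms gains a constant along omega_2, the energy argument is applied to its derivative. *)

Definition near (p : C) : (C -> Prop) -> Prop :=
  fun P => exists d : R, (0 < d)%R /\ forall z, (Cmod (z - p) < d)%R -> P z.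
Definition nearR (x : R) : (R -> Prop) -> Prop :=
  fun P => exists d : R, (0 < d)%R /\ forall s, (Rabs (s - x) < d)%R -> P s.
Notation tends F g l := (filterlim g F (near l)).
Definition cts (g : C -> C) (p : C) : Prop := tends (near p) g (g p).
Definition contR (g : R -> C) (s : R) : Prop := tends (nearR s) g (g s).
(** The little-o form with a non-strict bound admits w = z and passes to limits, unlike a difference
    quotient. *)
Definition cderiv (g : C -> C) (z l : C) : Prop :=
  forall e : R, (0 < e)%R ->
    near z (fun w => (Cmod (g w - g z - l * (w - z)) <= e * Cmod (w - z))%R).
Definition rderiv (g : R -> C) (s : R) (l : C) : Prop :=
  forall e : R, (0 < e)%R ->
    nearR s (fun x => (Cmod (g x - g s - l * (x - s)%R) <= e * Rabs (x - s))%R).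

Lemma Cmod_sub_self (z : C) : Cmod (z - z) = 0%R.
Proof. replace (z - z) with (RtoC 0) by ring. apply Cmod_0. Qed.

Lemma Cmod_sub_sym (z w : C) : Cmod (z - w) = Cmod (w - z).
Proof. replace (z - w) with (- (w - z)) by ring. apply Cmod_opp. Qed.

Lemma Cmod_sub_triangle (z w u : C) : (Cmod (z - u) <= Cmod (z - w) + Cmod (w - u))%R.
Proof. replace (z - u) with ((z - w) + (w - u)) by ring. apply Cmod_triangle. Qed.

Lemma Cmod_sub_ge (z w : C) : (Cmod z - Cmod (z - w) <= Cmod w)%R.
Proof.
  generalize (Cmod_triangle (z - w) w); replace (z - w + w) with z by ring. lra.
Qed.

Lemma Cinv_nonzero (z : C) : z <> 0 -> / z <> 0.
Proof.
  intros H E. assert (K := Cinv_r z H). rewrite E, Cmult_0_r in K.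
  apply RtoC_inj in K. lra.
Qed.

Global Instance near_proper (p : C) : ProperFilter (near p).
Proof.
  split.
  - intros P [d [Hd H]]. exists p. apply H. rewrite Cmod_sub_self; auto.
  - split.
    + exists 1%R; split; auto with real.
    + intros P Q [d [Hd H]] [d' [Hd' H']]. exists (Rmin d d'); split.
      apply Rmin_pos; auto.
      intros z Hz; split; [apply H | apply H'];
        eapply Rlt_le_trans; eauto using Rmin_l, Rmin_r.
    + intros P Q HPQ [d [Hd H]]. exists d; split; auto.
Qed.

Global Instance nearR_proper (p : R) : ProperFilter (nearR p).
Proof.
  split.
  - intros P [d [Hd H]]. exists p. apply H. rewrite Rminus_diag, Rabs_R0; auto.
  - split.
    + exists 1%R; split; auto with real.
    + intros P Q [d [Hd H]] [d' [Hd' H']]. exists (Rmin d d'); split.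
      apply Rmin_pos; auto.
      intros z Hz; split; [apply H | apply H'];
        eapply Rlt_le_trans; eauto using Rmin_l, Rmin_r.
    + intros P Q HPQ [d [Hd H]]. exists d; split; auto.
Qed.

Lemma near_ball (p : C) (d : R) : (0 < d)%R -> near p (fun z => (Cmod (z - p) < d)%R).
Proof. intros; exists d; auto. Qed.

Lemma near_self (p : C) (P : C -> Prop) : near p P -> P p.
Proof. intros [d [Hd H]]; apply H; rewrite Cmod_sub_self; auto. Qed.

Section Tends.
Context {T : Type} (F : (T -> Prop) -> Prop) {FF : Filter F}.

Lemma tends_eps (g : T -> C) (l : C) :
  tends F g l <-> forall e : R, (0 < e)%R -> F (fun x => (Cmod (g x - l) < e)%R).
Proof.
  split.
  - intros H e He. apply (H (fun y => (Cmod (y - l) < e)%R)). apply near_ball; auto.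
  - intros H P [d [Hd HP]]. unfold filtermap.
    apply filter_imp with (2 := H d Hd). intros; apply HP; auto.
Qed.

Lemma tends_const (c : C) : tends F (fun _ => c) c.
Proof.
  apply tends_eps; intros. apply filter_forall. intros; rewrite Cmod_sub_self; auto.
Qed.

Lemma tends_ext (g h : T -> C) (l : C) :
  F (fun x => g x = h x) -> tends F g l -> tends F h l.
Proof. intros; eapply filterlim_ext_loc; eauto. Qed.

Lemma tends_plus (g h : T -> C) (l m : C) :
  tends F g l -> tends F h m -> tends F (fun x => g x + h x) (l + m).
Proof.
  rewrite !tends_eps. intros Hg Hh e He.
  assert (He2 : (0 < e / 2)%R) by lra.
  generalize (filter_and _ _ (Hg _ He2) (Hh _ He2)). apply filter_imp.
  intros x [H1 H2]. replace (g x + h x - (l + m)) with ((g x - l) + (h x - m)) by ring.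
  eapply Rle_lt_trans; [apply Cmod_triangle | lra].
Qed.

Lemma tends_opp (g : T -> C) (l : C) : tends F g l -> tends F (fun x => - g x) (- l).
Proof.
  rewrite !tends_eps. intros Hg e He. generalize (Hg _ He). apply filter_imp.
  intros x H. replace (- g x - - l) with (- (g x - l)) by ring. rewrite Cmod_opp; auto.
Qed.

Lemma tends_minus (g h : T -> C) (l m : C) :
  tends F g l -> tends F h m -> tends F (fun x => g x - h x) (l - m).
Proof. intros. apply tends_plus; auto. apply tends_opp; auto. Qed.

Lemma tends_mult (g h : T -> C) (l m : C) :
  tends F g l -> tends F h m -> tends F (fun x => g x * h x) (l * m).
Proof.
  rewrite !tends_eps. intros Hg Hh e He.
  set (K := (Cmod l + Cmod m + 1)%R).
  assert (HK : (0 < K)%R) by (unfold K; generalize (Cmod_ge_0 l) (Cmod_ge_0 m); lra).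
  (* d <= 1 absorbs the product of the two errors, so that the total error is at most d K <= e /
     2. *)
  set (d := Rmin 1 (e / (2 * K))).
  assert (Hd : (0 < d)%R).
  { apply Rmin_pos; [lra|]. apply Rdiv_lt_0_compat; lra. }
  generalize (filter_and _ _ (Hg _ Hd) (Hh _ Hd)). apply filter_imp.
  intros x [H1 H2].
  replace (g x * h x - l * m) with
    ((g x - l) * (h x - m) + ((g x - l) * m + l * (h x - m))) by ring.
  eapply Rle_lt_trans; [apply Cmod_triangle|].
  eapply Rle_lt_trans; [apply Rplus_le_compat_l; apply Cmod_triangle|].
  rewrite !Cmod_mult.
  assert (Hd1 : (d <= 1)%R) by apply Rmin_l.
  assert (Hd2 : (d * (2 * K) <= e)%R).
  { apply Rle_trans with (e / (2 * K) * (2 * K))%R.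
    apply Rmult_le_compat_r; [lra|apply Rmin_r]. right; field; lra. }
  generalize (Cmod_ge_0 l) (Cmod_ge_0 m) (Cmod_ge_0 (g x - l)) (Cmod_ge_0 (h x - m)).
  intros. apply Rle_lt_trans with (d * 1 + (d * Cmod m + Cmod l * d))%R.
  { repeat apply Rplus_le_compat; apply Rmult_le_compat; lra. }
  apply Rle_lt_trans with (d * K)%R. unfold K; right; ring.
  assert (0 < d * K)%R by (apply Rmult_lt_0_compat; lra). lra.
Qed.

Lemma tends_inv (g : T -> C) (l : C) :
  l <> 0 -> tends F g l -> tends F (fun x => / g x) (/ l).
Proof.
  rewrite !tends_eps. intros Hl Hg e He.
  assert (Hl' : (0 < Cmod l)%R) by (apply Cmod_gt_0; auto).
  (* The first bound keeps |g x| above |l| / 2; with it the second one gives |g x - l| < e |g x|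
     |l|. *)
  set (d := Rmin (Cmod l / 2) (e * (Cmod l * Cmod l) / 4)).
  assert (Hd : (0 < d)%R).
  { apply Rmin_pos; [lra|]. apply Rdiv_lt_0_compat; [|lra].
    repeat apply Rmult_lt_0_compat; auto. }
  generalize (Hg _ Hd). apply filter_imp. intros x Hx.
  assert (H1 : (Cmod (g x - l) < Cmod l / 2)%R) by (eapply Rlt_le_trans; [exact Hx|apply Rmin_l]).
  assert (H2 : (Cmod (g x - l) < e * (Cmod l * Cmod l) / 4)%R)
    by (eapply Rlt_le_trans; [exact Hx|apply Rmin_r]).
  assert (H3 : (Cmod l / 2 < Cmod (g x))%R).
  { generalize (Cmod_sub_ge l (g x)). rewrite (Cmod_sub_sym l). lra. }
  assert (Hgx : g x <> 0) by (apply Cmod_gt_0; lra).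
  replace (/ g x - / l) with ((l - g x) / (g x * l)) by (field; auto).
  rewrite Cmod_div by (apply Cmult_neq_0; auto).
  rewrite Cmod_mult, Cmod_sub_sym.
  apply Rmult_lt_reg_r with (Cmod (g x) * Cmod l)%R. apply Rmult_lt_0_compat; lra.
  unfold Rdiv; rewrite Rmult_assoc, Rinv_l by (apply Rgt_not_eq; apply Rmult_lt_0_compat; lra).
  assert (Cmod l / 2 * Cmod l < Cmod (g x) * Cmod l)%R by (apply Rmult_lt_compat_r; lra).
  assert (e * (Cmod l / 2 * Cmod l) < e * (Cmod (g x) * Cmod l))%R
    by (apply Rmult_lt_compat_l; lra).
  assert (0 < e * (Cmod l * Cmod l))%R by (repeat apply Rmult_lt_0_compat; auto).
  lra.
Qed.

Lemma tends_div (g h : T -> C) (l m : C) :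
  m <> 0 -> tends F g l -> tends F h m -> tends F (fun x => g x / h x) (l / m).
Proof. intros. apply tends_mult; auto. apply tends_inv; auto. Qed.

Lemma tends_comp_cts (f : C -> C) (g : T -> C) (l : C) :
  cts f l -> tends F g l -> tends F (fun x => f (g x)) (f l).
Proof. intros Hf Hg. exact (filterlim_comp _ _ _ g f F (near l) _ Hg Hf). Qed.

Lemma tends_neq (g : T -> C) (l : C) : tends F g l -> l <> 0 -> F (fun x => g x <> 0).
Proof.
  intros H Hl. rewrite tends_eps in H.
  assert (Hl' : (0 < Cmod l)%R) by (apply Cmod_gt_0; auto).
  generalize (H _ Hl'). apply filter_imp. intros x Hx E. rewrite E in Hx.
  replace (0 - l) with (- l) in Hx by ring. rewrite Cmod_opp in Hx. lra.
Qed.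
End Tends.

Lemma tends_unique {T : Type} (F : (T -> Prop) -> Prop) {FF : ProperFilter F}
    (g : T -> C) (l m : C) : tends F g l -> tends F g m -> l = m.
Proof.
  rewrite !tends_eps by apply FF. intros Hl Hm.
  destruct (classic (l = m)) as [E|E]; auto. exfalso.
  assert (Hp : (0 < Cmod (l - m) / 2)%R).
  { assert (0 < Cmod (l - m))%R. apply Cmod_gt_0. intros H; apply E.
    replace l with (l - m + m) by ring. rewrite H; ring. lra. }
  destruct (filter_ex _ (filter_and _ _ (Hl _ Hp) (Hm _ Hp))) as [x [H1 H2]].
  generalize (Cmod_sub_triangle l (g x) m). rewrite (Cmod_sub_sym l (g x)). lra.
Qed.

Lemma tends_bound {T : Type} (F : (T -> Prop) -> Prop) {FF : ProperFilter F}
    (g : T -> C) (l : C) (M : R) :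
  tends F g l -> F (fun x => (Cmod (g x) <= M)%R) -> (Cmod l <= M)%R.
Proof.
  intros H HM. rewrite tends_eps in H by apply FF.
  apply Rnot_lt_le; intros Hlt.
  assert (Hp : (0 < Cmod l - M)%R) by lra.
  destruct (filter_ex _ (filter_and _ _ (H _ Hp) HM)) as [x [H1 H2]].
  generalize (Cmod_sub_ge l (g x)). rewrite Cmod_sub_sym. lra.
Qed.

Lemma cts_id (p : C) : cts (fun z => z) p.
Proof. intros P H; exact H. Qed.
Lemma cts_const (c p : C) : cts (fun _ => c) p.
Proof. apply tends_const; apply near_proper. Qed.
Lemma cts_plus (f g : C -> C) (p : C) : cts f p -> cts g p -> cts (fun z => f z + g z) p.
Proof. intros. apply tends_plus; auto; apply near_proper. Qed.
Lemma cts_opp (f : C -> C) (p : C) : cts f p -> cts (fun z => - f z) p.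
Proof. intros. apply tends_opp; auto; apply near_proper. Qed.
Lemma cts_minus (f g : C -> C) (p : C) : cts f p -> cts g p -> cts (fun z => f z - g z) p.
Proof. intros. apply tends_minus; auto; apply near_proper. Qed.
Lemma cts_mult (f g : C -> C) (p : C) : cts f p -> cts g p -> cts (fun z => f z * g z) p.
Proof. intros. apply tends_mult; auto; apply near_proper. Qed.
Lemma cts_inv (f : C -> C) (p : C) : f p <> 0 -> cts f p -> cts (fun z => / f z) p.
Proof. intros. apply tends_inv; auto; apply near_proper. Qed.
Lemma cts_div (f g : C -> C) (p : C) :
  g p <> 0 -> cts f p -> cts g p -> cts (fun z => f z / g z) p.
Proof. intros. apply cts_mult; auto. apply cts_inv; auto. Qed.
Lemma cts_comp (f g : C -> C) (p : C) : cts f (g p) -> cts g p -> cts (fun z => f (g z)) p.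
Proof. intros H H0. apply (tends_comp_cts (near p) f g (g p)); auto. Qed.
Lemma cts_ext (f g : C -> C) (p : C) : near p (fun z => f z = g z) -> cts f p -> cts g p.
Proof.
  intros H Hf. unfold cts. rewrite <- (near_self _ _ H).
  eapply tends_ext; eauto; apply near_proper.
Qed.

Lemma cderiv_cts (g : C -> C) (z l : C) : cderiv g z l -> cts g z.
Proof.
  intros H. apply tends_eps. apply near_proper. intros e He.
  assert (H1 := H 1%R Rlt_0_1). set (K := (1 + Cmod l)%R).
  assert (HK : (0 < K)%R) by (unfold K; generalize (Cmod_ge_0 l); lra).
  assert (Hd : (0 < e / K)%R) by (apply Rdiv_lt_0_compat; lra).
  generalize (filter_and _ _ H1 (near_ball z _ Hd)). apply filter_imp.
  intros w [Hw1 Hw2].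
  replace (g w - g z) with ((g w - g z - l * (w - z)) + l * (w - z)) by ring.
  eapply Rle_lt_trans; [apply Cmod_triangle|]. rewrite Cmod_mult.
  apply Rle_lt_trans with (K * Cmod (w - z))%R. unfold K; lra.
  apply Rmult_lt_compat_l with (r := K) in Hw2; auto.
  replace (K * (e / K))%R with e in Hw2 by (field; lra). auto.
Qed.

(** Caratheodory's form of differentiability: the difference quotient, completed by l at z, is
    continuous there. The product and chain rules become algebra together with continuity. *)
Lemma cderiv_quot (g : C -> C) (z l : C) :
  cderiv g z l <-> exists k : C -> C, cts k z /\ k z = l /\
    forall w, g w = g z + k w * (w - z).
Proof.
  split.
  - intros H.
    exists (fun w => if excluded_middle_informative (w = z) then l
                     else (g w - g z) / (w - z)).
    split; [|split].
    + apply tends_eps. apply near_proper. intros e He.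
      assert (He2 : (0 < e / 2)%R) by lra.
      generalize (H _ He2). apply filter_imp. intros w Hw.
      destruct (excluded_middle_informative (z = z)) as [_|C0]; [|tauto].
      destruct (excluded_middle_informative (w = z)) as [E|E].
      rewrite Cmod_sub_self; auto.
      assert (Hn : w - z <> 0) by (intros E'; apply E; replace w with (w - z + z) by ring;
        rewrite E'; ring).
      replace ((g w - g z) / (w - z) - l) with ((g w - g z - l * (w - z)) / (w - z))
        by (field; auto).
      rewrite Cmod_div by auto. apply Cmod_gt_0 in Hn.
      apply Rle_lt_trans with (e / 2)%R; [|lra].
      apply Rmult_le_reg_r with (Cmod (w - z)); auto.
      unfold Rdiv at 1. rewrite Rmult_assoc, Rinv_l by lra. lra.
    + destruct (excluded_middle_informative (z = z)); tauto.
    + intros w. destruct (excluded_middle_informative (w = z)) as [E|E].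
      rewrite E; ring.
      assert (Hn : w - z <> 0) by (intros E'; apply E; replace w with (w - z + z) by ring;
        rewrite E'; ring).
      field; auto.
  - intros [k [Hk [Hl E]]] e He. unfold cts in Hk. rewrite tends_eps in Hk by apply near_proper.
    generalize (Hk e He). apply filter_imp. intros w Hw. rewrite (E w).
    replace (g z + k w * (w - z) - g z - l * (w - z)) with ((k w - k z) * (w - z))
      by (rewrite Hl; ring).
    rewrite Cmod_mult. apply Rmult_le_compat_r. apply Cmod_ge_0. lra.
Qed.

Lemma cderiv_const (c z : C) : cderiv (fun _ => c) z 0.
Proof.
  apply cderiv_quot. exists (fun _ => 0). repeat split; try apply cts_const. intros; ring.
Qed.
Lemma cderiv_id (z : C) : cderiv (fun z => z) z 1.
Proof.
  apply cderiv_quot. exists (fun _ => 1). repeat split; try apply cts_const. intros; ring.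
Qed.
Lemma cderiv_plus (f g : C -> C) (z l m : C) :
  cderiv f z l -> cderiv g z m -> cderiv (fun w => f w + g w) z (l + m).
Proof.
  rewrite !cderiv_quot. intros [k [Hk [Hl E]]] [k' [Hk' [Hl' E']]].
  exists (fun w => k w + k' w). split; [apply cts_plus; auto | split].
  congruence. intros w; rewrite E, E'; ring.
Qed.
Lemma cderiv_mult (f g : C -> C) (z l m : C) :
  cderiv f z l -> cderiv g z m -> cderiv (fun w => f w * g w) z (l * g z + f z * m).
Proof.
  intros Hf Hg. assert (Cg := cderiv_cts _ _ _ Hg). revert Hf Hg.
  rewrite !cderiv_quot. intros [k [Hk [Hl E]]] [k' [Hk' [Hl' E']]].
  exists (fun w => k w * g w + f z * k' w). split; [|split].
  apply cts_plus; apply cts_mult; auto using cts_const. congruence.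
  intros w; rewrite (E w), (E' w); ring.
Qed.
Lemma cderiv_comp (f g : C -> C) (z l m : C) :
  cderiv f (g z) l -> cderiv g z m -> cderiv (fun w => f (g w)) z (l * m).
Proof.
  intros Hf Hg. assert (Cg := cderiv_cts _ _ _ Hg). revert Hf Hg.
  rewrite !cderiv_quot. intros [k [Hk [Hl E]]] [k' [Hk' [Hl' E']]].
  exists (fun w => k (g w) * k' w). split; [|split].
  apply cts_mult; auto. apply cts_comp; auto. congruence.
  intros w; rewrite (E (g w)). replace (g w - g z) with (k' w * (w - z)) by (rewrite E'; ring).
  ring.
Qed.
Lemma cderiv_inv (f : C -> C) (z l : C) :
  f z <> 0 -> cderiv f z l -> cderiv (fun w => / f w) z (- l / (f z * f z)).
Proof.
  intros H Hf. assert (Cf := cderiv_cts _ _ _ Hf). revert Hf.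
  intros Hf e He. apply cderiv_quot in Hf. destruct Hf as [k [Hk [Hl E]]].
  (* The slope [- k w / (f w * f z)] reproduces [/ f w] only where f w is nonzero, so the derivative
     is computed for this expression and transferred near z. *)
  assert (HH : cderiv (fun w => / f z + (- k w / (f w * f z)) * (w - z)) z (- l / (f z * f z))).
  { apply cderiv_quot. exists (fun w => - k w / (f w * f z)). split; [|split].
    - apply cts_div. apply Cmult_neq_0; auto. apply cts_opp; auto.
      apply cts_mult; auto using cts_const.
    - rewrite Hl; auto.
    - intros w. generalize (- k w / (f w * f z)) (- k z / (f z * f z)) (/ f z). intros; ring. }
  generalize (filter_and _ _ (HH e He) (tends_neq _ _ _ Cf H)). apply filter_imp.
  intros w [Hw Hn].
  replace (/ f w - / f z) with
    (/ f z + - k w / (f w * f z) * (w - z) - (/ f z + - k z / (f z * f z) * (z - z))).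
  exact Hw. rewrite (E w). rewrite E in Hn. field. auto.
Qed.
Lemma cderiv_ext (f g : C -> C) (z l : C) :
  near z (fun w => f w = g w) -> cderiv f z l -> cderiv g z l.
Proof.
  intros H Hf e He. generalize (filter_and _ _ H (Hf e He)). apply filter_imp.
  intros w [H1 H2]. rewrite <- H1, <- (near_self _ _ H). auto.
Qed.
Lemma cderiv_eq (f : C -> C) (z l m : C) : cderiv f z l -> l = m -> cderiv f z m.
Proof. intros; subst; auto. Qed.
Lemma cderiv_opp (f : C -> C) (z l : C) : cderiv f z l -> cderiv (fun w => - f w) z (- l).
Proof.
  rewrite !cderiv_quot. intros [k [Hk [Hl E]]].
  exists (fun w => - k w). split; [apply cts_opp; auto | split].
  congruence. intros w; rewrite E; ring.
Qed.
Lemma cderiv_minus (f g : C -> C) (z l m : C) :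
  cderiv f z l -> cderiv g z m -> cderiv (fun w => f w - g w) z (l - m).
Proof. intros; apply cderiv_plus; auto. apply cderiv_opp; auto. Qed.
Lemma cderiv_div (f g : C -> C) (z l m : C) : g z <> 0 ->
  cderiv f z l -> cderiv g z m ->
  cderiv (fun w => f w / g w) z ((l * g z - f z * m) / (g z * g z)).
Proof.
  intros Hn Hf Hg. eapply cderiv_eq. apply cderiv_mult; eauto. apply cderiv_inv; eauto.
  simpl. field; auto.
Qed.

Lemma cderiv_C_derive (g : C -> C) (z l : C) : cderiv g z l -> C_derive g z = l.
Proof.
  intros H. apply is_C_derive_unique. split.
  - apply is_linear_scal_l.
  - intros x Hx eps. assert (E : z = x).
    { apply (is_filter_lim_locally_unique (K := C_AbsRing) (V := C_NormedModule)).
      intros P HP. apply locally_C. apply Hx. apply locally_C. exact HP. }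
    destruct (H eps (cond_pos eps)) as [d [Hd HH]].
    exists (mkposreal d Hd). intros y Hy.
    rewrite <- E in *. specialize (HH y Hy). rewrite (Cmult_comm l) in HH. exact HH.
Qed.

Lemma cderiv_unique (g : C -> C) (z l m : C) : cderiv g z l -> cderiv g z m -> l = m.
Proof.
  intros H H'. rewrite <- (cderiv_C_derive _ _ _ H). apply cderiv_C_derive; auto.
Qed.

(** * Integration over [0,1] *)

Lemma rderiv_contR (g : R -> C) (s : R) (l : C) : rderiv g s l -> contR g s.
Proof.
  intros H. apply tends_eps. apply nearR_proper. intros e He.
  assert (H1 := H 1%R Rlt_0_1). set (K := (1 + Cmod l)%R).
  assert (HK : (0 < K)%R) by (unfold K; generalize (Cmod_ge_0 l); lra).
  assert (Hd : (0 < e / K)%R) by (apply Rdiv_lt_0_compat; lra).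
  assert (H2 : nearR s (fun x => (Rabs (x - s) < e / K)%R)) by (exists (e / K)%R; auto).
  generalize (filter_and _ _ H1 H2). apply filter_imp.
  intros w [Hw1 Hw2].
  replace (g w - g s) with ((g w - g s - l * (w - s)%R) + l * (w - s)%R) by ring.
  eapply Rle_lt_trans; [apply Cmod_triangle|]. rewrite Cmod_mult, Cmod_R.
  apply Rle_lt_trans with (K * Rabs (w - s))%R. unfold K; lra.
  apply Rmult_lt_compat_l with (r := K) in Hw2; auto.
  replace (K * (e / K))%R with e in Hw2 by (field; lra). auto.
Qed.

Lemma rderiv_comp (g : C -> C) (p : R -> C) (s : R) (l m : C) :
  cderiv g (p s) l -> rderiv p s m -> rderiv (fun x => g (p x)) s (l * m).
Proof.
  intros Hg Hp e He. assert (Cp := rderiv_contR _ _ _ Hp).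
  set (K := (1 + Cmod m + Cmod l)%R).
  assert (HK : (0 < K)%R) by (unfold K; generalize (Cmod_ge_0 l) (Cmod_ge_0 m); lra).
  set (d := Rmin 1 (e / K)).
  assert (Hd : (0 < d)%R).
  { apply Rmin_pos; [lra|]. apply Rdiv_lt_0_compat; lra. }
  assert (Hd1 : (d <= 1)%R) by apply Rmin_l.
  assert (Hd2 : (d * K <= e)%R).
  { apply Rle_trans with (e / K * K)%R.
    apply Rmult_le_compat_r; [lra|apply Rmin_r]. right; field; lra. }
  generalize (filter_and _ _ (Hp d Hd) (Cp _ (Hg d Hd))). apply filter_imp.
  intros x [H1 H2].
  replace (g (p x) - g (p s) - l * m * (x - s)%R) with
    ((g (p x) - g (p s) - l * (p x - p s)) + l * (p x - p s - m * (x - s)%R)) by ring.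
  eapply Rle_trans; [apply Cmod_triangle|]. rewrite Cmod_mult.
  assert (H3 : (Cmod (p x - p s) <= (1 + Cmod m) * Rabs (x - s))%R).
  { replace (p x - p s) with ((p x - p s - m * (x - s)%R) + m * (x - s)%R) by ring.
    eapply Rle_trans; [apply Cmod_triangle|]. rewrite Cmod_mult, Cmod_R.
    assert (d * Rabs (x - s) <= 1 * Rabs (x - s))%R
      by (apply Rmult_le_compat_r; [apply Rabs_pos|auto]). lra. }
  apply Rle_trans with (d * ((1 + Cmod m) * Rabs (x - s)) + Cmod l * (d * Rabs (x - s)))%R.
  apply Rplus_le_compat. eapply Rle_trans; [exact H2|].
  apply Rmult_le_compat_l; auto; lra.
  apply Rmult_le_compat_l; auto; apply Cmod_ge_0.
  apply Rle_trans with (d * K * Rabs (x - s))%R. unfold K; right; ring.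
  apply Rmult_le_compat_r; auto; apply Rabs_pos.
Qed.

Lemma rderiv_ext (f g : R -> C) (s : R) (l m : C) :
  (forall x, f x = g x) -> l = m -> rderiv f s l -> rderiv g s m.
Proof.
  intros E E' H e He. subst m. generalize (H e He). apply filter_imp.
  intros x; rewrite !E; auto.
Qed.

Lemma rderiv_affine (a b : C) (s : R) : rderiv (fun x => a + b * x) s b.
Proof.
  intros e He. apply filter_forall. intros x. rewrite RtoC_minus.
  replace (a + b * x - (a + b * s) - b * (x - s)) with (RtoC 0) by ring.
  rewrite Cmod_0. apply Rmult_le_pos. lra. apply Rabs_pos.
Qed.

Lemma rderiv_line (g : C -> C) (a b : C) (s : R) (l : C) :
  cderiv g (a + b * s) l -> rderiv (fun x => g (a + b * x)) s (l * b).
Proof. intros H. apply rderiv_comp with (p := fun x : R => a + b * x); auto. apply rderiv_affine. Qed.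

Lemma rderiv_plus (f g : R -> C) (s : R) (l m : C) :
  rderiv f s l -> rderiv g s m -> rderiv (fun x => f x + g x) s (l + m).
Proof.
  intros Hf Hg e He. assert (He2 : (0 < e / 2)%R) by lra.
  generalize (filter_and _ _ (Hf _ He2) (Hg _ He2)). apply filter_imp. intros x [H1 H2].
  replace (f x + g x - (f s + g s) - (l + m) * (x - s)%R) with
    ((f x - f s - l * (x - s)%R) + (g x - g s - m * (x - s)%R)) by ring.
  eapply Rle_trans; [apply Cmod_triangle|]. lra.
Qed.

Lemma rderiv_scal (g : R -> C) (s : R) (c l : C) :
  rderiv g s l -> rderiv (fun x => c * g x) s (c * l).
Proof.
  intros H. apply (rderiv_comp (fun z => c * z) g s c l); auto.
  eapply cderiv_eq. apply cderiv_mult. apply cderiv_const. apply cderiv_id. simpl; ring.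
Qed.

(* Polarization reduces the product to squares, hence to composition with a holomorphic map. *)
Lemma rderiv_mult (f g : R -> C) (s : R) (l m : C) :
  rderiv f s l -> rderiv g s m -> rderiv (fun x => f x * g x) s (l * g s + f s * m).
Proof.
  intros Hf Hg.
  assert (Hsq : forall h k, rderiv h s k -> rderiv (fun x => h x * h x) s (2 * h s * k)).
  { intros h k Hh. apply (rderiv_comp (fun z => z * z) h s (2 * h s) k); auto.
    eapply cderiv_eq. apply cderiv_mult; apply cderiv_id. simpl; ring. }
  apply rderiv_ext with
    (f := fun x => / 2 * ((f x + g x) * (f x + g x) + (-1) * (f x * f x + g x * g x)))
    (l := / 2 * (2 * (f s + g s) * (l + m) + (-1) * (2 * f s * l + 2 * g s * m))).
  - intros x. field.
  - field.
  - apply rderiv_scal. apply rderiv_plus.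
    apply (Hsq (fun x => f x + g x)). apply rderiv_plus; auto.
    apply rderiv_scal. apply rderiv_plus; apply Hsq; auto.
Qed.

Lemma Re_le_Cmod (z : C) : (Re z <= Cmod z)%R.
Proof. apply Rle_trans with (Rabs (Re z)). apply Rle_abs. apply re_le_Cmod. Qed.
Lemma Im_le_Cmod (z : C) : (Rabs (Im z) <= Cmod z)%R.
Proof. eapply Rle_trans; [|apply Rmax_Cmod]. apply Rmax_r. Qed.
Lemma Cmod_le_abs (z : C) : (Cmod z <= Rabs (Re z) + Rabs (Im z))%R.
Proof.
  replace z with (RtoC (Re z) + Ci * RtoC (Im z)) at 1.
  eapply Rle_trans; [apply Cmod_triangle|]. rewrite Cmod_mult, !Cmod_R, Cmod_Ci. lra.
  destruct z; unfold RtoC, Ci, Cplus, Cmult; simpl; f_equal; ring.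
Qed.

Lemma rderiv_Re (g : R -> C) (s : R) (l : C) :
  rderiv g s l -> is_derive (fun x => Re (g x)) s (Re l).
Proof.
  intros H. apply is_derive_Reals. intros e He.
  assert (He2 : (0 < e / 2)%R) by lra.
  destruct (H _ He2) as [d [Hd HH]].
  exists (mkposreal d Hd). intros h Hh Hlt. simpl in Hlt.
  assert (Hs : (Rabs (s + h - s) < d)%R) by (replace (s + h - s)%R with h by ring; auto).
  specialize (HH _ Hs). replace (s + h - s)%R with h in HH by ring.
  assert (Ha : (0 < Rabs h)%R) by (apply Rabs_pos_lt; auto).
  replace ((Re (g (s + h)%R) - Re (g s)) / h - Re l)%R
    with (Re (g (s + h)%R - g s - l * h) / h)%R by (destruct l, (g (s + h)%R), (g s); simpl; field; auto).
  unfold Rdiv. rewrite Rabs_mult, Rabs_inv.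
  apply Rle_lt_trans with (e / 2)%R; [|lra].
  apply Rmult_le_reg_r with (Rabs h); auto. rewrite Rmult_assoc, Rinv_l by lra.
  rewrite Rmult_1_r. eapply Rle_trans; [apply re_le_Cmod|]. auto.
Qed.

Lemma Re_Ci_mult (z : C) : Re (- Ci * z) = Im z.
Proof. destruct z; simpl; ring. Qed.

Lemma rderiv_Im (g : R -> C) (s : R) (l : C) :
  rderiv g s l -> is_derive (fun x => Im (g x)) s (Im l).
Proof.
  intros H. apply (rderiv_scal _ _ (- Ci)) in H. apply rderiv_Re in H.
  rewrite Re_Ci_mult in H. eapply is_derive_ext; [|exact H].
  intros t. simpl. apply Re_Ci_mult.
Qed.

(** The mean value theorem fails for complex values. It is applied to the real part of conj u * g
    with u = g b - g a: the increment there is |u|^2, and one factor |u| cancels. *)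
Lemma Cmod_mean_value (g dg : R -> C) (a b M : R) : (a <= b)%R ->
  (forall s, (a <= s <= b)%R -> rderiv g s (dg s) /\ (Cmod (dg s) <= M)%R) ->
  (Cmod (g b - g a) <= M * (b - a))%R.
Proof.
  intros Hab H. set (u := g b - g a).
  assert (Hr : (Rabs (Re (Cconj u * g b) - Re (Cconj u * g a)) <= Cmod u * M * Rabs (b - a))%R).
  { assert (Hd : forall t, (a <= t <= b)%R ->
      is_derive (fun s => Re (Cconj u * g s)) t (Re (Cconj u * dg t))).
    { intros t Ht. apply (rderiv_Re (fun s => Cconj u * g s)). apply rderiv_scal.
      apply H; auto. }
    destruct (MVT_gen (fun s => Re (Cconj u * g s)) a b (fun s => Re (Cconj u * dg s)))
      as [c [Hc E]].
    - intros x Hx. rewrite Rmin_left, Rmax_right in Hx by auto. apply Hd; lra.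
    - intros x Hx. rewrite Rmin_left, Rmax_right in Hx by auto.
      apply continuity_pt_filterlim. apply (ex_derive_continuous (fun s => Re (Cconj u * g s))).
      eexists. apply Hd; auto.
    - rewrite Rmin_left, Rmax_right in Hc by auto. rewrite E, Rabs_mult.
      apply Rmult_le_compat_r. apply Rabs_pos.
      eapply Rle_trans; [apply re_le_Cmod|]. rewrite Cmod_mult, Cmod_conj.
      apply Rmult_le_compat_l. apply Cmod_ge_0. apply H; auto. }
  replace (Re (Cconj u * g b) - Re (Cconj u * g a))%R with (Cmod u ^ 2)%R in Hr.
  2:{ rewrite Cmod2_alt. unfold u. destruct (g b), (g a); simpl; ring. }
  rewrite (Rabs_pos_eq (b - a)) in Hr by lra.
  rewrite Rabs_pos_eq in Hr by (apply pow_le; apply Cmod_ge_0).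
  destruct (Rle_lt_dec (Cmod u) 0) as [E|E].
  - assert (0 <= M)%R.
    { destruct (H a) as [_ Hm]; [lra|]. generalize (Cmod_ge_0 (dg a)); lra. }
    apply Rle_trans with 0%R; auto. apply Rmult_le_pos; lra.
  - apply Rmult_le_reg_l with (Cmod u); auto.
    replace (Cmod u * Cmod u)%R with (Cmod u ^ 2)%R by ring. lra.
Qed.

(** The mean value inequality for g minus the linear map of slope l. In this form closeness of the
    derivative to l along a segment controls the error of linearization between its end points. *)
Lemma cderiv_segment_bound (g dg : C -> C) (l a b : C) (e : R) :
  (forall s : R, (0 <= s <= 1)%R -> cderiv g (a + (b - a) * s) (dg (a + (b - a) * s)) /\
     (Cmod (dg (a + (b - a) * s) - l)%C <= e)%R) ->
  (Cmod (g b - g a - l * (b - a)) <= e * Cmod (b - a))%R.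
Proof.
  intros H.
  generalize (Cmod_mean_value (fun x => g (a + (b - a) * x) + - (l * (a + (b - a) * x)))
    (fun s => (dg (a + (b - a) * s) - l) * (b - a)) 0 1 (e * Cmod (b - a))).
  replace (g (a + (b - a) * 1) + - (l * (a + (b - a) * 1)) -
    (g (a + (b - a) * 0) + - (l * (a + (b - a) * 0)))) with (g b - g a - l * (b - a)).
  intros HH. eapply Rle_trans; [apply HH; [lra|]|lra].
  intros s Hs. destruct (H s Hs) as [H1 H2]. split.
  - apply (rderiv_line (fun z => g z + - (l * z)) a (b - a) s (dg (a + (b - a) * s) - l)).
    eapply cderiv_eq. apply cderiv_plus. exact H1.
    apply cderiv_opp. apply cderiv_mult. apply cderiv_const. apply cderiv_id. simpl; ring.
  - rewrite Cmod_mult. apply Rmult_le_compat_r; auto. apply Cmod_ge_0.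
  - replace (a + (b - a) * 1) with b by ring. replace (a + (b - a) * 0) with a by ring. ring.
Qed.

(** Two real integrals, so that monotonicity and the fundamental theorem come from the real line;
    [CInt_is_RInt] identifies it with the integral occurring in [path_integral]. *)
Definition CInt (f : R -> C) : C :=
  (RInt (fun s => Re (f s)) 0 1, RInt (fun s => Im (f s)) 0 1).

Lemma contR_Re (f : R -> C) (s : R) : contR f s -> continuous (fun x => Re (f x)) s.
Proof.
  intros H P [d HP]. unfold contR in H. rewrite tends_eps in H by apply nearR_proper.
  destruct (H d (cond_pos d)) as [r [Hr HH]]. exists (mkposreal r Hr).
  intros y Hy. apply HP. change (Rabs (Re (f y) - Re (f s)) < d)%R.
  eapply Rle_lt_trans; [|apply (HH y Hy)].
  replace (Re (f y) - Re (f s))%R with (Re (f y - f s)) by (destruct (f y), (f s); simpl; ring).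
  apply re_le_Cmod.
Qed.

Lemma contR_Im (f : R -> C) (s : R) : contR f s -> continuous (fun x => Im (f x)) s.
Proof.
  intros H P [d HP]. unfold contR in H. rewrite tends_eps in H by apply nearR_proper.
  destruct (H d (cond_pos d)) as [r [Hr HH]]. exists (mkposreal r Hr).
  intros y Hy. apply HP. change (Rabs (Im (f y) - Im (f s)) < d)%R.
  eapply Rle_lt_trans; [|apply (HH y Hy)].
  replace (Im (f y) - Im (f s))%R with (Im (f y - f s)) by (destruct (f y), (f s); simpl; ring).
  apply Im_le_Cmod.
Qed.

(** Continuity is two-sided even at 0 and 1: all integrands below are defined beyond the
    interval. *)
Definition cont01 (f : R -> C) : Prop := forall s, (0 <= s <= 1)%R -> contR f s.

Lemma ex_RInt_Re (f : R -> C) : cont01 f -> ex_RInt (fun s => Re (f s)) 0 1.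
Proof.
  intros H. apply (ex_RInt_continuous (V := R_CompleteNormedModule)).
  intros z Hz. rewrite Rmin_left, Rmax_right in Hz by lra. apply contR_Re; auto.
Qed.
Lemma ex_RInt_Im (f : R -> C) : cont01 f -> ex_RInt (fun s => Im (f s)) 0 1.
Proof.
  intros H. apply (ex_RInt_continuous (V := R_CompleteNormedModule)).
  intros z Hz. rewrite Rmin_left, Rmax_right in Hz by lra. apply contR_Im; auto.
Qed.

Lemma CInt_is_RInt (f : R -> C) :
  cont01 f -> @is_RInt C_R_NormedModule f 0 1 (CInt f).
Proof.
  intros H. apply (is_RInt_fct_extend_pair (U := R_NormedModule) (V := R_NormedModule)).
  apply (RInt_correct (V := R_CompleteNormedModule)). apply (ex_RInt_Re f H).
  apply (RInt_correct (V := R_CompleteNormedModule)). apply (ex_RInt_Im f H).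
Qed.

Lemma CInt_ext (f g : R -> C) :
  (forall s, (0 <= s <= 1)%R -> f s = g s) -> CInt f = CInt g.
Proof.
  intros H. unfold CInt. f_equal; apply RInt_ext; rewrite Rmin_left, Rmax_right by lra;
    intros x Hx; rewrite H; auto; lra.
Qed.

Lemma CInt_plus (f g : R -> C) :
  cont01 f -> cont01 g -> CInt (fun s => f s + g s) = CInt f + CInt g.
Proof.
  intros Hf Hg. unfold CInt, Cplus; simpl. f_equal.
  apply (RInt_plus (V := R_CompleteNormedModule) (fun s => Re (f s)) (fun s => Re (g s)));
    apply ex_RInt_Re; auto.
  apply (RInt_plus (V := R_CompleteNormedModule) (fun s => Im (f s)) (fun s => Im (g s)));
    apply ex_RInt_Im; auto.
Qed.

Lemma CInt_scal (c : C) (f : R -> C) : cont01 f -> CInt (fun s => c * f s) = c * CInt f.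
Proof.
  intros Hf. unfold CInt. destruct c as [a b]. unfold Cmult at 3. simpl.
  assert (H1 := ex_RInt_Re f Hf). assert (H2 := ex_RInt_Im f Hf). f_equal.
  - apply is_RInt_unique.
    apply (is_RInt_minus (V := R_NormedModule) (fun s => a * Re (f s))%R (fun s => b * Im (f s))%R);
      apply (is_RInt_scal (V := R_NormedModule)); apply (RInt_correct (V := R_CompleteNormedModule)); auto.
  - apply is_RInt_unique.
    apply (is_RInt_plus (V := R_NormedModule) (fun s => a * Im (f s))%R (fun s => b * Re (f s))%R);
      apply (is_RInt_scal (V := R_NormedModule)); apply (RInt_correct (V := R_CompleteNormedModule)); auto.
Qed.

Lemma contR_const (c : C) (s : R) : contR (fun _ => c) s.
Proof. apply tends_const. apply nearR_proper. Qed.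
Lemma contR_plus (f g : R -> C) (s : R) : contR f s -> contR g s -> contR (fun x => f x + g x) s.
Proof. intros. apply tends_plus; auto; apply nearR_proper. Qed.
Lemma contR_opp (f : R -> C) (s : R) : contR f s -> contR (fun x => - f x) s.
Proof. intros. apply tends_opp; auto; apply nearR_proper. Qed.
Lemma contR_mult (f g : R -> C) (s : R) : contR f s -> contR g s -> contR (fun x => f x * g x) s.
Proof. intros. apply tends_mult; auto; apply nearR_proper. Qed.
Lemma contR_comp (g : C -> C) (p : R -> C) (s : R) :
  cts g (p s) -> contR p s -> contR (fun x => g (p x)) s.
Proof. intros H H0. apply (tends_comp_cts (nearR s) g p (p s)); auto. Qed.
Lemma contR_affine (a b : C) (s : R) : contR (fun x => a + b * x) s.
Proof. eapply rderiv_contR. apply rderiv_affine. Qed.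

Lemma CInt_opp (f : R -> C) : cont01 f -> CInt (fun s => - f s) = - CInt f.
Proof.
  intros H. rewrite (CInt_ext _ (fun s => (-(1)) * f s)) by (intros; ring).
  rewrite CInt_scal by auto. ring.
Qed.

Lemma CInt_minus (f g : R -> C) :
  cont01 f -> cont01 g -> CInt (fun s => f s - g s) = CInt f - CInt g.
Proof.
  intros Hf Hg. unfold Cminus. rewrite CInt_plus, CInt_opp; auto.
  intros s Hs. apply contR_opp; auto.
Qed.

Lemma CInt_const (c : C) : CInt (fun _ => c) = c.
Proof.
  unfold CInt. rewrite !RInt_const. unfold scal; simpl. unfold mult; simpl.
  destruct c; simpl. f_equal; ring.
Qed.

(** With u the integral, the real part of conj u * f integrates to |u|^2 and is at most |u| M
    pointwise. *)
Lemma CInt_bound (f : R -> C) (M : R) :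
  cont01 f -> (forall s, (0 <= s <= 1)%R -> (Cmod (f s) <= M)%R) -> (Cmod (CInt f) <= M)%R.
Proof.
  intros Hf HM. set (u := CInt f).
  assert (HM0 : (0 <= M)%R).
  { generalize (HM 0%R) (Cmod_ge_0 (f 0%R)). intros H; specialize (H ltac:(lra)). lra. }
  assert (H : (Cmod u ^ 2 <= Cmod u * M)%R).
  { replace (Cmod u ^ 2)%R with (Re (CInt (fun s => Cconj u * f s))).
    - unfold CInt. unfold Re at 1; unfold fst at 1.
      apply Rle_trans with (RInt (fun _ => (Cmod u * M)%R) 0 1).
      apply RInt_le. lra.
      apply (ex_RInt_Re (fun s => Cconj u * f s)).
      intros s Hs; apply contR_mult; auto using contR_const.
      apply ex_RInt_const.
      intros x Hx. apply (Rle_trans _ (Cmod (Cconj u * f x))); [apply Re_le_Cmod|]. rewrite Cmod_mult, Cmod_conj.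
      apply Rmult_le_compat_l. apply Cmod_ge_0. apply HM; lra.
      rewrite RInt_const. unfold scal; simpl. unfold mult; simpl. lra.
    - rewrite CInt_scal by auto. fold u. rewrite Cmod2_alt. destruct u; simpl; ring. }
  destruct (Rle_lt_dec (Cmod u) 0) as [E|E]; [lra|].
  apply Rmult_le_reg_l with (Cmod u); auto. lra.
Qed.

Lemma CInt_FTC (g dg : R -> C) :
  (forall s, (0 <= s <= 1)%R -> rderiv g s (dg s)) -> cont01 dg ->
  CInt dg = g 1%R - g 0%R.
Proof.
  intros H Hc. unfold CInt.
  assert (E : forall k dk : R -> R, (forall s, (0 <= s <= 1)%R -> is_derive k s (dk s)) ->
    (forall s, (0 <= s <= 1)%R -> continuous dk s) -> RInt dk 0 1 = (k 1 - k 0)%R).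
  { intros k dk H1 H2. apply is_RInt_unique.
    apply (is_RInt_derive (V := R_CompleteNormedModule) k dk);
    rewrite Rmin_left, Rmax_right by lra; auto. }
  rewrite (E (fun s => Re (g s)) (fun s => Re (dg s))).
  rewrite (E (fun s => Im (g s)) (fun s => Im (dg s))).
  destruct (g 1%R), (g 0%R); unfold Cminus, Cplus, Copp; simpl; f_equal; ring.
  intros; apply rderiv_Im; auto. intros; apply contR_Im; auto.
  intros; apply rderiv_Re; auto. intros; apply contR_Re; auto.
Qed.

(** Compactness of [0, 1] in filter form. Since a filter is closed under finite intersections only,
    a supremum argument is run on those y for which the property holds eventually on all of [0, y].
    Every exchange of a limit with an integral rests on it. *)
Lemma unif_compact {T : Type} (F : (T -> Prop) -> Prop) {FF : Filter F} (P : R -> T -> Prop) :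
  (forall s, (0 <= s <= 1)%R -> exists d, (0 < d)%R /\
     F (fun x => forall s', (Rabs (s' - s) < d)%R -> P s' x)) ->
  F (fun x => forall s, (0 <= s <= 1)%R -> P s x).
Proof.
  intros H.
  set (E := fun y => (0 <= y <= 1)%R /\ F (fun x => forall s, (0 <= s <= y)%R -> P s x)).
  assert (E0 : E 0%R).
  { split; [lra|]. destruct (H 0%R) as [d [Hd HF]]; [lra|].
    revert HF. apply filter_imp. intros x Hx s Hs. apply Hx.
    replace s with 0%R by lra. rewrite Rminus_diag, Rabs_R0; auto. }
  destruct (completeness E) as [b [Hub Hlub]].
  { exists 1%R. intros y [Hy _]; lra. }
  { exists 0%R; auto. }
  assert (Hb0 : (0 <= b)%R) by (apply Hub; auto).
  assert (Hb1 : (b <= 1)%R) by (apply Hlub; intros y [Hy _]; lra).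
  destruct (H b (conj Hb0 Hb1)) as [d [Hd HF]].
  assert (Hy : exists y, E y /\ (b - d < y)%R).
  { apply NNPP. intros Hn. assert (b <= b - d)%R; [|lra]. apply Hlub.
    intros y Ey. apply Rnot_lt_le. intros Hl. apply Hn. exists y; auto. }
  destruct Hy as [y [Ey Hy]].
  assert (Hyb : (y <= b)%R) by (apply Hub; auto).
  destruct Ey as [Hy01 HFy].
  (* The neighbourhood of the supremum b carries the property past b, so the end point 1 is
     reached. *)
  assert (Hz : E (Rmin 1 (b + d / 2))).
  { split. split. apply Rmin_glb; lra. apply Rmin_l.
    generalize (filter_and _ _ HF HFy). apply filter_imp. intros x [H1 H2] s Hs.
    assert (s <= b + d / 2)%R by (eapply Rle_trans; [apply Hs|apply Rmin_r]).
    destruct (Rle_lt_dec s y). apply H2; lra. apply H1. apply Rabs_def1; lra. }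
  assert (Hle := Hub _ Hz).
  destruct (Rle_lt_dec 1 (b + d / 2)) as [M|M].
  rewrite Rmin_left in Hz by lra. destruct Hz as [_ Hz]. exact Hz.
  rewrite Rmin_right in Hle by lra. lra.
Qed.

(** A limit joint in s and x is uniformity near each s, which [unif_compact] makes uniform on
    [0, 1]. *)
Lemma CInt_tends {T : Type} (F : (T -> Prop) -> Prop) {FF : Filter F}
    (G : R -> T -> C) (G0 : R -> C) :
  (forall s, (0 <= s <= 1)%R ->
     tends (filter_prod (nearR s) F) (fun sx => G (fst sx) (snd sx)) (G0 s)) ->
  F (fun x => cont01 (fun s => G s x)) -> cont01 G0 ->
  tends F (fun x => CInt (fun s => G s x)) (CInt G0).
Proof.
  intros H Hc H0. apply tends_eps; auto. intros e He.
  assert (He4 : (0 < e / 4)%R) by lra.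
  assert (HU : F (fun x => forall s, (0 <= s <= 1)%R -> (Cmod (G s x - G0 s) <= e / 2)%R)).
  { apply unif_compact; auto. intros s Hs.
    assert (HL := H s Hs). rewrite tends_eps in HL by (apply filter_prod_filter; auto; apply nearR_proper).
    destruct (HL _ He4) as [Q1 Q2 HQ1 HQ2 HQ].
    assert (HC := H0 s Hs). unfold contR in HC. rewrite tends_eps in HC by apply nearR_proper.
    destruct (filter_and _ _ HQ1 (HC _ He4)) as [d [Hd HH]].
    exists d; split; auto. revert HQ2. apply filter_imp. intros x Hx s' Hs'.
    destruct (HH s' Hs') as [K1 K2]. specialize (HQ s' x K1 Hx). simpl in HQ.
    generalize (Cmod_sub_triangle (G s' x) (G0 s) (G0 s')). rewrite (Cmod_sub_sym (G0 s) (G0 s')).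
    lra. }
  generalize (filter_and _ _ Hc HU). apply filter_imp. intros x [K1 K2].
  rewrite <- CInt_minus by auto. apply Rle_lt_trans with (e / 2)%R; [|lra].
  apply CInt_bound; auto. intros s Hs. apply contR_plus; auto. apply contR_opp; auto.
Qed.

(** * Holomorphic functions *)

Definition Ball (p : C) (r : R) (z : C) : Prop := (Cmod (z - p) < r)%R.
Definition isopen (U : C -> Prop) : Prop := forall p, U p -> near p U.
(** Continuity of the derivative is part of the definition: Cauchy's formula then follows by
    differentiation under the integral sign, without Goursat's theorem. *)
Definition holo (U : C -> Prop) (g : C -> C) : Prop :=
  forall p, U p -> cderiv g p (C_derive g p) /\ cts (C_derive g) p.

Lemma Ball_open (p : C) (r : R) : isopen (Ball p r).
Proof.
  intros z Hz. unfold Ball in *. exists (r - Cmod (z - p))%R. split; [lra|].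
  intros w Hw. generalize (Cmod_sub_triangle w z p). unfold Ball; lra.
Qed.

Lemma Ball_center (p : C) (r : R) : (0 < r)%R -> Ball p r p.
Proof. intros; unfold Ball; rewrite Cmod_sub_self; auto. Qed.

Lemma open_ball (U : C -> Prop) (p : C) : isopen U -> U p ->
  exists r, (0 < r)%R /\ forall z, Ball p r z -> U z.
Proof. intros H Hp. destruct (H p Hp) as [d [Hd HH]]. exists d; auto. Qed.

Lemma holo_intro (U : C -> Prop) (g k : C -> C) : isopen U ->
  (forall p, U p -> cderiv g p (k p) /\ cts k p) -> holo U g.
Proof.
  intros HU H p Hp. destruct (H p Hp) as [H1 H2].
  rewrite (cderiv_C_derive _ _ _ H1). split; auto.
  apply cts_ext with k; auto.
  generalize (HU p Hp). apply filter_imp. intros z Hz.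
  symmetry. apply cderiv_C_derive. apply H; auto.
Qed.

Lemma holo_sub (U V : C -> Prop) (g : C -> C) : (forall z, V z -> U z) -> holo U g -> holo V g.
Proof. intros H Hg p Hp. apply Hg; auto. Qed.

Lemma holo_cts (U : C -> Prop) (g : C -> C) (p : C) : holo U g -> U p -> cts g p.
Proof. intros H Hp. eapply cderiv_cts. apply H; auto. Qed.

Lemma holo_const (U : C -> Prop) (c : C) : isopen U -> holo U (fun _ => c).
Proof.
  intros HU. apply holo_intro with (fun _ => 0); auto. intros p _; split.
  apply cderiv_const. apply cts_const.
Qed.
Lemma holo_id (U : C -> Prop) : isopen U -> holo U (fun z => z).
Proof.
  intros HU. apply holo_intro with (fun _ => 1); auto. intros p _; split.
  apply cderiv_id. apply cts_const.
Qed.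
Lemma holo_plus (U : C -> Prop) (f g : C -> C) : isopen U ->
  holo U f -> holo U g -> holo U (fun z => f z + g z).
Proof.
  intros HU Hf Hg. apply holo_intro with (fun z => C_derive f z + C_derive g z); auto.
  intros p Hp. destruct (Hf p Hp), (Hg p Hp). split.
  apply cderiv_plus; auto. apply cts_plus; auto.
Qed.
Lemma holo_mult (U : C -> Prop) (f g : C -> C) : isopen U ->
  holo U f -> holo U g -> holo U (fun z => f z * g z).
Proof.
  intros HU Hf Hg.
  apply holo_intro with (fun z => C_derive f z * g z + f z * C_derive g z); auto.
  intros p Hp. assert (Cf := holo_cts _ _ _ Hf Hp). assert (Cg := holo_cts _ _ _ Hg Hp).
  destruct (Hf p Hp), (Hg p Hp). split.
  apply cderiv_mult; auto. apply cts_plus; apply cts_mult; auto.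
Qed.
Lemma holo_opp (U : C -> Prop) (f : C -> C) : isopen U -> holo U f -> holo U (fun z => - f z).
Proof.
  intros HU Hf. apply holo_intro with (fun z => - C_derive f z); auto.
  intros p Hp. destruct (Hf p Hp). split. apply cderiv_opp; auto. apply cts_opp; auto.
Qed.
Lemma holo_minus (U : C -> Prop) (f g : C -> C) : isopen U ->
  holo U f -> holo U g -> holo U (fun z => f z - g z).
Proof. intros. apply holo_plus; auto. apply holo_opp; auto. Qed.
Lemma holo_inv (U : C -> Prop) (f : C -> C) : isopen U -> (forall z, U z -> f z <> 0) ->
  holo U f -> holo U (fun z => / f z).
Proof.
  intros HU Hn Hf. apply holo_intro with (fun z => - C_derive f z / (f z * f z)); auto.
  intros p Hp. assert (Cf := holo_cts _ _ _ Hf Hp). destruct (Hf p Hp). split.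
  apply cderiv_inv; auto. apply cts_div; auto using cts_opp, cts_mult.
  apply Cmult_neq_0; auto.
Qed.
Lemma holo_div (U : C -> Prop) (f g : C -> C) : isopen U -> (forall z, U z -> g z <> 0) ->
  holo U f -> holo U g -> holo U (fun z => f z / g z).
Proof. intros. apply holo_mult; auto. apply holo_inv; auto. Qed.
Lemma holo_comp (U V : C -> Prop) (f g : C -> C) : isopen U ->
  (forall z, U z -> V (g z)) -> holo V f -> holo U g -> holo U (fun z => f (g z)).
Proof.
  intros HU HV Hf Hg. apply holo_intro with (fun z => C_derive f (g z) * C_derive g z); auto.
  intros p Hp. assert (Cg := holo_cts _ _ _ Hg Hp).
  destruct (Hf (g p) (HV p Hp)), (Hg p Hp). split.
  apply cderiv_comp; auto. apply cts_mult; auto. apply cts_comp; auto.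
Qed.
Lemma holo_ext (U : C -> Prop) (f g : C -> C) : isopen U ->
  (forall z, U z -> f z = g z) -> holo U f -> holo U g.
Proof.
  intros HU E Hf. apply holo_intro with (C_derive f); auto. intros p Hp.
  destruct (Hf p Hp). split; auto. eapply cderiv_ext; [|eauto].
  generalize (HU p Hp). apply filter_imp; auto.
Qed.

Lemma near_filter_prod {T U : Type} (F : (T -> Prop) -> Prop) (G : (U -> Prop) -> Prop)
  (P : T -> Prop) (Q : U -> Prop) {FF : Filter F} {FG : Filter G} :
  F P -> G Q -> filter_prod F G (fun x => P (fst x) /\ Q (snd x)).
Proof. intros HP HQ. exists P Q; auto. Qed.

Lemma near_fst {T U : Type} (F : (T -> Prop) -> Prop) (G : (U -> Prop) -> Prop)
  (P : T -> Prop) {FF : Filter F} {FG : Filter G} :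
  F P -> filter_prod F G (fun x => P (fst x)).
Proof. intros HP. exists P (fun _ => True); auto. apply filter_true. Qed.
Lemma near_snd {T U : Type} (F : (T -> Prop) -> Prop) (G : (U -> Prop) -> Prop)
  (Q : U -> Prop) {FF : Filter F} {FG : Filter G} :
  G Q -> filter_prod F G (fun x => Q (snd x)).
Proof. intros HP. exists (fun _ => True) Q; auto. apply filter_true. Qed.

Lemma joint_at {T : Type} (F : (T -> Prop) -> Prop) {FF : Filter F} (G : C -> T -> C)
    (z l : C) :
  tends (filter_prod (near z) F) (fun zx => G (fst zx) (snd zx)) l -> tends F (G z) l.
Proof.
  intros H. apply (filterlim_comp _ _ _ (fun x => (z, x)) _ F _ _) with (2 := H).
  intros P [Q1 Q2 HQ1 HQ2 HQ]. unfold filtermap. revert HQ2. apply filter_imp.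
  intros x Hx. apply HQ; auto. apply near_self; auto.
Qed.

(** For z near p the limit G0 z is a limit of values G z x that already lie within e / 2 of G0 p. *)
Lemma joint_cts {T : Type} (F : (T -> Prop) -> Prop) {FF : ProperFilter F}
    (G : C -> T -> C) (G0 : C -> C) (p : C) :
  near p (fun z => tends (filter_prod (near z) F) (fun zx => G (fst zx) (snd zx)) (G0 z)) ->
  cts G0 p.
Proof.
  intros H. apply tends_eps. apply near_proper. intros e He.
  assert (H0 := near_self _ _ H). rewrite tends_eps in H0 by (apply filter_prod_filter; [apply near_proper|apply FF]).
  assert (He2 : (0 < e / 2)%R) by lra.
  destruct (H0 _ He2) as [Q1 Q2 HQ1 HQ2 HQ].
  generalize (filter_and _ _ HQ1 H). apply filter_imp. intros z [K1 K2].
  apply joint_at in K2; [|apply FF].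
  apply Rle_lt_trans with (e / 2)%R; [|lra].
  apply (tends_bound F (fun x => G z x - G0 p)).
  apply tends_minus; auto. apply FF. apply tends_const; apply FF.
  revert HQ2. apply filter_imp. intros x Hx. left. apply (HQ z x K1 Hx).
Qed.

(** Strict differentiability: both end points vary, as happens when the base point of a quotient
    moves with a parameter. The derivative is continuous and the ball convex, so the segment bound
    applies. *)
Lemma cderiv_strict (g dg : C -> C) (p : C) :
  near p (fun z => cderiv g z (dg z)) -> cts dg p ->
  forall e, (0 < e)%R -> exists d, (0 < d)%R /\ forall z w, Ball p d z -> Ball p d w ->
    (Cmod (g w - g z - dg p * (w - z)) <= e * Cmod (w - z))%R.
Proof.
  intros H Hc e He. unfold cts in Hc. rewrite tends_eps in Hc by apply near_proper.
  destruct (filter_and _ _ H (Hc e He)) as [d [Hd HH]].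
  exists d; split; auto. intros z w Hz Hw. apply cderiv_segment_bound with dg.
  intros s Hs. assert (K : Ball p d (z + (w - z) * s)).
  { unfold Ball in *.
    replace (z + (w - z) * s - p) with ((1 - s)%R * (z - p) + s * (w - p))
      by (rewrite RtoC_minus; ring).
    eapply Rle_lt_trans; [apply Cmod_triangle|]. rewrite !Cmod_mult, !Cmod_R.
    rewrite !Rabs_pos_eq by lra.
    destruct (Rle_lt_dec s 0) as [E|E].
    replace s with 0%R by lra. lra.
    apply Rle_lt_trans with ((1 - s) * Cmod (z - p) + s * Cmod (w - p))%R; [lra|].
    assert ((1 - s) * Cmod (z - p) <= (1 - s) * d)%R by (apply Rmult_le_compat_l; lra).
    assert (s * Cmod (w - p) < s * d)%R by (apply Rmult_lt_compat_l; lra). lra. }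
  destruct (HH _ K). split; auto. left; auto.
Qed.

(** Differentiation under the integral sign. The hypothesis compares the increment at s' with the
    derivative at the nearby s, a condition local in s that [unif_compact] globalizes; continuity of
    [G1] then replaces s by s'. *)
Lemma CInt_cderiv (G : C -> R -> C) (G1 : R -> C) (w : C) :
  near w (fun w' => cont01 (G w')) -> cont01 G1 ->
  (forall s, (0 <= s <= 1)%R -> forall e, (0 < e)%R -> exists d, (0 < d)%R /\
     forall s' w', (Rabs (s' - s) < d)%R -> Ball w d w' ->
     (Cmod (G w' s' - G w s' - G1 s * (w' - w)) <= e * Cmod (w' - w))%R) ->
  cderiv (fun w' => CInt (G w')) w (CInt G1).
Proof.
  intros Hc H1 H e He.
  assert (He2 : (0 < e / 2)%R) by lra.
  assert (HU : near w (fun w' => forall s, (0 <= s <= 1)%R ->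
     (Cmod (G w' s - G w s - (w' - w) * G1 s) <= e * Cmod (w' - w))%R)).
  { apply unif_compact. apply near_proper. intros s Hs.
    destruct (H s Hs _ He2) as [d [Hd HH]].
    assert (C1 := H1 s Hs). unfold contR in C1. rewrite tends_eps in C1 by apply nearR_proper.
    destruct (C1 _ He2) as [d' [Hd' HC]].
    exists (Rmin d d'). split. apply Rmin_pos; auto.
    exists d. split; auto. intros w' Hw' s' Hs'.
    assert (K1 := HH s' w' (Rlt_le_trans _ _ _ Hs' (Rmin_l _ _)) Hw').
    assert (K2 := HC s' (Rlt_le_trans _ _ _ Hs' (Rmin_r _ _))).
    replace (G w' s' - G w s' - (w' - w) * G1 s') with
      ((G w' s' - G w s' - G1 s * (w' - w)) - (G1 s' - G1 s) * (w' - w)) by ring.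
    eapply Rle_trans; [apply Cmod_triangle|]. rewrite Cmod_opp, Cmod_mult.
    assert (Cmod (G1 s' - G1 s) * Cmod (w' - w) <= e / 2 * Cmod (w' - w))%R
      by (apply Rmult_le_compat_r; [apply Cmod_ge_0|lra]). lra. }
  generalize (filter_and _ _ Hc HU). apply filter_imp. intros w' [K1 K2].
  assert (Cw := near_self _ _ Hc). simpl in Cw.
  rewrite <- CInt_minus by auto. rewrite (Cmult_comm (CInt G1)), <- CInt_scal by auto.
  rewrite <- CInt_minus. apply CInt_bound; auto.
  intros s Hs. apply contR_plus. apply contR_plus; auto. apply contR_opp; auto.
  apply contR_opp. apply contR_mult; auto. apply contR_const.
  intros s Hs. apply contR_plus; auto. apply contR_opp; auto.
  intros s Hs. apply contR_mult; auto. apply contR_const.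
Qed.

(** * The complex exponential *)

Lemma Cexp_plus (z w : C) : Cexp (z + w) = Cexp z * Cexp w.
Proof.
  destruct z as [a b], w as [c d]. unfold Cexp, Cmult, Cplus; simpl.
  rewrite exp_plus, cos_plus, sin_plus. f_equal; ring.
Qed.
Lemma Cexp_0 : Cexp 0 = 1.
Proof. unfold Cexp; simpl. rewrite exp_0, cos_0, sin_0. unfold RtoC; f_equal; ring. Qed.
Lemma Cexp_opp (z : C) : Cexp (- z) * Cexp z = 1.
Proof. rewrite <- Cexp_plus. replace (- z + z) with (RtoC 0) by ring. apply Cexp_0. Qed.
Lemma Cexp_neq_0 (z : C) : Cexp z <> 0.
Proof.
  intros H. generalize (Cexp_opp z). rewrite H. intros E.
  assert (E1 : RtoC 1 = RtoC 0) by (rewrite <- E; ring). apply RtoC_inj in E1; lra.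
Qed.
Lemma Cmod_Cexp (z : C) : Cmod (Cexp z) = exp (Re z).
Proof.
  unfold Cexp, Cmod; simpl.
  replace (exp (Re z) * cos (Im z) * (exp (Re z) * cos (Im z) * 1) +
    exp (Re z) * sin (Im z) * (exp (Re z) * sin (Im z) * 1))%R
   with (exp (Re z) * exp (Re z) * ((sin (Im z))² + (cos (Im z))²))%R by (unfold Rsqr; ring).
  rewrite sin2_cos2, Rmult_1_r. apply sqrt_square. left; apply exp_pos.
Qed.

Lemma real_diff_0 (f : R -> R) (l : R) : f 0%R = 0%R -> is_derive f 0 l ->
  forall e, (0 < e)%R -> exists d, (0 < d)%R /\ forall x, (Rabs x < d)%R ->
  (Rabs (f x - l * x) <= e * Rabs x)%R.
Proof.
  intros H0 H e He. apply is_derive_Reals in H. destruct (H e He) as [d HH].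
  exists d; split; [apply cond_pos|]. intros x Hx.
  destruct (Req_dec x 0) as [E|E].
  - subst x. rewrite H0, Rabs_R0. replace (0 - l * 0)%R with 0%R by ring. rewrite Rabs_R0. lra.
  - specialize (HH x E Hx). rewrite Rplus_0_l, H0 in HH.
    replace (f x - l * x)%R with (((f x - 0) / x - l) * x)%R by (field; auto).
    rewrite Rabs_mult. apply Rmult_le_compat_r; [apply Rabs_pos|]. left; auto.
Qed.

Lemma cderiv_Cexp_0 : cderiv Cexp 0 1.
Proof.
  (* The error turns out to be at most 4 d0 |w| in the real part and 5 d0 |w| in the imaginary part,
     hence the 9. *)
  intros e He. set (d0 := Rmin 1 (e / 9)).
  assert (Hd0 : (0 < d0)%R) by (apply Rmin_pos; lra).
  assert (Hd1 : (d0 <= 1)%R) by apply Rmin_l.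
  assert (Hd2 : (d0 <= e / 9)%R) by apply Rmin_r.
  destruct (real_diff_0 (fun x => exp x - 1)%R 1) with (e := d0) as [d1 [P1 H1]]; auto.
  { rewrite exp_0; ring. } { auto_derive; auto. rewrite exp_0; ring. }
  destruct (real_diff_0 (fun x => cos x - 1)%R 0) with (e := d0) as [d2 [P2 H2]]; auto.
  { rewrite cos_0; ring. } { auto_derive; auto. rewrite sin_0; ring. }
  destruct (real_diff_0 (fun x => sin x)%R 1) with (e := d0) as [d3 [P3 H3]]; auto.
  { apply sin_0. } { auto_derive; auto. rewrite cos_0; ring. }
  exists (Rmin d0 (Rmin d1 (Rmin d2 d3))). split. { repeat apply Rmin_pos; auto; lra. }
  intros w Hw. replace (w - 0) with w in * by ring. rewrite Cexp_0.
  assert (L0 : (Cmod w < d0)%R) by (eapply Rlt_le_trans; [exact Hw|apply Rmin_l]).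
  assert (L' : (Cmod w < Rmin d1 (Rmin d2 d3))%R) by (eapply Rlt_le_trans; [exact Hw|apply Rmin_r]).
  assert (L1 : (Cmod w < d1)%R) by (eapply Rlt_le_trans; [exact L'|apply Rmin_l]).
  assert (L'' : (Cmod w < (Rmin d2 d3))%R) by (eapply Rlt_le_trans; [exact L'|apply Rmin_r]).
  assert (L2 : (Cmod w < d2)%R) by (eapply Rlt_le_trans; [exact L''|apply Rmin_l]).
  assert (L3 : (Cmod w < d3)%R) by (eapply Rlt_le_trans; [exact L''|apply Rmin_r]).
  assert (Rx := re_le_Cmod w). assert (Ry := Im_le_Cmod w).
  destruct w as [x y]. simpl in Rx, Ry. set (r := Cmod (x, y)) in *.
  specialize (H1 x ltac:(lra)). specialize (H2 y ltac:(lra)). specialize (H3 y ltac:(lra)).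
  simpl in H1, H2, H3.
  eapply Rle_trans; [apply Cmod_le_abs|]. unfold Cexp; simpl.
  replace (exp x * cos y + - (1) + - (1 * x - 0 * y))%R with
    ((exp x - 1 - 1 * x) + (cos y - 1 - 0 * y) + (exp x - 1) * (cos y - 1 - 0 * y))%R by ring.
  replace (exp x * sin y + - 0 + - (1 * y + 0 * x))%R with
    ((sin y - 1 * y) + (exp x - 1) * sin y)%R by ring.
  assert (Hr0 : (0 <= r)%R) by (generalize (Rabs_pos x); lra).
  assert (Q1 : (Rabs (exp x - 1 - 1 * x) <= d0 * r)%R).
  { eapply Rle_trans; [exact H1|]. apply Rmult_le_compat_l; lra. }
  assert (Q2 : (Rabs (cos y - 1 - 0 * y) <= d0 * r)%R).
  { eapply Rle_trans; [exact H2|]. apply Rmult_le_compat_l; lra. }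
  assert (Q3 : (Rabs (sin y - 1 * y) <= d0 * r)%R).
  { eapply Rle_trans; [exact H3|]. apply Rmult_le_compat_l; lra. }
  assert (Q4 : (Rabs (exp x - 1) <= 2 * r)%R).
  { replace (exp x - 1)%R with ((exp x - 1 - 1 * x) + x)%R by ring.
    eapply Rle_trans; [apply Rabs_triang|]. assert (d0 * r <= 1 * r)%R; [|lra].
    apply Rmult_le_compat_r; lra. }
  assert (Q5 : (Rabs (sin y) <= 2 * r)%R).
  { replace (sin y)%R with ((sin y - 1 * y) + y)%R by ring.
    eapply Rle_trans; [apply Rabs_triang|]. assert (d0 * r <= 1 * r)%R; [|lra].
    apply Rmult_le_compat_r; lra. }
  assert (Hdr : (0 <= d0 * r)%R) by (apply Rmult_le_pos; lra).
  assert (Hrr : (r * r <= d0 * r)%R) by (apply Rmult_le_compat_r; lra).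
  assert (Q6 : (Rabs ((exp x - 1) * (cos y - 1 - 0 * y)) <= 2 * (d0 * r))%R).
  { rewrite Rabs_mult. apply Rle_trans with (2 * r * (d0 * r))%R.
    apply Rmult_le_compat; auto; apply Rabs_pos.
    assert (r * (d0 * r) <= 1 * (d0 * r))%R by (apply Rmult_le_compat_r; lra). lra. }
  assert (Q7 : (Rabs ((exp x - 1) * sin y) <= 4 * (d0 * r))%R).
  { rewrite Rabs_mult. apply Rle_trans with (2 * r * (2 * r))%R.
    apply Rmult_le_compat; auto; apply Rabs_pos. lra. }
  apply Rle_trans with (d0 * r * 9)%R.
  - generalize (Rabs_triang (exp x - 1 - 1 * x + (cos y - 1 - 0 * y))
      ((exp x - 1) * (cos y - 1 - 0 * y)))
      (Rabs_triang (exp x - 1 - 1 * x) (cos y - 1 - 0 * y))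
      (Rabs_triang (sin y - 1 * y) ((exp x - 1) * sin y)). lra.
  - assert (d0 * r <= e / 9 * r)%R by (apply Rmult_le_compat_r; lra). lra.
Qed.

Lemma cderiv_Cexp (z : C) : cderiv Cexp z (Cexp z).
Proof.
  apply cderiv_ext with (fun w => Cexp z * Cexp (w - z)).
  - apply filter_forall. intros w. rewrite <- Cexp_plus. f_equal. ring.
  - eapply cderiv_eq. apply cderiv_mult. apply cderiv_const.
    apply (cderiv_comp Cexp (fun w => w - z) z 1 1).
    replace (z - z) with (RtoC 0) by ring. apply cderiv_Cexp_0.
    eapply cderiv_eq. apply cderiv_minus. apply cderiv_id. apply cderiv_const. ring.
    simpl. ring.
Qed.
Lemma cts_Cexp (z : C) : cts Cexp z.
Proof. eapply cderiv_cts. apply cderiv_Cexp. Qed.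
Lemma holo_Cexp (U : C -> Prop) : isopen U -> holo U Cexp.
Proof.
  intros HU. apply holo_intro with Cexp; auto. intros; split. apply cderiv_Cexp. apply cts_Cexp.
Qed.

(** The summand 0 gives the exponent the shape a + b s expected by [rderiv_line]. *)
Definition ee (s : R) : C := Cexp (0 + (2 * PI)%R * Ci * s).

Lemma ee_neq_0 (s : R) : ee s <> 0.
Proof. apply Cexp_neq_0. Qed.
Lemma Cmod_ee (s : R) : Cmod (ee s) = 1%R.
Proof.
  unfold ee. rewrite Cmod_Cexp. rewrite <- exp_0. f_equal. simpl. ring.
Qed.
Lemma ee_0 : ee 0 = 1.
Proof. unfold ee. rewrite <- Cexp_0. f_equal. ring. Qed.
Lemma ee_1 : ee 1 = 1.
Proof.
  unfold ee, Cexp; simpl.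
  replace (0 + ((2 * PI * 0 - 0 * 1) * 1 - (2 * PI * 1 + 0 * 0) * 0))%R with 0%R by ring.
  replace (0 + ((2 * PI * 0 - 0 * 1) * 0 + (2 * PI * 1 + 0 * 0) * 1))%R with (2 * PI)%R by ring.
  rewrite exp_0, cos_2PI, sin_2PI. unfold RtoC; f_equal; ring.
Qed.
Lemma rderiv_ee (s : R) : rderiv ee s (ee s * ((2 * PI)%R * Ci)).
Proof. apply (rderiv_line Cexp). apply cderiv_Cexp. Qed.
Lemma contR_ee (s : R) : contR ee s.
Proof. eapply rderiv_contR. apply rderiv_ee. Qed.
Lemma contR_inv (f : R -> C) (s : R) : f s <> 0 -> contR f s -> contR (fun x => / f x) s.
Proof. intros. apply tends_inv; auto; apply nearR_proper. Qed.

(** * Cauchy and Weierstrass *)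

Lemma circle_dist (w x : C) (s : R) : Cmod (w + x * ee s - w) = Cmod x.
Proof. replace (w + x * ee s - w) with (x * ee s) by ring. rewrite Cmod_mult, Cmod_ee. ring. Qed.

Lemma contR_circle (g : C -> C) (w x : C) (s : R) :
  cts g (w + x * ee s) -> contR (fun s => g (w + x * ee s)) s.
Proof.
  intros H. apply (contR_comp g (fun s => w + x * ee s)); auto.
  apply contR_plus. apply contR_const. apply contR_mult. apply contR_const. apply contR_ee.
Qed.

Lemma cont01_circle_div (g : C -> C) (w x : C) :
  (forall s, cts g (w + x * ee s)) -> cont01 (fun s => g (w + x * ee s) / ee s).
Proof.
  intros H s _. apply contR_mult. apply contR_circle; auto.
  apply contR_inv. apply ee_neq_0. apply contR_ee.
Qed.

Lemma ee_close (s e : R) : (0 < e)%R -> exists d, (0 < d)%R /\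
  forall s', (Rabs (s' - s) < d)%R -> (Cmod (ee s' - ee s) < e)%R.
Proof.
  intros He. assert (H := contR_ee s). unfold contR in H.
  rewrite tends_eps in H by apply nearR_proper. exact (H e He).
Qed.

(* Integrating the derivative of [s |-> g (w + x e(s)) / e(s)], with e(s) = exp (2 pi i s), over
   one turn gives [phi x = x * phi' x] for [phi x = CInt (g (w + x e(s)) / e(s))], so that
   [phi x / x] is constant. *)
Lemma cauchy_deriv (g : C -> C) (w : C) (r r1 : R) :
  holo (Ball w r1) g -> (0 < r < r1)%R ->
  C_derive g w * r = CInt (fun s => g (w + r * ee s) / ee s).
Proof.
  intros Hg Hr.
  set (phi := fun x : C => CInt (fun s => g (w + x * ee s) / ee s)).
  set (M := fun x : C => CInt (fun s => C_derive g (w + x * ee s))).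
  assert (HB : forall x s, (Cmod x < r1)%R -> Ball w r1 (w + x * ee s)).
  { intros x s Hx. unfold Ball. rewrite circle_dist. auto. }
  assert (Hphi : forall x, (Cmod x < r1)%R -> cderiv phi x (M x)).
  { intros x Hx. apply CInt_cderiv.
    - exists (r1 - Cmod x)%R. split; [lra|]. intros z Hz.
      apply (cont01_circle_div g w z). intros s. eapply holo_cts; eauto.
      apply HB. generalize (Cmod_sub_ge z x). lra.
    - intros s Hs. apply (contR_circle (C_derive g)). apply Hg; auto.
    - intros s Hs e He.
      destruct (cderiv_strict g (C_derive g) (w + x * ee s)) with (e := e) as [d [Hd HS]]; auto.
      { generalize (Ball_open w r1 _ (HB x s Hx)). apply filter_imp. intros z Hz. apply Hg; auto. }
      { apply Hg; auto. }
      assert (HK : (0 < 2 * (1 + Cmod x))%R) by (generalize (Cmod_ge_0 x); lra).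
      destruct (ee_close s (d / (2 * (1 + Cmod x)))) as [d2 [Hd2 Hee]].
      { apply Rdiv_lt_0_compat; auto. }
      exists (Rmin (d / 2) d2). split. apply Rmin_pos; lra.
      intros s' w' Hs' Hw'. unfold Ball in Hw'.
      assert (K1 : (Cmod (w' - x) < d / 2)%R) by (eapply Rlt_le_trans; [exact Hw'|apply Rmin_l]).
      assert (K2 : (Cmod (ee s' - ee s) < d / (2 * (1 + Cmod x)))%R).
      { apply Hee. eapply Rlt_le_trans; [exact Hs'|apply Rmin_r]. }
      assert (K3 : (Cmod (x * (ee s' - ee s)) < d / 2)%R).
      { rewrite Cmod_mult. apply Rle_lt_trans with ((1 + Cmod x) * Cmod (ee s' - ee s))%R.
        apply Rmult_le_compat_r; [apply Cmod_ge_0|lra].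
        apply Rmult_lt_compat_l with (r := (1 + Cmod x)%R) in K2;
          [|generalize (Cmod_ge_0 x); lra].
        replace ((1 + Cmod x) * (d / (2 * (1 + Cmod x))))%R with (d / 2)%R in K2; auto.
        field. generalize (Cmod_ge_0 x); lra. }
      assert (B1 : Ball (w + x * ee s) d (w + x * ee s')).
      { unfold Ball. replace (w + x * ee s' - (w + x * ee s)) with (x * (ee s' - ee s)) by ring.
        lra. }
      assert (B2 : Ball (w + x * ee s) d (w + w' * ee s')).
      { unfold Ball. replace (w + w' * ee s' - (w + x * ee s)) with
          ((w' - x) * ee s' + x * (ee s' - ee s)) by ring.
        eapply Rle_lt_trans; [apply Cmod_triangle|]. rewrite Cmod_mult at 1.
        rewrite Cmod_ee. lra. }
      specialize (HS _ _ B1 B2).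
      replace (g (w + w' * ee s') / ee s' - g (w + x * ee s') / ee s' -
        C_derive g (w + x * ee s) * (w' - x)) with
       ((g (w + w' * ee s') - g (w + x * ee s') -
         C_derive g (w + x * ee s) * (w + w' * ee s' - (w + x * ee s'))) / ee s')
       by (field; apply ee_neq_0).
      rewrite Cmod_div by apply ee_neq_0. rewrite Cmod_ee.
      unfold Rdiv. rewrite Rinv_1, Rmult_1_r. eapply Rle_trans; [exact HS|].
      replace (w + w' * ee s' - (w + x * ee s')) with ((w' - x) * ee s') by ring.
      rewrite Cmod_mult, Cmod_ee. lra. }
  assert (Hparts : forall x, (Cmod x < r1)%R -> phi x = x * M x).
  { intros x Hx. unfold phi, M. rewrite <- CInt_scal.
    2:{ intros s _. apply (contR_circle (C_derive g)). apply Hg; auto. }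
    set (k := (2 * PI)%R * Ci).
    assert (Hk : k <> 0).
    { unfold k. apply Cmult_neq_0. intros E. apply RtoC_inj in E. generalize PI_RGT_0; lra.
      intros E. apply (f_equal Im) in E. simpl in E. lra. }
    set (dk := fun s => k * (x * C_derive g (w + x * ee s) - g (w + x * ee s) / ee s)).
    assert (Hc : cont01 (fun s => x * C_derive g (w + x * ee s) - g (w + x * ee s) / ee s)).
    { intros s Hs. apply contR_plus. apply contR_mult. apply contR_const.
      apply (contR_circle (C_derive g)). apply Hg; auto. apply contR_opp.
      apply cont01_circle_div; auto. intros; eapply holo_cts; eauto. }
    assert (E0 : CInt dk = 0).
    { rewrite (CInt_FTC (fun s => g (w + x * ee s) / ee s)).
      rewrite ee_0, ee_1. ring.
      - intros s Hs. unfold dk.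
        eapply (rderiv_ext (fun s => g (w + x * ee s) * / ee s)). reflexivity.
        2:{ apply rderiv_mult. apply (rderiv_comp g (fun s => w + x * ee s)). 
            apply Hg; auto. apply rderiv_plus. 
            apply (rderiv_ext (fun s : R => w + 0 * s) _ s 0 0); auto.
            intros; ring. apply rderiv_affine. apply rderiv_scal. apply rderiv_ee.
            apply (rderiv_comp (fun z => / z) ee). apply cderiv_inv. apply ee_neq_0.
            apply cderiv_id. apply rderiv_ee. }
        simpl. fold k. field. apply ee_neq_0.
      - intros s Hs. apply contR_mult. apply contR_const. apply Hc; auto. }
    unfold dk in E0. rewrite CInt_scal in E0 by auto.
    assert (E1 : CInt (fun s => x * C_derive g (w + x * ee s) - g (w + x * ee s) / ee s) = 0).
    { apply (f_equal (fun z => / k * z)) in E0. rewrite Cmult_assoc, Cinv_l in E0 by auto.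
      rewrite Cmult_1_l, Cmult_0_r in E0. exact E0. }
    rewrite CInt_minus in E1.
    - match type of E1 with ?a - ?b = _ => replace a with (a - b + b) by ring end.
      rewrite E1. ring.
    - intros s Hs. apply contR_mult. apply contR_const.
      apply (contR_circle (C_derive g)). apply Hg; auto.
    - apply cont01_circle_div; auto. intros; eapply holo_cts; eauto. }
  assert (Hconst : forall x : R, (0 < x <= r)%R -> M x = M r).
  { intros x Hx.
    assert (HH : (Cmod (phi r / r - phi x / x - 0 * (r - x)) <= 0 * Cmod (r - x))%R).
    { apply (cderiv_segment_bound (fun z => phi z / z) (fun _ => 0)).
      intros s Hs.
      assert (Hy : exists y : R, (0 < y <= r)%R /\ x + (r - x) * s = y).
      { exists (x + (r - x) * s)%R. split.
        - assert (0 <= (r - x) * s)%R by (apply Rmult_le_pos; lra).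
          assert ((r - x) * s <= (r - x) * 1)%R by (apply Rmult_le_compat_l; lra). lra.
        - rewrite RtoC_plus, RtoC_mult, RtoC_minus. auto. }
      destruct Hy as [y [Hy ->]].
      assert (Hm : (Cmod y < r1)%R) by (rewrite Cmod_R, Rabs_pos_eq; lra).
      assert (Hy0 : RtoC y <> 0) by (intros E; apply RtoC_inj in E; lra).
      split.
      - eapply cderiv_eq. apply cderiv_div; auto. apply cderiv_id.
        simpl. rewrite Hparts by auto. field. auto.
      - replace (0 - 0) with (RtoC 0) by ring. rewrite Cmod_0. lra. }
    rewrite Rmult_0_l in HH.
    assert (E : phi r / r - phi x / x - 0 * (r - x) = 0).
    { apply Cmod_eq_0. generalize (Cmod_ge_0 (phi r / r - phi x / x - 0 * (r - x))). lra. }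
    rewrite !Hparts in E by (rewrite Cmod_R, Rabs_pos_eq; lra).
    assert (RtoC r <> 0) by (intros E'; apply RtoC_inj in E'; lra).
    assert (RtoC x <> 0) by (intros E'; apply RtoC_inj in E'; lra).
    replace (M x) with (M r - (r * M r / r - x * M x / x - 0 * (r - x))) by (field; auto).
    rewrite E. ring. }
  assert (M0 : M 0 = C_derive g w).
  { unfold M. rewrite <- (CInt_const (C_derive g w)). apply CInt_ext.
    intros. f_equal. ring. }
  assert (HMc : tends (near 0) M (M 0)).
  { apply (CInt_tends (near 0) (fun s x => C_derive g (w + x * ee s))).
    - intros s Hs. apply (filterlim_comp _ _ _ (fun sx : R * C => w + snd sx * ee (fst sx))
        (C_derive g) _ (near (w + 0 * ee s)) _).
      + apply tends_plus. typeclasses eauto. apply tends_const. typeclasses eauto.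
        apply tends_mult. typeclasses eauto. intros P HP. apply near_snd; auto; typeclasses eauto.
        eapply filterlim_comp. apply filterlim_fst. apply contR_ee.
      + apply Hg. apply HB. rewrite Cmod_0; lra.
    - exists r1. split; [lra|]. intros x Hx s Hs. apply (contR_circle (C_derive g)).
      apply Hg. apply HB. replace x with (x - 0) by ring. auto.
    - intros s Hs. apply (contR_circle (C_derive g)). apply Hg. apply HB. rewrite Cmod_0; lra. }
  (* The constant value of [M] on (0, r] is identified by its limit at 0, where [M] is the
     derivative of g. *)
  assert (E : M 0 = M r).
  { apply (tends_unique (nearR 0) (fun _ => M 0)). apply tends_const; typeclasses eauto.
    apply tends_eps. typeclasses eauto. rewrite tends_eps in HMc by typeclasses eauto. intros e He.
    destruct (HMc e He) as [d [Hd HH]]. exists 1%R; split; [lra|]. intros _ _.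
    set (x := Rmin r (d / 2)).
    assert (Hx0 : (0 < x)%R) by (apply Rmin_pos; lra).
    assert (Hx1 : (x <= r)%R) by apply Rmin_l.
    assert (Hx2 : (x <= d / 2)%R) by apply Rmin_r.
    rewrite <- (Hconst x) by lra. rewrite Cmod_sub_sym. apply HH.
    replace (x - 0) with (RtoC x) by ring. rewrite Cmod_R, Rabs_pos_eq; lra. }
  rewrite <- M0, E, Cmult_comm. symmetry. apply (Hparts r). rewrite Cmod_R, Rabs_pos_eq; lra.
Qed.

(* Weierstrass' theorem on limits of holomorphic functions, for a limit along an arbitrary filter;
   the limit is joint in the variable and the parameter, which encodes locally uniform convergence. *)
Lemma weierstrass {T : Type} (F : (T -> Prop) -> Prop) {FF : ProperFilter F}
    (G : C -> T -> C) (G0 : C -> C) (p : C) (r : R) :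
  F (fun x => holo (Ball p r) (fun z => G z x)) ->
  (forall z, Ball p r z -> tends (filter_prod (near z) F) (fun zx => G (fst zx) (snd zx)) (G0 z)) ->
  holo (Ball p r) G0 /\
  (forall z, Ball p r z ->
     tends (filter_prod (near z) F)
       (fun zx => C_derive (fun u => G u (snd zx)) (fst zx)) (C_derive G0 z)).
Proof.
  intros Hh Hl. assert (FF' : Filter F) by apply FF.
  assert (Hc : forall z, Ball p r z -> cts G0 z).
  { intros z Hz. apply (joint_cts F G). generalize (Ball_open _ _ _ Hz). apply filter_imp; auto. }
  (* Cauchy's formula writes each derivative as an integral over a circle of fixed radius about the
     moving centre; its integrand converges jointly, so the derivatives have a joint limit. *)
  assert (HK : forall z, Ball p r z -> exists k,
     tends (filter_prod (near z) F)
       (fun zx => C_derive (fun u => G u (snd zx)) (fst zx)) k).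
  (* A quarter of the distance from z to the boundary: balls of radius 2 rho about points of the
     rho-ball at z stay in the domain. *)
  { intros z Hz. set (rho := ((r - Cmod (z - p)) / 4)%R).
    assert (Hrho : (0 < rho)%R) by (unfold Ball, rho in *; lra).
    assert (Hrho0 : RtoC rho <> 0) by (intros E; apply RtoC_inj in E; lra).
    assert (HBz : forall u v, Ball z rho u -> Ball u (2 * rho) v -> Ball p r v).
    { intros u v Hu Hv. unfold Ball, rho in *.
      generalize (Cmod_sub_triangle v u p) (Cmod_sub_triangle u z p). lra. }
    exists (/ rho * CInt (fun s => G0 (z + rho * ee s) / ee s)).
    apply tends_ext with (fun zx => / rho * CInt (fun s => G (fst zx + rho * ee s) (snd zx) / ee s)).
    - typeclasses eauto.
    - generalize (near_filter_prod (near z) F _ _ (near_ball z rho Hrho) Hh).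
      apply filter_imp. intros [u x] [Hu Hx]. simpl in *.
      rewrite <- (cauchy_deriv (fun u => G u x) u rho (2 * rho)).
      + field. auto.
      + eapply holo_sub; [|exact Hx]. intros v Hv. eapply HBz; eauto.
      + lra.
    - apply tends_mult. typeclasses eauto. apply tends_const; typeclasses eauto.
      apply (CInt_tends (filter_prod (near z) F)
        (fun s zx => G (fst zx + rho * ee s) (snd zx) / ee s)).
      + intros s Hs. apply tends_div. typeclasses eauto. apply ee_neq_0.
        * apply (filterlim_comp _ _ _
            (fun sx : R * (C * T) => (fst (snd sx) + rho * ee (fst sx), snd (snd sx)))
            (fun zx => G (fst zx) (snd zx)) _ (filter_prod (near (z + rho * ee s)) F) _).
          -- apply filterlim_pair.
             ++ apply tends_plus. typeclasses eauto.
                eapply filterlim_comp. apply filterlim_snd. apply filterlim_fst.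
                apply tends_mult. typeclasses eauto. apply tends_const; typeclasses eauto.
                eapply filterlim_comp. apply filterlim_fst. apply contR_ee.
             ++ eapply filterlim_comp. apply filterlim_snd. apply filterlim_snd.
          -- apply Hl. apply HBz with z. apply Ball_center; auto.
             unfold Ball. rewrite circle_dist, Cmod_R, Rabs_pos_eq; lra.
        * eapply filterlim_comp. apply filterlim_fst. apply contR_ee.
      + generalize (near_filter_prod (near z) F _ _ (near_ball z rho Hrho) Hh).
        apply filter_imp. intros [u x] [Hu Hx]. simpl in *.
        apply (cont01_circle_div (fun v => G v x)). intros s.
        eapply holo_cts; [exact Hx|]. apply HBz with u; auto.
        unfold Ball. rewrite circle_dist, Cmod_R, Rabs_pos_eq; lra.
      + apply cont01_circle_div. intros s. apply Hc. apply HBz with z.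
        apply Ball_center; auto.
        unfold Ball. rewrite circle_dist, Cmod_R, Rabs_pos_eq; lra. }
  set (k := fun z => epsilon (inhabits (RtoC 0)) (fun k =>
     tends (filter_prod (near z) F)
       (fun zx => C_derive (fun u => G u (snd zx)) (fst zx)) k)).
  assert (Hk : forall z, Ball p r z -> tends (filter_prod (near z) F)
       (fun zx => C_derive (fun u => G u (snd zx)) (fst zx)) (k z)).
  { intros z Hz. unfold k. apply epsilon_spec. auto. }
  (* The derivatives of G(., x) are within e of k z on a whole ball, eventually in x; the resulting
     bound on the linearization error passes to the limit function. *)
  assert (Hd : forall z, Ball p r z -> cderiv G0 z (k z) /\ cts k z).
  { intros z Hz. split.
    - intros e He. assert (L := Hk z Hz). rewrite tends_eps in L by typeclasses eauto.
      destruct (L e He) as [Q1 Q2 HQ1 HQ2 HQ].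
      destruct (filter_and _ _ HQ1 (Ball_open _ _ _ Hz)) as [d [Hd0 HH]].
      exists d; split; auto. intros u Hu.
      apply (tends_bound F (fun x => G u x - G z x - k z * (u - z))).
      + apply tends_minus; auto. apply tends_minus; auto.
        apply (joint_at F G); auto. apply Hl. apply HH; auto.
        apply (joint_at F G); auto. apply tends_const; auto.
      + generalize (filter_and _ _ Hh HQ2). apply filter_imp. intros x [K1 K2].
        apply (cderiv_segment_bound (fun v => G v x) (C_derive (fun v => G v x))).
        intros s Hs.
        assert (HB : (Cmod (z + (u - z) * s - z) < d)%R).
        { replace (z + (u - z) * s - z) with (s * (u - z)) by ring.
          rewrite Cmod_mult, Cmod_R, Rabs_pos_eq by lra.
          assert (s * Cmod (u - z) <= 1 * Cmod (u - z))%R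
            by (apply Rmult_le_compat_r; [apply Cmod_ge_0|lra]). lra. }
        destruct (HH _ HB) as [J1 J2]. split. apply K1; auto.
        left. apply (HQ _ x J1 K2).
    - apply (joint_cts F (fun z x => C_derive (fun u => G u x) z)).
      generalize (Ball_open _ _ _ Hz). apply filter_imp; auto. }
  split.
  - apply holo_intro with k; auto. apply Ball_open.
  - intros z Hz. rewrite (cderiv_C_derive G0 z (k z)); auto. apply Hd; auto.
Qed.

(** Used both for the increments h -> 0 of difference quotients and for removing isolated
    singularities. *)
Definition pnear (p : C) : (C -> Prop) -> Prop := within (fun z => z <> p) (near p).

Global Instance pnear_proper (p : C) : ProperFilter (pnear p).
Proof.
  split.
  - intros P [d [Hd H]]. exists (p + (d / 2)%R). apply H.
    + replace (p + (d / 2)%R - p) with (RtoC (d / 2)) by ring.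
      rewrite Cmod_R, Rabs_pos_eq; lra.
    + intros E. assert (E' : RtoC (d / 2) = RtoC 0).
      { replace (RtoC (d / 2)) with (p + (d / 2)%R - p) by ring. rewrite E; ring. }
      apply RtoC_inj in E'. lra.
  - apply within_filter. apply near_proper.
Qed.

Lemma Csub_neq_0 (z p : C) : z <> p -> z - p <> 0.
Proof. intros H E. apply H. replace z with (z - p + p) by ring. rewrite E. ring. Qed.

Lemma pnear_neq (p : C) : pnear p (fun z => z <> p).
Proof. exists 1%R. split; auto. lra. Qed.

Lemma pnear_of_near (p : C) (P : C -> Prop) : near p P -> pnear p P.
Proof. intros [d [Hd H]]. exists d. split; auto. Qed.

Lemma tends_diff_quot (U : C -> Prop) (g : C -> C) (p : C) : isopen U -> holo U g -> U p ->
  tends (filter_prod (near p) (pnear 0)) (fun zh => (g (fst zh + snd zh) - g (fst zh)) / snd zh)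
    (C_derive g p).
Proof.
  intros HU Hg Hp. apply tends_eps. typeclasses eauto. intros e He.
  destruct (cderiv_strict g (C_derive g) p) with (e := (e / 2)%R) as [d [Hd HS]]; try lra.
  { generalize (HU p Hp). apply filter_imp. intros; apply Hg; auto. }
  { apply Hg; auto. }
  exists (fun z => (Cmod (z - p) < d / 2)%R) (fun h => (Cmod (h - 0) < d / 2)%R /\ h <> 0).
  - apply near_ball; lra.
  - apply filter_and. apply pnear_of_near. apply near_ball; lra. apply pnear_neq.
  - intros z h Hz [Hh Hh0]. replace (h - 0) with h in Hh by ring. cbn [fst snd].
    assert (B1 : Ball p d z) by (unfold Ball; lra).
    assert (B2 : Ball p d (z + h)).
    { unfold Ball. replace (z + h - p) with ((z - p) + h) by ring.
      eapply Rle_lt_trans; [apply Cmod_triangle|]. lra. }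
    specialize (HS _ _ B1 B2). replace (z + h - z) with h in HS by ring.
    replace ((g (z + h) - g z) / h - C_derive g p) with ((g (z + h) - g z - C_derive g p * h) / h)
      by (field; auto).
    rewrite Cmod_div by auto. apply Cmod_gt_0 in Hh0.
    apply Rle_lt_trans with (e / 2)%R; [|lra].
    apply Rmult_le_reg_r with (Cmod h); auto.
    unfold Rdiv at 1. rewrite Rmult_assoc, Rinv_l by lra. lra.
Qed.

(** The derivative is the joint limit of the difference quotients, each holomorphic in z for fixed
    h, so Weierstrass' theorem applies along h -> 0. *)
Lemma holo_derive (U : C -> Prop) (g : C -> C) : isopen U -> holo U g -> holo U (C_derive g).
Proof.
  intros HU Hg p Hp. destruct (open_ball U p HU Hp) as [r [Hr HB]].
  apply (weierstrass (pnear 0) (fun z h => (g (z + h) - g z) / h) (C_derive g) p (r / 2)).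
  - generalize (filter_and (F := pnear 0) _ _ (pnear_of_near 0 _ (near_ball 0 (r / 2) ltac:(lra))) (pnear_neq 0)).
    apply filter_imp. intros h [Hh Hh0]. replace (h - 0) with h in Hh by ring.
    apply holo_div; auto using Ball_open, holo_const.
    apply holo_minus; auto using Ball_open.
    + apply holo_comp with (V := U) (f := g); auto using Ball_open.
      * intros z Hz. apply HB. unfold Ball in *.
        replace (z + h - p) with ((z - p) + h) by ring.
        eapply Rle_lt_trans; [apply Cmod_triangle|]. lra.
      * apply holo_plus; auto using Ball_open, holo_id, holo_const.
    + eapply holo_sub; [|exact Hg]. intros z Hz; apply HB; unfold Ball in *; lra.
  - intros z Hz. apply (tends_diff_quot U); auto. apply HB. unfold Ball in *; lra.
  - apply Ball_center; lra.
Qed.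

(** * Division by z - p and primitives on discs *)

Lemma Ball_segment (p z : C) (r s : R) : (0 <= s <= 1)%R -> Ball p r z -> Ball p r (p + (z - p) * s).
Proof.
  intros Hs Hz. unfold Ball in *. replace (p + (z - p) * s - p) with (s * (z - p)) by ring.
  rewrite Cmod_mult, Cmod_R, Rabs_pos_eq by lra.
  assert (s * Cmod (z - p) <= 1 * Cmod (z - p))%R
    by (apply Rmult_le_compat_r; [apply Cmod_ge_0|lra]). lra.
Qed.

Lemma contR_line (g : C -> C) (a b : C) (s : R) :
  cts g (a + b * s) -> contR (fun x => g (a + b * x)) s.
Proof. intros. apply (contR_comp g (fun x => a + b * x)); auto. apply contR_affine. Qed.

Lemma contR_RtoC (s : R) : contR RtoC s.
Proof.
  apply tends_eps. typeclasses eauto. intros e He. exists e. split; auto. intros x Hx.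
  rewrite <- RtoC_minus, Cmod_R. auto.
Qed.

(** For k = g' the radial mean is the quotient (g z - g p) / (z - p), and multiplied by z - p it is
    a primitive of k: division and primitives on discs both come from it. *)
Lemma holo_radial_mean (k : C -> C) (p : C) (r : R) : holo (Ball p r) k ->
  holo (Ball p r) (fun z => CInt (fun s => k (p + (z - p) * s))) /\
  forall z, Ball p r z ->
    cderiv (fun z => CInt (fun s => k (p + (z - p) * s))) z
           (CInt (fun s => s * C_derive k (p + (z - p) * s))).
Proof.
  intros Hk.
  assert (Hk' := holo_derive _ _ (Ball_open p r) Hk).
  assert (D : forall z, Ball p r z ->
    cderiv (fun z => CInt (fun s => k (p + (z - p) * s))) z
           (CInt (fun s => s * C_derive k (p + (z - p) * s)))).
  { intros z Hz. apply CInt_cderiv.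
    - generalize (Ball_open _ _ _ Hz). apply filter_imp. intros u Hu s Hs.
      apply (contR_line k). eapply holo_cts; [exact Hk|]. apply Ball_segment; auto.
    - intros s Hs. apply contR_mult. apply contR_RtoC.
      apply (contR_line (C_derive k)). eapply holo_cts; [exact Hk'|]. apply Ball_segment; auto.
    - intros s Hs e He. set (q := p + (z - p) * s).
      assert (Hq : Ball p r q) by (apply Ball_segment; auto).
      set (K := (1 + Cmod (C_derive k q))%R).
      assert (HK : (1 <= K)%R) by (unfold K; generalize (Cmod_ge_0 (C_derive k q)); lra).
      destruct (cderiv_strict k (C_derive k) q) with (e := (e / 4)%R) as [d [Hd HS]]; try lra.
      { generalize (Ball_open _ _ _ Hq). apply filter_imp. intros; apply Hk; auto. }
      { apply Hk; auto. }
      set (M := (1 + Cmod (z - p))%R).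
      assert (HM : (1 <= M)%R) by (unfold M; generalize (Cmod_ge_0 (z - p)); lra).
      (* Within d' both points p + (z - p) s' and p + (w - p) s' stay in the ball about q where k is
         strictly differentiable, and replacing s by s' in front of k' costs at most e / 4 per unit
         of |w - z|. *)
      set (d' := Rmin 1 (Rmin (d / (4 * M)) (e / (4 * K)))).
      assert (Hd' : (0 < d')%R).
      { apply Rmin_pos; [lra|]. apply Rmin_pos; apply Rdiv_lt_0_compat; lra. }
      assert (D1 : (d' <= 1)%R) by apply Rmin_l.
      assert (D2 : (d' * M <= d / 4)%R).
      { apply Rle_trans with (d / (4 * M) * M)%R. apply Rmult_le_compat_r; [lra|].
        eapply Rle_trans; [apply Rmin_r|apply Rmin_l]. right; field; lra. }
      assert (D3 : (d' * K <= e / 4)%R).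
      { apply Rle_trans with (e / (4 * K) * K)%R. apply Rmult_le_compat_r; [lra|].
        eapply Rle_trans; [apply Rmin_r|apply Rmin_r]. right; field; lra. }
      exists d'. split; auto.
      intros s' w Hs' Hw. unfold Ball in Hw.
      assert (S1 : (Rabs s' <= 2)%R).
      { replace s' with ((s' - s) + s)%R by ring. eapply Rle_trans; [apply Rabs_triang|].
        rewrite (Rabs_pos_eq s) by lra. lra. }
      assert (Hdz : (Cmod ((z - p) * (s' - s)%R) <= d / 4)%R).
      { rewrite Cmod_mult, Cmod_R. apply Rle_trans with (M * d')%R; [|lra].
        apply Rmult_le_compat; try apply Cmod_ge_0; try apply Rabs_pos; unfold M; lra. }
      assert (Hdw : (Cmod ((w - z) * s') <= d / 2)%R).
      { rewrite Cmod_mult, Cmod_R. apply Rle_trans with (d' * 2)%R.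
        apply Rmult_le_compat; try apply Cmod_ge_0; try apply Rabs_pos; lra.
        assert (d' * 1 <= d' * M)%R by (apply Rmult_le_compat_l; lra). lra. }
      assert (B1 : Ball q d (p + (z - p) * s')).
      { unfold Ball. replace (p + (z - p) * s' - q) with ((z - p) * (s' - s)%R)
          by (unfold q; rewrite RtoC_minus; ring). lra. }
      assert (B2 : Ball q d (p + (w - p) * s')).
      { unfold Ball. replace (p + (w - p) * s' - q) with ((z - p) * (s' - s)%R + (w - z) * s')
          by (unfold q; rewrite RtoC_minus; ring).
        eapply Rle_lt_trans; [apply Cmod_triangle|]. lra. }
      specialize (HS _ _ B1 B2). simpl.
      replace (p + (w - p) * s' - (p + (z - p) * s')) with ((w - z) * s') in HS by ring.
      replace (k (p + (w - p) * s') - k (p + (z - p) * s') - s * C_derive k q * (w - z)) with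
        ((k (p + (w - p) * s') - k (p + (z - p) * s') - C_derive k q * ((w - z) * s')) +
         C_derive k q * ((w - z) * (s' - s)%R)) by (rewrite RtoC_minus; ring).
      eapply Rle_trans; [apply Cmod_triangle|].
      rewrite !Cmod_mult, !Cmod_R in *.
      assert (T1 : (e / 4 * (Cmod (w - z) * Rabs s') <= e / 2 * Cmod (w - z))%R).
      { apply Rle_trans with (e / 4 * (Cmod (w - z) * 2))%R; [|lra].
        apply Rmult_le_compat_l; [lra|]. apply Rmult_le_compat_l; auto. apply Cmod_ge_0. }
      assert (T2 : (Cmod (C_derive k q) * (Cmod (w - z) * Rabs (s' - s)) <= e / 4 * Cmod (w - z))%R).
      { apply Rle_trans with (K * (Cmod (w - z) * d'))%R.
        - apply Rmult_le_compat. apply Cmod_ge_0.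
          apply Rmult_le_pos; [apply Cmod_ge_0|apply Rabs_pos]. unfold K; lra.
          apply Rmult_le_compat_l; [apply Cmod_ge_0|lra].
        - replace (K * (Cmod (w - z) * d'))%R with (d' * K * Cmod (w - z))%R by ring.
          apply Rmult_le_compat_r; auto. apply Cmod_ge_0. }
      generalize (Cmod_ge_0 (w - z)); intros Hpos.
      assert (0 <= e * Cmod (w - z))%R by (apply Rmult_le_pos; lra). lra. }
  split; auto.
  apply holo_intro with (fun z => CInt (fun s => s * C_derive k (p + (z - p) * s))); auto using Ball_open.
  intros z Hz. split; auto.
  apply (CInt_tends (near z) (fun s z => s * C_derive k (p + (z - p) * s))).
  - intros s Hs. apply tends_mult. typeclasses eauto.
    eapply filterlim_comp. apply filterlim_fst. apply contR_RtoC.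
    apply tends_comp_cts. eapply holo_cts; [exact Hk'|]. apply Ball_segment; auto.
    apply tends_plus. typeclasses eauto. apply tends_const; typeclasses eauto.
    apply tends_mult. typeclasses eauto. apply tends_minus. typeclasses eauto.
    intros P HP. apply near_snd; auto; typeclasses eauto. apply tends_const; typeclasses eauto.
    eapply filterlim_comp. apply filterlim_fst. apply contR_RtoC.
  - generalize (Ball_open _ _ _ Hz). apply filter_imp. intros u Hu s Hs. apply contR_mult.
    apply contR_RtoC.
    apply (contR_line (C_derive k)). eapply holo_cts; [exact Hk'|]. apply Ball_segment; auto.
  - intros s Hs. apply contR_mult. apply contR_RtoC.
    apply (contR_line (C_derive k)). eapply holo_cts; [exact Hk'|]. apply Ball_segment; auto.
Qed.

(** Hadamard's division, with q the mean of g' over the segment from p to z. It stands in for Taylor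
    expansion: coefficients are values at p of successive quotients. *)
Lemma holo_divide (g : C -> C) (p : C) (r : R) : (0 < r)%R -> holo (Ball p r) g ->
  exists q, holo (Ball p r) q /\ q p = C_derive g p /\
    forall z, Ball p r z -> g z = g p + (z - p) * q z.
Proof.
  intros Hr Hg. assert (Hg' := holo_derive _ _ (Ball_open p r) Hg).
  exists (fun z => CInt (fun s => C_derive g (p + (z - p) * s))). split; [|split].
  - apply holo_radial_mean; auto.
  - rewrite <- (CInt_const (C_derive g p)). apply CInt_ext. intros; f_equal; ring.
  - intros z Hz. rewrite <- CInt_scal.
    rewrite (CInt_FTC (fun s => g (p + (z - p) * s))).
    + replace (p + (z - p) * 1) with z by ring. replace (p + (z - p) * 0) with p by ring. ring.
    + intros s Hs. rewrite Cmult_comm. apply rderiv_line. apply Hg. apply Ball_segment; auto.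
    + intros s Hs. apply contR_mult. apply contR_const. apply (contR_line (C_derive g)).
      apply Hg. apply Ball_segment; auto.
    + intros s Hs. apply (contR_line (C_derive g)). apply Hg. apply Ball_segment; auto.
Qed.

(** Integration by parts: the derivative under the integral combines to d/ds of s k(p + (z - p) s),
    whose integral is k z. *)
Lemma cderiv_radial (k : C -> C) (p z : C) (r : R) : holo (Ball p r) k -> Ball p r z ->
  cderiv (fun z => (z - p) * CInt (fun s => k (p + (z - p) * s))) z (k z).
Proof.
  intros Hk Hz. destruct (holo_radial_mean k p r Hk) as [_ H2].
  eapply cderiv_eq. apply cderiv_mult. apply cderiv_minus. apply cderiv_id.
  apply cderiv_const. apply H2; auto. simpl.
  assert (C1 : cont01 (fun s => k (p + (z - p) * s))).
  { intros s Hs. apply (contR_line k). eapply holo_cts; eauto. apply Ball_segment; auto. }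
  assert (C2 : cont01 (fun s => s * C_derive k (p + (z - p) * s))).
  { intros s Hs. apply contR_mult. apply contR_RtoC. apply (contR_line (C_derive k)).
    apply Hk. apply Ball_segment; auto. }
  assert (C3 : cont01 (fun s => (z - p) * (s * C_derive k (p + (z - p) * s)))).
  { intros s Hs. apply contR_mult; auto using contR_const. }
  replace (1 - 0) with (RtoC 1) by ring. rewrite Cmult_1_l.
  rewrite <- CInt_scal, <- CInt_plus by auto.
  rewrite (CInt_FTC (fun s => s * k (p + (z - p) * s))).
  - replace (p + (z - p) * 1) with z by ring. ring.
  - intros s Hs. eapply rderiv_ext. reflexivity.
    2:{ apply rderiv_mult. apply (rderiv_ext (fun x : R => 0 + 1 * x) _ s 1 1); auto.
        intros; ring. apply rderiv_affine.
        apply rderiv_line. apply Hk. apply Ball_segment; auto. }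
    simpl. ring.
  - intros s Hs. apply contR_plus; auto.
Qed.

Lemma holo_primitive (k : C -> C) (p : C) (r : R) : holo (Ball p r) k ->
  exists q, holo (Ball p r) q /\ forall z, Ball p r z -> cderiv q z (k z).
Proof.
  intros Hk. exists (fun z => (z - p) * CInt (fun s => k (p + (z - p) * s))). split.
  - apply holo_mult; auto using Ball_open. apply holo_minus; auto using Ball_open, holo_id, holo_const.
    apply holo_radial_mean; auto.
  - intros z Hz. apply cderiv_radial with r; auto.
Qed.

Lemma segment_const (g : C -> C) (a b : C) :
  (forall s : R, (0 <= s <= 1)%R -> cderiv g (a + (b - a) * s) 0) -> g a = g b.
Proof.
  intros H.
  assert (HH : (Cmod (g b - g a - 0 * (b - a)) <= 0 * Cmod (b - a))%R).
  { apply (cderiv_segment_bound g (fun _ => 0)). intros s Hs; split; auto.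
    rewrite Cmod_sub_self. lra. }
  rewrite Rmult_0_l in HH.
  assert (E : g b - g a - 0 * (b - a) = 0).
  { apply Cmod_eq_0. generalize (Cmod_ge_0 (g b - g a - 0 * (b - a))). lra. }
  replace (g b) with (g b - g a - 0 * (b - a) + g a) by ring. rewrite E. ring.
Qed.

Lemma Ball_convex (p z w : C) (r s : R) : (0 <= s <= 1)%R -> Ball p r z -> Ball p r w ->
  Ball p r (z + (w - z) * s).
Proof.
  unfold Ball. intros Hs Hz Hw.
  replace (z + (w - z) * s - p) with ((1 - s)%R * (z - p) + s * (w - p))
    by (rewrite RtoC_minus; ring).
  eapply Rle_lt_trans; [apply Cmod_triangle|]. rewrite !Cmod_mult, !Cmod_R.
  rewrite !Rabs_pos_eq by lra.
  destruct (Rle_lt_dec s 0) as [E|E]. replace s with 0%R by lra. lra.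
  assert ((1 - s) * Cmod (z - p) <= (1 - s) * r)%R by (apply Rmult_le_compat_l; lra).
  assert (s * Cmod (w - p) < s * r)%R by (apply Rmult_lt_compat_l; lra). lra.
Qed.

(* If [p] lies on the segment [z, w], a detour through [p + i (w - p)] avoids it. *)
Lemma punctured_const (g : C -> C) (p z w : C) (r : R) :
  (forall u, Ball p r u -> u <> p -> cderiv g u 0) ->
  Ball p r z -> z <> p -> Ball p r w -> w <> p -> g z = g w.
Proof.
  intros H Hz Hzp Hw Hwp.
  assert (Hseg : forall a b, Ball p r a -> Ball p r b ->
    (forall s : R, (0 <= s <= 1)%R -> a + (b - a) * s <> p) -> g a = g b).
  { intros a b Ha Hb Hn. apply segment_const. intros s Hs. apply H; auto. apply Ball_convex; auto. }
  assert (HB : forall a : C, Ball p r a -> Ball p r (p + Ci * (a - p))).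
  { intros a. unfold Ball. replace (p + Ci * (a - p) - p) with (Ci * (a - p)) by ring.
    rewrite Cmod_mult, Cmod_Ci. lra. }
  assert (Hturn : forall a : C, a <> p -> forall s : R,
    a + (p + Ci * (a - p) - a) * s <> p).
  { intros a Ha s E.
    assert (E' : (a - p) * (1 - s + Ci * s) = 0).
    { replace ((a - p) * (1 - s + Ci * s)) with (a + (p + Ci * (a - p) - a) * s - p) by ring.
      rewrite E; ring. }
    destruct (Ceq_dec (1 - s + Ci * s) 0) as [K|K].
    - assert (K1 := f_equal Re K). assert (K2 := f_equal Im K). simpl in K1, K2. lra.
    - apply (Cmult_neq_0 (a - p) (1 - s + Ci * s)); auto. apply Csub_neq_0; auto. }
  destruct (classic (exists s : R, (0 <= s <= 1)%R /\ z + (w - z) * s = p)) as [[s [Hs E]]|N].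
  - rewrite (Hseg w (p + Ci * (w - p))); auto.
    apply Hseg; auto. intros s' Hs' E'.
    assert (F1 : z - p = - s * (w - z)) by (rewrite <- E; ring).
    assert (F2 : (w - p) = (1 - s) * (w - z)) by (rewrite <- E; ring).
    assert (F3 : (1 - s') * (z - p) + s' * Ci * (w - p) = 0).
    { replace ((1 - s') * (z - p) + s' * Ci * (w - p)) with
       (z + (p + Ci * (w - p) - z) * s' - p) by ring. rewrite E'. ring. }
    rewrite F1, F2 in F3.
    assert (F4 : (w - z) * (- ((1 - s') * s) + Ci * (s' * (1 - s))) = 0).
    { rewrite <- F3. ring. }
    destruct (Ceq_dec (- ((1 - s') * s) + Ci * (s' * (1 - s))) 0) as [K|K].
    + assert (K1 := f_equal Re K). assert (K2 := f_equal Im K). simpl in K1, K2.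
      assert (P1 : ((1 - s') * s = 0)%R) by lra. assert (P2 : (s' * (1 - s) = 0)%R) by lra.
      assert (s <> 0)%R.
      { intros ->. apply Hzp. rewrite <- E. ring. }
      assert (s <> 1)%R.
      { intros ->. apply Hwp. rewrite <- E. ring. }
      apply Rmult_integral in P1. apply Rmult_integral in P2. lra.
    + apply (Cmult_neq_0 (w - z) _) in F4; auto. intros Q.
      apply Hzp. rewrite <- E. replace w with (w - z + z) by ring. rewrite Q. ring.
  - apply Hseg; auto. intros s Hs E. apply N. exists s; auto.
Qed.

(** * Liouville for doubly periodic functions *)

Lemma cts_punctured_eq (f g : C -> C) (p : C) :
  cts f p -> cts g p -> pnear p (fun z => f z = g z) -> f p = g p.
Proof.
  intros Hf Hg H. apply (tends_unique (pnear p) f).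
  - intros P HP. apply pnear_of_near. apply Hf; auto.
  - apply tends_ext with g. typeclasses eauto.
    revert H; apply filter_imp; auto.
    intros P HP. apply pnear_of_near. apply Hg; auto.
Qed.

Lemma cderiv_reflect (g : C -> C) (z l : C) :
  cderiv g (Cconj z) l -> cderiv (fun w => Cconj (g (Cconj w))) z (Cconj l).
Proof.
  intros H e He. destruct (H e He) as [d [Hd HH]]. exists d; split; auto.
  intros w Hw. specialize (HH (Cconj w)).
  assert (E : Cconj w - Cconj z = Cconj (w - z)) by (rewrite Cminus_conj; auto).
  rewrite E, Cmod_conj in HH. specialize (HH Hw).
  rewrite <- Cmod_conj. rewrite !Cminus_conj, Cmult_conj, !Cconj_conj. exact HH.
Qed.

Lemma cts_reflect (g : C -> C) (z : C) : cts g (Cconj z) -> cts (fun w => Cconj (g (Cconj w))) z.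
Proof.
  intros H. unfold cts in *. rewrite tends_eps in * by typeclasses eauto.
  intros e He. destruct (H e He) as [d [Hd HH]]. exists d; split; auto.
  intros w Hw. rewrite <- Cminus_conj, Cmod_conj. apply HH.
  rewrite <- Cminus_conj, Cmod_conj. auto.
Qed.

Lemma holo_reflect (U : C -> Prop) (g : C -> C) : isopen U -> holo U g ->
  holo (fun z => U (Cconj z)) (fun z => Cconj (g (Cconj z))).
Proof.
  intros HU Hg. apply holo_intro with (fun z => Cconj (C_derive g (Cconj z))).
  - intros p Hp. destruct (HU _ Hp) as [d [Hd HH]]. exists d; split; auto. intros z Hz.
    apply HH. rewrite <- Cminus_conj, Cmod_conj. auto.
  - intros p Hp. destruct (Hg _ Hp). split. apply cderiv_reflect; auto. apply cts_reflect; auto.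
Qed.

Definition everywhere : C -> Prop := fun _ => True.
Lemma everywhere_open : isopen everywhere.
Proof. intros p _. apply filter_forall. intros; exact I. Qed.

Lemma C_derive_shift (g : C -> C) (a z : C) : holo everywhere g ->
  C_derive (fun u => g (u + a)) z = C_derive g (z + a).
Proof.
  intros Hg. apply cderiv_C_derive. eapply cderiv_eq.
  apply (cderiv_comp g (fun u => u + a)). apply (Hg (z + a) I).
  apply cderiv_plus. apply cderiv_id. apply cderiv_const. simpl; ring.
Qed.

Lemma holo_shift (g : C -> C) (a : C) : holo everywhere g -> holo everywhere (fun u => g (u + a)).
Proof.
  intros Hg. apply holo_comp with (V := everywhere) (f := g); auto using everywhere_open.
  apply holo_plus; auto using everywhere_open, holo_id, holo_const.
Qed.

Lemma C_derive_periodic (g : C -> C) (a z : C) : holo everywhere g ->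
  (forall z, g (z + a) = g z) -> C_derive g (z + a) = C_derive g z.
Proof.
  intros Hg Hp. rewrite <- C_derive_shift by auto. 
  apply cderiv_C_derive. apply cderiv_ext with g. apply filter_forall. auto. apply (Hg z I).
Qed.

Lemma RInt_pos_continuous_zero (k : R -> R) (c : R) : (0 < c < 1)%R ->
  (forall x, (0 <= x <= 1)%R -> continuous k x) -> (forall x, (0 <= x <= 1)%R -> (0 <= k x)%R) ->
  RInt k 0 1 = 0%R -> k c = 0%R.
Proof.
  intros Hc Hk Hpos H0.
  assert (EX : forall a b, (0 <= a)%R -> (a <= b)%R -> (b <= 1)%R -> ex_RInt k a b).
  { intros a b Ha Hab Hb. apply (ex_RInt_continuous (V := R_CompleteNormedModule)).
    intros z Hz. rewrite Rmin_left, Rmax_right in Hz by lra. apply Hk; lra. }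
  apply NNPP. intros Hn.
  assert (Hkc : (0 < k c)%R) by (generalize (Hpos c); intros; lra).
  assert (HL : locally c (fun x => (0 < k x)%R)).
  { apply (Hk c ltac:(lra)). exists (mkposreal _ Hkc). intros y Hy.
    change (Rabs (y - k c) < k c)%R in Hy. apply Rabs_def2 in Hy. lra. }
  destruct HL as [d Hd].
  set (r := Rmin (d / 2) (Rmin c (1 - c))).
  assert (Hr : (0 < r)%R).
  { generalize (cond_pos d). intros. repeat apply Rmin_pos; lra. }
  assert (R1 : (r <= d / 2)%R) by apply Rmin_l.
  assert (R2 : (r <= c)%R) by (eapply Rle_trans; [apply Rmin_r|apply Rmin_l]).
  assert (R3 : (r <= 1 - c)%R) by (eapply Rle_trans; [apply Rmin_r|apply Rmin_r]).
  assert (P1 : (0 < RInt k (c - r) (c + r))%R).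
  { apply RInt_gt_0. lra.
    - intros x Hx. apply Hd. change (Rabs (x - c) < d)%R. apply Rabs_def1; lra.
    - intros x Hx. apply Hk; lra. }
  assert (P2 : (0 <= RInt k 0 (c - r))%R).
  { apply RInt_ge_0. lra. apply EX; lra. intros; apply Hpos; lra. }
  assert (P3 : (0 <= RInt k (c + r) 1)%R).
  { apply RInt_ge_0. lra. apply EX; lra. intros; apply Hpos; lra. }
  assert (X1 : ex_RInt k 0 (c - r)) by (apply EX; lra).
  assert (X2 : ex_RInt k (c - r) (c + r)) by (apply EX; lra).
  assert (X3 : ex_RInt k (c + r) 1) by (apply EX; lra).
  assert (X4 : ex_RInt k (c - r) 1) by (apply EX; lra).
  assert (C1 := RInt_Chasles k 0 (c - r) 1 X1 X4).
  assert (C2 := RInt_Chasles k (c - r) (c + r) 1 X2 X3).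
  change (RInt k 0 (c - r) + RInt k (c - r) 1 = RInt k 0 1)%R in C1.
  change (RInt k (c - r) (c + r) + RInt k (c + r) 1 = RInt k (c - r) 1)%R in C2. lra.
Qed.

Lemma cconj_mult_self (z : C) : Cconj z * z = RtoC (Cmod z ^ 2).
Proof. rewrite Cmult_comm. symmetry. apply Cmod2_conj. Qed.

(* Energy argument: with [g* z = conj (g (conj z))], the function
   [psi y = int_0^1 g*(x - i y) g'(x + i y) dx] is [L]-periodic and, by integration by parts,
   satisfies [i psi' = 2 int_0^1 |g'(x + i y)|^2 dx >= 0]. *)
Lemma liouville_mid (g : C -> C) (L : R) : (0 < L)%R -> holo everywhere g ->
  (forall z, g (z + 1) = g z) -> (forall z, g (z + Ci * L) = g z) ->
  C_derive g (RtoC (1 / 2) + Ci * (L / 2)%R) = 0.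
Proof.
  intros HL Hg P1 PL.
  set (gs := fun z => Cconj (g (Cconj z))).
  assert (Hgs : holo everywhere gs) by (apply (holo_reflect everywhere); auto using everywhere_open).
  assert (Hgs' : forall z, C_derive gs z = Cconj (C_derive g (Cconj z))).
  { intros z. apply cderiv_C_derive. apply cderiv_reflect. apply (Hg _ I). }
  assert (Hdg := holo_derive _ _ everywhere_open Hg).
  assert (Hdgs := holo_derive _ _ everywhere_open Hgs).
  assert (Hddg := holo_derive _ _ everywhere_open Hdg).
  set (dg := C_derive g) in *. set (dgs := C_derive gs) in *. set (ddg := C_derive dg) in *.
  assert (D1 : forall z, cderiv g z (dg z)) by (intros; apply (Hg _ I)).
  assert (D2 : forall z, cderiv gs z (dgs z)) by (intros; apply (Hgs _ I)).
  assert (D3 : forall z, cderiv dg z (ddg z)) by (intros; apply (Hdg _ I)).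
  assert (cG : forall z, cts gs z) by (intros; eapply holo_cts; eauto; exact I).
  assert (cdG : forall z, cts dgs z) by (intros; eapply holo_cts; eauto; exact I).
  assert (cdg : forall z, cts dg z) by (intros; eapply holo_cts; eauto; exact I).
  assert (cddg : forall z, cts ddg z) by (intros; eapply holo_cts; eauto; exact I).
  set (Y := fun y x => gs (x - Ci * y) * dg (x + Ci * y)).
  set (Y1 := fun y x => - Ci * dgs (x - Ci * y) * dg (x + Ci * y) +
     Ci * (gs (x - Ci * y) * ddg (x + Ci * y))).
  assert (cline : forall (k : C -> C) (c : C) (s : R), (forall z, cts k z) ->
     contR (fun x : R => k (x + c)) s).
  { intros k c s Hk. apply (contR_comp k (fun x : R => x + c)); auto.
    apply contR_plus. apply contR_RtoC. apply contR_const. }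
  (* y is complex here, because differentiation under the integral is available for a complex
     parameter; [chi] below restricts it to the real line. *)
  set (psi := fun y => CInt (fun x => Y y x)).
  assert (Dpsi : forall y, cderiv psi y (CInt (fun x => Y1 y x))).
  { intros y. apply (CInt_cderiv (fun y (x : R) => Y y x) (fun x => Y1 y x)).
    - apply filter_forall. intros y' s _. apply contR_mult. apply (cline gs); auto.
      apply (cline dg); auto.
    - intros s _. repeat first [apply contR_plus | apply contR_mult | apply contR_const].
      apply (cline dgs); auto. apply (cline dg); auto. apply (cline gs); auto.
      apply (cline ddg); auto.
    - intros s _ e He.
      set (Z := fun y' (s' : R) => Y1 y' s').
      assert (HJ : tends (filter_prod (nearR s) (near y)) (fun sy => Z (snd sy) (fst sy)) (Z y s)).
      { assert (a1 : tends (filter_prod (nearR s) (near y))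
                  (fun sy : R * C => fst sy - Ci * snd sy) (s - Ci * y)).
        { apply tends_minus. typeclasses eauto. eapply filterlim_comp. apply filterlim_fst.
          apply contR_RtoC. apply tends_mult. typeclasses eauto. apply tends_const; typeclasses eauto.
          intros P HP. apply near_snd; auto; typeclasses eauto. }
        assert (a2 : tends (filter_prod (nearR s) (near y))
                  (fun sy : R * C => fst sy + Ci * snd sy) (s + Ci * y)).
        { apply tends_plus. typeclasses eauto. eapply filterlim_comp. apply filterlim_fst.
          apply contR_RtoC. apply tends_mult. typeclasses eauto. apply tends_const; typeclasses eauto.
          intros P HP. apply near_snd; auto; typeclasses eauto. }
        unfold Z, Y1. apply tends_plus. typeclasses eauto.
        apply tends_mult. typeclasses eauto. apply tends_mult. typeclasses eauto.
        apply tends_const; typeclasses eauto. apply tends_comp_cts; auto.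
        apply tends_comp_cts; auto.
        apply tends_mult. typeclasses eauto. apply tends_const; typeclasses eauto.
        apply tends_mult. typeclasses eauto. apply tends_comp_cts; auto.
        apply tends_comp_cts; auto. }
      rewrite tends_eps in HJ by typeclasses eauto.
      destruct (HJ e He) as [Q1 Q2 [d1 [Hd1 HQ1]] [d2 [Hd2 HQ2]] HQ].
      exists (Rmin d1 d2). split. apply Rmin_pos; auto.
      intros s' y' Hs' Hy'. fold (Z y s).
      apply (cderiv_segment_bound (fun y => Y y s') (fun y => Z y s')).
      intros v Hv. split.
      + set (u := y + (y' - y) * v). unfold Y, Z, Y1. eapply cderiv_eq. apply cderiv_mult.
        apply (cderiv_comp gs (fun u => s' - Ci * u)). apply D2.
        apply cderiv_minus. apply cderiv_const. apply cderiv_mult. apply cderiv_const. apply cderiv_id.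
        apply (cderiv_comp dg (fun u => s' + Ci * u)). apply D3.
        apply cderiv_plus. apply cderiv_const. apply cderiv_mult. apply cderiv_const. apply cderiv_id.
        simpl. ring.
      + left. apply (HQ s' (y + (y' - y) * v)).
        apply HQ1. eapply Rlt_le_trans; [exact Hs'|apply Rmin_l].
        apply HQ2. apply (Ball_segment y y' d2 v Hv).
        eapply Rlt_le_trans; [exact Hy'|apply Rmin_r]. }
  assert (Hparts : forall y, CInt (fun x => Y1 y x) =
     (- (2) * Ci) * CInt (fun x : R => dgs (x - Ci * y) * dg (x + Ci * y))).
  { intros y.
    assert (c1 : cont01 (fun x : R => dgs (x - Ci * y) * dg (x + Ci * y))).
    { intros s _. apply contR_mult. apply (cline dgs); auto. apply (cline dg); auto. }
    assert (c2 : cont01 (fun x : R => gs (x - Ci * y) * ddg (x + Ci * y))).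
    { intros s _. apply contR_mult. apply (cline gs); auto. apply (cline ddg); auto. }
    assert (c3 : cont01 (fun x : R => dgs (x - Ci * y) * dg (x + Ci * y) +
        gs (x - Ci * y) * ddg (x + Ci * y))).
    { intros s Hs. apply contR_plus; auto. }
    assert (E : CInt (fun x : R => dgs (x - Ci * y) * dg (x + Ci * y) +
        gs (x - Ci * y) * ddg (x + Ci * y)) = 0).
    { rewrite (CInt_FTC (fun x : R => gs (x - Ci * y) * dg (x + Ci * y))); auto.
      - replace (1 - Ci * y) with (0 - Ci * y + 1) by ring.
        replace (1 + Ci * y) with (0 + Ci * y + 1) by ring.
        assert (Eg : forall z, gs (z + 1) = gs z).
        { intros z. unfold gs. rewrite Cplus_conj.
          replace (Cconj 1) with (RtoC 1) by (unfold Cconj, RtoC; simpl; f_equal; ring).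
          rewrite P1. auto. }
        rewrite Eg. unfold dg at 1. rewrite (C_derive_periodic g 1) by auto. fold dg. ring.
      - intros s Hs. eapply rderiv_ext. reflexivity.
        2:{ apply rderiv_mult.
            apply (rderiv_ext (fun x : R => gs (- Ci * y + 1 * x)) _ s (dgs (s - Ci * y) * 1) (dgs (s - Ci * y))).
            intros; f_equal; ring. ring. apply rderiv_line.
            replace (- Ci * y + 1 * s) with (s - Ci * y) by ring. apply D2.
            apply (rderiv_ext (fun x : R => dg (Ci * y + 1 * x)) _ s (ddg (s + Ci * y) * 1) (ddg (s + Ci * y))).
            intros; f_equal; ring. ring. apply rderiv_line.
            replace (Ci * y + 1 * s) with (s + Ci * y) by ring. apply D3. }
        simpl. ring. }
    rewrite CInt_plus in E by auto.
    rewrite (CInt_ext _ (fun x : R => (- Ci) * (dgs (x - Ci * y) * dg (x + Ci * y)) +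
        Ci * (gs (x - Ci * y) * ddg (x + Ci * y)))) by (intros; unfold Y1; ring).
    rewrite CInt_plus, !CInt_scal; auto.
    2,3: intros s Hs; apply contR_mult; auto using contR_const.
    set (A := CInt (fun x : R => dgs (x - Ci * y) * dg (x + Ci * y))) in *.
    set (B := CInt (fun x : R => gs (x - Ci * y) * ddg (x + Ci * y))) in *.
    replace (- Ci * A + Ci * B) with (- (2) * Ci * A + Ci * (A + B)) by ring.
    rewrite E. ring. }
  set (en := fun y : R => RInt (fun x => (Cmod (dg (x + Ci * y)%C) ^ 2)%R) 0 1).
  assert (Hen : forall y : R, CInt (fun x => Y1 y x) = (- (2) * Ci) * RtoC (en y)).
  { intros y. rewrite Hparts. f_equal.
    rewrite (CInt_ext _ (fun x : R => RtoC (Cmod (dg (x + Ci * y)%C) ^ 2))).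
    - unfold CInt, RtoC, en. f_equal. simpl. rewrite RInt_const. 
      unfold scal; simpl. unfold mult; simpl. ring.
    - intros x Hx. rewrite Hgs'. rewrite <- cconj_mult_self. do 3 f_equal.
      unfold Cconj, Cminus, Cplus, Cmult, Copp, Ci, RtoC; simpl; f_equal; ring. }
  set (chi := fun y : R => Re (Ci * / 2 * psi (0 + 1 * y))).
  assert (Dchi : forall y, is_derive chi y (en y)).
  { intros y. assert (RD : rderiv (fun y : R => Ci * / 2 * psi (0 + 1 * y)) y (RtoC (en y))).
    { eapply rderiv_ext. reflexivity.
      2:{ apply rderiv_scal. apply rderiv_line. apply Dpsi. }
      replace (0 + 1 * y) with (RtoC y) by ring. rewrite Hen.
      replace (Ci * / 2 * (- (2) * Ci * en y * 1)) with (- (Ci * Ci) * en y) by (field).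
      replace (Ci * Ci) with (- (1)) by (unfold Ci, Cmult, Copp, RtoC; simpl; f_equal; ring). ring. }
    apply rderiv_Re in RD. exact RD. }
  assert (Hcont : forall y x : R, continuous (fun x : R => (Cmod (dg (x + Ci * y)%C) ^ 2)%R) x).
  { intros y x.
    assert (K := contR_Re (fun x : R => Cconj (dg (x + Ci * y)) * dg (x + Ci * y)) x).
    eapply continuous_ext; [|apply K].
    - intros t. cbv beta. rewrite cconj_mult_self. reflexivity.
    - apply contR_mult; [|apply (cline dg); auto].
      eapply filterlim_ext with (f := fun x : R => dgs (x - Ci * y)).
      + intros t. rewrite Hgs'. do 2 f_equal.
        unfold Cconj, Cminus, Cplus, Cmult, Copp, Ci, RtoC; simpl; f_equal; ring.
      + replace (Cconj (dg (x + Ci * y))) with (dgs (x - Ci * y)).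
        apply (cline dgs); auto.
        rewrite Hgs'. do 2 f_equal.
        unfold Cconj, Cminus, Cplus, Cmult, Copp, Ci, RtoC; simpl; f_equal; ring. }
  assert (Hen0 : forall y, (0 <= en y)%R).
  { intros y. apply RInt_ge_0. lra.
    apply (ex_RInt_continuous (V := R_CompleteNormedModule)). intros; apply Hcont.
    intros. apply pow2_ge_0. }
  assert (Hmono : forall a b, (a <= b)%R -> (chi a <= chi b)%R).
  { intros a b Hab. destruct (MVT_gen chi a b en) as [c [Hc E]].
    - intros; apply Dchi.
    - intros. apply continuity_pt_filterlim. apply (ex_derive_continuous chi).
      eexists; apply Dchi.
    - assert (0 <= en c * (b - a))%R by (apply Rmult_le_pos; auto; lra). lra. }
  assert (Hper : chi L = chi 0%R).
  { unfold chi. do 2 f_equal. unfold psi. apply CInt_ext. intros x _. unfold Y.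
    f_equal.
    - unfold gs. f_equal.
      rewrite <- (PL (Cconj (x - Ci * (0 + 1 * 0)))). f_equal.
      unfold Cconj, Cminus, Cplus, Cmult, Copp, Ci, RtoC; simpl; f_equal; ring.
    - unfold dg. rewrite <- (C_derive_periodic g (Ci * L) (x + Ci * (0 + 1 * 0))) by auto.
      f_equal. ring. }
  (* [chi] is monotone with equal values at 0 and L, hence constant between them. At the interior
     point L / 2 its two-sided derivative, the energy, must vanish. *)
  assert (Hz : en (L / 2)%R = 0%R).
  { assert (U1 := is_derive_unique _ _ _ (Dchi (L / 2)%R)). rewrite <- U1.
    apply is_derive_unique. apply is_derive_ext_loc with (fun _ => chi 0%R).
    - assert (HL2 : (0 < L / 2)%R) by lra. exists (mkposreal _ HL2). intros y Hy.
      change (Rabs (y - L / 2) < L / 2)%R in Hy. apply Rabs_def2 in Hy.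
      apply Rle_antisym. apply Hmono; lra. rewrite <- Hper. apply Hmono; lra.
    - apply (is_derive_const (K := R_AbsRing) (V := R_NormedModule)). }
  assert (F := RInt_pos_continuous_zero (fun x => (Cmod (dg (x + Ci * (L / 2)%R)%C) ^ 2)%R) (1/2)
     ltac:(lra) (fun x _ => Hcont _ x) (fun x _ => pow2_ge_0 _) Hz).
  simpl in F. apply Cmod_eq_0.
  apply Rmult_integral in F. destruct F as [F|F]; auto. lra.
Qed.

(** Translation moves any point to the centre of the period rectangle, where [liouville_mid]
    evaluates the derivative. *)
Lemma liouville_doubly_periodic (g : C -> C) (L : R) : (0 < L)%R -> holo everywhere g ->
  (forall z, g (z + 1) = g z) -> (forall z, g (z + Ci * L) = g z) ->
  forall z, C_derive g z = 0.
Proof.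
  intros HL Hg P1 PL z. set (a := RtoC (1 / 2) + Ci * (L / 2)%R).
  replace z with (a + (z - a)) by ring. rewrite <- (C_derive_shift g) by auto.
  apply liouville_mid; auto. apply holo_shift; auto.
  - intros u. rewrite <- (P1 (u + (z - a))). f_equal; ring.
  - intros u. rewrite <- (PL (u + (z - a))). f_equal; ring.
Qed.

(** * Functions of two variables *)

Definition upper (w : C) : Prop := (0 < Im w)%R.

Lemma upper_open : isopen upper.
Proof.
  intros p Hp. exists (Im p). split; auto. intros z Hz. unfold upper.
  assert (K := Im_le_Cmod (z - p)). simpl in K.
  assert (L : (Rabs (Im z + - Im p) < Im p)%R) by (unfold Im in *; lra).
  apply Rabs_def2 in L. lra.
Qed.

(** The second variable stands for the period omega_2 and is confined to the upper half-plane. Joint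
    continuity is the local uniformity that [weierstrass] requires in order to differentiate in
    either variable. *)
Record analytic2 (F : C -> C -> C) : Prop := {
  an_cont : forall z w, upper w ->
    tends (filter_prod (near z) (near w)) (fun x => F (fst x) (snd x)) (F z w);
  an_fst : forall w, upper w -> holo everywhere (fun z => F z w);
  an_snd : forall z, holo upper (fun w => F z w)
}.

Lemma tends_swap {T U : Type} (F : (T -> Prop) -> Prop) (G : (U -> Prop) -> Prop)
    {FF : Filter F} {FG : Filter G} (k : T -> U -> C) (l : C) :
  tends (filter_prod F G) (fun x => k (fst x) (snd x)) l ->
  tends (filter_prod G F) (fun x => k (snd x) (fst x)) l.
Proof.
  intros H. apply (filterlim_comp _ _ _ (fun x : U * T => (snd x, fst x))
     (fun x => k (fst x) (snd x)) _ (filter_prod F G) _); auto.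
  apply filterlim_pair; [apply filterlim_snd | apply filterlim_fst].
Qed.

Definition d_fst (F : C -> C -> C) : C -> C -> C := fun z w => C_derive (fun u => F u w) z.
Definition d_snd (F : C -> C -> C) : C -> C -> C := fun z w => C_derive (fun u => F z u) w.

Lemma everywhere_sub (p : C) (r : R) : forall z, Ball p r z -> everywhere z.
Proof. intros; exact I. Qed.

Lemma holo_everywhere (g : C -> C) : (forall p, holo (Ball p 1) g) -> holo everywhere g.
Proof. intros H p _. apply (H p). apply Ball_center. lra. Qed.

(** Stated with the bare hypotheses because [analytic2_d_fst] applies it to [d_snd F], whose
    analyticity is not yet known there. *)
Lemma d_fst_cont_gen (F : C -> C -> C) :
  (forall z w, upper w ->
    tends (filter_prod (near z) (near w)) (fun x => F (fst x) (snd x)) (F z w)) ->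
  (forall w, upper w -> holo everywhere (fun z => F z w)) ->
  forall z w, upper w ->
  tends (filter_prod (near z) (near w)) (fun x => d_fst F (fst x) (snd x)) (d_fst F z w).
Proof.
  intros Hc Hz z w Hw.
  apply (weierstrass (near w) F (fun z => F z w) z 1).
  - generalize (upper_open w Hw). apply filter_imp. intros u Hu.
    eapply holo_sub; [|apply (Hz u Hu)]. apply everywhere_sub.
  - intros u _. apply Hc; auto.
  - apply Ball_center; lra.
Qed.

Lemma d_fst_cont (F : C -> C -> C) (z w : C) : analytic2 F -> upper w ->
  tends (filter_prod (near z) (near w)) (fun x => d_fst F (fst x) (snd x)) (d_fst F z w).
Proof. intros HF Hw. apply d_fst_cont_gen; auto; apply HF. Qed.

Lemma d_snd_cont (F : C -> C -> C) (z w : C) : analytic2 F -> upper w ->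
  tends (filter_prod (near z) (near w)) (fun x => d_snd F (fst x) (snd x)) (d_snd F z w).
Proof.
  intros HF Hw. destruct (open_ball _ _ upper_open Hw) as [r [Hr HB]].
  apply (tends_swap (near w) (near z) (fun w z => d_snd F z w)).
  apply (weierstrass (near z) (fun w z => F z w) (fun w => F z w) w r).
  - apply filter_forall. intros u. eapply holo_sub; [|apply (an_snd F HF u)]. auto.
  - intros u Hu. apply (tends_swap (near z) (near u) F). apply HF; auto.
  - apply Ball_center; auto.
Qed.

(** One variable is moved at a time, through the intermediate point (z, w'); joint continuity of the
    partial derivatives keeps each within e of its value at (z0, w0). *)
Lemma analytic2_strict (F : C -> C -> C) (z0 w0 : C) (e : R) :
  analytic2 F -> upper w0 -> (0 < e)%R -> exists d, (0 < d)%R /\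
  forall z z' w w', Ball z0 d z -> Ball z0 d z' -> Ball w0 d w -> Ball w0 d w' ->
   (Cmod (F z' w' - F z w - d_fst F z0 w0 * (z' - z) - d_snd F z0 w0 * (w' - w))
     <= e * (Cmod (z' - z) + Cmod (w' - w)))%R.
Proof.
  intros HF Hw He.
  assert (T1 := d_fst_cont F z0 w0 HF Hw). assert (T2 := d_snd_cont F z0 w0 HF Hw).
  rewrite tends_eps in T1, T2 by typeclasses eauto.
  destruct (T1 e He) as [Q1 Q2 [d1 [Hd1 HQ1]] [d2 [Hd2 HQ2]] HQ].
  destruct (T2 e He) as [R1 R2 [d3 [Hd3 HR1]] [d4 [Hd4 HR2]] HR].
  destruct (open_ball _ _ upper_open Hw) as [d5 [Hd5 HU]].
  set (d := Rmin d1 (Rmin d2 (Rmin d3 (Rmin d4 d5)))).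
  assert (Hd : (0 < d)%R) by (repeat apply Rmin_pos; auto).
  assert (L1 : (d <= d1)%R) by apply Rmin_l.
  assert (M1 : (d <= Rmin d2 (Rmin d3 (Rmin d4 d5)))%R) by apply Rmin_r.
  assert (L2 : (d <= d2)%R) by (eapply Rle_trans; [exact M1|apply Rmin_l]).
  assert (M2 : (d <= Rmin d3 (Rmin d4 d5))%R) by (eapply Rle_trans; [exact M1|apply Rmin_r]).
  assert (L3 : (d <= d3)%R) by (eapply Rle_trans; [exact M2|apply Rmin_l]).
  assert (M3 : (d <= Rmin d4 d5)%R) by (eapply Rle_trans; [exact M2|apply Rmin_r]).
  assert (L4 : (d <= d4)%R) by (eapply Rle_trans; [exact M3|apply Rmin_l]).
  assert (L5 : (d <= d5)%R) by (eapply Rle_trans; [exact M3|apply Rmin_r]).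
  exists d; split; auto. intros z z' w w' Bz Bz' Bw Bw'.
  assert (E1 : (Cmod (F z' w' - F z w' - d_fst F z0 w0 * (z' - z)) <= e * Cmod (z' - z))%R).
  { apply (cderiv_segment_bound (fun u => F u w') (fun u => d_fst F u w')).
    intros s Hs. split.
    - apply (an_fst F HF w'). apply HU. unfold Ball in *; lra. exact I.
    - left. apply (HQ (z + (z' - z) * s) w').
      + apply HQ1. assert (K := Ball_convex z0 z z' d s Hs Bz Bz'). unfold Ball in K; lra.
      + apply HQ2. unfold Ball in *; lra. }
  assert (E2 : (Cmod (F z w' - F z w - d_snd F z0 w0 * (w' - w)) <= e * Cmod (w' - w))%R).
  { apply (cderiv_segment_bound (fun u => F z u) (fun u => d_snd F z u)).
    intros s Hs. assert (K := Ball_convex w0 w w' d s Hs Bw Bw'). split.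
    - apply (an_snd F HF z). apply HU. unfold Ball in *; lra.
    - left. apply (HR z (w + (w' - w) * s)).
      + apply HR1. unfold Ball in *; lra.
      + apply HR2. unfold Ball in *; lra. }
  replace (F z' w' - F z w - d_fst F z0 w0 * (z' - z) - d_snd F z0 w0 * (w' - w)) with
    ((F z' w' - F z w' - d_fst F z0 w0 * (z' - z)) + (F z w' - F z w - d_snd F z0 w0 * (w' - w)))
    by ring.
  eapply Rle_trans; [apply Cmod_triangle|]. lra.
Qed.

(* The difference quotients in [w] are holomorphic in [z], so Weierstrass' theorem applies to them
   and exchanges the two derivatives. *)
Lemma analytic2_d_fst (F : C -> C -> C) : analytic2 F -> analytic2 (d_fst F).
Proof.
  intros HF.
  assert (HDQ : forall w, upper w -> forall z0, holo (Ball z0 1) (fun z => d_snd F z w) /\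
    forall z, Ball z0 1 z -> tends (filter_prod (near z) (pnear 0))
       (fun zh => C_derive (fun u => (F u (w + snd zh) - F u w) / snd zh) (fst zh))
       (d_fst (d_snd F) z w)).
  { intros w Hw z0. destruct (open_ball _ _ upper_open Hw) as [r [Hr HB]].
    apply (weierstrass (pnear 0) (fun z h => (F z (w + h) - F z w) / h) (fun z => d_snd F z w) z0 1).
    - generalize (filter_and (F := pnear 0) _ _
        (pnear_of_near 0 _ (near_ball 0 r Hr)) (pnear_neq 0)).
      apply filter_imp. intros h [Hh Hh0]. replace (h - 0) with h in Hh by ring.
      apply holo_div; auto using Ball_open, holo_const.
      apply holo_minus; auto using Ball_open.
      + eapply holo_sub; [apply everywhere_sub|]. apply HF. apply HB. unfold Ball.
        replace (w + h - w) with h by ring. auto.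
      + eapply holo_sub; [apply everywhere_sub|]. apply HF; auto.
    - intros z Hz. apply tends_eps. typeclasses eauto. intros e He.
      destruct (analytic2_strict F z w (e / 2)) as [d [Hd HS]]; auto; try lra.
      exists (Ball z d) (fun h => (Cmod (h - 0) < d)%R /\ h <> 0).
      + apply near_ball; auto.
      + apply filter_and. apply pnear_of_near. apply near_ball; auto. apply pnear_neq.
      + intros u h Hu [Hh Hh0]. replace (h - 0) with h in Hh by ring. cbn [fst snd].
        assert (B : Ball w d (w + h)) by (unfold Ball; replace (w + h - w) with h by ring; auto).
        specialize (HS u u w (w + h) Hu Hu (Ball_center w d Hd) B).
        replace (w + h - w) with h in HS by ring.
        replace (F u (w + h) - F u w - d_fst F z w * (u - u) - d_snd F z w * h) with
          (F u (w + h) - F u w - d_snd F z w * h) in HS by ring.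
        rewrite Cmod_sub_self in HS.
        replace ((F u (w + h) - F u w) / h - d_snd F z w) with
          ((F u (w + h) - F u w - d_snd F z w * h) / h) by (field; auto).
        rewrite Cmod_div by auto. apply Cmod_gt_0 in Hh0.
        apply Rle_lt_trans with (e / 2)%R; [|lra].
        apply Rmult_le_reg_r with (Cmod h); auto.
        unfold Rdiv at 1. rewrite Rmult_assoc, Rinv_l by lra. lra. }
  assert (Hws : forall w, upper w -> holo everywhere (fun z => d_snd F z w)).
  { intros w Hw. apply holo_everywhere. intros p. apply HDQ; auto. }
  assert (Hcws := d_fst_cont_gen (d_snd F) (fun z w Hw => d_snd_cont F z w HF Hw) Hws).
  split.
  - intros z w Hw. apply d_fst_cont; auto.
  - intros w Hw. apply (holo_derive everywhere (fun z => F z w)). apply everywhere_open.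
    apply HF; auto.
  - intros z. apply holo_intro with (fun w => d_fst (d_snd F) z w). apply upper_open.
    intros w Hw. split.
    + destruct (HDQ w Hw z) as [_ HT]. specialize (HT z (Ball_center z 1 Rlt_0_1)).
      apply (joint_at (pnear 0) (fun z h => C_derive (fun u => (F u (w + h) - F u w) / h) z)) in HT.
      rewrite tends_eps in HT by typeclasses eauto.
      intros e He. destruct (HT e He) as [d [Hd HH]].
      destruct (open_ball _ _ upper_open Hw) as [r [Hr HB]].
      exists (Rmin d r). split. apply Rmin_pos; auto. intros w' Hw'.
      destruct (Ceq_dec w' w) as [E|E].
      { rewrite E. replace (d_fst F z w - d_fst F z w - d_fst (d_snd F) z w * (w - w))
          with (RtoC 0) by ring. rewrite Cmod_sub_self, Cmod_0. lra. }
      set (h := w' - w). assert (Hh0 : h <> 0) by (apply Csub_neq_0; auto).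
      assert (Hh : (Cmod (h - 0) < d)%R).
      { replace (h - 0) with h by ring. eapply Rlt_le_trans; [exact Hw'|apply Rmin_l]. }
      specialize (HH h Hh Hh0).
      assert (Hw1 : upper w').
      { apply HB. eapply Rlt_le_trans; [exact Hw'|apply Rmin_r]. }
      (* The z-derivative of the quotient in w is the quotient in w of [d_fst F], so its limit is
         the sought w-derivative. *)
      rewrite (cderiv_C_derive _ _ ((d_fst F z w' - d_fst F z w) / h)) in HH.
      * replace (d_fst F z w' - d_fst F z w - d_fst (d_snd F) z w * h) with
          (((d_fst F z w' - d_fst F z w) / h - d_fst (d_snd F) z w) * h) by (field; auto).
        rewrite Cmod_mult. apply Rmult_le_compat_r. apply Cmod_ge_0. lra.
      * replace (w + h) with w' by (unfold h; ring).
        eapply cderiv_eq. apply cderiv_div; auto. apply cderiv_minus.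
        apply (an_fst F HF w' Hw1 z I). apply (an_fst F HF w Hw z I). apply cderiv_const.
        unfold d_fst. simpl. field. auto.
    + assert (K := Hcws z w Hw). apply joint_at in K. exact K.
  Unshelve. all: typeclasses eauto.
Qed.

Lemma analytic2_const (c : C) : analytic2 (fun _ _ => c).
Proof.
  split; intros. apply tends_const; typeclasses eauto.
  apply holo_const, everywhere_open. apply holo_const, upper_open.
Qed.

Lemma analytic2_mult (F G : C -> C -> C) : analytic2 F -> analytic2 G ->
  analytic2 (fun z w => F z w * G z w).
Proof.
  intros HF HG. split; intros.
  - apply tends_mult. typeclasses eauto. apply HF; auto. apply HG; auto.
  - apply holo_mult. apply everywhere_open. apply HF; auto. apply HG; auto.
  - apply holo_mult. apply upper_open. apply HF; auto. apply HG; auto.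
Qed.

Lemma analytic2_fst : analytic2 (fun z _ => z).
Proof.
  split; intros. apply filterlim_fst.
  apply holo_id, everywhere_open. apply holo_const, upper_open.
Qed.

(** Joint continuity by an e / 4 argument; holomorphy in each variable by [weierstrass] along N ->
    infinity, the other variable being frozen. *)
Lemma analytic2_limit (FN : nat -> C -> C -> C) (F : C -> C -> C) :
  (forall N, analytic2 (FN N)) ->
  (forall z0 w0, upper w0 -> forall e, (0 < e)%R -> exists N0 d, (0 < d)%R /\
     forall N z w, (N0 <= N)%nat -> Ball z0 d z -> Ball w0 d w ->
       (Cmod (FN N z w - F z w) <= e)%R) ->
  analytic2 F.
Proof.
  intros HN HL.
  assert (Hc : forall z w, upper w ->
    tends (filter_prod (near z) (near w)) (fun x => F (fst x) (snd x)) (F z w)).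
  { intros z w Hw. apply tends_eps. typeclasses eauto. intros e He.
    assert (He4 : (0 < e / 4)%R) by lra.
    destruct (HL z w Hw (e / 4)%R He4) as [N0 [d [Hd HH]]].
    assert (K := an_cont _ (HN N0) z w Hw). rewrite tends_eps in K by typeclasses eauto.
    generalize (filter_and (F := filter_prod (near z) (near w)) _ _ (K (e / 4)%R He4)
      (near_filter_prod (near z) (near w) _ _ (near_ball z d Hd) (near_ball w d Hd))).
    apply filter_imp. intros [u v] [K1 [K2 K3]]. cbn [fst snd] in *.
    assert (A1 := HH N0 u v (le_n _) K2 K3).
    assert (A2 := HH N0 z w (le_n _) (Ball_center z d Hd) (Ball_center w d Hd)).
    generalize (Cmod_sub_triangle (F u v) (FN N0 u v) (F z w))
      (Cmod_sub_triangle (FN N0 u v) (FN N0 z w) (F z w)).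
    rewrite (Cmod_sub_sym (F u v) (FN N0 u v)). lra. }
  assert (Hjoint : forall z0 w0, upper w0 -> forall e, (0 < e)%R -> exists N0 d, (0 < d)%R /\
     forall N z w, (N0 <= N)%nat -> Ball z0 d z -> Ball w0 d w ->
       (Cmod (FN N z w - F z0 w0) < e)%R).
  { intros z w Hw e He. assert (He4 : (0 < e / 4)%R) by lra.
    destruct (HL z w Hw (e / 4)%R He4) as [N0 [d [Hd HH]]].
    assert (K := Hc z w Hw). rewrite tends_eps in K by typeclasses eauto.
    destruct (K (e / 4)%R He4) as [Q1 Q2 [d1 [Hd1 HQ1]] [d2 [Hd2 HQ2]] HQ].
    exists N0, (Rmin d (Rmin d1 d2)). split. repeat apply Rmin_pos; auto.
    intros N u v HN0 Hu Hv. unfold Ball in Hu, Hv.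
    assert (A1 : (Cmod (FN N u v - F u v) <= e / 4)%R).
    { apply HH; auto; unfold Ball; (eapply Rlt_le_trans; [eassumption|apply Rmin_l]). }
    assert (A2 : (Cmod (F u v - F z w) < e / 4)%R).
    { apply (HQ u v). apply HQ1. eapply Rlt_le_trans; [exact Hu|].
      eapply Rle_trans; [apply Rmin_r|apply Rmin_l].
      apply HQ2. eapply Rlt_le_trans; [exact Hv|].
      eapply Rle_trans; [apply Rmin_r|apply Rmin_r]. }
    generalize (Cmod_sub_triangle (FN N u v) (F u v) (F z w)). lra. }
  split; auto.
  - intros w Hw. apply holo_everywhere. intros p.
    apply (weierstrass eventually (fun z N => FN N z w) (fun z => F z w) p 1).
    + exists 0%nat. intros n _. eapply holo_sub; [apply everywhere_sub|]. apply HN; auto.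
    + intros z _. apply tends_eps. typeclasses eauto. intros e He.
      destruct (Hjoint z w Hw e He) as [N0 [d [Hd HH]]].
      exists (Ball z d) (fun N => (N0 <= N)%nat). apply near_ball; auto. exists N0; auto.
      intros u N Hu HN0. apply HH; auto. apply Ball_center; auto.
  - intros z p Hp. destruct (open_ball _ _ upper_open Hp) as [r [Hr HB]].
    apply (weierstrass eventually (fun w N => FN N z w) (fun w => F z w) p r).
    + exists 0%nat. intros n _. eapply holo_sub; [|apply (HN n)]. auto.
    + intros w Hw. apply tends_eps. typeclasses eauto. intros e He.
      destruct (Hjoint z w (HB w Hw) e He) as [N0 [d [Hd HH]]].
      exists (Ball w d) (fun N => (N0 <= N)%nat). apply near_ball; auto. exists N0; auto.
      intros u N Hu HN0. apply HH; auto. apply Ball_center; auto.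
    + apply Ball_center; auto.
Qed.

(** * The sigma function and its quasi-periods *)

Lemma cprod_app {T : Type} (s s' : list T) (F : T -> C) :
  cprod (s ++ s') F = cprod s F * cprod s' F.
Proof.
  induction s as [|x s IH]; unfold cprod in *; simpl. ring. rewrite IH. ring.
Qed.

Lemma cprod_perm {T : Type} (s s' : list T) (F : T -> C) :
  Permutation s s' -> cprod s F = cprod s' F.
Proof.
  induction 1; unfold cprod in *; simpl; try congruence. ring.
Qed.

Lemma cprod_ext {T : Type} (s : list T) (F G : T -> C) :
  (forall x, In x s -> F x = G x) -> cprod s F = cprod s G.
Proof.
  induction s as [|x s IH]; intros H; unfold cprod in *; simpl; auto.
  rewrite H by (left; auto). rewrite IH; auto. intros; apply H; right; auto.
Qed.

Lemma cprod_map {T U : Type} (s : list T) (h : T -> U) (F : U -> C) :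
  cprod (map h s) F = cprod s (fun x => F (h x)).
Proof. unfold cprod. rewrite map_map. auto. Qed.

Lemma cprod_neq_0 {T : Type} (s : list T) (F : T -> C) :
  (forall x, In x s -> F x <> 0) -> cprod s F <> 0.
Proof.
  induction s as [|x s IH]; intros H; unfold cprod in *; simpl.
  intros E; apply RtoC_inj in E; lra.
  apply Cmult_neq_0. apply H; left; auto. apply IH. intros; apply H; right; auto.
Qed.

Lemma cprod_eq_0 {T : Type} (s : list T) (F : T -> C) (x : T) :
  In x s -> F x = 0 -> cprod s F = 0.
Proof.
  intros Hx H0. induction s as [|y s IH]; [destruct Hx|].
  destruct Hx as [E|Hx]; unfold cprod in *; simpl.
  rewrite E, H0. ring. rewrite IH; auto. ring.
Qed.

Lemma csum_app {T : Type} (s s' : list T) (F : T -> C) :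
  csum (s ++ s') F = csum s F + csum s' F.
Proof.
  induction s as [|x s IH]; unfold csum in *; simpl. ring. rewrite IH. ring.
Qed.

Lemma csum_ext {T : Type} (s : list T) (F G : T -> C) :
  (forall x, In x s -> F x = G x) -> csum s F = csum s G.
Proof.
  induction s as [|x s IH]; intros H; unfold csum in *; simpl; auto.
  rewrite H by (left; auto). rewrite IH; auto. intros; apply H; right; auto.
Qed.

Lemma csum_perm {T : Type} (s s' : list T) (F : T -> C) :
  Permutation s s' -> csum s F = csum s' F.
Proof. induction 1; unfold csum in *; simpl; try congruence. ring. Qed.

Lemma csum_plus {T : Type} (s : list T) (F G : T -> C) :
  csum s (fun x => F x + G x) = csum s F + csum s G.
Proof. induction s as [|x s IH]; unfold csum in *; simpl. ring. rewrite IH. ring. Qed.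

Lemma csum_scal {T : Type} (s : list T) (c : C) (F : T -> C) :
  csum s (fun x => c * F x) = c * csum s F.
Proof. induction s as [|x s IH]; unfold csum in *; simpl. ring. rewrite IH. ring. Qed.

Lemma csum_0 {T : Type} (s : list T) : csum s (fun _ => 0) = 0.
Proof. induction s as [|x s IH]; unfold csum in *; simpl. ring. rewrite IH. ring. Qed.

Lemma csum_map {T U : Type} (s : list T) (h : T -> U) (F : U -> C) :
  csum (map h s) F = csum s (fun x => F (h x)).
Proof. unfold csum. rewrite map_map. auto. Qed.

Lemma csum_list_prod {T U : Type} (s : list T) (s' : list U) (F : T * U -> C) :
  csum (list_prod s s') F = csum s (fun a => csum s' (fun b => F (a, b))).
Proof.
  induction s as [|x s IH]; simpl; auto.
  rewrite csum_app, IH, csum_map. unfold csum at 4. simpl. auto.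
Qed.

Lemma csum_swap {T U : Type} (s : list T) (s' : list U) (F : T -> U -> C) :
  csum s (fun a => csum s' (F a)) = csum s' (fun b => csum s (fun a => F a b)).
Proof.
  induction s as [|x s IH].
  - unfold csum at 1; simpl. symmetry. rewrite <- (csum_0 s'). apply csum_ext; auto.
  - transitivity (csum s' (F x) + csum s (fun a => csum s' (F a))). reflexivity.
    rewrite IH, <- csum_plus. apply csum_ext. intros; reflexivity.
Qed.

Lemma csum_bound {T : Type} (s : list T) (F : T -> C) (b : R) :
  (forall x, In x s -> (Cmod (F x) <= b)%R) -> (Cmod (csum s F) <= INR (length s) * b)%R.
Proof.
  induction s as [|x s IH]; intros H.
  - unfold csum; simpl. rewrite Cmod_0. lra.
  - rewrite length_cons, S_INR. unfold csum in *; simpl.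
    eapply Rle_trans; [apply Cmod_triangle|].
    assert (Cmod (F x) <= b)%R by (apply H; left; auto).
    assert (Cmod (fold_right Cplus 0 (map F s)) <= INR (length s) * b)%R
      by (apply IH; intros; apply H; right; auto). lra.
Qed.

(** A product differs from 1 by no more than the exponential of the summed deviations; the induction
    step is 1 + b <= exp b. *)
Lemma cprod_near_1 {T : Type} (s : list T) (F : T -> C) (b : R) : (0 <= b)%R ->
  (forall x, In x s -> (Cmod (F x - 1) <= b)%R) ->
  (Cmod (cprod s F - 1) <= exp (INR (length s) * b) - 1)%R.
Proof.
  intros Hb. induction s as [|x s IH]; intros H.
  - unfold cprod; simpl. replace (1 - 1) with (RtoC 0) by ring.
    rewrite Cmod_0, Rmult_0_l, exp_0. lra.
  - rewrite length_cons, S_INR.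
    change (cprod (x :: s) F) with (F x * cprod s F).
    specialize (IH (fun y Hy => H y (or_intror Hy))).
    assert (Hx := H x (or_introl eq_refl)).
    set (P := cprod s F) in *. set (n := INR (length s)) in *.
    replace (F x * P - 1) with ((F x - 1) + (F x - 1) * (P - 1) + (P - 1)) by ring.
    eapply Rle_trans; [apply Cmod_triangle|].
    eapply Rle_trans; [apply Rplus_le_compat_r; apply Cmod_triangle|].
    rewrite Cmod_mult.
    replace ((n + 1) * b)%R with (n * b + b)%R by ring. rewrite exp_plus.
    assert (He : (1 + b <= exp b)%R) by apply exp_ineq1_le.
    assert (Hn : (0 < exp (n * b))%R) by apply exp_pos.
    assert (Cmod (F x - 1) * Cmod (P - 1) <= b * (exp (n * b) - 1))%R.
    { apply Rmult_le_compat; auto using Cmod_ge_0. }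
    assert (exp (n * b) * (1 + b) <= exp (n * b) * exp b)%R by (apply Rmult_le_compat_l; lra).
    lra.
Qed.

(* [E' u = - u^2 exp (u + u^2/2)] for [E u = (1 - u) exp (u + u^2/2)]. *)
Lemma sigma_factor_bound (w z : C) (A : R) : (Cmod (z / w) <= A)%R ->
  (Cmod (sigma_factor w z - 1) <= exp (A + A ^ 2) * Cmod (z / w) ^ 3)%R.
Proof.
  unfold sigma_factor. set (u := z / w). intros HA.
  assert (HA0 : (0 <= A)%R) by (generalize (Cmod_ge_0 u); lra).
  set (E := fun u => (1 - u) * Cexp (u + u ^ 2 / 2)).
  set (dE := fun u => - (u * u) * Cexp (u + u ^ 2 / 2)).
  assert (H2 : RtoC 2 <> 0) by (intros K; apply RtoC_inj in K; lra).
  assert (D : forall v, cderiv E v (dE v)).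
  { intros v. unfold E, dE. eapply cderiv_eq. apply cderiv_mult.
    apply cderiv_minus. apply cderiv_const. apply cderiv_id.
    apply (cderiv_comp Cexp (fun v => v + v ^ 2 / 2)). apply cderiv_Cexp.
    apply cderiv_plus. apply cderiv_id. apply cderiv_div; auto.
    apply (cderiv_mult (fun v => v) (fun v => v * 1)). apply cderiv_id.
    apply cderiv_mult. apply cderiv_id. apply cderiv_const. apply cderiv_const.
    simpl. field. }
  assert (K : (Cmod (E u - E 0 - 0 * (u - 0)) <= exp (A + A ^ 2) * Cmod u ^ 2 * Cmod (u - 0))%R).
  { apply (cderiv_segment_bound E dE). intros s Hs. split; auto.
    replace (0 + (u - 0) * s) with (s * u) by ring.
    replace (dE (s * u) - 0) with (dE (s * u)) by ring.
    assert (Hv : (Cmod (s * u) <= Cmod u)%R).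
    { rewrite Cmod_mult, Cmod_R, Rabs_pos_eq by lra.
      assert (s * Cmod u <= 1 * Cmod u)%R by (apply Rmult_le_compat_r; [apply Cmod_ge_0|lra]). lra. }
    set (v := s * u) in *.
    unfold dE. rewrite Cmod_mult, Cmod_opp, Cmod_mult, Cmod_Cexp.
    rewrite (Rmult_comm (exp _)). apply Rmult_le_compat.
    - apply Rmult_le_pos; apply Cmod_ge_0.
    - left; apply exp_pos.
    - simpl. rewrite Rmult_1_r. apply Rmult_le_compat; auto using Cmod_ge_0.
    - assert (Re (v + v ^ 2 / 2) <= A + A ^ 2)%R.
      { eapply Rle_trans; [apply Re_le_Cmod|]. eapply Rle_trans; [apply Cmod_triangle|].
        rewrite Cmod_div, Cmod_pow, Cmod_R, Rabs_pos_eq by (auto; lra).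
        assert (Cmod v ^ 2 <= A ^ 2)%R.
        { apply pow_incr. split. apply Cmod_ge_0. lra. }
        assert (0 <= Cmod v ^ 2)%R by (apply pow_le; apply Cmod_ge_0). lra. }
      destruct H as [H|H]. left; apply exp_increasing; auto. rewrite H; right; auto. }
  replace (E u - E 0 - 0 * (u - 0)) with (E u - 1) in K.
  - replace (u - 0) with u in K by ring. unfold E in K. 
    eapply Rle_trans; [exact K|]. right; ring.
  - unfold E. replace (0 + 0 ^ 2 / 2) with (RtoC 0) by (simpl; field; auto).
    rewrite Cexp_0. ring.
Qed.

(** * Size of lattice points and convergence of the sigma product *)

Definition lattice_lower (K : R) (w : C) : Prop :=
  forall jk : Z * Z, (IZR (Z.max (Z.abs (fst jk)) (Z.abs (snd jk))) <= K * Cmod (lattice_point 1 w jk))%R.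

(** The imaginary part of j + k w bounds |k|, since Im w >= Im w0 / 2, and then j = l - k w is
    bounded too. One constant serves all periods near w0, which makes the convergence of sigma
    locally uniform in the period. *)
Lemma lattice_lower_near (w0 : C) : upper w0 -> exists K, (1 <= K)%R /\ near w0 (lattice_lower K).
Proof.
  intros Hw. unfold upper in Hw. set (v := Im w0) in *.
  set (W := (Cmod w0 + v / 2)%R).
  assert (HW : (0 < W)%R) by (unfold W; generalize (Cmod_ge_0 w0); lra).
  set (K := (1 + (2 / v) * (1 + W))%R).
  assert (Hv2 : (0 < 2 / v)%R) by (apply Rdiv_lt_0_compat; lra).
  assert (Hp : (0 < (2 / v) * W)%R) by (apply Rmult_lt_0_compat; lra).
  exists K. split; [unfold K; lra|].
  exists (v / 2)%R. split; [lra|]. intros w Hww [j k]. simpl.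
  unfold lattice_point; simpl. set (l := (IZR j * 1 + IZR k * w)).
  assert (Hvw : (v / 2 <= Im w)%R).
  { assert (Q := Im_le_Cmod (w - w0)). simpl in Q. fold v in Q.
    assert (Q2 : (Rabs (Im w + - v) < v / 2)%R).
    { unfold v, Im in *. lra. } apply Rabs_def2 in Q2. lra. }
  assert (HwW : (Cmod w <= W)%R).
  { unfold W. generalize (Cmod_sub_ge w w0). lra. }
  assert (Hk : (Rabs (IZR k) <= (2 / v) * Cmod l)%R).
  { assert (Q := Im_le_Cmod l). unfold l at 1 in Q. simpl in Q.
    replace (IZR j * 0 + 0 * 1 + (IZR k * snd w + 0 * fst w))%R with (IZR k * Im w)%R in Q
      by (unfold Im; ring).
    rewrite Rabs_mult, (Rabs_pos_eq (Im w)) in Q by lra.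
    assert (Rabs (IZR k) * (v / 2) <= Cmod l)%R.
    { eapply Rle_trans; [|exact Q]. apply Rmult_le_compat_l. apply Rabs_pos. auto. }
    apply Rmult_le_reg_r with (v / 2)%R; [lra|].
    replace (2 / v * Cmod l * (v / 2))%R with (Cmod l) by (field; lra). auto. }
  assert (Hj : (Rabs (IZR j) <= Cmod l + Rabs (IZR k) * W)%R).
  { replace (RtoC (IZR j)) with (l - IZR k * w) by (unfold l; ring).
    rewrite <- Cmod_R. replace (RtoC (IZR j)) with (l + - (IZR k * w)) by (unfold l; ring).
    eapply Rle_trans; [apply Cmod_triangle|]. rewrite Cmod_opp, Cmod_mult, Cmod_R.
    apply Rplus_le_compat_l. apply Rmult_le_compat_l; auto. apply Rabs_pos. }
  assert (Hl := Cmod_ge_0 l).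
  assert (Hkw : (Rabs (IZR k) * W <= (2 / v) * Cmod l * W)%R) by (apply Rmult_le_compat_r; lra).
  assert (P1 : (0 <= 2 / v * Cmod l)%R) by (apply Rmult_le_pos; lra).
  assert (P2 : (0 <= 2 / v * Cmod l * W)%R) by (apply Rmult_le_pos; lra).
  unfold K. destruct (Z.max_spec (Z.abs j) (Z.abs k)) as [[_ ->]|[_ ->]]; rewrite abs_IZR; lra.
Qed.

Lemma In_Zrange (N : nat) (j : Z) : In j (Zrange N) <-> (Z.abs j <= Z.of_nat N)%Z.
Proof.
  unfold Zrange. rewrite in_map_iff. split.
  - intros [i [E Hi]]. apply in_seq in Hi. lia.
  - intros H. exists (Z.to_nat (j + Z.of_nat N)). split. lia. apply in_seq. lia.
Qed.

Lemma NoDup_Zrange (N : nat) : NoDup (Zrange N).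
Proof.
  unfold Zrange. apply FinFun.Injective_map_NoDup.
  intros a b H. lia. apply seq_NoDup.
Qed.

Lemma NoDup_pairs {A B : Type} (s : list A) (s' : list B) :
  NoDup s -> NoDup s' -> NoDup (list_prod s s').
Proof.
  induction 1 as [|x s Hx Hs IH]; intros H'; simpl. constructor.
  apply NoDup_app; auto.
  - apply FinFun.Injective_map_NoDup; auto. intros a b E; congruence.
  - intros [a b] H1 H2. apply in_map_iff in H1. destruct H1 as [y [E _]].
    apply in_prod_iff in H2. inversion E; subst. tauto.
Qed.

Definition square (N : nat) : list (Z * Z) := list_prod (Zrange N) (Zrange N).
(** The boundary of the square of side 2 N: consecutive boxes differ by a shell, whose points have
    modulus at least N / K under [lattice_lower]. *)
Definition shell (N : nat) : list (Z * Z) :=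
  filter (fun jk => Z.eqb (Z.max (Z.abs (fst jk)) (Z.abs (snd jk))) (Z.of_nat N)) (square N).

Lemma In_square (N : nat) (jk : Z * Z) :
  In jk (square N) <-> (Z.max (Z.abs (fst jk)) (Z.abs (snd jk)) <= Z.of_nat N)%Z.
Proof. destruct jk. unfold square. rewrite in_prod_iff, !In_Zrange. simpl. lia. Qed.
Lemma In_box (N : nat) (jk : Z * Z) : In jk (lattice_box N) <->
  (1 <= Z.max (Z.abs (fst jk)) (Z.abs (snd jk)) <= Z.of_nat N)%Z.
Proof.
  destruct jk as [j k]. unfold lattice_box. rewrite filter_In, in_prod_iff, !In_Zrange. simpl.
  destruct (Z.eqb_spec j 0), (Z.eqb_spec k 0); simpl; intuition; try lia; discriminate.
Qed.
Lemma In_shell (N : nat) (jk : Z * Z) : In jk (shell N) <->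
  (Z.max (Z.abs (fst jk)) (Z.abs (snd jk)) = Z.of_nat N)%Z.
Proof. unfold shell. rewrite filter_In, In_square, Z.eqb_eq. lia. Qed.
Lemma NoDup_square (N : nat) : NoDup (square N).
Proof. apply NoDup_pairs; apply NoDup_Zrange. Qed.
Lemma NoDup_box (N : nat) : NoDup (lattice_box N).
Proof. apply NoDup_filter. apply NoDup_square. Qed.
Lemma NoDup_shell (N : nat) : NoDup (shell N).
Proof. apply NoDup_filter. apply NoDup_square. Qed.

Lemma square_shell (N : nat) : Permutation (square (S N)) (square N ++ shell (S N)).
Proof.
  apply NoDup_Permutation. apply NoDup_square.
  - apply NoDup_app; auto using NoDup_square, NoDup_shell. intros jk.
    rewrite In_square, In_shell. lia.
  - intros jk. rewrite in_app_iff, !In_square, In_shell. lia.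
Qed.
Lemma box_shell (N : nat) : Permutation (lattice_box (S N)) (lattice_box N ++ shell (S N)).
Proof.
  apply NoDup_Permutation. apply NoDup_box.
  - apply NoDup_app; auto using NoDup_box, NoDup_shell. intros jk.
    rewrite In_box, In_shell. lia.
  - intros jk. rewrite in_app_iff, !In_box, In_shell. lia.
Qed.
Lemma square_box (N : nat) : Permutation (square N) ((0%Z, 0%Z) :: lattice_box N).
Proof.
  apply NoDup_Permutation. apply NoDup_square.
  - constructor. rewrite In_box. simpl. lia. apply NoDup_box.
  - intros [j k]. simpl. rewrite In_square, In_box. simpl. split.
    + intros H. destruct (Z.eq_dec j 0), (Z.eq_dec k 0); subst; auto; right; lia.
    + intros [E|H]. inversion E; subst; simpl; lia. lia.
Qed.
(** (2 N + 3)^2 - (2 N + 1)^2 = 8 (N + 1). *)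
Lemma length_shell (N : nat) : length (shell (S N)) = (8 * (S N))%nat.
Proof.
  assert (H := Permutation_length (square_shell N)). rewrite length_app in H.
  unfold square in H. rewrite !length_prod in H. unfold Zrange in H.
  rewrite !length_map, !length_seq in H. nia.
Qed.

Definition sprod (N : nat) (z w : C) : C :=
  cprod (lattice_box N) (fun jk => sigma_factor (lattice_point 1 w jk) z).
(** sigma(z) / z, with value 1 at 0. It replaces sigma wherever a simple zero or a pole has to be
    divided out. *)
Definition sinf (z w : C) : C := Clim_seq (fun N => sprod N z w).

Lemma wsigma_sinf (w z : C) : wsigma 1 w z = z * sinf z w.
Proof. reflexivity. Qed.

(** With A = Z0 K each factor in shell n differs from 1 by at most exp(A + A^2) (A / n)^3. The shell
    has 8 n points, so the deviations sum to at most [shell_const K Z0] / n^2. *)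
Definition shell_const (K Z0 : R) : R := (8 * exp (Z0 * K + (Z0 * K) ^ 2) * (Z0 * K) ^ 3)%R.

Lemma shell_const_pos (K Z0 : R) : (0 <= K)%R -> (0 <= Z0)%R -> (0 <= shell_const K Z0)%R.
Proof.
  intros. unfold shell_const. apply Rmult_le_pos. 
  generalize (exp_pos (Z0 * K + (Z0 * K) ^ 2)); lra.
  apply pow_le. apply Rmult_le_pos; auto.
Qed.

Lemma Cmod_lattice_pos (K : R) (w : C) (jk : Z * Z) : (0 <= K)%R -> lattice_lower K w ->
  (1 <= Z.max (Z.abs (fst jk)) (Z.abs (snd jk)))%Z -> (0 < Cmod (lattice_point 1 w jk))%R.
Proof.
  intros HK H Hm. apply IZR_le in Hm. specialize (H jk).
  destruct (Cmod_ge_0 (lattice_point 1 w jk)) as [L|L]; auto. rewrite <- L in H. lra.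
Qed.

Lemma shell_prod_near_1 (K Z0 : R) (N : nat) (z w : C) :
  (0 <= K)%R -> lattice_lower K w -> (Cmod z <= Z0)%R ->
  (Cmod (cprod (shell (S N)) (fun jk => sigma_factor (lattice_point 1 w jk) z) - 1)
   <= exp (shell_const K Z0 / INR (S N) ^ 2) - 1)%R.
Proof.
  intros HK HL Hz. set (A := (Z0 * K)%R).
  assert (HZ : (0 <= Z0)%R) by (generalize (Cmod_ge_0 z); lra).
  assert (HA : (0 <= A)%R) by (apply Rmult_le_pos; auto).
  assert (Hn : (1 <= INR (S N))%R) by (rewrite S_INR; generalize (pos_INR N); lra).
  set (n := INR (S N)) in *.
  assert (He : (0 < exp (A + A ^ 2))%R) by apply exp_pos.
  set (b := (exp (A + A ^ 2) * (A / n) ^ 3)%R).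
  assert (HAn : (0 <= A / n)%R) by (apply Rdiv_le_0_compat; lra).
  assert (Hb : (0 <= b)%R).
  { apply Rmult_le_pos; [lra|]. apply pow_le; auto. }
  eapply Rle_trans. apply cprod_near_1 with (b := b); auto.
  - intros jk Hjk. apply In_shell in Hjk.
    assert (Hu : (Cmod (z / lattice_point 1 w jk) <= A / n)%R).
    { assert (Hpos : (0 < Cmod (lattice_point 1 w jk))%R).
      { apply (Cmod_lattice_pos K); auto. lia. }
      assert (Hne : lattice_point 1 w jk <> 0) by (apply Cmod_gt_0; auto).
      rewrite Cmod_div by auto. specialize (HL jk). rewrite Hjk in HL.
      rewrite <- INR_IZR_INZ in HL. fold n in HL.
      apply Rmult_le_reg_r with (Cmod (lattice_point 1 w jk) * n)%R.
      apply Rmult_lt_0_compat; lra.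
      replace (Cmod z / Cmod (lattice_point 1 w jk) * (Cmod (lattice_point 1 w jk) * n))%R
        with (Cmod z * n)%R by (field; lra).
      replace (A / n * (Cmod (lattice_point 1 w jk) * n))%R
        with (Z0 * (K * Cmod (lattice_point 1 w jk)))%R by (unfold A; field; lra).
      apply Rmult_le_compat; auto. apply Cmod_ge_0. lra. }
    eapply Rle_trans. apply (sigma_factor_bound _ _ A).
    + eapply Rle_trans; [exact Hu|]. apply Rmult_le_reg_r with n; [lra|].
      unfold Rdiv. rewrite Rmult_assoc, Rinv_l by lra.
      apply Rmult_le_compat_l; lra.
    + apply Rmult_le_compat_l. lra. apply pow_incr. split; auto. apply Cmod_ge_0.
  - rewrite length_shell. right. do 2 f_equal. rewrite mult_INR. fold n.
    replace (INR 8) with 8%R by (simpl; ring). unfold b, shell_const. fold A. field. lra.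
Qed.

Section Convergence.
Variables (K Z0 : R) (z w : C).
Hypotheses (HK : (0 <= K)%R) (HL : lattice_lower K w) (Hz : (Cmod z <= Z0)%R).
Let B := shell_const K Z0.

(** The shell bounds telescope by B / (M + 1)^2 <= B / M - B / (M + 1). The estimate is relative to
    the partial product, so that it also shows the limit to be nonzero. *)
Lemma sprod_ratio (N M : nat) : (1 <= N)%nat -> (N <= M)%nat ->
  (Cmod (sprod M z w - sprod N z w) <=
   Cmod (sprod N z w) * (exp (B / INR N - B / INR M) - 1))%R.
Proof.
  assert (HZ : (0 <= Z0)%R) by (generalize (Cmod_ge_0 z); lra).
  assert (HB : (0 <= B)%R) by (apply shell_const_pos; auto).
  intros HN HM. induction HM as [|M HM IH].
  - rewrite Cmod_sub_self, Rminus_diag, exp_0. lra.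
  - set (F := fun jk => sigma_factor (lattice_point 1 w jk) z).
    assert (E : sprod (S M) z w = sprod M z w * cprod (shell (S M)) F).
    { unfold sprod. rewrite (cprod_perm _ _ _ (box_shell M)), cprod_app. auto. }
    assert (Hs := shell_prod_near_1 K Z0 M z w HK HL Hz). fold F in Hs. fold B in Hs.
    set (Q := cprod (shell (S M)) F) in *.
    set (PM := sprod M z w) in *. set (PN := sprod N z w) in *.
    assert (HM1 : (1 <= INR M)%R).
    { replace 1%R with (INR 1) by auto. apply le_INR. lia. }
    set (t := (B / INR N - B / INR M)%R) in *.
    set (b := (B / INR (S M) ^ 2)%R) in *.
    assert (Hb : (b <= B / INR M - B / INR (S M))%R).
    { unfold b. rewrite S_INR. set (m := INR M) in *.
      replace (B / m - B / (m + 1))%R with (B * / (m * (m + 1)))%R by (field; lra).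
      unfold Rdiv. apply Rmult_le_compat_l; auto. apply Rinv_le_contravar.
      apply Rmult_lt_0_compat; lra. simpl. rewrite Rmult_1_r. apply Rmult_le_compat_r; lra. }
    assert (Ht : (B / INR N - B / INR (S M) = t + (B / INR M - B / INR (S M)))%R)
      by (unfold t; ring).
    assert (Hexp : (exp (t + b) <= exp (B / INR N - B / INR (S M)))%R).
    { rewrite Ht. destruct Hb as [Hb|Hb]. left; apply exp_increasing; lra. rewrite Hb; right; auto. }
    rewrite exp_plus in Hexp.
    rewrite E. replace (PM * Q - PN) with (PM * (Q - 1) + (PM - PN)) by ring.
    eapply Rle_trans; [apply Cmod_triangle|]. rewrite Cmod_mult.
    assert (HPM : (Cmod PM <= Cmod PN * exp t)%R).
    { generalize (Cmod_sub_ge PM PN). lra. }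
    assert (H1 : (Cmod PM * Cmod (Q - 1) <= Cmod PN * exp t * (exp b - 1))%R).
    { apply Rmult_le_compat; auto using Cmod_ge_0. }
    assert (H2 : (Cmod PN * (exp t * exp b) <= Cmod PN * exp (B / INR N - B / INR (S M)))%R).
    { apply Rmult_le_compat_l; auto using Cmod_ge_0. }
    lra.
Qed.

Lemma sprod_1_bound : (Cmod (sprod 1 z w) <= exp B)%R.
Proof.
  assert (Hs := shell_prod_near_1 K Z0 0 z w HK HL Hz). fold B in Hs.
  replace (B / INR 1 ^ 2)%R with B in Hs by (simpl; field).
  unfold sprod. rewrite (cprod_perm _ _ _ (box_shell 0)), cprod_app.
  replace (cprod (lattice_box 0) (fun jk => sigma_factor (lattice_point 1 w jk) z))
    with (RtoC 1) by (unfold cprod; simpl; auto).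
  rewrite Cmult_1_l. set (Q := cprod _ _) in *.
  generalize (Cmod_sub_ge Q 1). rewrite Cmod_1. lra.
Qed.

(** Of the factor exp(3 B), exp(2 B) bounds the partial product and the remaining exp B comes from
    exp x - 1 <= x exp x at x = B / N <= B. *)
Lemma sprod_cauchy (N M : nat) : (1 <= N)%nat -> (N <= M)%nat ->
  (Cmod (sprod M z w - sprod N z w) <= exp (3 * B) * B / INR N)%R.
Proof.
  assert (HZ : (0 <= Z0)%R) by (generalize (Cmod_ge_0 z); lra).
  assert (HB : (0 <= B)%R) by (apply shell_const_pos; auto).
  intros HN HM. eapply Rle_trans; [apply sprod_ratio; auto|].
  assert (Hinv : forall n, (1 <= n)%nat -> (0 <= B / INR n <= B)%R).
  { intros n Hn. apply le_INR in Hn. simpl in Hn. split. apply Rdiv_le_0_compat; lra.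
    apply Rmult_le_reg_r with (INR n); [lra|]. unfold Rdiv. rewrite Rmult_assoc, Rinv_l by lra.
    apply Rmult_le_compat_l; lra. }
  assert (HexpB : (1 <= exp B)%R) by (generalize (exp_ineq1_le B); lra).
  assert (HPN : (Cmod (sprod N z w) <= exp B * exp B)%R).
  { assert (R1 := sprod_ratio 1 N (le_n _) HN).
    assert (E : (exp (B / INR 1 - B / INR N) <= exp B)%R).
    { destruct (Hinv N HN). simpl. rewrite Rdiv_1_r.
      destruct (Req_dec (B / INR N) 0) as [E|E]. rewrite E, Rminus_0_r; lra.
      left; apply exp_increasing; lra. }
    assert (HP1 := sprod_1_bound).
    assert (Cmod (sprod 1 z w) * exp (B / INR 1 - B / INR N) <= exp B * exp B)%R.
    { apply Rmult_le_compat; auto using Cmod_ge_0. left; apply exp_pos. }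
    generalize (Cmod_sub_ge (sprod N z w) (sprod 1 z w)). lra. }
  set (x := (B / INR N)%R). destruct (Hinv N HN) as [Hx0 HxB]. fold x in Hx0, HxB.
  destruct (Hinv M ltac:(lia)) as [HM0 _].
  assert (E1 : (exp (x - B / INR M) <= exp x)%R).
  { destruct (Req_dec (B / INR M) 0) as [E|E]. rewrite E, Rminus_0_r; lra.
    left; apply exp_increasing; lra. }
  assert (E2 : (exp x - 1 <= x * exp x)%R).
  { assert (F := exp_ineq1_le (- x)). 
    assert (F2 : (exp (- x) * exp x = 1)%R) by (rewrite <- exp_plus, Rplus_opp_l, exp_0; auto).
    assert ((1 + - x) * exp x <= exp (- x) * exp x)%R.
    { apply Rmult_le_compat_r; auto. left; apply exp_pos. } lra. }
  assert (E3 : (exp x <= exp B)%R).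
  { destruct (Req_dec x B) as [->|E]. lra. left; apply exp_increasing; lra. }
  assert (E4 : (x * exp x <= x * exp B)%R) by (apply Rmult_le_compat_l; auto).
  apply Rle_trans with (exp B * exp B * (x * exp B))%R.
  - apply Rmult_le_compat; auto using Cmod_ge_0; try lra.
    assert (1 <= exp (x - B / INR M))%R; [|lra].
    assert (Hle : (B / INR M <= x)%R).
    { unfold x. unfold Rdiv. apply Rmult_le_compat_l; auto. apply Rinv_le_contravar.
      apply lt_0_INR; lia. apply le_INR; auto. }
    generalize (exp_ineq1_le (x - B / INR M)). lra.
  - right. replace (3 * B)%R with (B + B + B)%R by ring. rewrite !exp_plus. unfold x. field.
    apply not_0_INR. lia.
Qed.

(** [Clim_seq] takes the limits of real and imaginary parts, with [real] sending an infinite limit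
    to a default value. The Cauchy bound makes each part converge to a finite limit; the factor 2
    adds the two errors. *)
Lemma sinf_approx (N : nat) : (1 <= N)%nat ->
  (Cmod (sprod N z w - sinf z w) <= 2 * (exp (3 * B) * B / INR N))%R.
Proof.
  intros HN. set (D := (exp (3 * B) * B)%R).
  assert (HZ : (0 <= Z0)%R) by (generalize (Cmod_ge_0 z); lra).
  assert (HB : (0 <= B)%R) by (apply shell_const_pos; auto).
  assert (HD : (0 <= D)%R) by (apply Rmult_le_pos; auto; left; apply exp_pos).
  assert (Lim1 : forall k : C -> R, (forall u v, Rabs (k u - k v) <= Cmod (u - v))%R ->
    (Rabs (k (sprod N z w) - real (Lim_seq (fun n => k (sprod n z w)))) <= D / INR N)%R).
  { intros k Hk.
    assert (Hc : ex_finite_lim_seq (fun n => k (sprod n z w))).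
    { apply ex_lim_seq_cauchy_corr. intros eps.
      destruct (nfloor_ex (2 * D / eps)) as [n0 [_ Hn0]].
      { apply Rdiv_le_0_compat. lra. apply cond_pos. }
      exists (S n0). 
      assert (Hwl : forall a b, (S n0 <= a)%nat -> (a <= b)%nat ->
         (Rabs (k (sprod b z w) - k (sprod a z w)) < eps)%R).
      { intros a b Ha Hab. eapply Rle_lt_trans; [apply Hk|].
        eapply Rle_lt_trans; [apply sprod_cauchy; lia|]. fold D.
        assert (Hia : (INR n0 + 1 <= INR a)%R) by (rewrite <- S_INR; apply le_INR; auto).
        assert (H0 := pos_INR n0). assert (He := cond_pos eps).
        apply Rmult_lt_reg_r with (INR a); [lra|]. unfold Rdiv.
        rewrite Rmult_assoc, Rinv_l, Rmult_1_r by lra.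
        assert (Hlt : (2 * D < eps * INR a)%R).
        { apply Rlt_le_trans with (eps * (INR n0 + 1))%R.
          apply Rmult_lt_compat_l with (r := eps) in Hn0; auto.
          replace (eps * (2 * D / eps))%R with (2 * D)%R in Hn0 by (field; lra). auto.
          apply Rmult_le_compat_l; lra. }
        lra. }
      intros n m Hn Hm. destruct (Nat.le_ge_cases n m) as [H|H].
      - rewrite Rabs_minus_sym. apply Hwl; auto.
      - apply Hwl; auto. }
    destruct Hc as [l Hl]. rewrite (is_lim_seq_unique _ _ Hl). simpl.
    apply Rnot_lt_le. intros Hlt.
    apply is_lim_seq_Reals in Hl.
    destruct (Hl (Rabs (k (sprod N z w) - l) - D / INR N)%R) as [n0 Hn0]. lra.
    specialize (Hn0 (max n0 N) (Nat.le_max_l _ _)). unfold Rdist in Hn0.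
    assert (Q := Hk (sprod (max n0 N) z w) (sprod N z w)).
    assert (Q2 := sprod_cauchy N (max n0 N) HN (Nat.le_max_r _ _)). fold D in Q2.
    generalize (Rabs_triang (k (sprod N z w) - k (sprod (max n0 N) z w)) (k (sprod (max n0 N) z w) - l)).
    replace (k (sprod N z w) - k (sprod (max n0 N) z w) + (k (sprod (max n0 N) z w) - l))%R
      with (k (sprod N z w) - l)%R by ring.
    rewrite (Rabs_minus_sym (k (sprod N z w)) (k (sprod (max n0 N) z w))). lra. }
  eapply Rle_trans; [apply Cmod_le_abs|].
  assert (A1 := Lim1 Re). assert (A2 := Lim1 Im).
  replace (2 * (D / INR N))%R with (D / INR N + D / INR N)%R by ring.
  apply Rplus_le_compat.
  - apply A1. intros u v. replace (Re u - Re v)%R with (Re (u - v)) by (destruct u, v; simpl; ring).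
    apply re_le_Cmod.
  - apply A2. intros u v. replace (Im u - Im v)%R with (Im (u - v)) by (destruct u, v; simpl; ring).
    apply Im_le_Cmod.
Qed.
End Convergence.

Lemma lattice_neq_0 (w : C) (jk : Z * Z) : upper w ->
  (1 <= Z.max (Z.abs (fst jk)) (Z.abs (snd jk)))%Z -> lattice_point 1 w jk <> 0.
Proof.
  intros Hw Hm. destruct (lattice_lower_near w Hw) as [K [HK HN]].
  apply near_self in HN. apply Cmod_gt_0. apply (Cmod_lattice_pos K); auto. lra.
Qed.

Lemma analytic2_sigma_factor (jk : Z * Z) :
  (1 <= Z.max (Z.abs (fst jk)) (Z.abs (snd jk)))%Z ->
  analytic2 (fun z w => sigma_factor (lattice_point 1 w jk) z).
Proof.
  intros Hm. unfold sigma_factor.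
  assert (H2 : RtoC 2 <> 0) by (intros K; apply RtoC_inj in K; lra).
  assert (HU : isopen upper) by apply upper_open.
  assert (HE : isopen everywhere) by apply everywhere_open.
  assert (HL : holo upper (fun w => lattice_point 1 w jk)).
  { unfold lattice_point. apply holo_plus; auto using holo_const.
    apply holo_mult; auto using holo_const, holo_id. }
  split.
  - intros z w Hw.
    assert (T : tends (filter_prod (near z) (near w))
      (fun x => fst x / lattice_point 1 (snd x) jk) (z / lattice_point 1 w jk)).
    { apply tends_div. typeclasses eauto. apply lattice_neq_0; auto. apply filterlim_fst.
      apply (filterlim_comp _ _ _ snd (fun w => lattice_point 1 w jk) _ (near w) _).
      apply filterlim_snd. apply (holo_cts _ _ _ HL Hw). }
    apply (filterlim_comp _ _ _ (fun x => fst x / lattice_point 1 (snd x) jk)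
      (fun u => (1 - u) * Cexp (u + u ^ 2 / 2)) _ _ _ T).
    set (u := z / lattice_point 1 w jk).
    apply (cts_mult (fun u => 1 - u) (fun u => Cexp (u + u ^ 2 / 2))).
    apply cts_minus. apply cts_const. apply cts_id.
    apply (cts_comp Cexp (fun u => u + u ^ 2 / 2)). apply cts_Cexp.
    apply cts_plus. apply cts_id. apply cts_div; auto using cts_const.
    apply (cts_mult (fun u => u) (fun u => u * 1)). apply cts_id. apply cts_mult.
    apply cts_id. apply cts_const.
  - intros w Hw.
    assert (Hq : holo everywhere (fun z => z / lattice_point 1 w jk)).
    { apply holo_div; auto using holo_id, holo_const. intros; apply lattice_neq_0; auto. }
    apply holo_mult; auto. apply holo_minus; auto using holo_const.
    apply holo_comp with (V := everywhere) (f := Cexp); auto using holo_Cexp.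
    apply holo_plus; auto. apply holo_div; auto using holo_const.
    simpl. apply holo_mult; auto. apply holo_mult; auto using holo_const.
  - intros z.
    assert (Hq : holo upper (fun w => z / lattice_point 1 w jk)).
    { apply holo_div; auto using holo_id, holo_const. intros; apply lattice_neq_0; auto. }
    apply holo_mult; auto. apply holo_minus; auto using holo_const.
    apply holo_comp with (V := everywhere) (f := Cexp); auto using holo_Cexp.
    intros; exact I.
    apply holo_plus; auto. apply holo_div; auto using holo_const.
    simpl. apply holo_mult; auto. apply holo_mult; auto using holo_const.
Qed.

Lemma analytic2_sprod (N : nat) : analytic2 (sprod N).
Proof.
  unfold sprod.
  assert (H : forall jk, In jk (lattice_box N) ->
    analytic2 (fun z w => sigma_factor (lattice_point 1 w jk) z)).
  { intros jk Hjk. apply analytic2_sigma_factor. apply In_box in Hjk. lia. }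
  revert H. generalize (lattice_box N). intros s; induction s as [|x s IH]; intros H.
  - unfold cprod; simpl. apply analytic2_const.
  - apply (analytic2_mult (fun z w => sigma_factor (lattice_point 1 w x) z)
      (fun z w => cprod s (fun jk => sigma_factor (lattice_point 1 w jk) z))).
    apply H; left; auto. apply IH. intros; apply H; right; auto.
Qed.

Lemma sprod_uniform (z0 w0 : C) (e : R) : upper w0 -> (0 < e)%R -> exists N0 d, (0 < d)%R /\
  forall N z w, (N0 <= N)%nat -> Ball z0 d z -> Ball w0 d w ->
    (Cmod (sprod N z w - sinf z w) <= e)%R.
Proof.
  intros Hw He. destruct (lattice_lower_near w0 Hw) as [K [HK [d [Hd HL]]]].
  set (Z0 := (Cmod z0 + d)%R). set (D := (2 * (exp (3 * shell_const K Z0) * shell_const K Z0))%R).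
  assert (HZ : (0 <= Z0)%R) by (unfold Z0; generalize (Cmod_ge_0 z0); lra).
  assert (HB := shell_const_pos K Z0 ltac:(lra) HZ).
  assert (HD : (0 <= D)%R).
  { apply Rmult_le_pos; [lra|]. apply Rmult_le_pos; auto. left; apply exp_pos. }
  destruct (nfloor_ex (D / e)) as [n0 [_ Hn0]].
  { apply Rdiv_le_0_compat; auto. }
  exists (S n0), d. split; auto. intros N z w HN Bz Bw.
  eapply Rle_trans. apply (sinf_approx K Z0); auto. lra.
  - unfold Z0. unfold Ball in Bz. generalize (Cmod_sub_ge z z0). lra.
  - lia.
  - replace (2 * (exp (3 * shell_const K Z0) * shell_const K Z0 / INR N))%R with (D / INR N)%R
      by (unfold D; field; apply not_0_INR; lia).
    assert (Hi : (INR n0 + 1 <= INR N)%R) by (rewrite <- S_INR; apply le_INR; auto).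
    assert (H0 := pos_INR n0).
    apply Rmult_le_reg_r with (INR N); [lra|]. unfold Rdiv at 1.
    rewrite Rmult_assoc, Rinv_l, Rmult_1_r by lra.
    apply Rmult_lt_compat_l with (r := e) in Hn0; auto.
    replace (e * (D / e))%R with D in Hn0 by (field; lra).
    assert (e * (INR n0 + 1) <= e * INR N)%R by (apply Rmult_le_compat_l; lra). lra.
Qed.

Lemma analytic2_sinf : analytic2 sinf.
Proof.
  apply (analytic2_limit sprod). apply analytic2_sprod.
  intros; apply sprod_uniform; auto.
Qed.

Definition sig2 (z w : C) : C := wsigma 1 w z.
Definition in_lattice (w z : C) : Prop := exists jk : Z * Z, z = lattice_point 1 w jk.

Lemma analytic2_sig2 : analytic2 sig2.
Proof. apply (analytic2_mult (fun z _ => z) sinf). apply analytic2_fst. apply analytic2_sinf. Qed.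

Lemma sprod_tends (z w : C) : upper w ->
  tends (filter_prod (near z) eventually) (fun x => sprod (snd x) (fst x) w) (sinf z w).
Proof.
  intros Hw. apply tends_eps. typeclasses eauto. intros e He.
  assert (He2 : (0 < e / 2)%R) by lra.
  destruct (sprod_uniform z w _ Hw He2) as [N0 [d [Hd HH]]].
  assert (Hc := holo_cts _ _ z (an_fst _ analytic2_sinf w Hw) I). unfold cts in Hc.
  rewrite tends_eps in Hc by typeclasses eauto.
  exists (fun u => Ball z d u /\ (Cmod (sinf u w - sinf z w) < e / 2)%R) (fun N => (N0 <= N)%nat).
  - apply filter_and. apply near_ball; auto. apply Hc; auto.
  - exists N0; auto.
  - intros u N [Hu1 Hu2] HN. cbn [fst snd].
    assert (Q := HH N u w HN Hu1 (Ball_center w d Hd)).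
    generalize (Cmod_sub_triangle (sprod N u w) (sinf u w) (sinf z w)). lra.
Qed.

Lemma sprod_tends_at (z w : C) : upper w -> tends eventually (fun N => sprod N z w) (sinf z w).
Proof.
  intros Hw. apply (joint_at eventually (fun z N => sprod N z w)). apply sprod_tends; auto.
Qed.

Lemma sigma_factor_eq_0 (l z : C) : l <> 0 -> (sigma_factor l z = 0 <-> z = l).
Proof.
  intros Hl. unfold sigma_factor. split.
  - intros E. destruct (Ceq_dec (1 - z / l) 0) as [K|K].
    + replace z with (l - l * (1 - z / l)) by (field; auto). rewrite K. ring.
    + exfalso. apply (Cmult_neq_0 _ _ K (Cexp_neq_0 (z / l + (z / l) ^ 2 / 2))). exact E.
  - intros ->. replace (1 - l / l) with (RtoC 0) by (field; auto). ring.
Qed.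

(** Once B / N <= ln(3/2), all later partial products stay within half of |sprod N| from sprod N,
    which is nonzero, and so does the limit. *)
Lemma sinf_neq_0 (z w : C) : upper w ->
  (forall jk, (1 <= Z.max (Z.abs (fst jk)) (Z.abs (snd jk)))%Z -> z <> lattice_point 1 w jk) ->
  sinf z w <> 0.
Proof.
  intros Hw Hz. destruct (lattice_lower_near w Hw) as [K [HK HN]]. apply near_self in HN.
  set (B := shell_const K (Cmod z)).
  assert (HB : (0 <= B)%R) by (apply shell_const_pos; [lra|apply Cmod_ge_0]).
  assert (Hl2 : (0 < ln (3 / 2))%R) by (rewrite <- ln_1; apply ln_increasing; lra).
  destruct (nfloor_ex (B / ln (3 / 2))) as [n0 [_ Hn0]].
  { apply Rdiv_le_0_compat; auto. }
  set (N := S n0).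
  assert (HN1 : (B / INR N <= ln (3 / 2))%R).
  { apply Rmult_le_reg_r with (INR N). apply lt_0_INR; unfold N; lia.
    unfold Rdiv at 1. rewrite Rmult_assoc, Rinv_l, Rmult_1_r by (apply not_0_INR; unfold N; lia).
    unfold N. rewrite S_INR. apply Rmult_lt_compat_l with (r := ln (3/2)) in Hn0; auto.
    replace (ln (3 / 2) * (B / ln (3 / 2)))%R with B in Hn0 by (field; lra). lra. }
  assert (HP : sprod N z w <> 0).
  { apply cprod_neq_0. intros jk Hjk. apply In_box in Hjk.
    assert (Hl : lattice_point 1 w jk <> 0) by (apply lattice_neq_0; auto; lia).
    intros E. apply (sigma_factor_eq_0 _ _ Hl) in E. apply (Hz jk); auto. lia. }
  assert (Hp : (0 < Cmod (sprod N z w))%R) by (apply Cmod_gt_0; auto).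
  intros E.
  assert (Q : (Cmod (sinf z w - sprod N z w) <= Cmod (sprod N z w) * (1 / 2))%R).
  { apply (tends_bound eventually (fun M => sprod M z w - sprod N z w)).
    - apply tends_minus. typeclasses eauto. apply sprod_tends_at; auto.
      apply tends_const; typeclasses eauto.
    - exists N. intros M HM. eapply Rle_trans. apply (sprod_ratio K (Cmod z)); auto; try lra.
      unfold N; lia. fold B. apply Rmult_le_compat_l. lra.
      assert (HM1 : (0 <= B / INR M)%R).
      { apply Rdiv_le_0_compat; auto. apply lt_0_INR. unfold N in HM; lia. }
      assert (exp (B / INR N - B / INR M) <= 3 / 2)%R; [|lra].
      rewrite <- (exp_ln (3 / 2)) by lra.
      destruct (Rle_lt_or_eq_dec (B / INR N - B / INR M) (ln (3 / 2))) as [L|L]; [lra| |].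
      left; apply exp_increasing; auto. rewrite L; right; auto. }
  rewrite E in Q. replace (0 - sprod N z w) with (- sprod N z w) in Q by ring.
  rewrite Cmod_opp in Q. lra.
Qed.

Lemma lattice_point_00 (w : C) : lattice_point 1 w (0%Z, 0%Z) = 0.
Proof. unfold lattice_point; simpl. ring. Qed.

Lemma sinf_lattice (w : C) (jk : Z * Z) : upper w ->
  (1 <= Z.max (Z.abs (fst jk)) (Z.abs (snd jk)))%Z -> sinf (lattice_point 1 w jk) w = 0.
Proof.
  intros Hw Hm. apply (tends_unique eventually (fun N => sprod N (lattice_point 1 w jk) w)).
  apply sprod_tends_at; auto.
  apply tends_ext with (fun _ => RtoC 0). typeclasses eauto. 2: apply tends_const; typeclasses eauto.
  exists (Z.to_nat (Z.max (Z.abs (fst jk)) (Z.abs (snd jk)))). intros N HN.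
  symmetry. apply cprod_eq_0 with jk. apply In_box. lia.
  apply sigma_factor_eq_0; auto. apply lattice_neq_0; auto.
Qed.

Lemma sinf_0 (w : C) : upper w -> sinf 0 w = 1.
Proof.
  intros Hw. apply (tends_unique eventually (fun N => sprod N 0 w)).
  apply sprod_tends_at; auto.
  apply tends_ext with (fun _ => RtoC 1). typeclasses eauto. 2: apply tends_const; typeclasses eauto.
  apply filter_forall. intros N. unfold sprod. symmetry.
  rewrite (cprod_ext _ _ (fun _ => RtoC 1)).
  - generalize (lattice_box N). intros s; induction s as [|x s IH]; unfold cprod in *; simpl; auto.
    rewrite IH. ring.
  - intros jk _. unfold sigma_factor. replace (0 / lattice_point 1 w jk) with (RtoC 0)
      by (unfold Cdiv; ring).
    replace (0 + 0 ^ 2 / 2) with (RtoC 0) by (simpl; unfold Cdiv; ring). rewrite Cexp_0. ring.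
Qed.

Lemma sig2_eq_0 (z w : C) : upper w -> (sig2 z w = 0 <-> in_lattice w z).
Proof.
  intros Hw. unfold sig2. rewrite wsigma_sinf. split.
  - intros E. apply NNPP. intros Hn.
    apply (Cmult_neq_0 z (sinf z w)); auto.
    + intros E0. apply Hn. exists (0%Z, 0%Z). rewrite lattice_point_00. auto.
    + apply sinf_neq_0; auto. intros jk _ E1. apply Hn. exists jk; auto.
  - intros [[j k] ->]. destruct (Z.eq_dec j 0), (Z.eq_dec k 0).
    { subst. rewrite lattice_point_00. ring. }
    all: rewrite sinf_lattice; [ring|auto|simpl; lia].
Qed.

Definition zneg (jk : Z * Z) : Z * Z := ((- fst jk)%Z, (- snd jk)%Z).

Lemma lattice_point_neg (w : C) (jk : Z * Z) : lattice_point 1 w (zneg jk) = - lattice_point 1 w jk.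
Proof. unfold lattice_point, zneg; simpl. rewrite !opp_IZR, !RtoC_opp. ring. Qed.

Lemma in_lattice_neg (w z : C) : in_lattice w z -> in_lattice w (- z).
Proof. intros [jk ->]. exists (zneg jk). rewrite lattice_point_neg. auto. Qed.

(** The boxes are symmetric under a change of sign of the indices, and a factor depends only on the
    quotient of z by the lattice point. *)
Lemma sinf_even (z w : C) : upper w -> sinf (- z) w = sinf z w.
Proof.
  intros Hw. apply (tends_unique eventually (fun N => sprod N (- z) w)).
  apply sprod_tends_at; auto.
  apply tends_ext with (fun N => sprod N z w). typeclasses eauto. 2: apply sprod_tends_at; auto.
  apply filter_forall. intros N. unfold sprod. symmetry.
  rewrite (cprod_perm (lattice_box N) (map zneg (lattice_box N))).
  - rewrite cprod_map. apply cprod_ext. intros jk Hjk. apply In_box in Hjk.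
    rewrite lattice_point_neg. unfold sigma_factor.
    replace (- z / - lattice_point 1 w jk) with (z / lattice_point 1 w jk). auto.
    field. apply (lattice_neq_0 w jk Hw). lia.
  - apply NoDup_Permutation. apply NoDup_box.
    + apply FinFun.Injective_map_NoDup; [|apply NoDup_box].
      intros [a b] [c d] E. unfold zneg in E. simpl in E. inversion E. f_equal; lia.
    + intros jk. rewrite in_map_iff, In_box. split.
      * intros H. exists (zneg jk). split. destruct jk; unfold zneg; simpl; f_equal; lia.
        apply In_box. unfold zneg; simpl. lia.
      * intros [jk' [<- H]]. apply In_box in H. unfold zneg; simpl. lia.
Qed.

Lemma sig2_odd (z w : C) : upper w -> sig2 (- z) w = - sig2 z w.
Proof. intros Hw. unfold sig2. rewrite !wsigma_sinf, sinf_even by auto. ring. Qed.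

Lemma cderiv_sig2 (z w : C) : upper w -> cderiv (fun u => sig2 u w) z (d_fst sig2 z w).
Proof. intros Hw. apply (an_fst _ analytic2_sig2 w Hw z I). Qed.
Lemma cderiv_sinf (z w : C) : upper w -> cderiv (fun u => sinf u w) z (d_fst sinf z w).
Proof. intros Hw. apply (an_fst _ analytic2_sinf w Hw z I). Qed.

(** Evenness. In logarithmic derivatives taken at the point whose factor was divided out, [sinf]
    therefore contributes nothing. *)
Lemma d_sinf_0 (w : C) : upper w -> d_fst sinf 0 w = 0.
Proof.
  intros Hw.
  assert (E : d_fst sinf 0 w = d_fst sinf 0 w * - (1)).
  { apply (cderiv_unique (fun u => sinf u w) 0). apply cderiv_sinf; auto.
    apply cderiv_ext with (fun u => sinf (- u) w).
    apply filter_forall. intros; apply sinf_even; auto.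
    apply (cderiv_comp (fun u => sinf u w) (fun u => - u)).
    replace (- 0) with (RtoC 0) by ring. apply cderiv_sinf; auto.
    apply cderiv_opp. apply cderiv_id. }
  set (a := d_fst sinf 0 w) in *.
  replace a with (/ 2 * (a + a)) by field. rewrite E at 1. field.
Qed.

Lemma d_sig2_sinf (z w : C) : upper w -> d_fst sig2 z w = sinf z w + z * d_fst sinf z w.
Proof.
  intros Hw. apply cderiv_C_derive. eapply cderiv_eq.
  apply (cderiv_mult (fun u => u) (fun u => sinf u w)). apply cderiv_id.
  apply cderiv_sinf; auto. simpl. ring.
Qed.

Lemma d_sig2_even (z w : C) : upper w -> d_fst sig2 (- z) w = d_fst sig2 z w.
Proof.
  intros Hw.
  assert (E : d_fst sig2 z w = - (d_fst sig2 (- z) w * - (1))).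
  { apply (cderiv_unique (fun u => sig2 u w) z). apply cderiv_sig2; auto.
    apply cderiv_ext with (fun u => - sig2 (- u) w).
    apply filter_forall. intros u. rewrite sig2_odd by auto. ring.
    apply cderiv_opp. apply (cderiv_comp (fun u => sig2 u w) (fun u => - u)).
    apply cderiv_sig2; auto. apply cderiv_opp. apply cderiv_id. }
  rewrite E. ring.
Qed.

(** * Zeta, its partial fractions and its quasi-periods *)

Lemma wzeta_eq (z w : C) : wzeta 1 w z = d_fst sig2 z w / sig2 z w.
Proof. reflexivity. Qed.

Lemma wzeta_odd (z w : C) : upper w -> ~ in_lattice w z -> wzeta 1 w (- z) = - wzeta 1 w z.
Proof.
  intros Hw Hz. rewrite !wzeta_eq, d_sig2_even, sig2_odd by auto. field.
  assert (H : sig2 z w <> 0) by (rewrite sig2_eq_0; auto).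
  auto.
Qed.

(** Partial sums of the Mittag-Leffler series of zeta. The constant and the linear corrections are
    kept as separate sums, since they cancel in the second differences formed below. *)
Definition zeta_part (N : nat) (w z : C) : C :=
  csum (square N) (fun jk => / (z - lattice_point 1 w jk)) +
  csum (lattice_box N) (fun jk => / lattice_point 1 w jk) +
  csum (lattice_box N) (fun jk => / (lattice_point 1 w jk * lattice_point 1 w jk)) * z.

(** The logarithmic derivative of a product, with l as a factor instead of a quotient, so that the
    statement is free of nonvanishing conditions. *)
Lemma cderiv_cprod {T : Type} (s : list T) (F : T -> C -> C) (l : T -> C) (z : C) :
  (forall x, In x s -> cderiv (F x) z (F x z * l x)) ->
  cderiv (fun u => cprod s (fun x => F x u)) z (cprod s (fun x => F x z) * csum s l).
Proof.
  induction s as [|x s IH]; intros H.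
  - unfold cprod, csum; simpl. eapply cderiv_eq. apply cderiv_const. ring.
  - eapply cderiv_eq.
    apply (cderiv_mult (F x) (fun u => cprod s (fun x => F x u))). apply H; left; auto.
    apply IH. intros; apply H; right; auto.
    unfold cprod, csum; simpl. ring.
Qed.

(** By Weierstrass' theorem the partial products of sigma converge together with their derivatives,
    and their logarithmic derivatives are exactly these partial sums. *)
Lemma zeta_part_tends (z w : C) : upper w -> ~ in_lattice w z ->
  tends eventually (fun N => zeta_part N w z) (wzeta 1 w z).
Proof.
  intros Hw Hz.
  assert (HN : forall jk, z <> lattice_point 1 w jk) by (intros jk E; apply Hz; exists jk; auto).
  assert (Hz0 : z <> 0) by (rewrite <- (lattice_point_00 w); auto).
  set (PN := fun N u => u * sprod N u w).
  assert (HW := weierstrass eventually (fun u N => PN N u) (fun u => sig2 u w) z 1).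
  destruct HW as [_ HD].
  - apply filter_forall. intros N. apply (holo_mult (Ball z 1) (fun u => u) (fun u => sprod N u w)).
    apply Ball_open. apply holo_id, Ball_open.
    eapply holo_sub; [apply everywhere_sub|]. apply (an_fst _ (analytic2_sprod N)); auto.
  - intros u _. apply (tends_mult (filter_prod (near u) eventually)). apply filterlim_fst.
    apply sprod_tends; auto.
  - specialize (HD z (Ball_center z 1 Rlt_0_1)).
    apply (joint_at eventually (fun z N => C_derive (fun u => PN N u) z)) in HD.
    assert (HP : tends eventually (fun N => PN N z) (sig2 z w)).
    { apply tends_mult. typeclasses eauto. apply tends_const; typeclasses eauto.
      apply sprod_tends_at; auto. }
    rewrite wzeta_eq.
    apply tends_ext with (fun N => C_derive (fun u => PN N u) z / PN N z). typeclasses eauto.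
    2:{ apply tends_div; auto. typeclasses eauto. rewrite sig2_eq_0; auto. }
    apply filter_forall. intros N.
    set (L := csum (lattice_box N) (fun jk => / (z - lattice_point 1 w jk) +
       (/ lattice_point 1 w jk + / (lattice_point 1 w jk * lattice_point 1 w jk) * z))).
    assert (D : cderiv (fun u => PN N u) z (sprod N z w + z * (sprod N z w * L))).
    { eapply cderiv_eq. apply (cderiv_mult (fun u => u) (fun u => sprod N u w)). apply cderiv_id.
      apply (cderiv_cprod (lattice_box N) (fun jk u => sigma_factor (lattice_point 1 w jk) u)
        (fun jk => / (z - lattice_point 1 w jk) +
       (/ lattice_point 1 w jk + / (lattice_point 1 w jk * lattice_point 1 w jk) * z))).
      - intros jk Hjk. apply In_box in Hjk.
        assert (Hl : lattice_point 1 w jk <> 0) by (apply lattice_neq_0; auto; lia).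
        specialize (HN jk). set (l := lattice_point 1 w jk) in *.
        assert (Hzl : z - l <> 0) by (apply Csub_neq_0; auto).
        unfold sigma_factor.
        assert (Du : cderiv (fun u => u / l) z (/ l)).
        { eapply cderiv_eq. apply cderiv_div; auto. apply cderiv_id. apply cderiv_const. simpl.
          field; auto. }
        eapply cderiv_eq. apply cderiv_mult. apply cderiv_minus. apply cderiv_const. exact Du.
        apply (cderiv_comp Cexp (fun u => u / l + (u / l) ^ 2 / 2)). apply cderiv_Cexp.
        apply cderiv_plus. exact Du. apply cderiv_div.
        intros K; apply RtoC_inj in K; lra.
        apply (cderiv_mult (fun u => u / l) (fun u => u / l * 1)). exact Du.
        apply cderiv_mult. exact Du. apply cderiv_const. apply cderiv_const.
        simpl. field. auto.
      - fold L. unfold sprod. ring. }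
    rewrite (cderiv_C_derive _ _ _ D). unfold PN.
    assert (HPn : sprod N z w <> 0).
    { apply cprod_neq_0. intros jk Hjk. apply In_box in Hjk.
      assert (Hl : lattice_point 1 w jk <> 0) by (apply lattice_neq_0; auto; lia).
      intros E. apply (sigma_factor_eq_0 _ _ Hl) in E. apply (HN jk); auto. }
    unfold zeta_part. rewrite (csum_perm _ _ _ (square_box N)).
    unfold L. rewrite !csum_plus.
    rewrite (csum_ext _ (fun x => / (lattice_point 1 w x * lattice_point 1 w x) * z)
       (fun x => z * / (lattice_point 1 w x * lattice_point 1 w x))) by (intros; ring).
    rewrite csum_scal.
    match goal with |- _ = csum (?a :: ?s) ?F + _ + _ =>
      change (csum (a :: s) F) with (F a + csum s F) end.
    cbv beta. rewrite lattice_point_00.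
    generalize (csum (lattice_box N) (fun x => / (z - lattice_point 1 w x)))
      (csum (lattice_box N) (fun x => / lattice_point 1 w x))
      (csum (lattice_box N) (fun x => / (lattice_point 1 w x * lattice_point 1 w x))).
    intros a b c. replace (z - 0) with z by ring. field. auto.
Qed.

Lemma csum_telescope (N : nat) (g : Z -> C) :
  csum (Zrange N) (fun j => g (j - 1)%Z - g j) = g (- Z.of_nat N - 1)%Z - g (Z.of_nat N).
Proof.
  unfold Zrange. rewrite csum_map.
  assert (H : forall n, csum (seq 0 n) (fun i => g (Z.of_nat i - Z.of_nat N - 1)%Z - g (Z.of_nat i - Z.of_nat N)%Z)
    = g (- Z.of_nat N - 1)%Z - g (Z.of_nat n - 1 - Z.of_nat N)%Z).
  { induction n as [|n IH].
    - replace (Z.of_nat 0 - 1 - Z.of_nat N)%Z with (- Z.of_nat N - 1)%Z by lia.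
      unfold csum; simpl. ring.
    - rewrite seq_S, csum_app, IH. unfold csum; simpl map; simpl fold_right.
      replace (Z.of_nat n - Z.of_nat N - 1)%Z with (Z.of_nat n - 1 - Z.of_nat N)%Z by lia.
      replace (Z.of_nat (S n) - 1 - Z.of_nat N)%Z with (Z.of_nat n - Z.of_nat N)%Z by lia. ring. }
  rewrite H. do 2 f_equal. lia.
Qed.

(** [psi l] is (z' - z) / ((z - l) (z' - l)), of order 1 / |l|^2. A side of the box has 2 N + 1
    points, all of modulus at least N / K, so the sum is of order 1 / N. *)
Lemma zeta_boundary_tends (w z z' : C) (a b : nat -> Z -> Z * Z) : upper w ->
  (forall N k, (Z.of_nat N <= Z.max (Z.abs (fst (a N k))) (Z.abs (snd (a N k))))%Z) ->
  (forall N k, (Z.of_nat N <= Z.max (Z.abs (fst (b N k))) (Z.abs (snd (b N k))))%Z) ->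
  let psi := fun l => / (z - l) - / (z' - l) in
  tends eventually (fun N => csum (Zrange N)
    (fun k => psi (lattice_point 1 w (a N k)) - psi (lattice_point 1 w (b N k)))) 0.
Proof.
  intros Hw Ha Hb psi. destruct (lattice_lower_near w Hw) as [K [HK HL]]. apply near_self in HL.
  set (Z0 := (Cmod z + Cmod z' + 1)%R).
  assert (HZ0 : (1 <= Z0)%R) by (unfold Z0; generalize (Cmod_ge_0 z) (Cmod_ge_0 z'); lra).
  set (D := (Cmod (z' - z) * (4 * K ^ 2))%R).
  assert (HD : (0 <= D)%R).
  { apply Rmult_le_pos. apply Cmod_ge_0. generalize (pow2_ge_0 K); lra. }
  assert (Hpsi : forall N jk, (2 * K * Z0 <= INR N)%R ->
    (Z.of_nat N <= Z.max (Z.abs (fst jk)) (Z.abs (snd jk)))%Z ->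
    (Cmod (psi (lattice_point 1 w jk)) <= D / INR N ^ 2)%R).
  { intros N jk HN Hm. specialize (HL jk). set (l := lattice_point 1 w jk) in *.
    apply IZR_le in Hm. rewrite <- INR_IZR_INZ in Hm. set (n := INR N) in *.
    assert (HKZ : (1 <= K * Z0)%R).
    { replace 1%R with (1 * 1)%R by ring. apply Rmult_le_compat; lra. }
    assert (Hl : (n / K <= Cmod l)%R).
    { apply Rmult_le_reg_l with K; [lra|]. replace (K * (n / K))%R with n by (field; lra). lra. }
    assert (HZn : (Z0 <= n / K / 2)%R).
    { apply Rmult_le_reg_l with (2 * K)%R; [lra|].
      replace (2 * K * (n / K / 2))%R with n by (field; lra). lra. }
    assert (Hb1 : forall u, (Cmod u <= Z0)%R -> (n / (2 * K) <= Cmod (u - l))%R).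
    { intros u Hu. replace (n / (2 * K))%R with (n / K / 2)%R by (field; lra).
      generalize (Cmod_sub_ge l u). rewrite (Cmod_sub_sym l u). lra. }
    assert (H1 := Hb1 z ltac:(unfold Z0; generalize (Cmod_ge_0 z'); lra)).
    assert (H2 := Hb1 z' ltac:(unfold Z0; generalize (Cmod_ge_0 z); lra)).
    assert (Hpos : (0 < n / (2 * K))%R) by (apply Rdiv_lt_0_compat; lra).
    assert (N1 : z - l <> 0) by (apply Cmod_gt_0; lra).
    assert (N2 : z' - l <> 0) by (apply Cmod_gt_0; lra).
    unfold psi. replace (/ (z - l) - / (z' - l)) with ((z' - z) / ((z - l) * (z' - l)))
      by (field; auto).
    rewrite Cmod_div by (apply Cmult_neq_0; auto). rewrite Cmod_mult.
    replace (D / n ^ 2)%R with (Cmod (z' - z) * / (n / (2 * K) * (n / (2 * K))))%R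
      by (unfold D; field; lra).
    unfold Rdiv at 1. apply Rmult_le_compat_l. apply Cmod_ge_0.
    apply Rinv_le_contravar. apply Rmult_lt_0_compat; auto.
    apply Rmult_le_compat; lra. }
  apply tends_eps. typeclasses eauto. intros e He.
  (* The first term makes boundary points at least twice as large as z and z'. The second gives 6 D
     / N < e, where at most 3 N summands of size 2 D / N^2 add up to 6 D / N. *)
  destruct (nfloor_ex (2 * K * Z0 + 6 * D / e)) as [n0 [_ Hn0]].
  { apply Rplus_le_le_0_compat. repeat apply Rmult_le_pos; lra. apply Rdiv_le_0_compat; lra. }
  assert (HDe : (0 <= 6 * D / e)%R) by (apply Rdiv_le_0_compat; lra).
  assert (HKZ : (0 <= 2 * K * Z0)%R) by (repeat apply Rmult_le_pos; lra).
  exists (S n0). intros N HN.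
  assert (Hi : (INR n0 + 1 <= INR N)%R) by (rewrite <- S_INR; apply le_INR; auto).
  assert (H0 := pos_INR n0).
  assert (Hm0 : forall X : C, X - 0 = X) by (intros; ring). rewrite Hm0.
  eapply Rle_lt_trans. apply csum_bound with (b := (2 * (D / INR N ^ 2))%R).
  - intros k _. eapply Rle_trans; [apply Cmod_triangle|]. rewrite Cmod_opp.
    assert (Cmod (psi (lattice_point 1 w (a N k))) <= D / INR N ^ 2)%R by (apply Hpsi; auto; lra).
    assert (Cmod (psi (lattice_point 1 w (b N k))) <= D / INR N ^ 2)%R by (apply Hpsi; auto; lra).
    lra.
  - unfold Zrange. rewrite length_map, length_seq, plus_INR, mult_INR.
    replace (INR 2) with 2%R by (simpl; ring). replace (INR 1) with 1%R by (simpl; ring).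
    set (n := INR N) in *.
    apply Rle_lt_trans with (6 * D / n)%R.
    + apply Rmult_le_reg_r with (n ^ 2)%R. apply pow_lt; lra.
      replace ((2 * n + 1) * (2 * (D / n ^ 2)) * n ^ 2)%R with ((2 * (2 * n + 1)) * D)%R by (field; lra).
      replace (6 * D / n * n ^ 2)%R with (6 * n * D)%R by (field; lra).
      apply Rmult_le_compat_r; lra.
    + apply Rmult_lt_reg_r with n; [lra|]. unfold Rdiv. rewrite Rmult_assoc, Rinv_l, Rmult_1_r by lra.
      assert (Q : (6 * D / e < n)%R) by lra.
      apply Rmult_lt_compat_l with (r := e) in Q; auto.
      replace (e * (6 * D / e))%R with (6 * D)%R in Q by (field; lra). lra.
Qed.

(** In the second difference the corrections of [zeta_part] cancel, and the shift by a period
    telescopes the sum over the square to two opposite sides, which vanish in the limit. *)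
Lemma wzeta_period_const (w z z' tau : C) : upper w -> (tau = 1 \/ tau = w) ->
  ~ in_lattice w z -> ~ in_lattice w z' -> ~ in_lattice w (z + tau) -> ~ in_lattice w (z' + tau) ->
  wzeta 1 w (z + tau) - wzeta 1 w z = wzeta 1 w (z' + tau) - wzeta 1 w z'.
Proof.
  intros Hw Ht H1 H2 H3 H4.
  set (psi := fun l => / (z - l) - / (z' - l)).
  set (DN := fun N => (zeta_part N w (z + tau) - zeta_part N w z) -
     (zeta_part N w (z' + tau) - zeta_part N w z')).
  assert (T1 : tends eventually DN ((wzeta 1 w (z + tau) - wzeta 1 w z) -
     (wzeta 1 w (z' + tau) - wzeta 1 w z'))).
  { repeat (apply tends_minus; [typeclasses eauto| |]); apply zeta_part_tends; auto. }
  assert (E : forall N, DN N = csum (square N)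
     (fun jk => psi (lattice_point 1 w jk - tau) - psi (lattice_point 1 w jk))).
  { intros N. unfold DN, zeta_part, psi. symmetry.
    rewrite (csum_ext _ _ (fun jk => / (z + tau - lattice_point 1 w jk) +
      ((-(1)) * / (z - lattice_point 1 w jk) + ((-(1)) * / (z' + tau - lattice_point 1 w jk) +
       / (z' - lattice_point 1 w jk))))).
    - rewrite !csum_plus, !csum_scal. ring.
    - intros jk _. replace (z - (lattice_point 1 w jk - tau)) with (z + tau - lattice_point 1 w jk) by ring.
      replace (z' - (lattice_point 1 w jk - tau)) with (z' + tau - lattice_point 1 w jk) by ring. ring. }
  assert (T2 : tends eventually DN 0).
  { destruct Ht as [-> | ->].
    - apply tends_ext with (fun N => csum (Zrange N)
       (fun k => psi (lattice_point 1 w (- Z.of_nat N - 1, k)%Z) - psi (lattice_point 1 w (Z.of_nat N, k)))).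
      typeclasses eauto.
      + apply filter_forall. intros N. rewrite E. unfold square.
        rewrite csum_list_prod, csum_swap. apply csum_ext. intros k _.
        rewrite <- (csum_telescope N (fun j => psi (lattice_point 1 w (j, k)))).
        apply csum_ext. intros j _. do 2 f_equal. unfold lattice_point; simpl.
        rewrite minus_IZR, RtoC_minus. ring.
      + apply (zeta_boundary_tends w z z' (fun N k => (- Z.of_nat N - 1, k)%Z)
          (fun N k => (Z.of_nat N, k))); auto; intros; simpl; lia.
    - apply tends_ext with (fun N => csum (Zrange N)
       (fun k => psi (lattice_point 1 w (k, - Z.of_nat N - 1)%Z) - psi (lattice_point 1 w (k, Z.of_nat N)))).
      typeclasses eauto.
      + apply filter_forall. intros N. rewrite E. unfold square.
        rewrite csum_list_prod. apply csum_ext. intros k _.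
        rewrite <- (csum_telescope N (fun j => psi (lattice_point 1 w (k, j)))).
        apply csum_ext. intros j _. do 2 f_equal. unfold lattice_point; simpl.
        rewrite minus_IZR, RtoC_minus. ring.
      + apply (zeta_boundary_tends w z z' (fun N k => (k, - Z.of_nat N - 1)%Z)
          (fun N k => (k, Z.of_nat N))); auto; intros; simpl; lia. }
  assert (E0 := tends_unique eventually DN _ _ T1 T2).
  set (A := wzeta 1 w (z + tau) - wzeta 1 w z) in *.
  set (B := wzeta 1 w (z' + tau) - wzeta 1 w z') in *.
  replace A with (A - B + B) by ring. rewrite E0. ring.
Qed.

(** * Derivatives along the family *)

(** One-sided at an end point of I, in accordance with [is_derive_on], and without t itself, so that
    quotients by s - t make sense. *)
Definition tnear (I : R -> Prop) (t : R) : (R -> Prop) -> Prop :=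
  fun Q => exists d : R, (0 < d)%R /\ forall s, I s -> s <> t -> (Rabs (s - t) < d)%R -> Q s.

Lemma tnear_proper (I : R -> Prop) (t : R) : is_interval I -> I t -> ProperFilter (tnear I t).
Proof.
  intros [HI [a [b [Ha [Hb Hab]]]]] Ht. split.
  - intros Q [d [Hd H]].
    assert (Hd2 : (0 < d / 2)%R) by lra.
    (* If t < b there is room to the right of t inside I, otherwise a < t and there is room to the
       left. *)
    destruct (Rlt_le_dec t b) as [L|L].
    + exists (Rmin b (t + d / 2)).
      assert (M1 : (Rmin b (t + d / 2) <= b)%R) by apply Rmin_l.
      assert (M2 : (Rmin b (t + d / 2) <= t + d / 2)%R) by apply Rmin_r.
      assert (M3 : (t < Rmin b (t + d / 2))%R) by (apply Rmin_glb_lt; lra).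
      apply H. apply (HI t b); auto; lra. lra. apply Rabs_def1; lra.
    + exists (Rmax a (t - d / 2)).
      assert (M1 : (a <= Rmax a (t - d / 2))%R) by apply Rmax_l.
      assert (M2 : (t - d / 2 <= Rmax a (t - d / 2))%R) by apply Rmax_r.
      assert (M3 : (Rmax a (t - d / 2) < t)%R) by (apply Rmax_lub_lt; lra).
      apply H. apply (HI a t); auto; lra. lra. apply Rabs_def1; lra.
  - split.
    + exists 1%R; split; auto with real.
    + intros Q Q' [d [Hd H]] [d' [Hd' H']]. exists (Rmin d d'); split.
      apply Rmin_pos; auto.
      intros z Hz Hzt Hl; split; [apply H | apply H']; auto;
        eapply Rlt_le_trans; eauto using Rmin_l, Rmin_r.
    + intros Q Q' HPQ [d [Hd H]]. exists d; split; auto.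
Qed.

Lemma tnear_I (I : R -> Prop) (t : R) : tnear I t (fun s => I s /\ s <> t).
Proof. exists 1%R. split; auto. lra. Qed.

Lemma is_derive_on_iff {V : NormedModule R_AbsRing} (I : R -> Prop) (g : R -> V) (t : R) (l : V) :
  I t -> (is_derive_on I g t l <-> forall e : R, (0 < e)%R -> exists d, (0 < d)%R /\
    forall s, I s -> (Rabs (s - t) < d)%R ->
     (norm (minus (minus (g s) (g t)) (scal (s - t)%R l)) <= e * Rabs (s - t))%R).
Proof.
  intros Ht. split.
  - intros [_ H] e He. specialize (H t). destruct (H) with (eps := mkposreal e He) as [d Hd].
    { intros Q [d Hd]. exists d. intros y Hy _. apply Hd; auto. }
    exists d. split. apply cond_pos. intros s Hs Hst. apply (Hd s Hst Hs).
  - intros H. split.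
    + apply (is_linear_scal_l (K := R_AbsRing) (V := V)).
    + intros x Hx.
      assert (E : x = t).
      { apply NNPP. intros Hn.
        assert (Hp : (0 < Rabs (t - x))%R) by (apply Rabs_pos_lt; lra).
        assert (K : within I (locally t) (fun y => (Rabs (y - x) < Rabs (t - x))%R)).
        { apply Hx. exists (mkposreal _ Hp). intros y Hy. exact Hy. }
        destruct K as [d Hd]. specialize (Hd t (ball_center t d) Ht). lra. }
      subst x. intros eps. destruct (H eps (cond_pos eps)) as [d [Hd HH]].
      exists (mkposreal d Hd). intros s Hs Is. apply (HH s Is Hs).
Qed.

Definition dquot (g : R -> C) (t s : R) : C := (g s - g t) / RtoC (s - t).

Lemma is_derive_on_C (I : R -> Prop) (g : R -> C) (t : R) (l : C) : is_interval I -> I t ->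
  (@is_derive_on C_R_NormedModule I g t l <-> tends (tnear I t) (dquot g t) l).
Proof.
  intros HI Ht. assert (TF := tnear_proper I t HI Ht).
  rewrite is_derive_on_iff by auto. rewrite tends_eps by typeclasses eauto.
  assert (E : forall s, @norm R_AbsRing C_R_NormedModule
     (minus (minus (g s) (g t)) (scal (s - t)%R (l : C_R_NormedModule))) =
      Cmod (g s - g t - l * RtoC (s - t))).
  { intros s. rewrite <- Cmod_norm. f_equal.
    destruct (g s), (g t), l. unfold minus, plus, opp, scal; simpl.
    unfold prod_scal, scal; simpl. unfold mult; simpl.
    unfold Cminus, Cplus, Copp, Cmult, RtoC; simpl. unfold plus, opp; simpl. f_equal; ring. }
  assert (Q : forall s, s <> t -> dquot g t s - l = (g s - g t - l * RtoC (s - t)) / RtoC (s - t)).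
  { intros s Hs. unfold dquot. field. intros K; apply RtoC_inj in K. lra. }
  split.
  - intros H e He. destruct (H (e / 2)%R) as [d [Hd HH]]. lra.
    exists d. split; auto. intros s Is Hs Hl. specialize (HH s Is Hl).
    assert (HH' : (Cmod (g s - g t - l * RtoC (s - t)) <= e / 2 * Rabs (s - t))%R)
      by (rewrite <- E; exact HH). clear HH. rename HH' into HH.
    rewrite Q by auto. assert (Hp : (0 < Rabs (s - t))%R) by (apply Rabs_pos_lt; lra).
    rewrite Cmod_div by (intros K; apply RtoC_inj in K; lra). rewrite Cmod_R.
    apply Rle_lt_trans with (e / 2)%R; [|lra].
    apply Rmult_le_reg_r with (Rabs (s - t)); auto.
    unfold Rdiv at 1. rewrite Rmult_assoc, Rinv_l by lra. lra.
  - intros H e He. destruct (H e He) as [d [Hd HH]]. exists d; split; auto.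
    intros s Is Hl. apply (Rle_trans _ (Cmod (g s - g t - l * RtoC (s - t)))); [right; apply E|].
    destruct (Req_dec s t) as [->|Hs].
    + rewrite Rminus_diag, Rabs_R0. replace (g t - g t - l * 0) with (RtoC 0) by ring.
      rewrite Cmod_0. lra.
    + specialize (HH s Is Hs Hl). rewrite Q in HH by auto.
      assert (Hp : (0 < Rabs (s - t))%R) by (apply Rabs_pos_lt; lra).
      rewrite Cmod_div in HH by (intros K; apply RtoC_inj in K; lra). rewrite Cmod_R in HH.
      apply Rmult_le_reg_r with (/ Rabs (s - t))%R. apply Rinv_0_lt_compat; auto.
      rewrite Rmult_assoc, Rinv_r, Rmult_1_r by lra. left; exact HH.
Qed.

(** [dot] is given by [iota], which needs existence and uniqueness; the derivative is unique because
    t is an accumulation point of I. *)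
Lemma dotC_eq (I : R -> Prop) (g : R -> C) (t : R) (l : C) : is_interval I -> I t ->
  tends (tnear I t) (dquot g t) l -> dotC I g t = l.
Proof.
  intros HI Ht H. assert (TF := tnear_proper I t HI Ht).
  unfold dotC, dot. apply (iota_unique (V := C_R_CompleteNormedModule)).
  - intros y Hy. apply (is_derive_on_C I g t y HI Ht) in Hy.
    apply (tends_unique (tnear I t) (dquot g t)); auto.
  - apply (is_derive_on_C I g t l HI Ht). auto.
Qed.

(** Real functions are viewed as complex-valued, so that a single calculus of limits serves both. *)
Lemma is_derive_on_R (I : R -> Prop) (g : R -> R) (t l : R) : is_interval I -> I t ->
  (@is_derive_on R_NormedModule I g t l <-> tends (tnear I t) (dquot (fun s => RtoC (g s)) t) (RtoC l)).
Proof.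
  intros HI Ht. rewrite <- is_derive_on_C by auto. rewrite !is_derive_on_iff by auto.
  assert (E : forall s, @norm R_AbsRing C_R_NormedModule
     (minus (minus (RtoC (g s) : C_R_NormedModule) (RtoC (g t))) (scal (s - t)%R (RtoC l : C_R_NormedModule))) =
     @norm R_AbsRing R_NormedModule
     (minus (minus (g s : R_NormedModule) (g t)) (scal (s - t)%R (l : R_NormedModule)))).
  { intros s. rewrite <- Cmod_norm. change (@norm R_AbsRing R_NormedModule ?x) with (Rabs x).
    rewrite <- Cmod_R. f_equal.
    unfold minus, plus, opp, scal; simpl.
    unfold prod_scal, scal; simpl. unfold mult; simpl. unfold RtoC; simpl.
    apply injective_projections; simpl; unfold plus, opp; simpl; ring. }
  split; intros H e He; destruct (H e He) as [d [Hd HH]]; exists d; split; auto; intros s Is Hs;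
    specialize (HH s Is Hs); eapply Rle_trans; try exact HH; right; first [apply E | symmetry; apply E].
Qed.

Lemma dotR_eq (I : R -> Prop) (g : R -> R) (t l : R) : is_interval I -> I t ->
  tends (tnear I t) (dquot (fun s => RtoC (g s)) t) (RtoC l) -> dotR I g t = l.
Proof.
  intros HI Ht H. assert (TF := tnear_proper I t HI Ht).
  unfold dotR, dot. apply (iota_unique (V := R_CompleteNormedModule)).
  - intros y Hy. apply (is_derive_on_R I g t y HI Ht) in Hy. apply RtoC_inj.
    apply (tends_unique (tnear I t) (dquot (fun s => RtoC (g s)) t)); auto.
  - apply (is_derive_on_R I g t l HI Ht). auto.
Qed.

Lemma smoothC_tends (I : R -> Prop) (g : R -> C) (t : R) : is_interval I -> I t ->
  smoothC I g -> tends (tnear I t) (dquot g t) (dotC I g t).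
Proof.
  intros HI Ht [G [H0 HG]]. specialize (HG 0%nat t Ht).
  apply (is_derive_on_C I (G 0%nat) t _ HI Ht) in HG.
  assert (K : tends (tnear I t) (dquot g t) (G 1%nat t)).
  { assert (TF := tnear_proper I t HI Ht). eapply tends_ext; [typeclasses eauto| |exact HG].
    generalize (tnear_I I t). apply filter_imp. intros s [Hs _].
    unfold dquot. rewrite !H0; auto. }
  rewrite (dotC_eq I g t (G 1%nat t)); auto.
Qed.

Lemma smoothR_tends (I : R -> Prop) (g : R -> R) (t : R) : is_interval I -> I t ->
  smoothR I g -> tends (tnear I t) (dquot (fun s => RtoC (g s)) t) (RtoC (dotR I g t)).
Proof.
  intros HI Ht [G [H0 HG]]. specialize (HG 0%nat t Ht).
  apply (is_derive_on_R I (G 0%nat) t _ HI Ht) in HG.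
  assert (K : tends (tnear I t) (dquot (fun s => RtoC (g s)) t) (RtoC (G 1%nat t))).
  { assert (TF := tnear_proper I t HI Ht). eapply tends_ext; [typeclasses eauto| |exact HG].
    generalize (tnear_I I t). apply filter_imp. intros s [Hs _].
    unfold dquot. rewrite !H0; auto. }
  rewrite (dotR_eq I g t (G 1%nat t)); auto.
Qed.

(* The limit is joint in [z] and [s -> t], which encodes a derivative at [t] that exists locally
   uniformly in [z]. *)
Definition jd (I : R -> Prop) (t : R) (F : C -> R -> C) (z l : C) : Prop :=
  cts (fun u => F u t) z /\
  tends (filter_prod (near z) (tnear I t))
    (fun x => (F (fst x) (snd x) - F (fst x) t) / RtoC (snd x - t)) l.

Section JD.
Variables (I : R -> Prop) (t : R).
Hypotheses (HI : is_interval I) (Ht : I t).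

Let TF : ProperFilter (tnear I t) := tnear_proper I t HI Ht.
Local Existing Instance TF.

Lemma tnear_sub_tends : tends (tnear I t) (fun s => RtoC (s - t)) 0.
Proof.
  apply tends_eps. typeclasses eauto. intros e He. exists e. split; auto. intros s _ _ Hs.
  replace (RtoC (s - t) - 0) with (RtoC (s - t)) by ring. rewrite Cmod_R. auto.
Qed.

Lemma tnear_neq : tnear I t (fun s => RtoC (s - t) <> 0).
Proof.
  exists 1%R. split; [lra|]. intros s _ Hs _ E. apply RtoC_inj in E. lra.
Qed.

(** F(u, s) is F(u, t) plus the quotient times s - t: the first part is controlled by the continuity
    clause of [jd], the second tends to 0. *)
Lemma jd_tends (F : C -> R -> C) (z l : C) : jd I t F z l ->
  tends (filter_prod (near z) (tnear I t)) (fun x => F (fst x) (snd x)) (F z t).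
Proof.
  intros [Hc Hq].
  apply tends_ext with (fun x : C * R => F (fst x) t +
    (F (fst x) (snd x) - F (fst x) t) / RtoC (snd x - t) * RtoC (snd x - t)).
  - typeclasses eauto.
  - generalize (near_snd (near z) (tnear I t) _ tnear_neq). apply filter_imp.
    intros [u s] Hs. cbn [fst snd] in *. field. auto.
  - replace (F z t) with (F z t + l * 0) by ring. apply tends_plus. typeclasses eauto.
    apply (filterlim_comp _ _ _ fst (fun u => F u t) _ (near z) _). apply filterlim_fst. exact Hc.
    apply tends_mult; auto. typeclasses eauto.
    apply (filterlim_comp _ _ _ snd (fun s => RtoC (s - t)) _ (tnear I t) _).
    apply filterlim_snd. apply tnear_sub_tends.
Qed.

Lemma jd_unique (F : C -> R -> C) (z l m : C) : jd I t F z l -> jd I t F z m -> l = m.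
Proof. intros [_ H] [_ H']. eapply (tends_unique (filter_prod (near z) (tnear I t))); eauto. Qed.

Lemma jd_space (f : C -> C) (z : C) : cts f z -> jd I t (fun u _ => f u) z 0.
Proof.
  intros Hf. split; auto. apply tends_ext with (fun _ => RtoC 0). typeclasses eauto.
  apply filter_forall. intros [u s]. cbn [fst snd]. unfold Cdiv. ring.
  apply tends_const; typeclasses eauto.
Qed.

Lemma jd_time (g : R -> C) (z l : C) : tends (tnear I t) (dquot g t) l -> jd I t (fun _ s => g s) z l.
Proof.
  intros H. split. apply cts_const.
  apply (filterlim_comp _ _ _ snd (dquot g t) _ (tnear I t) _). apply filterlim_snd. exact H.
Qed.

Lemma jd_eq (F : C -> R -> C) (z l m : C) : jd I t F z l -> l = m -> jd I t F z m.
Proof. intros; subst; auto. Qed.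

Lemma jd_ext (F G : C -> R -> C) (z l : C) : (forall u s, F u s = G u s) ->
  jd I t F z l -> jd I t G z l.
Proof.
  intros E [Hc Hq]. split.
  - eapply cts_ext; [|exact Hc]. apply filter_forall. auto.
  - eapply tends_ext; [typeclasses eauto| |exact Hq]. apply filter_forall. intros; rewrite !E; auto.
Qed.

(** Equality at time t is asked for separately because [tnear] leaves t out. *)
Lemma jd_ext_loc (F G : C -> R -> C) (z l : C) :
  near z (fun u => F u t = G u t) ->
  filter_prod (near z) (tnear I t) (fun x => F (fst x) (snd x) = G (fst x) (snd x)) ->
  jd I t F z l -> jd I t G z l.
Proof.
  intros E0 E [Hc Hq]. split.
  - eapply cts_ext; [|exact Hc]. auto.
  - eapply tends_ext; [typeclasses eauto| |exact Hq].
    generalize (filter_and (F := filter_prod (near z) (tnear I t)) _ _ E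
      (near_fst (near z) (tnear I t) _ E0)). apply filter_imp.
    intros [u s] [H1 H2]. cbn [fst snd] in *. rewrite H1, H2; auto.
Qed.

Lemma jd_plus (F G : C -> R -> C) (z l m : C) : jd I t F z l -> jd I t G z m ->
  jd I t (fun u s => F u s + G u s) z (l + m).
Proof.
  intros [Hc Hq] [Hc' Hq']. split. apply cts_plus; auto.
  eapply tends_ext; [typeclasses eauto| |apply (tends_plus _ _ _ _ _ Hq Hq')].
  apply filter_forall. intros [u s]. cbn [fst snd]. unfold Cdiv. ring.
Qed.

Lemma jd_mult (F G : C -> R -> C) (z l m : C) : jd I t F z l -> jd I t G z m ->
  jd I t (fun u s => F u s * G u s) z (l * G z t + F z t * m).
Proof.
  intros HF HG. assert (TG := jd_tends _ _ _ HG).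
  destruct HF as [Hc Hq]. destruct HG as [Hc' Hq'].
  split. apply cts_mult; auto.
  eapply tends_ext; [typeclasses eauto| |].
  2:{ apply tends_plus. typeclasses eauto. apply tends_mult. typeclasses eauto. exact Hq. exact TG.
      apply tends_mult. typeclasses eauto.
      apply (filterlim_comp _ _ _ fst (fun u => F u t) _ (near z) _). apply filterlim_fst. exact Hc.
      exact Hq'. }
  apply filter_forall. intros [u s]. cbn [fst snd]. unfold Cdiv. ring.
Qed.

Lemma jd_const (c z : C) : jd I t (fun _ _ => c) z 0.
Proof. apply (jd_space (fun _ => c)). apply cts_const. Qed.

Lemma jd_scal (F : C -> R -> C) (c z l : C) : jd I t F z l -> jd I t (fun u s => c * F u s) z (c * l).
Proof.
  intros H. eapply jd_eq. apply jd_mult. apply jd_const. exact H. simpl. ring.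
Qed.

Lemma jd_minus (F G : C -> R -> C) (z l m : C) : jd I t F z l -> jd I t G z m ->
  jd I t (fun u s => F u s - G u s) z (l - m).
Proof.
  intros HF HG. apply jd_ext with (fun u s => F u s + (- (1)) * G u s). intros; ring.
  eapply jd_eq. apply jd_plus; [exact HF|apply jd_scal; exact HG]. ring.
Qed.

(** The chain rule for B in two variables. Strict differentiability is required because the base
    point (F u t, W u t) of the increment moves with u. *)
Lemma jd_strict (F W : C -> R -> C) (B : C -> C -> C) (z l m b1 b2 : C) :
  (forall e, (0 < e)%R -> exists d, (0 < d)%R /\ forall z1 z2 w1 w2,
     Ball (F z t) d z1 -> Ball (F z t) d z2 -> Ball (W z t) d w1 -> Ball (W z t) d w2 ->
     (Cmod (B z2 w2 - B z1 w1 - b1 * (z2 - z1) - b2 * (w2 - w1))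
       <= e * (Cmod (z2 - z1) + Cmod (w2 - w1)))%R) ->
  cts (fun u => B (F u t) (W u t)) z -> jd I t F z l -> jd I t W z m ->
  jd I t (fun u s => B (F u s) (W u s)) z (b1 * l + b2 * m).
Proof.
  intros HB HBc HF HG. assert (T1 := jd_tends _ _ _ HF). assert (T2 := jd_tends _ _ _ HG).
  destruct HF as [Hc Hq]. destruct HG as [Hc' Hq'].
  split; auto.
  assert (K0 : (0 < Cmod l + Cmod m + 2)%R)
    by (generalize (Cmod_ge_0 l) (Cmod_ge_0 m); lra).
  assert (T3 : tends (filter_prod (near z) (tnear I t))
    (fun x => b1 * ((F (fst x) (snd x) - F (fst x) t) / RtoC (snd x - t)) +
              b2 * ((W (fst x) (snd x) - W (fst x) t) / RtoC (snd x - t))) (b1 * l + b2 * m)).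
  { apply tends_plus. typeclasses eauto. apply tends_mult; auto. typeclasses eauto.
    apply tends_const; typeclasses eauto. apply tends_mult; auto. typeclasses eauto.
    apply tends_const; typeclasses eauto. }
  rewrite tends_eps in * by typeclasses eauto. unfold cts in Hc, Hc'.
  rewrite tends_eps in Hc, Hc' by typeclasses eauto. intros e He.
  assert (He2 : (0 < e / 2)%R) by lra.
  (* The quotients of F and W are eventually bounded by |l| + 1 and |m| + 1, so the error of
     linearization amounts to at most e / 2. *)
  set (e1 := (e / 2 / (Cmod l + Cmod m + 2))%R).
  assert (He1 : (0 < e1)%R) by (apply Rdiv_lt_0_compat; lra).
  destruct (HB e1 He1) as [d [Hd HS]].
  generalize (filter_and (F := filter_prod (near z) (tnear I t)) _ _
    (filter_and (F := filter_prod (near z) (tnear I t)) _ _ (T3 _ He2)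
     (near_filter_prod (near z) (tnear I t) _ _ (filter_and _ _ (Hc d Hd) (Hc' d Hd)) tnear_neq))
    (filter_and (F := filter_prod (near z) (tnear I t)) _ _
      (filter_and (F := filter_prod (near z) (tnear I t)) _ _ (T1 d Hd) (T2 d Hd))
      (filter_and (F := filter_prod (near z) (tnear I t)) _ _ (Hq 1%R Rlt_0_1) (Hq' 1%R Rlt_0_1)))).
  apply filter_imp. intros [u s] [[A1 [[A2 A3] A4]] [[A5 A6] [A7 A8]]]. cbn [fst snd] in *.
  specialize (HS _ _ _ _ A2 A5 A3 A6).
  set (h := RtoC (s - t)) in *.
  set (dF := F u s - F u t) in *. set (dW := W u s - W u t) in *.
  assert (Hh : (0 < Cmod h)%R) by (apply Cmod_gt_0; auto).
  assert (Q1 : (Cmod (dF / h) <= Cmod l + 1)%R).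
  { generalize (Cmod_sub_ge (dF / h) l). lra. }
  assert (Q2 : (Cmod (dW / h) <= Cmod m + 1)%R).
  { generalize (Cmod_sub_ge (dW / h) m). lra. }
  replace ((B (F u s) (W u s) - B (F u t) (W u t)) / h - (b1 * l + b2 * m)) with
    ((B (F u s) (W u s) - B (F u t) (W u t) - b1 * dF - b2 * dW) / h +
     (b1 * (dF / h) + b2 * (dW / h) - (b1 * l + b2 * m))) by (field; auto).
  eapply Rle_lt_trans; [apply Cmod_triangle|].
  assert (Q3 : (Cmod ((B (F u s) (W u s) - B (F u t) (W u t) - b1 * dF - b2 * dW) / h) <= e / 2)%R).
  { rewrite Cmod_div by auto. apply Rmult_le_reg_r with (Cmod h); auto.
    unfold Rdiv at 1. rewrite Rmult_assoc, Rinv_l, Rmult_1_r by lra.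
    eapply Rle_trans; [exact HS|].
    replace dF with (dF / h * h) by (field; auto). replace dW with (dW / h * h) by (field; auto).
    rewrite !Cmod_mult, <- Rmult_plus_distr_r, <- Rmult_assoc.
    apply Rmult_le_compat_r; [lra|].
    apply Rle_trans with (e1 * (Cmod l + Cmod m + 2))%R.
    apply Rmult_le_compat_l; lra. unfold e1. right; field; lra. }
  lra.
Qed.

Lemma jd_analytic2 (F W : C -> R -> C) (B : C -> C -> C) (z l m : C) : analytic2 B ->
  upper (W z t) -> jd I t F z l -> jd I t W z m ->
  jd I t (fun u s => B (F u s) (W u s)) z
    (d_fst B (F z t) (W z t) * l + d_snd B (F z t) (W z t) * m).
Proof.
  intros HB HW HF HG. apply jd_strict; auto.
  - intros e He. apply analytic2_strict; auto.
  - apply (filterlim_comp _ _ _ (fun u => (F u t, W u t)) (fun x => B (fst x) (snd x)) _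
      (filter_prod (near (F z t)) (near (W z t))) _).
    apply filterlim_pair; [apply HF|apply HG]. apply HB; auto.
Qed.

Lemma jd_holo (F : C -> R -> C) (f : C -> C) (U : C -> Prop) (z l : C) : isopen U -> holo U f ->
  U (F z t) -> jd I t F z l -> jd I t (fun u s => f (F u s)) z (C_derive f (F z t) * l).
Proof.
  intros HU Hf Hz HF.
  eapply jd_eq. apply (jd_strict F (fun _ _ => 0) (fun z _ => f z) z l 0 (C_derive f (F z t)) 0); auto.
  - intros e He.
    destruct (cderiv_strict f (C_derive f) (F z t)) with (e := e) as [d [Hd HS]]; auto.
    { generalize (HU _ Hz). apply filter_imp. intros; apply Hf; auto. } { apply Hf; auto. }
    exists d. split; auto. intros z1 z2 w1 w2 B1 B2 _ _. specialize (HS _ _ B1 B2).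
    replace (f z2 - f z1 - C_derive f (F z t) * (z2 - z1) - 0 * (w2 - w1)) with
      (f z2 - f z1 - C_derive f (F z t) * (z2 - z1)) by ring.
    assert (0 <= e * Cmod (w2 - w1))%R by (apply Rmult_le_pos; [lra|apply Cmod_ge_0]). lra.
  - apply (cts_comp f (fun u => F u t)). eapply holo_cts; eauto. apply HF.
  - apply (jd_space (fun _ => 0)). apply cts_const.
  - ring.
Qed.

Lemma jd_inv (F : C -> R -> C) (z l : C) : F z t <> 0 -> jd I t F z l ->
  jd I t (fun u s => / F u s) z (- l / (F z t * F z t)).
Proof.
  intros Hn HF.
  assert (HU : isopen (fun z => z <> 0)).
  { intros p Hp. apply (tends_neq (near p) (fun z => z) p); auto. apply cts_id. }
  eapply jd_eq. apply (jd_holo F (fun z => / z) (fun z => z <> 0)); auto.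
  - apply holo_inv; auto. apply holo_id; auto.
  - exact HF.
  - rewrite (cderiv_C_derive _ _ (- (1) / (F z t * F z t))).
    field; auto. eapply cderiv_inv; auto. apply cderiv_id.
Qed.

Lemma jd_div (F G : C -> R -> C) (z l m : C) : G z t <> 0 -> jd I t F z l -> jd I t G z m ->
  jd I t (fun u s => F u s / G u s) z ((l * G z t - F z t * m) / (G z t * G z t)).
Proof.
  intros Hn HF HG. eapply jd_eq. apply (jd_mult F (fun u s => / G u s)). exact HF.
  apply jd_inv; eauto. simpl. field; auto.
Qed.

Lemma jd_at (F : C -> R -> C) (z l : C) : jd I t F z l -> tends (tnear I t) (dquot (F z) t) l.
Proof.
  intros [_ H]. apply (joint_at (tnear I t) (fun u s => (F u s - F u t) / RtoC (s - t))) in H.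
  exact H.
Qed.

Lemma dquot_tends (g : R -> C) (l : C) : tends (tnear I t) (dquot g t) l ->
  tends (tnear I t) g (g t).
Proof.
  intros H. assert (K := jd_tends _ _ _ (jd_time g 0 l H)).
  apply (joint_at (tnear I t) (fun _ s => g s)) in K. exact K.
Qed.

(** The increment is split at F (p s) t. The time quotient is then evaluated at the moving point p
    s, which is legitimate because its limit is joint. *)
Lemma jd_move (F : C -> R -> C) (p : R -> C) (l m v : C) : jd I t F (p t) l ->
  cderiv (fun u => F u t) (p t) m -> tends (tnear I t) (dquot p t) v ->
  tends (tnear I t) (dquot (fun s => F (p s) s) t) (l + m * v).
Proof.
  intros [Hc Hq] Hd Hp. assert (Tp := dquot_tends p v Hp).
  apply cderiv_quot in Hd. destruct Hd as [k [Hk [Hkm E]]].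
  eapply tends_ext; [typeclasses eauto| |].
  2:{ apply tends_plus. typeclasses eauto.
      apply (filterlim_comp _ _ _ (fun s => (p s, s))
        (fun x => (F (fst x) (snd x) - F (fst x) t) / RtoC (snd x - t)) _
        (filter_prod (near (p t)) (tnear I t)) _).
      apply filterlim_pair. exact Tp. apply filterlim_id. exact Hq.
      apply tends_mult. typeclasses eauto.
      apply (filterlim_comp _ _ _ p k _ (near (p t)) _). exact Tp. rewrite <- Hkm. exact Hk.
      exact Hp. }
  apply filter_forall. intros s. cbn [fst snd]. unfold dquot.
  replace (F (p s) t) with (F (p t) t + k (p s) * (p s - p t)) by (rewrite (E (p s)); auto).
  unfold Cdiv. ring.
Qed.

Lemma jd_cts (F : C -> R -> C) (Fd : C -> C) (U : C -> Prop) (z : C) : isopen U -> U z ->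
  (forall u, U u -> jd I t F u (Fd u)) -> cts Fd z.
Proof.
  intros HU Hz H.
  apply (joint_cts (tnear I t) (fun u s => (F u s - F u t) / RtoC (s - t))).
  generalize (HU z Hz). apply filter_imp. intros u Hu. apply (H u Hu).
Qed.

(** The exchange of d/dt and d/dz: the quotients in t are holomorphic in z and converge jointly, so
    Weierstrass' theorem gives the convergence of their z-derivatives. *)
Lemma jd_holo_limit (F : C -> R -> C) (Fd : C -> C) (p : C) (r : R) :
  (forall u, Ball p r u -> jd I t F u (Fd u)) ->
  holo (Ball p r) (fun u => F u t) ->
  tnear I t (fun s => holo (Ball p r) (fun u => F u s)) ->
  holo (Ball p r) Fd /\
  forall u, Ball p r u -> jd I t (fun u s => C_derive (fun v => F v s) u) u (C_derive Fd u).
Proof.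
  intros H H0 Hs.
  destruct (weierstrass (tnear I t) (fun u s => (F u s - F u t) / RtoC (s - t)) Fd p r) as [W1 W2].
  - generalize (filter_and _ _ Hs tnear_neq). apply filter_imp. intros s [K1 K2].
    apply holo_div; auto using Ball_open, holo_const. apply holo_minus; auto using Ball_open.
  - intros u Hu. apply (H u Hu).
  - split; auto. intros u Hu. split.
    + apply H0; auto.
    + eapply tends_ext; [typeclasses eauto| |apply (W2 u Hu)].
      generalize (near_filter_prod (near u) (tnear I t) _ _ (Ball_open p r u Hu)
        (filter_and _ _ Hs tnear_neq)). apply filter_imp.
      intros [v s] [K1 [K2 K3]]. cbn [fst snd] in *. apply cderiv_C_derive.
      eapply cderiv_eq. apply cderiv_div; auto. apply cderiv_minus. apply (K2 v K1).
      apply (H0 v K1). apply cderiv_const. simpl. field; auto.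
Qed.

(** Differentiation in t under an integral over a segment with one moving end. The continuity
    hypothesis at neighbouring times makes the integrals exist there, so that they may be
    subtracted. *)
Lemma jd_segment (F : C -> R -> C) (Fd : C -> C) (U : C -> Prop) (a z : C) : isopen U ->
  (forall u, U u -> jd I t F u (Fd u)) ->
  (forall u, U u -> filter_prod (near u) (tnear I t) (fun x => cts (fun v => F v (snd x)) (fst x))) ->
  (forall s : R, (0 <= s <= 1)%R -> U (a + (z - a) * s)) ->
  jd I t (fun u s => CInt (fun x => F (a + (u - a) * x) s * (u - a))) z
    (CInt (fun x => Fd (a + (z - a) * x) * (z - a))).
Proof.
  intros HU HF HFc Hseg.
  assert (Hcl : forall (Fc : Filter (tnear I t)) (x : R), tends (filter_prod (nearR x) (filter_prod (near z) (tnear I t)))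
     (fun y : R * (C * R) => a + (fst (snd y) - a) * RtoC (fst y)) (a + (z - a) * x)).
  { intros _ x. apply tends_plus. typeclasses eauto. apply tends_const; typeclasses eauto.
    apply tends_mult. typeclasses eauto. apply tends_minus. typeclasses eauto.
    eapply filterlim_comp. apply filterlim_snd. apply filterlim_fst.
    apply tends_const; typeclasses eauto.
    eapply filterlim_comp. apply filterlim_fst. apply contR_RtoC. }
  assert (Hsn : forall x, filterlim (fun y : R * (C * R) => snd (snd y))
     (filter_prod (nearR x) (filter_prod (near z) (tnear I t))) (tnear I t)).
  { intros x. eapply filterlim_comp. apply filterlim_snd. apply filterlim_snd. }
  assert (Hcl0 : forall x, tends (filter_prod (nearR x) (near z))
     (fun y : R * C => a + (snd y - a) * RtoC (fst y)) (a + (z - a) * x)).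
  { intros x. apply tends_plus. typeclasses eauto. apply tends_const; typeclasses eauto.
    apply tends_mult. typeclasses eauto. apply tends_minus. typeclasses eauto.
    apply filterlim_snd. apply tends_const; typeclasses eauto.
    eapply filterlim_comp. apply filterlim_fst. apply contR_RtoC. }
  assert (Hct : forall u, U u -> cts (fun v => F v t) u) by (intros u Hu; apply (HF u Hu)).
  assert (HFdc : forall u, U u -> cts Fd u) by (intros u Hu; apply (jd_cts F Fd U); auto).
  (* By compactness the whole segment from a to u lies in U, with F(., s) continuous along it, for
     all (u, s) close to (z, t). *)
  assert (Hev : filter_prod (near z) (tnear I t) (fun y => forall x, (0 <= x <= 1)%R ->
      cts (fun v => F v (snd y)) (a + (fst y - a) * x) /\ U (a + (fst y - a) * x))).
  { apply (unif_compact (filter_prod (near z) (tnear I t)) (fun x y =>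
      cts (fun v => F v (snd y)) (a + (fst y - a) * x) /\ U (a + (fst y - a) * x))).
    intros x Hx. assert (Q := HFc _ (Hseg x Hx)).
    assert (Q' := near_fst (near (a + (z - a) * x)) (tnear I t) _ (HU _ (Hseg x Hx))).
    assert (QQ := filter_and (F := filter_prod (near (a + (z - a) * x)) (tnear I t)) _ _ Q Q').
    assert (HP : filterlim (fun y : R * (C * R) => (a + (fst (snd y) - a) * fst y, snd (snd y)))
      (filter_prod (nearR x) (filter_prod (near z) (tnear I t)))
      (filter_prod (near (a + (z - a) * x)) (tnear I t))).
    { apply filterlim_pair; auto. apply Hcl. typeclasses eauto. }
    apply HP in QQ. destruct QQ as [Q1 Q2 [d [Hd HQ1]] HQ2 HQ].
    exists d; split; auto. revert HQ2. apply filter_imp. intros y Hy x' Hx'.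
    apply (HQ x' y); auto. }
  assert (Hpath : forall u x, contR (fun x : R => a + (u - a) * x) x)
    by (intros; apply contR_affine).
  assert (Hcont : forall u s, (forall x, (0 <= x <= 1)%R -> cts (fun v => F v s) (a + (u - a) * x)) ->
    cont01 (fun x => F (a + (u - a) * x) s * (u - a))).
  { intros u s H x Hx. apply contR_mult; [|apply contR_const].
    apply (contR_line (fun v => F v s)). auto. }
  assert (Hev0 : near z (fun u => forall x, (0 <= x <= 1)%R -> U (a + (u - a) * x))).
  { apply (unif_compact (near z) (fun x u => U (a + (u - a) * x))).
    intros x Hx. assert (QQ := Hcl0 x _ (HU _ (Hseg x Hx))).
    destruct QQ as [Q1 Q2 [d [Hd HQ1]] HQ2 HQ].
    exists d; split; auto. revert HQ2. apply filter_imp. intros y Hy x' Hx'.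
    apply (HQ x' y); auto. }
  split.
  - apply (CInt_tends (near z) (fun x u => F (a + (u - a) * x) t * (u - a))
      (fun x => F (a + (z - a) * x) t * (z - a))).
    + intros x Hx. apply tends_mult. typeclasses eauto.
      apply (filterlim_comp _ _ _ (fun y : R * C => a + (snd y - a) * fst y) (fun v => F v t) _
        (near (a + (z - a) * x)) _). apply Hcl0. apply Hct; auto.
      apply tends_minus. typeclasses eauto. apply filterlim_snd. apply tends_const; typeclasses eauto.
    + revert Hev0. apply filter_imp. intros u Hu. apply Hcont. intros; apply Hct; auto.
    + apply Hcont. intros; apply Hct; auto.
  - apply tends_ext with (fun y => CInt (fun x =>
      (F (a + (fst y - a) * x) (snd y) - F (a + (fst y - a) * x) t) / RtoC (snd y - t) * (fst y - a))).
    + typeclasses eauto.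
    + generalize (filter_and (F := filter_prod (near z) (tnear I t)) _ _ Hev
        (near_snd (near z) (tnear I t) _ tnear_neq)). apply filter_imp.
      intros [u s] [K1 K2]. cbn [fst snd] in *.
      assert (C1 : cont01 (fun x => F (a + (u - a) * x) s * (u - a))).
      { apply Hcont. intros; apply K1; auto. }
      assert (C2 : cont01 (fun x => F (a + (u - a) * x) t * (u - a))).
      { apply Hcont. intros; apply Hct; apply K1; auto. }
      rewrite <- CInt_minus by auto. unfold Cdiv at 2. rewrite Cmult_comm, <- CInt_scal.
      apply CInt_ext. intros x _. unfold Cdiv; ring.
      intros x Hx. apply contR_plus; auto. apply contR_opp; auto.
    + apply (CInt_tends (filter_prod (near z) (tnear I t)) (fun x y =>
        (F (a + (fst y - a) * x) (snd y) - F (a + (fst y - a) * x) t) / RtoC (snd y - t) * (fst y - a))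
        (fun x => Fd (a + (z - a) * x) * (z - a))).
      * intros x Hx. apply tends_mult. typeclasses eauto.
        apply (filterlim_comp _ _ _ (fun y : R * (C * R) => (a + (fst (snd y) - a) * fst y, snd (snd y)))
          (fun x => (F (fst x) (snd x) - F (fst x) t) / RtoC (snd x - t)) _
          (filter_prod (near (a + (z - a) * x)) (tnear I t)) _).
        apply filterlim_pair; auto. apply Hcl. typeclasses eauto. apply (HF _ (Hseg x Hx)).
        apply tends_minus. typeclasses eauto.
        eapply filterlim_comp. apply filterlim_snd. apply filterlim_fst.
        apply tends_const; typeclasses eauto.
      * revert Hev. apply filter_imp. intros [u s] K1. cbn [fst snd] in *.
        intros x Hx. apply contR_mult; [|apply contR_const].
        apply contR_mult; [|apply contR_const]. apply contR_plus.
        apply (contR_line (fun v => F v s)). apply K1; auto.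
        apply contR_opp. apply (contR_line (fun v => F v t)). apply Hct. apply K1; auto.
      * intros x Hx. apply contR_mult; [|apply contR_const].
        apply (contR_line Fd). auto.
Qed.
End JD.

(** * The mapping at one instant *)

Definition seg_int (g : C -> C) (a b : C) : C := CInt (fun x => g (a + (b - a) * x) * (b - a)).

Lemma rderiv_is_derive (p : R -> C) (s : R) (l : C) : rderiv p s l ->
  @is_derive R_AbsRing C_R_NormedModule p s l.
Proof.
  intros H. split.
  - apply (is_linear_scal_l (K := R_AbsRing) (V := C_R_NormedModule)).
  - intros x Hx. assert (E : s = x) by (apply (is_filter_lim_locally_unique (K := R_AbsRing) (V := R_NormedModule)); exact Hx).
    subst x. intros eps. destruct (H eps (cond_pos eps)) as [d [Hd HH]].
    exists (mkposreal d Hd). intros y Hy. specialize (HH y Hy).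
    eapply Rle_trans; [|exact HH]. right.
    rewrite <- Cmod_norm. f_equal.
    destruct (p y), (p s), l. unfold minus, plus, opp, scal; simpl.
    unfold prod_scal, scal; simpl. unfold mult; simpl.
    unfold Cminus, Cplus, Copp, Cmult, RtoC; simpl. apply injective_projections; simpl; unfold plus, opp; simpl; ring.
Qed.

Lemma path_segment (g : C -> C) (Dom : C -> Prop) (a b c w : C) :
  (forall x : R, (0 <= x <= 1)%R -> Dom (a + (b - a) * x) /\ cts g (a + (b - a) * x)) ->
  path_integral g Dom b c w -> path_integral g Dom a c (seg_int g a b + w).
Proof.
  intros H Hp.
  assert (E0 : a + (b - a) * 0%R = a) by ring. assert (E1 : a + (b - a) * 1%R = b) by ring.
  rewrite <- E1 in Hp. rewrite <- E0 at 1.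
  apply (path_arc g Dom (fun x : R => a + (b - a) * x) (fun _ => b - a)); auto.
  - intros s Hs. split; [|split].
    + apply H; auto.
    + apply rderiv_is_derive. apply rderiv_affine.
    + apply continuous_const.
  - apply CInt_is_RInt. intros s Hs. apply contR_mult; [|apply contR_const].
    apply (contR_line g). apply H; auto.
Qed.

Lemma cderiv_seg_int (k : C -> C) (p z : C) (r : R) : holo (Ball p r) k -> Ball p r z ->
  cderiv (fun u => seg_int k p u) z (k z).
Proof.
  intros Hk Hz.
  apply cderiv_ext with (fun z => (z - p) * CInt (fun s => k (p + (z - p) * s))).
  - generalize (Ball_open p r z Hz). apply filter_imp. intros u Hu. unfold seg_int.
    rewrite <- CInt_scal. apply CInt_ext. intros; ring.
    intros s Hs. apply (contR_line k). eapply holo_cts; eauto. apply Ball_segment; auto.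
  - apply cderiv_radial with r; auto.
Qed.

Lemma Cpow_2_neq_0 (z : C) : z <> 0 -> z ^ 2 <> 0.
Proof. intros H. replace (z ^ 2) with (z * z) by ring. apply Cmult_neq_0; auto. Qed.

Lemma holo_pow_2 (U : C -> Prop) (g : C -> C) : isopen U -> holo U g -> holo U (fun z => g z ^ 2).
Proof.
  intros HU Hg. apply holo_ext with (fun z => g z * g z); auto. intros; ring. apply holo_mult; auto.
Qed.

Lemma cprod_but (k : nat) (F : nat -> C) : In k idx -> cprod idx F = F k * cprod (idx_but k) F.
Proof.
  intros [<-|[<-|[<-|[<-|[]]]]]; unfold cprod, idx_but, idx; simpl; ring.
Qed.

Lemma csum_but (k : nat) (F : nat -> C) : In k idx -> csum idx F = F k + csum (idx_but k) F.
Proof.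
  intros [<-|[<-|[<-|[<-|[]]]]]; unfold csum, idx_but, idx; simpl; ring.
Qed.

(** This and the next rules express logarithmic differentiation as F' = F a. For products of sigma
    functions the terms a are values of zeta. *)
Lemma logd_mult (F G : C -> C) (z a b : C) : cderiv F z (F z * a) -> cderiv G z (G z * b) ->
  cderiv (fun u => F u * G u) z (F z * G z * (a + b)).
Proof. intros H1 H2. eapply cderiv_eq. apply cderiv_mult; eauto. simpl. ring. Qed.

Lemma logd_pow2 (F : C -> C) (z a : C) : cderiv F z (F z * a) ->
  cderiv (fun u => F u ^ 2) z (F z ^ 2 * (2 * a)).
Proof.
  intros H. apply cderiv_ext with (fun u => F u * F u). apply filter_forall; intros; ring.
  eapply cderiv_eq. apply logd_mult; eauto. ring.
Qed.

Lemma logd_div (F G : C -> C) (z a b : C) : G z <> 0 ->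
  cderiv F z (F z * a) -> cderiv G z (G z * b) ->
  cderiv (fun u => F u / G u) z (F z / G z * (a - b)).
Proof. intros Hn H1 H2. eapply cderiv_eq. apply cderiv_div; eauto. simpl. field; auto. Qed.

Lemma logd_const_mult (c : C) (F : C -> C) (z a : C) : cderiv F z (F z * a) ->
  cderiv (fun u => c * F u) z (c * F z * a).
Proof.
  intros H. eapply cderiv_eq. apply cderiv_mult. apply cderiv_const. exact H. simpl; ring.
Qed.

Lemma logd_Cexp_mult (g z : C) : cderiv (fun u => Cexp (g * u)) z (Cexp (g * z) * g).
Proof.
  apply (cderiv_comp Cexp (fun u => g * u)). apply cderiv_Cexp.
  eapply cderiv_eq. apply cderiv_mult. apply cderiv_const. apply cderiv_id. simpl; ring.
Qed.

Section Params.
Variables (beta : R) (Q : params).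
Hypothesis HQ : params_ok beta Q.

Definition nonpole (z : C) : Prop := ~ is_pole Q z.

Lemma omega2_upper : upper (omega2 Q).
Proof.
  unfold upper, omega2. simpl. assert (H := ok_m _ _ HQ). ring_simplify. lra.
Qed.

Lemma in_lattice_omega2 (z : C) : in_lattice (omega2 Q) z <->
  exists j k : Z, z = (IZR j, (2 * pm Q * IZR k)%R).
Proof.
  split.
  - intros [[j k] ->]. exists j, k. unfold lattice_point, omega2, Cplus, Cmult, RtoC, Ci; simpl.
    f_equal; ring.
  - intros [j [k ->]]. exists (j, k). unfold lattice_point, omega2, Cplus, Cmult, RtoC, Ci; simpl.
    f_equal; ring.
Qed.

Lemma is_pole_iff (z : C) : is_pole Q z <->
  in_lattice (omega2 Q) (z - zpole Q) \/ in_lattice (omega2 Q) (z - Cconj (zpole Q)).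
Proof.
  split.
  - intros [jk [E|E]]; [left|right]; exists jk; rewrite E; ring.
  - intros [[jk E]|[jk E]]; exists jk; [left|right]; rewrite <- E; ring.
Qed.

Lemma nonpole_iff (z : C) : nonpole z <->
  sig2 (z - zpole Q) (omega2 Q) <> 0 /\ sig2 (z - Cconj (zpole Q)) (omega2 Q) <> 0.
Proof.
  unfold nonpole. rewrite is_pole_iff, !sig2_eq_0 by apply omega2_upper. tauto.
Qed.

Lemma cts_sig2_shift (a z : C) : cts (fun u => sig2 (u - a) (omega2 Q)) z.
Proof.
  apply (cts_comp (fun u => sig2 u (omega2 Q)) (fun u => u - a)).
  eapply holo_cts. apply (an_fst _ analytic2_sig2 _ omega2_upper). exact I.
  apply cts_minus. apply cts_id. apply cts_const.
Qed.

Lemma holo_sig2_shift (U : C -> Prop) (a : C) : isopen U ->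
  holo U (fun u => sig2 (u - a) (omega2 Q)).
Proof.
  intros HU. apply holo_comp with (V := everywhere) (f := fun u => sig2 u (omega2 Q)); auto.
  intros; exact I. apply (an_fst _ analytic2_sig2 _ omega2_upper).
  apply holo_minus; auto using holo_id, holo_const.
Qed.

Lemma nonpole_open : isopen nonpole.
Proof.
  intros z Hz. apply nonpole_iff in Hz. destruct Hz as [H1 H2].
  generalize (filter_and (F := near z) _ _ (tends_neq (near z) _ _ (cts_sig2_shift (zpole Q) z) H1)
    (tends_neq (near z) _ _ (cts_sig2_shift (Cconj (zpole Q)) z) H2)).
  apply filter_imp. intros u Hu. apply nonpole_iff. exact Hu.
Qed.

Definition fprime (z : C) : C := pc Q * integrand beta Q z.

Lemma holo_integrand : holo nonpole (integrand beta Q).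
Proof.
  assert (HO := nonpole_open). unfold integrand.
  assert (Hs : forall a, holo nonpole (fun u => psigma Q (u - a)))
    by (intros a; apply (holo_sig2_shift nonpole a HO)).
  apply holo_div; auto.
  - intros z Hz. apply nonpole_iff in Hz. destruct Hz as [H1 H2].
    apply Cmult_neq_0; apply Cpow_2_neq_0; [exact H1 | exact H2].
  - apply holo_mult; auto.
    + apply holo_comp with (V := everywhere) (f := Cexp); auto. intros; exact I.
      apply holo_Cexp, everywhere_open.
      apply holo_mult; auto using holo_const, holo_id.
    + unfold cprod, idx; simpl. repeat (apply holo_mult; auto). apply holo_const; auto.
  - apply holo_mult; auto; apply holo_pow_2; auto.
Qed.

Lemma holo_fprime : holo nonpole fprime.
Proof.
  apply holo_mult. apply nonpole_open. apply holo_const, nonpole_open. apply holo_integrand.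
Qed.

(** The poles have imaginary parts 2 m k + y0 and 2 m k - y0, never 0 because 0 < y0 < m. *)
Lemma nonpole_Im0 (z : C) : Im z = 0%R -> nonpole z.
Proof.
  intros H Hp. apply is_pole_iff in Hp. rewrite !in_lattice_omega2 in Hp.
  assert (Hm := ok_m _ _ HQ). assert (Hy := ok_y0 _ _ HQ).
  assert (HK : exists k : Z, (py0 Q = 2 * pm Q * IZR k)%R).
  { destruct Hp as [[j [k E]]|[j [k E]]]; apply (f_equal Im) in E; unfold zpole in E; simpl in E;
      unfold Im in H; rewrite H in E.
    - exists (- k)%Z. rewrite opp_IZR. lra.
    - exists k. lra. }
  destruct HK as [k Hk]. destruct (Z_lt_le_dec k 1) as [L|L].
  - assert (L' : (k <= 0)%Z) by lia. apply IZR_le in L'.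
    assert (2 * pm Q * IZR k <= 0)%R; [|lra].
    assert (0 <= 2 * pm Q * - IZR k)%R by (apply Rmult_le_pos; lra). lra.
  - apply IZR_le in L. assert (2 * pm Q * 1 <= 2 * pm Q * IZR k)%R by (apply Rmult_le_compat_l; lra). lra.
Qed.

(** [zpole] and the second period are purely imaginary, so all poles lie on vertical lines through
    the integers, and the lines halfway between are free corridors. *)
Lemma pole_Re (z : C) : is_pole Q z -> exists j : Z, Re z = IZR j.
Proof.
  intros Hp. apply is_pole_iff in Hp. rewrite !in_lattice_omega2 in Hp.
  destruct Hp as [[j [k E]]|[j [k E]]]; apply (f_equal Re) in E; unfold zpole in E; simpl in E;
    exists j; unfold Re; lra.
Qed.

Lemma nonpole_Re (z : C) (n : Z) : (Re z = IZR n + 1 / 2)%R -> nonpole z.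
Proof.
  intros H Hp. destruct (pole_Re z Hp) as [j E]. rewrite H in E.
  assert (E2 : (IZR (2 * n + 1) = IZR (2 * j))%R).
  { rewrite plus_IZR, !mult_IZR. lra. }
  apply eq_IZR in E2. lia.
Qed.

(* From [n + 1/2 + i Im z], with [n <= Re z < n + 1], the point [z] is reached horizontally without
   meeting a pole. *)
Lemma nonpole_horizontal (z : C) (n : Z) (x : R) : nonpole z ->
  (IZR n <= Re z < IZR n + 1)%R -> (0 <= x <= 1)%R ->
  let a := (IZR n + 1 / 2, Im z)%R in nonpole (a + (z - a) * x).
Proof.
  intros Hz Hn Hx a Hp. destruct (pole_Re _ Hp) as [j E].
  assert (EI : Im (a + (z - a) * x) = Im z).
  { unfold a. destruct z; simpl. ring. }
  assert (ER : Re (a + (z - a) * x) = (IZR n + 1 / 2 + (Re z - (IZR n + 1 / 2)) * x)%R).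
  { unfold a. destruct z; simpl. ring. }
  rewrite ER in E.
  (* The moving point keeps its real part in [n, n + 1), so a pole on the way has real part n; this
     value is attained only at the end point z. *)
  assert (Hb : (- (1/2) <= (Re z - (IZR n + 1 / 2)) * x < 1 / 2)%R).
  { destruct (Rle_lt_dec 0 (Re z - (IZR n + 1 / 2))).
    - assert (0 <= (Re z - (IZR n + 1 / 2)) * x)%R by (apply Rmult_le_pos; lra).
      assert ((Re z - (IZR n + 1 / 2)) * x <= (Re z - (IZR n + 1 / 2)) * 1)%R
        by (apply Rmult_le_compat_l; lra). lra.
    - assert (0 <= - (Re z - (IZR n + 1 / 2)) * x)%R by (apply Rmult_le_pos; lra).
      assert (- (Re z - (IZR n + 1 / 2)) * x <= - (Re z - (IZR n + 1 / 2)) * 1)%R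
        by (apply Rmult_le_compat_l; lra). lra. }
  assert (Hj : j = n).
  { assert (IZR j < IZR (n + 1))%R by (rewrite plus_IZR; lra).
    assert (IZR (n - 1) < IZR j)%R by (rewrite minus_IZR; lra).
    apply lt_IZR in H, H0. lia. }
  subst j. apply Hz.
  assert (E3 : ((Re z - (IZR n + 1 / 2)) * x = - (1 / 2))%R) by lra.
  assert (Hneg : (Re z - (IZR n + 1/2) < 0)%R).
  { apply Rnot_le_lt. intros Hle.
    assert (0 <= (Re z - (IZR n + 1 / 2)) * x)%R by (apply Rmult_le_pos; lra). lra. }
  assert (Hge : (- (1/2) <= Re z - (IZR n + 1/2))%R) by lra.
  assert (E4 : (Re z = IZR n)%R).
  { apply Rle_antisym; [|lra].
    assert (- (Re z - (IZR n + 1 / 2)) * x <= - (Re z - (IZR n + 1 / 2)) * 1)%R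
        by (apply Rmult_le_compat_l; lra). lra. }
  assert (EZ : a + (z - a) * x = z).
  { apply injective_projections; [|exact EI].
    change (Re (a + (z - a) * x) = Re z). rewrite ER. lra. }
  rewrite EZ in Hp. exact Hp.
Qed.

Definition corner (n : Z) (z : C) : C := (IZR n + 1 / 2, Im z)%R.

(** The route from 0 to z: along the real axis to n + 1/2, along the vertical line of that real
    part, then horizontally to z. *)
Lemma nonpole_path (n : Z) (z : C) (x : R) : nonpole z -> (IZR n <= Re z < IZR n + 1)%R ->
  (0 <= x <= 1)%R ->
  nonpole (0 + (RtoC (IZR n + 1 / 2) - 0) * x) /\
  nonpole (RtoC (IZR n + 1 / 2) + (corner n z - RtoC (IZR n + 1 / 2)) * x) /\
  nonpole (corner n z + (z - corner n z) * x).
Proof.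
  intros Hz Hn Hx. split; [|split].
  - apply nonpole_Im0. simpl. ring.
  - apply nonpole_Re with n. simpl. ring.
  - apply nonpole_horizontal; auto.
Qed.

Lemma logd_psigma (a z : C) : ~ in_lattice (omega2 Q) (z - a) ->
  cderiv (fun u => psigma Q (u - a)) z (psigma Q (z - a) * pzeta Q (z - a)).
Proof.
  intros Hn. assert (Hw := omega2_upper). assert (Hs : sig2 (z - a) (omega2 Q) <> 0) by (rewrite sig2_eq_0; auto).
  eapply cderiv_eq. apply (cderiv_comp (fun u => sig2 u (omega2 Q)) (fun u => u - a)).
  apply cderiv_sig2; auto. apply cderiv_minus. apply cderiv_id. apply cderiv_const.
  unfold pzeta. rewrite wzeta_eq. change (psigma Q (z - a)) with (sig2 (z - a) (omega2 Q)).
  field. auto.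
Qed.

Lemma logd_sinf_at (a : C) :
  cderiv (fun u => sinf (u - a) (omega2 Q)) a (sinf (a - a) (omega2 Q) * 0).
Proof.
  eapply cderiv_eq. apply (cderiv_comp (fun u => sinf u (omega2 Q)) (fun u => u - a)).
  apply cderiv_sinf; auto using omega2_upper. apply cderiv_minus. apply cderiv_id. apply cderiv_const.
  replace (a - a) with (RtoC 0) by ring. rewrite d_sinf_0 by apply omega2_upper. ring.
Qed.

(* The derivative of f with its double pole at [zpole] divided out. *)
Definition Ufun (u : C) : C :=
  pc Q * (Cexp (gamma0 beta Q * u) * cprod idx (fun j => psigma Q (u - zpt Q j))
   / (sinf (u - zpole Q) (omega2 Q) ^ 2 * psigma Q (u - Cconj (zpole Q)) ^ 2)).

(** The logarithmic derivative of [Ufun] at [zpole] is the left side of [ok_res]. Its vanishing says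
    that f' has no residue at its double pole. *)
Lemma cderiv_Ufun_zpole :
  (forall k, In k idx -> ~ in_lattice (omega2 Q) (zpole Q - zpt Q k)) ->
  ~ in_lattice (omega2 Q) (zpole Q - Cconj (zpole Q)) -> cderiv Ufun (zpole Q) 0.
Proof.
  intros H1 H2. assert (Hw := omega2_upper).
  assert (Hs : sig2 (zpole Q - Cconj (zpole Q)) (omega2 Q) <> 0) by (rewrite sig2_eq_0; auto).
  eapply cderiv_eq. unfold Ufun.
  apply (logd_const_mult (pc Q) (fun u => Cexp (gamma0 beta Q * u) * cprod idx (fun j => psigma Q (u - zpt Q j))
   / (sinf (u - zpole Q) (omega2 Q) ^ 2 * psigma Q (u - Cconj (zpole Q)) ^ 2))).
  apply (logd_div (fun u => Cexp (gamma0 beta Q * u) * cprod idx (fun j => psigma Q (u - zpt Q j)))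
    (fun u => sinf (u - zpole Q) (omega2 Q) ^ 2 * psigma Q (u - Cconj (zpole Q)) ^ 2)).
  - apply Cmult_neq_0; apply Cpow_2_neq_0; [|exact Hs].
    replace (zpole Q - zpole Q) with (RtoC 0) by ring. rewrite sinf_0 by auto.
    intros E; apply RtoC_inj in E; lra.
  - apply (logd_mult (fun u => Cexp (gamma0 beta Q * u)) (fun u => cprod idx (fun j => psigma Q (u - zpt Q j)))).
    apply logd_Cexp_mult.
    apply (cderiv_cprod idx (fun j u => psigma Q (u - zpt Q j)) (fun j => pzeta Q (zpole Q - zpt Q j))).
    intros j Hj. apply logd_psigma. auto.
  - apply (logd_mult (fun u => sinf (u - zpole Q) (omega2 Q) ^ 2) (fun u => psigma Q (u - Cconj (zpole Q)) ^ 2)).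
    apply (logd_pow2 (fun u => sinf (u - zpole Q) (omega2 Q))). apply logd_sinf_at.
    apply (logd_pow2 (fun u => psigma Q (u - Cconj (zpole Q)))). apply logd_psigma; auto.
  - match goal with |- ?A * ?B = _ => replace B with (gamma0 beta Q + csum idx (fun k => pzeta Q (zpole Q - zpt Q k))
           - 2 * pzeta Q (zpole Q - Cconj (zpole Q))) by ring end.
    rewrite (ok_res _ _ HQ). ring.
Qed.

Variable (F : C -> sphere).
Hypothesis HF : forall z v : C, ~ is_pole Q z ->
    path_integral (integrand beta Q) (fun u => ~ is_pole Q u) 0 z v ->
    F z = Some (pc Q * v + pc1 Q).

(** The route to [zs] is held fixed and a fourth segment leads from [zs] to z, so that the
    dependence on z is confined to one integral. *)
Definition prim4 (n : Z) (zs z : C) : C :=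
  pc Q * (seg_int (integrand beta Q) 0 (RtoC (IZR n + 1 / 2)) +
    (seg_int (integrand beta Q) (RtoC (IZR n + 1 / 2)) (corner n zs) +
      (seg_int (integrand beta Q) (corner n zs) zs + (seg_int (integrand beta Q) zs z + 0)))) + pc1 Q.

Lemma value_by_segments (n : Z) (zs z : C) :
  (forall x : R, (0 <= x <= 1)%R -> nonpole (0 + (RtoC (IZR n + 1 / 2) - 0) * x)) ->
  (forall x : R, (0 <= x <= 1)%R -> nonpole (RtoC (IZR n + 1 / 2) + (corner n zs - RtoC (IZR n + 1 / 2)) * x)) ->
  (forall x : R, (0 <= x <= 1)%R -> nonpole (corner n zs + (zs - corner n zs) * x)) ->
  (forall x : R, (0 <= x <= 1)%R -> nonpole (zs + (z - zs) * x)) ->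
  F z = Some (prim4 n zs z).
Proof.
  intros H1 H2 H3 H4. apply HF.
  - specialize (H4 1%R ltac:(lra)). replace (zs + (z - zs) * 1) with z in H4 by ring. exact H4.
  - assert (Hc : forall u, nonpole u -> cts (integrand beta Q) u)
      by (intros u Hu; eapply holo_cts; [apply holo_integrand|exact Hu]).
    repeat apply path_segment; try apply path_nil; intros x Hx; (split; [|apply Hc]);
      first [exact (H1 x Hx) | exact (H2 x Hx) | exact (H3 x Hx) | exact (H4 x Hx)].
Qed.

Lemma ex_floor (x : R) : exists n : Z, (IZR n <= x < IZR n + 1)%R.
Proof.
  exists (up x - 1)%Z. destruct (archimed x). rewrite minus_IZR. lra.
Qed.

Lemma value_finite (z : C) : nonpole z -> F z = Some (chart0 (F z)).
Proof.
  intros Hz. destruct (ex_floor (Re z)) as [n Hn].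
  rewrite (value_by_segments n z z); auto; intros x Hx;
    destruct (nonpole_path n z x Hz Hn Hx) as [A [B D]]; try assumption.
  replace (z + (z - z) * x) with z by ring. exact Hz.
Qed.

Lemma cderiv_value (z : C) : nonpole z -> cderiv (fun u => chart0 (F u)) z (fprime z).
Proof.
  intros Hz. destruct (ex_floor (Re z)) as [n Hn].
  destruct (open_ball _ _ nonpole_open Hz) as [r [Hr HB]].
  apply cderiv_ext with (prim4 n z).
  - generalize (near_ball z r Hr). apply filter_imp. intros u Hu.
    rewrite (value_by_segments n z u); auto; intros x Hx;
      destruct (nonpole_path n z x Hz Hn Hx) as [A [B D]]; try assumption.
    apply HB. apply Ball_segment; auto.
  - unfold prim4. eapply cderiv_eq. apply cderiv_plus. apply cderiv_mult. apply cderiv_const.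
    apply cderiv_plus. apply cderiv_const. apply cderiv_plus. apply cderiv_const.
    apply cderiv_plus. apply cderiv_const. apply cderiv_plus.
    apply cderiv_seg_int with (r := r). eapply holo_sub; [exact HB|]. apply holo_integrand.
    apply Ball_center; auto. apply cderiv_const. apply cderiv_const.
    unfold fprime. simpl. ring.
Qed.

Lemma holo_value : holo nonpole (fun u => chart0 (F u)).
Proof.
  apply holo_intro with fprime. apply nonpole_open. intros p Hp. split.
  apply cderiv_value; auto. eapply holo_cts; [apply holo_fprime|auto].
Qed.
End Params.

(** * The variation of the mapping *)

Section Family.
Variables (I : R -> Prop) (theta beta : R) (P : R -> params) (f : R -> C -> sphere).
Hypotheses (HI : is_interval I)
    (Hsmooth : smooth_params I P)
    (Hparams : forall t, I t -> params_ok beta (P t))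
    (Hf : forall t, I t ->
       exists p1 q1 p2 q2 : R, slit_map theta beta (P t) (f t) p1 q1 p2 q2).
Variable t : R.
Hypothesis Ht : I t.

Let TF : ProperFilter (tnear I t) := tnear_proper I t HI Ht.
Local Existing Instance TF.

Definition om (s : R) : C := omega2 (P s).
Definition md : R := dotR I (fun s => pm (P s)) t.
Definition xd (k : nat) : R := dotR I (fun s => px (P s) k) t.
Definition yd : R := dotR I (fun s => py0 (P s)) t.
Definition cd : C := dotC I (fun s => pc (P s)) t.
Definition omd : C := 2 * md * Ci.
Definition zptd (k : nat) : C :=
  match k with
  | 3%nat => xd 3 + Ci * md
  | 4%nat => xd 4 - Ci * md
  | _ => RtoC (xd k)
  end.
Definition z0d : C := Ci * yd.

Lemma om_upper (s : R) : I s -> upper (om s).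
Proof. intros Hs. apply (omega2_upper beta). auto. Qed.

Lemma dq_m : tends (tnear I t) (dquot (fun s => RtoC (pm (P s))) t) (RtoC md).
Proof. apply smoothR_tends; auto. apply Hsmooth. Qed.
Lemma dq_x (k : nat) : In k idx -> tends (tnear I t) (dquot (fun s => RtoC (px (P s) k)) t) (RtoC (xd k)).
Proof. intros. apply (smoothR_tends I (fun s => px (P s) k)); auto. apply Hsmooth; auto. Qed.
Lemma dq_y : tends (tnear I t) (dquot (fun s => RtoC (py0 (P s))) t) (RtoC yd).
Proof. apply (smoothR_tends I (fun s => py0 (P s))); auto. apply Hsmooth. Qed.
Lemma dq_c : tends (tnear I t) (dquot (fun s => pc (P s)) t) cd.
Proof. apply smoothC_tends; auto. apply Hsmooth. Qed.
Lemma dq_c1 : tends (tnear I t) (dquot (fun s => pc1 (P s)) t) (dotC I (fun s => pc1 (P s)) t).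
Proof. apply smoothC_tends; auto. apply Hsmooth. Qed.

Lemma jd_om (z : C) : jd I t (fun _ s => om s) z omd.
Proof.
  unfold om, omega2, omd. eapply jd_eq.
  apply (jd_mult I t HI Ht (fun _ s => 2 * pm (P s)) (fun _ _ => Ci)).
  apply (jd_scal I t HI Ht (fun _ s => RtoC (pm (P s)))). apply (jd_time I t (fun s => RtoC (pm (P s)))). apply dq_m.
  apply jd_const; auto. simpl. ring.
Qed.

Lemma jd_zpt (k : nat) (z : C) : In k idx -> jd I t (fun _ s => zpt (P s) k) z (zptd k).
Proof.
  intros Hk. assert (Hx := jd_time I t (fun s => RtoC (px (P s) k)) z _ (dq_x k Hk)).
  assert (Hm := jd_scal I t HI Ht _ Ci z _ (jd_time I t (fun s => RtoC (pm (P s))) z _ dq_m)).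
  destruct Hk as [<-|[<-|[<-|[<-|[]]]]]; simpl; auto.
  - exact (jd_plus I t HI Ht _ _ _ _ _ Hx Hm).
  - exact (jd_minus I t HI Ht _ _ _ _ _ Hx Hm).
Qed.

Lemma jd_zpole (z : C) : jd I t (fun _ s => zpole (P s)) z z0d.
Proof.
  apply (jd_scal I t HI Ht (fun _ s => RtoC (py0 (P s)))).
  apply (jd_time I t (fun s => RtoC (py0 (P s)))). apply dq_y.
Qed.

Lemma zpole_conj (s : R) : Cconj (zpole (P s)) = - zpole (P s).
Proof. unfold zpole, Cconj, Copp, Cmult, Ci, RtoC; simpl; f_equal; ring. Qed.

Lemma jd_zpole_conj (z : C) : jd I t (fun _ s => Cconj (zpole (P s))) z (- z0d).
Proof.
  eapply jd_eq. apply (jd_ext I t HI Ht (fun _ s => (-(1)) * zpole (P s))).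
  intros _ s. rewrite zpole_conj. ring. apply jd_scal; auto. apply jd_zpole. ring.
Qed.

Lemma jd_id (z : C) : jd I t (fun u _ => u) z 0.
Proof. apply (jd_space I t HI Ht (fun u => u)). apply cts_id. Qed.

Lemma jd_shift (a : R -> C) (z l : C) : jd I t (fun _ s => a s) z l ->
  jd I t (fun u s => u - a s) z (- l).
Proof.
  intros H. eapply jd_eq. apply (jd_minus I t HI Ht (fun u _ => u) (fun _ s => a s)).
  apply jd_id. exact H. ring.
Qed.

Lemma jd_an2 (B : C -> C -> C) (F : C -> R -> C) (z l : C) : analytic2 B -> jd I t F z l ->
  jd I t (fun u s => B (F u s) (om s)) z
    (d_fst B (F z t) (om t) * l + d_snd B (F z t) (om t) * omd).
Proof.
  intros HB HF. apply (jd_analytic2 I t HI Ht F (fun _ s => om s) B); auto.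
  apply om_upper; auto. apply jd_om.
Qed.

Lemma sig2_nonzero (w u : C) : upper w -> ~ in_lattice w u -> sig2 u w <> 0.
Proof. intros Hw Hu. rewrite sig2_eq_0; auto. Qed.

Lemma cderiv_wzeta (w u : C) : upper w -> ~ in_lattice w u ->
  cderiv (wzeta 1 w) u ((d_fst (d_fst sig2) u w * sig2 u w - d_fst sig2 u w * d_fst sig2 u w) /
    (sig2 u w * sig2 u w)).
Proof.
  intros Hw Hu. apply (cderiv_div (fun u => d_fst sig2 u w) (fun u => sig2 u w)).
  apply sig2_nonzero; auto.
  apply (an_fst _ (analytic2_d_fst _ analytic2_sig2) w Hw u Logic.I).
  apply cderiv_sig2; auto.
Qed.

Lemma cderiv_wzeta_snd (w u : C) : upper w -> ~ in_lattice w u ->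
  cderiv (fun w => wzeta 1 w u) w ((d_snd (d_fst sig2) u w * sig2 u w - d_fst sig2 u w * d_snd sig2 u w) /
    (sig2 u w * sig2 u w)).
Proof.
  intros Hw Hu. apply (cderiv_div (fun w => d_fst sig2 u w) (fun w => sig2 u w)).
  apply sig2_nonzero; auto.
  apply (an_snd _ (analytic2_d_fst _ analytic2_sig2) u w Hw).
  apply (an_snd _ analytic2_sig2 u w Hw).
Qed.

Lemma jd_pzeta (F : C -> R -> C) (z l : C) : ~ in_lattice (om t) (F z t) -> jd I t F z l ->
  jd I t (fun u s => pzeta (P s) (F u s)) z
    (- pwp (P t) (F z t) * l + pdzeta (P t) (F z t) * omd).
Proof.
  intros Hn HF. assert (Hw := om_upper t Ht).
  assert (H1 := jd_an2 _ F z l (analytic2_d_fst _ analytic2_sig2) HF).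
  assert (H2 := jd_an2 _ F z l analytic2_sig2 HF).
  assert (Hs := sig2_nonzero _ _ Hw Hn).
  eapply jd_eq.
  apply (jd_div I t HI Ht (fun u s => d_fst sig2 (F u s) (om s)) (fun u s => sig2 (F u s) (om s)));
    eauto.
  unfold pwp, wp, pdzeta, dzeta_dw2. fold (om t).
  rewrite (cderiv_C_derive _ _ _ (cderiv_wzeta _ _ Hw Hn)).
  rewrite (cderiv_C_derive _ _ _ (cderiv_wzeta_snd _ _ Hw Hn)). cbv beta.
  field. auto.
Qed.

Lemma half_notin (s : R) : I s -> ~ in_lattice (om s) (1 / 2).
Proof.
  intros Hs. unfold om. rewrite in_lattice_omega2. intros [j [k E]].
  apply (f_equal Re) in E. simpl in E.
  assert (E2 : IZR (2 * j) = IZR 1).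
  { rewrite mult_IZR. unfold Re in E; simpl in E. lra. }
  apply eq_IZR in E2. lia.
Qed.

Lemma jd_gamma0 (z : C) : jd I t (fun _ s => gamma0 beta (P s)) z
   ((beta / PI)%R * (2 * (pdzeta (P t) (1 / 2) * omd))).
Proof.
  unfold gamma0, eta1. apply (jd_scal I t HI Ht (fun _ s => 2 * pzeta (P s) (1 / 2))).
  apply jd_scal; auto. eapply jd_eq.
  apply (jd_pzeta (fun _ _ => 1 / 2)). apply half_notin; auto. apply jd_const; auto. ring.
Qed.

(** The time derivatives of the integrand and of f are never computed at a general point, so
    products and quotients are handled by existence alone. *)
Definition ejd (F : C -> R -> C) (z : C) : Prop := exists l, jd I t F z l.

Lemma ejd_mult (F G : C -> R -> C) (z : C) : ejd F z -> ejd G z -> ejd (fun u s => F u s * G u s) z.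
Proof. intros [l Hl] [m Hm]. eexists. apply jd_mult; eauto. Qed.

Lemma ejd_plus (F G : C -> R -> C) (z : C) : ejd F z -> ejd G z -> ejd (fun u s => F u s + G u s) z.
Proof. intros [l Hl] [m Hm]. eexists. apply jd_plus; eauto. Qed.

Lemma ejd_const (c z : C) : ejd (fun _ _ => c) z.
Proof. eexists. apply jd_const; auto. Qed.

Lemma ejd_pow2 (F : C -> R -> C) (z : C) : ejd F z -> ejd (fun u s => F u s ^ 2) z.
Proof.
  intros [l Hl]. eexists. apply (jd_ext I t HI Ht (fun u s => F u s * F u s)). intros; ring.
  apply jd_mult; eauto.
Qed.

Lemma ejd_div (F G : C -> R -> C) (z : C) : G z t <> 0 ->
  ejd F z -> ejd G z -> ejd (fun u s => F u s / G u s) z.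
Proof. intros Hn [l Hl] [m Hm]. eexists. apply jd_div; eauto. Qed.

Lemma ejd_an2 (B : C -> C -> C) (a : R -> C) (z l : C) : analytic2 B ->
  jd I t (fun _ s => a s) z l -> ejd (fun u s => B (u - a s) (om s)) z.
Proof.
  intros HB H. eexists. apply (jd_an2 B (fun u s => u - a s)); auto. apply jd_shift; eauto.
Qed.

Lemma ejd_psigma (a : R -> C) (z l : C) : jd I t (fun _ s => a s) z l ->
  ejd (fun u s => psigma (P s) (u - a s)) z.
Proof. apply (ejd_an2 sig2). apply analytic2_sig2. Qed.

Lemma ejd_Cexp (z : C) : ejd (fun u s => Cexp (gamma0 beta (P s) * u)) z.
Proof.
  destruct (ejd_mult (fun _ s => gamma0 beta (P s)) (fun u _ => u) z) as [l Hl].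
  eexists; apply jd_gamma0. eexists; apply jd_id.
  eexists. apply (jd_holo I t HI Ht (fun u s => gamma0 beta (P s) * u) Cexp everywhere).
  apply everywhere_open. apply holo_Cexp, everywhere_open. exact Logic.I. exact Hl.
Qed.

Lemma ejd_cprod (s : list nat) (F : nat -> C -> R -> C) (z : C) :
  (forall k, In k s -> ejd (F k) z) -> ejd (fun u x => cprod s (fun k => F k u x)) z.
Proof.
  induction s as [|k s IH]; intros H.
  - apply ejd_const.
  - apply (ejd_mult (F k) (fun u x => cprod s (fun k => F k u x))).
    apply H; left; auto. apply IH. intros; apply H; right; auto.
Qed.

(** * Differentiability of f in the parameter *)

Lemma ejd_integrand (z : C) : nonpole (P t) z -> ejd (fun u s => integrand beta (P s) u) z.
Proof.
  intros Hz. apply (nonpole_iff beta) in Hz; [|auto]. destruct Hz as [H1 H2].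
  unfold integrand. apply ejd_div.
  - apply Cmult_neq_0; apply Cpow_2_neq_0; [exact H1|exact H2].
  - apply ejd_mult. apply ejd_Cexp.
    apply (ejd_cprod idx (fun k u s => psigma (P s) (u - zpt (P s) k))).
    intros k Hk. eapply (ejd_psigma (fun s => zpt (P s) k)). apply jd_zpt; auto.
  - apply ejd_mult; apply ejd_pow2.
    + eapply (ejd_psigma (fun s => zpole (P s))). apply jd_zpole.
    + eapply (ejd_psigma (fun s => Cconj (zpole (P s)))). apply jd_zpole_conj.
Qed.

(** Poles are detected by the zeros of two sigma values, which are continuous in z and s together
    and hence stay nonzero near (z, t). *)
Lemma nonpole_joint (z : C) : nonpole (P t) z ->
  filter_prod (near z) (tnear I t) (fun x => I (snd x) /\ nonpole (P (snd x)) (fst x)).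
Proof.
  intros Hz. apply (nonpole_iff beta) in Hz; [|auto]. destruct Hz as [H1 H2].
  destruct (ejd_psigma (fun s => zpole (P s)) z _ (jd_zpole z)) as [l1 L1].
  destruct (ejd_psigma (fun s => Cconj (zpole (P s))) z _ (jd_zpole_conj z)) as [l2 L2].
  assert (N1 := tends_neq _ _ _ (jd_tends I t HI Ht _ _ _ L1) H1).
  assert (N2 := tends_neq _ _ _ (jd_tends I t HI Ht _ _ _ L2) H2).
  generalize (filter_and (F := filter_prod (near z) (tnear I t)) _ _
    (filter_and (F := filter_prod (near z) (tnear I t)) _ _ N1 N2)
    (near_snd (near z) (tnear I t) _ (tnear_I I t))).
  apply filter_imp. intros [u s] [[K1 K2] [K3 _]]. cbn [fst snd] in *. split; auto.
  apply (nonpole_iff beta); auto.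
Qed.

Lemma nonpole_segment (a z : C) :
  (forall x : R, (0 <= x <= 1)%R -> nonpole (P t) (a + (z - a) * x)) ->
  filter_prod (near z) (tnear I t) (fun y => I (snd y) /\
    forall x : R, (0 <= x <= 1)%R -> nonpole (P (snd y)) (a + (fst y - a) * x)).
Proof.
  intros H.
  assert (HU : filter_prod (near z) (tnear I t) (fun y =>
    forall x : R, (0 <= x <= 1)%R -> nonpole (P (snd y)) (a + (fst y - a) * x))).
  { apply (unif_compact (filter_prod (near z) (tnear I t)) (fun x y => nonpole (P (snd y)) (a + (fst y - a) * x))).
    intros x Hx. assert (QQ := nonpole_joint _ (H x Hx)).
    assert (HP : filterlim (fun y : R * (C * R) => (a + (fst (snd y) - a) * RtoC (fst y), snd (snd y)))
      (filter_prod (nearR x) (filter_prod (near z) (tnear I t)))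
      (filter_prod (near (a + (z - a) * x)) (tnear I t))).
    { apply filterlim_pair.
      - apply tends_plus. typeclasses eauto. apply tends_const; typeclasses eauto.
        apply tends_mult. typeclasses eauto. apply tends_minus. typeclasses eauto.
        eapply filterlim_comp. apply filterlim_snd. apply filterlim_fst.
        apply tends_const; typeclasses eauto.
        eapply filterlim_comp. apply filterlim_fst. apply contR_RtoC.
      - eapply filterlim_comp. apply filterlim_snd. apply filterlim_snd. }
    apply HP in QQ. destruct QQ as [Q1 Q2 [d [Hd HQ1]] HQ2 HQ].
    exists d; split; auto. revert HQ2. apply filter_imp. intros y Hy x' Hx'.
    apply (HQ x' y); auto. }
  generalize (filter_and (F := filter_prod (near z) (tnear I t)) _ _ HU
    (near_snd (near z) (tnear I t) _ (tnear_I I t))).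
  apply filter_imp. intros [u s] [K1 [K2 _]]. cbn [fst snd] in *. auto.
Qed.

Lemma filter_prod_at (z : C) (Q : C * R -> Prop) :
  filter_prod (near z) (tnear I t) Q -> tnear I t (fun s => Q (z, s)).
Proof.
  intros [Q1 Q2 HQ1 HQ2 HQ]. revert HQ2. apply filter_imp. intros s Hs. apply HQ; auto.
  apply near_self; auto.
Qed.

Lemma ejd_seg_int (a z : C) :
  (forall x : R, (0 <= x <= 1)%R -> nonpole (P t) (a + (z - a) * x)) ->
  ejd (fun u s => seg_int (integrand beta (P s)) a u) z.
Proof.
  intros H.
  set (Fd := fun u => epsilon (inhabits (RtoC 0)) (fun l => jd I t (fun u s => integrand beta (P s) u) u l)).
  assert (HFd : forall u, nonpole (P t) u -> jd I t (fun u s => integrand beta (P s) u) u (Fd u)).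
  { intros u Hu. unfold Fd. apply epsilon_spec. apply ejd_integrand; auto. }
  eexists.
  apply (jd_segment I t HI Ht (fun u s => integrand beta (P s) u) Fd (nonpole (P t))); auto.
  - apply (nonpole_open beta); auto.
  - intros u Hu. generalize (nonpole_joint u Hu). apply filter_imp. intros [v s] [Is Hv].
    cbn [fst snd] in *. eapply holo_cts; [apply (holo_integrand beta); auto|auto].
Qed.

Lemma ejd_time_of (F : C -> R -> C) (a z : C) : ejd F a -> ejd (fun _ s => F a s) z.
Proof.
  intros [l Hl]. exists l. apply (jd_time I t (F a)). apply (jd_at I t HI Ht F a l). exact Hl.
Qed.

Lemma f_formula (s : R) : I s -> forall z v : C, ~ is_pole (P s) z ->
    path_integral (integrand beta (P s)) (fun u => ~ is_pole (P s) u) 0 z v ->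
    f s z = Some (pc (P s) * v + pc1 (P s)).
Proof. intros Hs. destruct (Hf s Hs) as [p1 [q1 [p2 [q2 H]]]]. apply H. Qed.

Definition fv (s : R) (z : C) : C := chart0 (f s z).

Lemma f_finite (s : R) (z : C) : I s -> nonpole (P s) z -> f s z = Some (fv s z).
Proof. intros Hs Hz. apply (value_finite beta (P s)); auto. apply f_formula; auto. Qed.

Lemma cderiv_fv (s : R) (z : C) : I s -> nonpole (P s) z -> cderiv (fv s) z (fprime beta (P s) z).
Proof. intros Hs Hz. apply (cderiv_value beta (P s)); auto. apply f_formula; auto. Qed.

Lemma holo_fv (s : R) : I s -> holo (nonpole (P s)) (fv s).
Proof. intros Hs. apply (holo_value beta (P s)); auto. apply f_formula; auto. Qed.

(** Near (z, t) the value of f is [prim4] along one and the same route. By compactness this route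
    avoids the poles at all times near t, so its four integrals can be differentiated. *)
Lemma ejd_fv (z : C) : nonpole (P t) z -> ejd (fun u s => fv s u) z.
Proof.
  intros Hz. destruct (ex_floor (Re z)) as [n Hn].
  assert (Hpath := fun x => nonpole_path beta (P t) (Hparams t Ht) n z x Hz Hn).
  destruct (open_ball _ _ (nonpole_open beta (P t) (Hparams t Ht)) Hz) as [r [Hr HB]].
  assert (H4 : forall x : R, (0 <= x <= 1)%R -> nonpole (P t) (z + (z - z) * x)).
  { intros x Hx. replace (z + (z - z) * x) with z by ring. auto. }
  assert (HE : ejd (fun u s => prim4 beta (P s) n z u) z).
  { unfold prim4. apply ejd_plus.
    2:{ eexists. apply (jd_time I t (fun s => pc1 (P s))). apply dq_c1. }
    apply ejd_mult.
    { eexists. apply (jd_time I t (fun s => pc (P s))). apply dq_c. }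
    apply ejd_plus; [|apply ejd_plus; [|apply ejd_plus; [|apply ejd_plus; [|apply ejd_const]]]].
    - apply (ejd_time_of (fun u s => seg_int (integrand beta (P s)) 0 u)). apply ejd_seg_int.
      intros x Hx; apply Hpath; auto.
    - apply (ejd_time_of (fun u s => seg_int (integrand beta (P s)) (RtoC (IZR n + 1 / 2)) u)).
      apply ejd_seg_int. intros x Hx; apply Hpath; auto.
    - apply (ejd_time_of (fun u s => seg_int (integrand beta (P s)) (corner n z) u)).
      apply ejd_seg_int. intros x Hx; apply Hpath; auto.
    - apply ejd_seg_int; auto. }
  destruct HE as [l Hl]. exists l. revert Hl. apply jd_ext_loc; auto.
  - generalize (near_ball z r Hr). apply filter_imp. intros u Hu. symmetry.
    unfold fv. rewrite (value_by_segments beta (P t) (Hparams t Ht) (f t) (f_formula t Ht) n z u); auto;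
      intros x Hx; try (apply Hpath; exact Hx). apply HB. apply Ball_segment; auto.
  (* The first three segments do not depend on u, so for them pole avoidance is a condition on s
     alone. *)
  - assert (S1 := filter_prod_at _ _ (nonpole_segment 0 (RtoC (IZR n + 1 / 2)) (fun x Hx => proj1 (Hpath x Hx)))).
    assert (S2 := filter_prod_at _ _ (nonpole_segment (RtoC (IZR n + 1 / 2)) (corner n z)
       (fun x Hx => proj1 (proj2 (Hpath x Hx))))).
    assert (S3 := filter_prod_at _ _ (nonpole_segment (corner n z) z
       (fun x Hx => proj2 (proj2 (Hpath x Hx))))).
    assert (S4 := nonpole_segment z z H4).
    generalize (filter_and (F := filter_prod (near z) (tnear I t)) _ _ S4
      (near_snd (near z) (tnear I t) _ (filter_and _ _ S1 (filter_and _ _ S2 S3)))).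
    apply filter_imp. intros [u s] [[Is K4] [K1 [K2 K3]]]. cbn [fst snd] in *. symmetry.
    unfold fv. rewrite (value_by_segments beta (P s) (Hparams s Is) (f s) (f_formula s Is) n z u); auto;
      intros x Hx; first [apply K1 | apply K2 | apply K3 | apply K4]; auto.
Qed.

(** df/dt at time t for fixed z, meaningful away from the poles by [jd_fv]. *)
Definition fd (z : C) : C := epsilon (inhabits (RtoC 0)) (fun l => jd I t (fun u s => fv s u) z l).

Lemma jd_fv (z : C) : nonpole (P t) z -> jd I t (fun u s => fv s u) z (fd z).
Proof. intros Hz. unfold fd. apply epsilon_spec. apply ejd_fv; auto. Qed.

(** A ball about z that is free of poles at all times near t makes [jd_holo_limit] available: the
    z-derivative of df/dt is the time derivative of f'. *)
Lemma fd_local (z : C) : nonpole (P t) z -> exists r, (0 < r)%R /\ holo (Ball z r) fd /\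
  forall u, Ball z r u -> nonpole (P t) u /\
    jd I t (fun u s => fprime beta (P s) u) u (C_derive fd u).
Proof.
  intros Hz. destruct (nonpole_joint z Hz) as [Q1 Q2 HQ1 HQ2 HQ].
  destruct (filter_and _ _ HQ1 (nonpole_open beta (P t) (Hparams t Ht) z Hz)) as [r [Hr HB]].
  exists r. split; auto.
  assert (Hs : tnear I t (fun s => holo (Ball z r) (fv s))).
  { revert HQ2. apply filter_imp. intros s Hs2. eapply holo_sub; [|apply (holo_fv s)].
    - intros u Hu. destruct (HB u Hu) as [K1 _]. apply (HQ u s K1 Hs2).
    - destruct (HB z (Ball_center z r Hr)) as [K1 _]. apply (HQ z s K1 Hs2). }
  destruct (jd_holo_limit I t HI Ht (fun u s => fv s u) fd z r) as [W1 W2]; auto.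
  - intros u Hu. apply jd_fv. apply HB; auto.
  - eapply holo_sub; [|apply (holo_fv t Ht)]. intros u Hu. apply HB; auto.
  - split; auto. intros u Hu. split. apply HB; auto.
    generalize (W2 u Hu). apply jd_ext_loc; auto.
    + generalize (Ball_open z r u Hu). apply filter_imp. intros v Hv.
      apply cderiv_C_derive. apply cderiv_fv; auto. apply HB; auto.
    + generalize (near_filter_prod (near u) (tnear I t) _ _ (Ball_open z r u Hu) HQ2). apply filter_imp.
      intros [v s] [Hv Hs2]. cbn [fst snd] in *. destruct (HB v Hv) as [K1 _].
      destruct (HQ v s K1 Hs2) as [Is Hn]. apply cderiv_C_derive. apply cderiv_fv; auto.
Qed.

Lemma holo_fd : holo (nonpole (P t)) fd.
Proof.
  intros z Hz. destruct (fd_local z Hz) as [r [Hr [H _]]]. apply H. apply Ball_center; auto.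
Qed.

Lemma jd_fprime (z : C) : nonpole (P t) z ->
  jd I t (fun u s => fprime beta (P s) u) z (C_derive fd z).
Proof.
  intros Hz. destruct (fd_local z Hz) as [r [Hr [_ H]]]. apply H. apply Ball_center; auto.
Qed.

(** The z_k have imaginary parts 0, m or -m, while those of the poles are y0 or -y0 modulo 2 m, and
    y0 is no integer multiple of m. *)
Lemma zpt_nonpole (s : R) (k : nat) : I s -> In k idx -> nonpole (P s) (zpt (P s) k).
Proof.
  intros Hs Hk Hp. apply is_pole_iff in Hp. rewrite !in_lattice_omega2 in Hp.
  assert (Hok := Hparams s Hs). assert (Hm := ok_m _ _ Hok). assert (Hy := ok_y0 _ _ Hok).
  assert (HK : exists n e : Z, (e = 1 \/ e = -1)%Z /\
     (IZR n * pm (P s) = IZR e * py0 (P s))%R).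
  { destruct Hk as [<-|[<-|[<-|[<-|[]]]]];
    destruct Hp as [[a [b E]]|[a [b E]]]; apply (f_equal Im) in E; unfold zpole in E; simpl in E.
    - exists (-2 * b)%Z, 1%Z. split; auto. rewrite mult_IZR. lra.
    - exists (2 * b)%Z, 1%Z. split; auto. rewrite mult_IZR. lra.
    - exists (-2 * b)%Z, 1%Z. split; auto. rewrite mult_IZR. lra.
    - exists (2 * b)%Z, 1%Z. split; auto. rewrite mult_IZR. lra.
    - exists (1 - 2 * b)%Z, 1%Z. split; auto. rewrite minus_IZR, mult_IZR. lra.
    - exists (1 - 2 * b)%Z, (-1)%Z. split; auto. rewrite minus_IZR, mult_IZR. lra.
    - exists (-1 - 2 * b)%Z, 1%Z. split; auto. rewrite minus_IZR, mult_IZR. lra.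
    - exists (-1 - 2 * b)%Z, (-1)%Z. split; auto. rewrite minus_IZR, mult_IZR. lra. }
  assert (Hno : forall n : Z, (IZR n * pm (P s) = py0 (P s))%R -> False).
  { intros n E. destruct (Z_lt_le_dec n 1) as [L|L].
    - assert (L' : (n <= 0)%Z) by lia. apply IZR_le in L'.
      assert (0 <= - IZR n * pm (P s))%R by (apply Rmult_le_pos; lra). lra.
    - apply IZR_le in L. assert (1 * pm (P s) <= IZR n * pm (P s))%R
        by (apply Rmult_le_compat_r; lra). lra. }
  destruct HK as [n [e [[-> | ->] E]]].
  - apply (Hno n). lra.
  - apply (Hno (- n)%Z). rewrite opp_IZR. lra.
Qed.

(** * Lattice translates, zeros and poles of f' *)

Lemma in_lattice_plus (w a b : C) : in_lattice w a -> in_lattice w b -> in_lattice w (a + b).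
Proof.
  intros [[j k] ->] [[j' k'] ->]. exists (j + j', k + k')%Z. unfold lattice_point; simpl.
  rewrite !plus_IZR, !RtoC_plus. ring.
Qed.
Lemma in_lattice_minus (w a b : C) : in_lattice w a -> in_lattice w b -> in_lattice w (a - b).
Proof. intros. apply in_lattice_plus; auto. apply in_lattice_neg; auto. Qed.
Lemma in_lattice_1 (w : C) : in_lattice w 1.
Proof. exists (1, 0)%Z. unfold lattice_point; simpl. ring. Qed.
Lemma in_lattice_w (w : C) : in_lattice w w.
Proof. exists (0, 1)%Z. unfold lattice_point; simpl. ring. Qed.
Lemma notin_lattice_shift (w a b : C) : in_lattice w b -> ~ in_lattice w a -> ~ in_lattice w (a + b).
Proof.
  intros Hb Ha H. apply Ha. replace a with (a + b - b) by ring. apply in_lattice_minus; auto.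
Qed.
Lemma notin_lattice_sym (w a b : C) : ~ in_lattice w (a - b) -> ~ in_lattice w (b - a).
Proof.
  intros H H'. apply H. replace (a - b) with (- (b - a)) by ring. apply in_lattice_neg; auto.
Qed.

Let w0 : C := om t.
Let Lat : C -> Prop := in_lattice w0.
Let z0 : C := zpole (P t).
Let zk : nat -> C := zpt (P t).
Let q : C -> C := fprime beta (P t).
Let zeta : C -> C := wzeta 1 w0.
Let sg : C -> C := fun u => sig2 u w0.
Let gma : C := gamma0 beta (P t).
Let h1 : C := eta1 (P t).

Let Hw0 : upper w0 := om_upper t Ht.
Let Hok : params_ok beta (P t) := Hparams t Ht.

Lemma sg_0_iff (u : C) : sg u = 0 <-> Lat u.
Proof. apply sig2_eq_0; auto. Qed.

Lemma nonpole_lat (z : C) : nonpole (P t) z <-> ~ Lat (z - z0) /\ ~ Lat (z - Cconj z0).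
Proof. unfold nonpole. rewrite is_pole_iff. unfold Lat, w0, om, z0. tauto. Qed.

(** Within each of the pairs (1, 2) and (3, 4) the real parts differ by a number strictly between 0
    and 1; across the pairs the imaginary parts differ by m, which is no multiple of 2 m. *)
Lemma zpt_distinct (k j : nat) : In k idx -> In j idx -> k <> j -> ~ Lat (zk k - zk j).
Proof.
  intros Hk Hj Hkj H. unfold Lat, w0, om in H. rewrite in_lattice_omega2 in H.
  destruct H as [a [b E]].
  assert (ER := f_equal Re E). assert (EI := f_equal Im E). clear E.
  assert (Hm := ok_m _ _ Hok). assert (H12 := ok_x12 _ _ Hok). assert (H34 := ok_x34 _ _ Hok).
  assert (Hint : forall x y : R, (x < y < x + 1)%R -> (x - y = IZR a \/ y - x = IZR a)%R -> False).
  { intros x y Hxy [Ha|Ha].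
    - assert (L1 : (IZR (-1) < IZR a)%R) by lra. assert (L2 : (IZR a < IZR 0)%R) by lra.
      apply lt_IZR in L1, L2. lia.
    - assert (L1 : (IZR 0 < IZR a)%R) by lra. assert (L2 : (IZR a < IZR 1)%R) by lra.
      apply lt_IZR in L1, L2. lia. }
  assert (Hodd : forall e : Z, (e = 1 \/ e = -1)%Z -> (IZR e * pm (P t) = 2 * pm (P t) * IZR b)%R -> False).
  { intros e He E. assert (E2 : IZR e = IZR (2 * b)).
    { rewrite mult_IZR. apply Rmult_eq_reg_r with (pm (P t)); lra. }
    apply eq_IZR in E2. lia. }
  unfold zk in *.
  destruct Hk as [<-|[<-|[<-|[<-|[]]]]]; destruct Hj as [<-|[<-|[<-|[<-|[]]]]]; try tauto;
    simpl in ER, EI;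
    first [ apply (Hint _ _ H12); (left; lra) || (right; lra)
          | apply (Hint _ _ H34); (left; lra) || (right; lra)
          | apply (Hodd 1%Z); [auto|lra] | apply (Hodd (-1)%Z); [auto|lra] ].
Qed.

Lemma zpt_zpole_notin (k : nat) : In k idx -> ~ Lat (zk k - z0) /\ ~ Lat (zk k - Cconj z0).
Proof. intros Hk. apply nonpole_lat. apply zpt_nonpole; auto. Qed.

Lemma c_neq_0 : pc (P t) <> 0.
Proof. apply Hok. Qed.

Lemma q_eq_0 (z : C) : nonpole (P t) z -> (q z = 0 <-> exists k, In k idx /\ Lat (z - zk k)).
Proof.
  intros Hz. assert (Hz' := Hz). apply (nonpole_iff beta) in Hz'; auto. destruct Hz' as [H1 H2].
  unfold q, fprime, integrand. split.
  - intros E. apply NNPP. intros Hn. revert E.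
    apply Cmult_neq_0; [apply c_neq_0|]. apply Cmult_neq_0.
    apply Cmult_neq_0; [apply Cexp_neq_0|]. apply cprod_neq_0. intros k Hk E.
    apply Hn. exists k. split; auto. apply sg_0_iff. exact E.
    apply Cinv_nonzero. apply Cmult_neq_0; apply Cpow_2_neq_0; [exact H1|exact H2].
  - intros [k [Hk HL]]. rewrite (cprod_eq_0 idx _ k Hk). unfold Cdiv; ring.
    apply sg_0_iff in HL. exact HL.
Qed.

Definition regular (z : C) : Prop := nonpole (P t) z /\ forall k, In k idx -> ~ Lat (z - zk k).

Lemma regular_q (z : C) : regular z -> q z <> 0.
Proof. intros [H1 H2] E. apply q_eq_0 in E; auto. destruct E as [k [Hk HL]]. exact (H2 k Hk HL). Qed.

Lemma nonpole_shift (z l : C) : Lat l -> nonpole (P t) z -> nonpole (P t) (z + l).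
Proof.
  intros Hl. rewrite !nonpole_lat.
  assert (E : forall a, z + l - a = z - a + l) by (intros; ring). rewrite !E.
  intros [H1 H2]; split; apply notin_lattice_shift; auto.
Qed.

(** Discreteness of the lattice: by [lattice_lower] two of its points closer than 1 / K coincide. If
    p - a is off the lattice, openness is enough. *)
Lemma punctured_notin (p a : C) : near p (fun z => z <> p -> ~ Lat (z - a)).
Proof.
  destruct (classic (Lat (p - a))) as [H|H].
  - destruct (lattice_lower_near w0 Hw0) as [K [HK HN]]. apply near_self in HN.
    exists (/ K)%R. split. apply Rinv_0_lt_compat; lra. intros z Hz Hzp Hl.
    assert (Hd : Lat (z - p)).
    { replace (z - p) with (z - a - (p - a)) by ring. apply in_lattice_minus; auto. }
    destruct Hd as [jk E]. specialize (HN jk). rewrite <- E in HN.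
    assert (Hm : (1 <= Z.max (Z.abs (fst jk)) (Z.abs (snd jk)))%Z).
    { destruct (Z_lt_le_dec (Z.max (Z.abs (fst jk)) (Z.abs (snd jk))) 1) as [L|L]; auto.
      exfalso. apply Hzp. destruct jk as [j k]; simpl in *.
      assert (j = 0%Z) by lia. assert (k = 0%Z) by lia. subst.
      rewrite lattice_point_00 in E. replace z with (z - p + p) by ring. rewrite E. ring. }
    apply IZR_le in Hm.
    apply Rmult_lt_compat_l with (r := K) in Hz; [|lra]. rewrite Rinv_r in Hz by lra. lra.
  - assert (Hs : sg (p - a) <> 0) by (rewrite sg_0_iff; auto).
    assert (T := tends_neq (near p) _ _ (cts_sig2_shift beta (P t) Hok a p) Hs).
    revert T. apply filter_imp. intros z Hz _. rewrite <- sg_0_iff. exact Hz.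
Qed.

Lemma punctured_regular (p : C) : near p (fun z => z <> p -> regular z).
Proof.
  generalize (filter_and (F := near p) _ _ (filter_and (F := near p) _ _ (punctured_notin p z0) (punctured_notin p (Cconj z0)))
    (filter_and (F := near p) _ _ (filter_and (F := near p) _ _ (punctured_notin p (zk 1)) (punctured_notin p (zk 2)))
       (filter_and (F := near p) _ _ (punctured_notin p (zk 3)) (punctured_notin p (zk 4))))).
  apply filter_imp. intros z [[A B] [[D E] [G H]]] Hz. split.
  - apply nonpole_lat. auto.
  - intros k Hk. destruct Hk as [<-|[<-|[<-|[<-|[]]]]]; auto.
Qed.

Lemma holo_zeta_shift (a : C) : holo (fun z => ~ Lat (z - a)) (fun z => zeta (z - a)).
Proof.
  assert (HU : isopen (fun z => ~ Lat (z - a))).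
  { intros p Hp. assert (Hs : sg (p - a) <> 0) by (rewrite sg_0_iff; auto).
    generalize (tends_neq (near p) _ _ (cts_sig2_shift beta (P t) Hok a p) Hs).
    apply filter_imp. intros z Hz. rewrite <- sg_0_iff. exact Hz. }
  assert (Hsh : holo (fun z => ~ Lat (z - a)) (fun z => z - a)).
  { apply holo_minus; auto using holo_id, holo_const. }
  apply (holo_div _ (fun z => d_fst sig2 (z - a) w0) (fun z => sg (z - a))); auto.
  - intros z Hz. rewrite sg_0_iff. auto.
  - apply holo_comp with (V := everywhere) (f := fun u => d_fst sig2 u w0); auto.
    intros; exact Logic.I. apply (an_fst _ (analytic2_d_fst _ analytic2_sig2)); auto.
  - apply holo_comp with (V := everywhere) (f := fun u => sig2 u w0); auto.
    intros; exact Logic.I. apply (an_fst _ analytic2_sig2); auto.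
Qed.

(** The increment is evaluated at -1/2, where oddness of zeta turns it into 2 zeta(1/2) = eta_1. *)
Lemma zeta_period_1 (u : C) : ~ Lat u -> zeta (u + 1) = zeta u + h1.
Proof.
  intros Hu.
  assert (Hh : ~ Lat (1 / 2)) by (apply half_notin; auto).
  assert (Hn : ~ Lat (- (1 / 2))).
  { intros H. apply Hh. replace (1 / 2) with (- - (1 / 2)) by ring. apply in_lattice_neg; auto. }
  assert (E1 : - (1 / 2) + 1 = 1 / 2) by field.
  assert (K : zeta (u + 1) - zeta u = zeta (- (1 / 2) + 1) - zeta (- (1 / 2))).
  { apply wzeta_period_const; auto. apply notin_lattice_shift; auto. apply in_lattice_1.
    rewrite E1; auto. }
  rewrite E1 in K. unfold zeta at 4 in K. rewrite wzeta_odd in K by auto. fold zeta in K.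
  replace (zeta (u + 1)) with (zeta (u + 1) - zeta u + zeta u) by ring. rewrite K.
  unfold h1, eta1, pzeta. fold (om t). fold w0. fold zeta. ring.
Qed.

(** The second quasi-period, as an increment at 1/2; it enters only through the constant [Rper]. *)
Let h2 : C := zeta (1 / 2 + w0) - zeta (1 / 2).

Lemma zeta_period_w (u : C) : ~ Lat u -> zeta (u + w0) = zeta u + h2.
Proof.
  intros Hu. assert (Hh : ~ Lat (1 / 2)) by (apply half_notin; auto).
  assert (K : zeta (u + w0) - zeta u = zeta (1 / 2 + w0) - zeta (1 / 2)).
  { apply wzeta_period_const; auto; apply notin_lattice_shift; auto; apply in_lattice_w. }
  replace (zeta (u + w0)) with (zeta (u + w0) - zeta u + zeta u) by ring. rewrite K.
  unfold h2. ring.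
Qed.

(** * Periodicity and reflection of f, f' and df/dt *)

Lemma fv_period_1 (s : R) (z : C) : I s -> fv s (z + 1) = fv s z.
Proof.
  intros Hs. destruct (Hf s Hs) as [p1 [q1 [p2 [q2 H]]]]. unfold fv. f_equal.
  apply (cyl_periodic _ _ _ (sl_conformal _ _ _ _ _ _ _ _ H)).
Qed.

Lemma fv_period_w (s : R) (z : C) : I s -> nonpole (P s) z ->
  fv s (z + om s) = Cexp (Ci * (2 * beta)) * fv s z.
Proof.
  intros Hs Hz. destruct (Hf s Hs) as [p1 [q1 [p2 [q2 H]]]].
  unfold fv at 1. unfold om. rewrite (sl_omega2 _ _ _ _ _ _ _ _ H), (f_finite s z Hs Hz). reflexivity.
Qed.

Lemma fv_reflect (s : R) (z : C) : I s -> nonpole (P s) z ->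
  fv s (Cconj z) = Cexp (Ci * (2 * theta)) * Cconj (fv s z).
Proof.
  intros Hs Hz. destruct (Hf s Hs) as [p1 [q1 [p2 [q2 H]]]].
  unfold fv at 1. rewrite (sl_reflection _ _ _ _ _ _ _ _ H), (f_finite s z Hs Hz). reflexivity.
Qed.

Lemma nonpole_ev (z : C) : nonpole (P t) z -> tnear I t (fun s => I s /\ nonpole (P s) z).
Proof. intros Hz. apply (filter_prod_at z _ (nonpole_joint z Hz)). Qed.

Lemma dq_fv (z : C) : nonpole (P t) z -> tends (tnear I t) (dquot (fun s => fv s z) t) (fd z).
Proof. intros Hz. apply (jd_at I t HI Ht (fun u s => fv s u)). apply jd_fv; auto. Qed.

Lemma nonpole_open_t : isopen (nonpole (P t)).
Proof. apply (nonpole_open beta); auto. Qed.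

Lemma q_period_1 (z : C) : nonpole (P t) z -> q (z + 1) = q z.
Proof.
  intros Hz. assert (Hz1 := nonpole_shift z 1 (in_lattice_1 _) Hz).
  apply (cderiv_unique (fv t) z); [|apply cderiv_fv; auto].
  apply cderiv_ext with (fun u => fv t (u + 1)).
  apply filter_forall. intros; apply fv_period_1; auto.
  eapply cderiv_eq. apply (cderiv_comp (fv t) (fun u => u + 1)). apply cderiv_fv; auto.
  apply cderiv_plus. apply cderiv_id. apply cderiv_const. unfold q. ring.
Qed.

Lemma q_period_w (z : C) : nonpole (P t) z -> q (z + w0) = Cexp (Ci * (2 * beta)) * q z.
Proof.
  intros Hz. assert (Hz1 := nonpole_shift z w0 (in_lattice_w _) Hz).
  apply (cderiv_unique (fun u => fv t (u + w0)) z).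
  - eapply cderiv_eq. apply (cderiv_comp (fv t) (fun u => u + w0)). apply cderiv_fv; auto.
    apply cderiv_plus. apply cderiv_id. apply cderiv_const. unfold q. ring.
  - apply cderiv_ext with (fun u => Cexp (Ci * (2 * beta)) * fv t u).
    + generalize (nonpole_open_t z Hz). apply filter_imp. intros u Hu. symmetry.
      apply fv_period_w; auto.
    + eapply cderiv_eq. apply cderiv_mult. apply cderiv_const. apply cderiv_fv; auto.
      unfold q. simpl. ring.
Qed.

Lemma fd_period_1 (z : C) : nonpole (P t) z -> fd (z + 1) = fd z.
Proof.
  intros Hz. assert (Hz1 := nonpole_shift z 1 (in_lattice_1 _) Hz).
  apply (tends_unique (tnear I t) (dquot (fun s => fv s (z + 1)) t)). apply dq_fv; auto.
  eapply tends_ext; [typeclasses eauto| |apply (dq_fv z Hz)].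
  generalize (tnear_I I t). apply filter_imp. intros s [Hs _]. unfold dquot.
  rewrite !fv_period_1; auto.
Qed.

(** Differentiate f(z + omega_2(s), s) = exp(2 i beta) f(z, s) in s: the period moves too, which
    produces the term with f'. *)
Lemma fd_period_w (z : C) : nonpole (P t) z ->
  fd (z + w0) + q (z + w0) * omd = Cexp (Ci * (2 * beta)) * fd z.
Proof.
  intros Hz. assert (Hz1 := nonpole_shift z w0 (in_lattice_w _) Hz).
  apply (tends_unique (tnear I t) (dquot (fun s => fv s (z + om s)) t)).
  - apply (jd_move I t HI Ht (fun u s => fv s u) (fun s => z + om s)).
    + apply jd_fv; auto.
    + apply cderiv_fv; auto.
    + eapply tends_ext; [typeclasses eauto| |apply (jd_at I t HI Ht _ 0 _ (jd_om 0))].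
      apply filter_forall. intros s. unfold dquot, Cdiv. ring.
  - eapply tends_ext; [typeclasses eauto| |].
    2:{ apply tends_mult. typeclasses eauto. apply tends_const; typeclasses eauto.
        apply (dq_fv z Hz). }
    generalize (nonpole_ev z Hz). apply filter_imp. intros s [Hs Hn]. unfold dquot.
    rewrite !fv_period_w; auto. unfold Cdiv. ring.
Qed.

Lemma nonpole_conj (z : C) : nonpole (P t) z -> nonpole (P t) (Cconj z).
Proof.
  rewrite !nonpole_lat. unfold Lat, w0, om. rewrite !in_lattice_omega2. intros [H1 H2].
  assert (E : forall a, (exists j k : Z, Cconj z - a = (IZR j, (2 * pm (P t) * IZR k)%R)) ->
     exists j k : Z, z - Cconj a = (IZR j, (2 * pm (P t) * IZR k)%R)).
  { intros a [j [k E]]. exists j, (- k)%Z. rewrite <- (Cconj_conj z), <- Cminus_conj, E.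
    unfold Cconj; simpl. rewrite opp_IZR. f_equal. ring. }
  split; intros H; apply E in H; [apply H2|apply H1].
  exact H. rewrite Cconj_conj in H. exact H.
Qed.

Lemma q_reflect (z : C) : nonpole (P t) z -> q (Cconj z) = Cexp (Ci * (2 * theta)) * Cconj (q z).
Proof.
  intros Hz. assert (Hz1 := nonpole_conj z Hz).
  apply (cderiv_unique (fv t) (Cconj z)). apply cderiv_fv; auto.
  apply cderiv_ext with (fun u => Cexp (Ci * (2 * theta)) * Cconj (fv t (Cconj u))).
  - generalize (nonpole_open_t _ Hz1). apply filter_imp. intros u Hu.
    rewrite <- fv_reflect by (auto; apply nonpole_conj; auto). rewrite Cconj_conj. auto.
  - eapply cderiv_eq. apply cderiv_mult. apply cderiv_const.
    apply (cderiv_reflect (fv t)). rewrite Cconj_conj. apply cderiv_fv; auto.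
    unfold q. simpl. ring.
Qed.

Lemma fd_reflect (z : C) : nonpole (P t) z -> fd (Cconj z) = Cexp (Ci * (2 * theta)) * Cconj (fd z).
Proof.
  intros Hz. assert (Hz1 := nonpole_conj z Hz).
  apply (tends_unique (tnear I t) (dquot (fun s => fv s (Cconj z)) t)). apply dq_fv; auto.
  eapply tends_ext; [typeclasses eauto| |].
  2:{ apply tends_mult. typeclasses eauto. apply tends_const; typeclasses eauto.
      assert (K := dq_fv z Hz). rewrite tends_eps in K by typeclasses eauto.
      apply (proj2 (tends_eps (tnear I t) (fun s => Cconj (dquot (fun s => fv s z) t s)) (Cconj (fd z)))).
      intros e He. generalize (K e He). apply filter_imp. intros s Hs.
      rewrite <- Cminus_conj, Cmod_conj. exact Hs. }
  generalize (filter_and _ _ (nonpole_ev z Hz) (tnear_neq I t)). apply filter_imp.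
  intros s [[Hs Hn] Hne]. unfold dquot.
  rewrite !fv_reflect; auto. rewrite Cdiv_conj by auto. rewrite Cminus_conj.
  replace (Cconj (RtoC (s - t))) with (RtoC (s - t)).
  unfold Cdiv. ring. unfold Cconj, RtoC; simpl; f_equal; ring.
Qed.

(** * Behaviour at the zeros z_k of f' *)

Lemma in_idx_but (k j : nat) : In j (idx_but k) -> In j idx /\ j <> k.
Proof.
  unfold idx_but. rewrite filter_In. intros [H1 H2]. split; auto.
  intros ->. rewrite Nat.eqb_refl in H2. discriminate.
Qed.

Lemma logd_sg (a z : C) : ~ Lat (z - a) -> cderiv (fun u => sg (u - a)) z (sg (z - a) * zeta (z - a)).
Proof. exact (logd_psigma beta (P t) Hok a z). Qed.

Lemma logd_sinf_0 (a : C) : cderiv (fun u => sinf (u - a) w0) a (sinf (a - a) w0 * 0).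
Proof. exact (logd_sinf_at beta (P t) Hok a). Qed.

Lemma logd_Cexp (z : C) : cderiv (fun u => Cexp (gma * u)) z (Cexp (gma * z) * gma).
Proof. exact (logd_Cexp_mult gma z). Qed.

Lemma holo_sinf_shift (U : C -> Prop) (s : R) (a : C) : isopen U -> I s ->
  holo U (fun u => sinf (u - a) (om s)).
Proof.
  intros HU Hs. apply holo_comp with (V := everywhere) (f := fun u => sinf u (om s)); auto.
  intros; exact Logic.I. apply (an_fst _ analytic2_sinf). apply om_upper; auto.
  apply holo_minus; auto using holo_id, holo_const.
Qed.

Lemma holo_psigma_shift (U : C -> Prop) (s : R) (a : C) : isopen U -> I s ->
  holo U (fun u => psigma (P s) (u - a)).
Proof. intros HU Hs. apply (holo_sig2_shift beta (P s)); auto. Qed.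

Lemma holo_Cexp_gamma (U : C -> Prop) (s : R) : isopen U ->
  holo U (fun u => Cexp (gamma0 beta (P s) * u)).
Proof.
  intros HU. apply holo_comp with (V := everywhere) (f := Cexp); auto. intros; exact Logic.I.
  apply holo_Cexp, everywhere_open. apply holo_mult; auto using holo_const, holo_id.
Qed.

Lemma holo_cprod (U : C -> Prop) (l : list nat) (F : nat -> C -> C) : isopen U ->
  (forall k, In k l -> holo U (F k)) -> holo U (fun u => cprod l (fun k => F k u)).
Proof.
  intros HU. induction l as [|k l IH]; intros H. apply (holo_const U 1); auto.
  apply (holo_mult U (F k) (fun u => cprod l (fun k => F k u))); auto.
  apply H; left; auto. apply IH; intros; apply H; right; auto.
Qed.

(* The derivative of f with the simple zero at [zpt k] divided out. *)
Definition Gf (k : nat) (s : R) (u : C) : C :=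
  pc (P s) * (Cexp (gamma0 beta (P s) * u) *
    (sinf (u - zpt (P s) k) (om s) * cprod (idx_but k) (fun j => psigma (P s) (u - zpt (P s) j)))
   / (psigma (P s) (u - zpole (P s)) ^ 2 * psigma (P s) (u - Cconj (zpole (P s))) ^ 2)).

Lemma fprime_Gf (k : nat) (s : R) (u : C) : In k idx ->
  fprime beta (P s) u = (u - zpt (P s) k) * Gf k s u.
Proof.
  intros Hk. unfold fprime, integrand, Gf.
  rewrite (cprod_but k (fun k => psigma (P s) (u - zpt (P s) k))) by auto.
  replace (psigma (P s) (u - zpt (P s) k)) with ((u - zpt (P s) k) * sinf (u - zpt (P s) k) (om s))
    by reflexivity.
  unfold Cdiv. ring.
Qed.

Lemma holo_Gf (k : nat) (s : R) : I s -> holo (nonpole (P s)) (Gf k s).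
Proof.
  intros Hs. assert (HO := nonpole_open beta (P s) (Hparams s Hs)). unfold Gf.
  apply holo_mult; auto using holo_const. apply holo_div; auto.
  - intros z Hz. apply (nonpole_iff beta) in Hz; auto. destruct Hz as [H1 H2].
    apply Cmult_neq_0; apply Cpow_2_neq_0; [exact H1 | exact H2].
  - apply holo_mult; auto using holo_Cexp_gamma. apply holo_mult; auto using holo_sinf_shift.
    apply (holo_cprod _ _ (fun j u => psigma (P s) (u - zpt (P s) j))); auto using holo_psigma_shift.
  - apply holo_mult; auto; apply holo_pow_2; auto using holo_psigma_shift.
Qed.

Lemma Gf_Dcoef (k : nat) : Gf k t (zk k) = Dcoef beta (P t) k.
Proof.
  unfold Gf, Dcoef. fold (zk k).
  replace (zk k - zk k) with (RtoC 0) by ring. rewrite sinf_0 by (apply Hw0).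
  unfold Cdiv. ring.
Qed.

Lemma Dcoef_neq_0 (k : nat) : In k idx -> Dcoef beta (P t) k <> 0.
Proof.
  intros Hk. destruct (zpt_zpole_notin k Hk) as [N1 N2]. unfold Dcoef. fold (zk k).
  apply Cmult_neq_0. apply Cmult_neq_0; [apply c_neq_0|apply Cexp_neq_0].
  unfold Cdiv. apply Cmult_neq_0.
  - apply cprod_neq_0. intros j Hj E. apply in_idx_but in Hj. destruct Hj as [Hj Hjk].
    apply (zpt_distinct k j); auto. apply sg_0_iff. exact E.
  - rewrite <- sg_0_iff in N1, N2.
    apply Cinv_nonzero. apply Cmult_neq_0; apply Cpow_2_neq_0; [exact N1|exact N2].
Qed.

Lemma ejd_Gf (k : nat) : In k idx -> ejd (fun u s => Gf k s u) (zk k).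
Proof.
  intros Hk. destruct (zpt_zpole_notin k Hk) as [N1 N2]. rewrite <- sg_0_iff in N1, N2.
  unfold Gf. apply (ejd_mult (fun _ s => pc (P s))).
  { eexists; apply (jd_time I t (fun s => pc (P s))). apply dq_c. }
  apply ejd_div.
  - apply Cmult_neq_0; apply Cpow_2_neq_0; [exact N1|exact N2].
  - apply ejd_mult. apply ejd_Cexp. apply ejd_mult.
    eapply (ejd_an2 sinf (fun s => zpt (P s) k)). apply analytic2_sinf. apply jd_zpt; auto.
    apply (ejd_cprod (idx_but k) (fun k u s => psigma (P s) (u - zpt (P s) k))).
    intros j Hj. apply in_idx_but in Hj.
    eapply (ejd_psigma (fun s => zpt (P s) j)). apply jd_zpt; tauto.
  - apply ejd_mult; apply ejd_pow2.
    + eapply (ejd_psigma (fun s => zpole (P s))). apply jd_zpole.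
    + eapply (ejd_psigma (fun s => Cconj (zpole (P s)))). apply jd_zpole_conj.
Qed.

(** f' is (z - z_k) times a factor equal to D_k at z_k. When it is differentiated in t at z = z_k,
    only the motion of the zero contributes. *)
Lemma d_fd_zk (k : nat) : In k idx -> C_derive fd (zk k) = - zptd k * Dcoef beta (P t) k.
Proof.
  intros Hk. destruct (ejd_Gf k Hk) as [l Hl].
  apply (jd_unique I t HI Ht (fun u s => fprime beta (P s) u) (zk k)).
  - apply jd_fprime. apply zpt_nonpole; auto.
  - eapply jd_eq. eapply (jd_ext I t HI Ht (fun u s => (u - zpt (P s) k) * Gf k s u)).
    intros; symmetry; apply fprime_Gf; auto.
    apply (jd_mult I t HI Ht (fun u s => u - zpt (P s) k)).
    apply (jd_shift (fun s => zpt (P s) k)). apply jd_zpt; auto. exact Hl.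
    cbv beta. rewrite Gf_Dcoef. fold (zk k). ring.
Qed.

Lemma q_zk (k : nat) : In k idx -> q (zk k) = 0.
Proof.
  intros Hk. unfold q. rewrite (fprime_Gf k) by auto. fold (zk k). ring.
Qed.

(** * h minus its polar parts, and the removal of its singularities *)

Definition gk (k : nat) : C := gam I beta P f k t.

(** A_k is f at the moving point z_k, but the motion of z_k contributes the factor f'(z_k) = 0. *)
Lemma gk_fd (k : nat) : In k idx -> gk k = fd (zk k) / Dcoef beta (P t) k.
Proof.
  intros Hk. unfold gk, gam. f_equal. apply dotC_eq; auto.
  replace (fd (zk k)) with (fd (zk k) + q (zk k) * zptd k) by (rewrite q_zk by auto; ring).
  apply (jd_move I t HI Ht (fun u s => fv s u) (fun s => zpt (P s) k)).
  - apply jd_fv. apply zpt_nonpole; auto.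
  - apply cderiv_fv; auto. apply zpt_nonpole; auto.
  - apply (jd_at I t HI Ht (fun _ s => zpt (P s) k) 0). apply jd_zpt; auto.
Qed.

(** The correction [- h1 * z] makes every term 1-periodic. *)
Definition zsum (z : C) : C := csum idx (fun k => gk k * (zeta (z - zk k) - h1 * z)).
Definition Rf (z : C) : C := fd z / q z - zsum z.

Lemma regular_nonlat (k : nat) (z : C) : In k idx -> regular z -> ~ Lat (z - zk k).
Proof. intros Hk [_ H]. auto. Qed.

Lemma Rf_period_1 (z : C) : regular z -> Rf (z + 1) = Rf z.
Proof.
  intros Hz. unfold Rf. rewrite fd_period_1, q_period_1 by apply Hz.
  assert (E : zsum (z + 1) = zsum z).
  { unfold zsum. apply csum_ext. intros k Hk.
    replace (z + 1 - zk k) with (z - zk k + 1) by ring.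
    rewrite zeta_period_1 by (apply regular_nonlat; auto). ring. }
  rewrite E. auto.
Qed.

Definition Rper : C := - omd - csum idx (fun k => gk k * (h2 - h1 * w0)).

Lemma Rf_period_w (z : C) : regular z -> Rf (z + w0) = Rf z + Rper.
Proof.
  intros Hz. assert (Hq := regular_q z Hz).
  assert (Hfd := fd_period_w z (proj1 Hz)). assert (Hqw := q_period_w z (proj1 Hz)).
  assert (He := Cexp_neq_0 (Ci * (2 * beta))).
  assert (E1 : fd (z + w0) / q (z + w0) = fd z / q z - omd).
  { replace (fd (z + w0)) with (fd (z + w0) + q (z + w0) * omd - q (z + w0) * omd) by ring.
    rewrite Hfd, Hqw. field. auto. }
  unfold Rf. rewrite E1. unfold Rper.
  assert (E2 : zsum (z + w0) = zsum z + csum idx (fun k => gk k * (h2 - h1 * w0))).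
  { unfold zsum. rewrite <- csum_plus. apply csum_ext. intros k Hk.
    replace (z + w0 - zk k) with (z - zk k + w0) by ring.
    rewrite zeta_period_w by (apply regular_nonlat; auto). ring. }
  rewrite E2. ring.
Qed.

(** Removability is phrased by a local holomorphic g, because at a singular point [Rf] itself has a
    meaningless value: a division by 0 or an unspecified [fd]. *)
Definition extends_at (p : C) : Prop := exists r g, (0 < r)%R /\ holo (Ball p r) g /\
  forall z, Ball p r z -> z <> p -> g z = Rf z.

(** Quasi-periodicity of [Rf] reduces the removal of singularities to the representatives z_1, ...,
    z_4, z0 and conj z0 modulo the lattice. *)
Lemma extends_shift (p tau c : C) :
  (forall z, regular z -> Rf (z + tau) = Rf z + c) -> Lat tau ->
  (extends_at p <-> extends_at (p + tau)).
Proof.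
  intros HR Hl. 
  destruct (punctured_regular p) as [r0 [Hr0 Hreg]].
  assert (Hne : forall z, z <> p + tau -> z - tau <> p).
  { intros z H E. apply H. rewrite <- E. ring. }
  split; intros [r [g [Hr [Hg E]]]].
  - exists (Rmin r r0), (fun z => g (z - tau) + c). split; [apply Rmin_pos; auto|]. split.
    + apply holo_plus; auto using Ball_open, holo_const.
      apply holo_comp with (V := Ball p r) (f := g); auto using Ball_open.
      * intros z Hz. unfold Ball in *. replace (z - tau - p) with (z - (p + tau)) by ring.
        eapply Rlt_le_trans; [exact Hz|apply Rmin_l].
      * apply holo_minus; auto using Ball_open, holo_id, holo_const.
    + intros z Hz Hn. unfold Ball in Hz.
      assert (Hz' : Ball p r (z - tau)).
      { unfold Ball. replace (z - tau - p) with (z - (p + tau)) by ring.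
        eapply Rlt_le_trans; [exact Hz|apply Rmin_l]. }
      assert (Hz2 : regular (z - tau)).
      { apply Hreg; auto. replace (z - tau - p) with (z - (p + tau)) by ring.
        eapply Rlt_le_trans; [exact Hz|apply Rmin_r]. }
      rewrite E by auto. rewrite <- HR by auto. f_equal. ring.
  - exists (Rmin r r0), (fun z => g (z + tau) - c). split; [apply Rmin_pos; auto|]. split.
    + apply holo_minus; auto using Ball_open, holo_const.
      apply holo_comp with (V := Ball (p + tau) r) (f := g); auto using Ball_open.
      * intros z Hz. unfold Ball in *. replace (z + tau - (p + tau)) with (z - p) by ring.
        eapply Rlt_le_trans; [exact Hz|apply Rmin_l].
      * apply holo_plus; auto using Ball_open, holo_id, holo_const.
    + intros z Hz Hn. unfold Ball in Hz.
      assert (Hz2 : regular z).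
      { apply Hreg; auto. eapply Rlt_le_trans; [exact Hz|apply Rmin_r]. }
      rewrite E. rewrite HR by auto. ring.
      unfold Ball. replace (z + tau - (p + tau)) with (z - p) by ring.
      eapply Rlt_le_trans; [exact Hz|apply Rmin_l].
      intros E'. apply Hn. replace z with (z + tau - tau) by ring. rewrite E'. ring.
Qed.

Lemma extends_multiple (tau c p : C) (n : Z) :
  (forall z, regular z -> Rf (z + tau) = Rf z + c) -> Lat tau ->
  extends_at p -> extends_at (p + IZR n * tau).
Proof.
  intros HR Hl Hp. 
  assert (Hnat : forall m : nat, extends_at (p + IZR (Z.of_nat m) * tau) /\
     extends_at (p + IZR (- Z.of_nat m) * tau)).
  { induction m as [|m [IH1 IH2]].
    - simpl. replace (p + 0 * tau) with p by ring. auto.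
    - split.
      + rewrite (extends_shift _ tau c) in IH1 by auto.
        replace (p + IZR (Z.of_nat (S m)) * tau) with (p + IZR (Z.of_nat m) * tau + tau); auto.
        rewrite Nat2Z.inj_succ, succ_IZR, RtoC_plus. ring.
      + rewrite (extends_shift _ tau c) by auto.
        replace (p + IZR (- Z.of_nat (S m)) * tau + tau) with (p + IZR (- Z.of_nat m) * tau); auto.
        rewrite Nat2Z.inj_succ, !opp_IZR, succ_IZR, !RtoC_opp, RtoC_plus. ring. }
  destruct (Z_le_gt_dec 0 n).
  - rewrite <- (Z2Nat.id n) by lia. apply Hnat.
  - replace n with (- Z.of_nat (Z.to_nat (- n)))%Z by lia. apply Hnat.
Qed.

Lemma extends_lattice (p l : C) : Lat l -> extends_at p -> extends_at (p + l).
Proof.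
  intros [[j k] ->] Hp. unfold lattice_point; simpl.
  replace (p + (IZR j * 1 + IZR k * w0)) with (p + IZR j * 1 + IZR k * w0) by ring.
  apply (extends_multiple w0 Rper); [exact Rf_period_w|apply in_lattice_w|].
  apply (extends_multiple 1 (RtoC 0)); auto.
  - intros z Hz. rewrite Rf_period_1 by auto. ring.
  - apply in_lattice_1.
Qed.

Lemma holo_csum_zeta (U : C -> Prop) (l : list nat) : isopen U ->
  (forall k z, In k l -> U z -> ~ Lat (z - zk k)) ->
  holo U (fun z => csum l (fun k => gk k * (zeta (z - zk k) - h1 * z))).
Proof.
  intros HU. induction l as [|k l IH]; intros H. apply (holo_const U 0); auto.
  apply (holo_plus U (fun z => gk k * (zeta (z - zk k) - h1 * z))); auto.
  - apply holo_mult; auto using holo_const. apply holo_minus; auto.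
    + eapply holo_sub; [|apply (holo_zeta_shift (zk k))]. intros z Hz. apply H; auto. left; auto.
    + apply holo_mult; auto using holo_const, holo_id.
  - apply IH. intros; apply H; auto. right; auto.
Qed.

Lemma holo_q : holo (nonpole (P t)) q.
Proof. apply (holo_fprime beta); auto. Qed.

Lemma regular_open (p : C) : regular p -> near p regular.
Proof.
  intros Hp. generalize (punctured_regular p). apply filter_imp. intros z Hz.
  destruct (classic (z = p)) as [->|N]; auto.
Qed.

Lemma extends_regular (p : C) : regular p -> extends_at p.
Proof.
  intros Hp. destruct (regular_open p Hp) as [r [Hr HB]].
  exists r, Rf. split; auto. split; auto. unfold Rf.
  apply holo_minus; auto using Ball_open.
  - apply holo_div; auto using Ball_open. intros z Hz; apply regular_q; apply HB; auto.
    eapply holo_sub; [|apply holo_fd]. intros z Hz; apply HB; auto.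
    eapply holo_sub; [|apply holo_q]. intros z Hz; apply HB; auto.
  - apply holo_csum_zeta; auto using Ball_open. intros k z Hk Hz. apply (HB z Hz); auto.
Qed.

(** The logarithmic derivative of [Gf k t] at z_k, that is f'''(z_k) / (2 f''(z_k)). *)
Definition Llog (k : nat) : C :=
  gma + csum (idx_but k) (fun j => zeta (zk k - zk j)) - 2 * zeta (zk k - z0) - 2 * zeta (zk k - Cconj z0).

Lemma cderiv_Gf (k : nat) : In k idx -> cderiv (Gf k t) (zk k) (Gf k t (zk k) * Llog k).
Proof.
  intros Hk. destruct (zpt_zpole_notin k Hk) as [N1 N2].
  assert (S1 : sg (zk k - z0) <> 0) by (rewrite sg_0_iff; auto).
  assert (S2 : sg (zk k - Cconj z0) <> 0) by (rewrite sg_0_iff; auto).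
  unfold Gf. apply (logd_const_mult (pc (P t)) (fun u => Cexp (gamma0 beta (P t) * u) *
     (sinf (u - zpt (P t) k) (om t) * cprod (idx_but k) (fun j => psigma (P t) (u - zpt (P t) j))) /
     (psigma (P t) (u - zpole (P t)) ^ 2 * psigma (P t) (u - Cconj (zpole (P t))) ^ 2))). unfold Llog.
  replace (gma + csum (idx_but k) (fun j => zeta (zk k - zk j)) - 2 * zeta (zk k - z0) -
    2 * zeta (zk k - Cconj z0)) with
   ((gma + (0 + csum (idx_but k) (fun j => zeta (zk k - zk j)))) -
    (2 * zeta (zk k - z0) + 2 * zeta (zk k - Cconj z0))) by ring.
  apply (logd_div (fun u => Cexp (gamma0 beta (P t) * u) *
     (sinf (u - zpt (P t) k) (om t) * cprod (idx_but k) (fun j => psigma (P t) (u - zpt (P t) j))))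
     (fun u => psigma (P t) (u - zpole (P t)) ^ 2 * psigma (P t) (u - Cconj (zpole (P t))) ^ 2)).
  - apply Cmult_neq_0; apply Cpow_2_neq_0; [exact S1|exact S2].
  - apply (logd_mult (fun u => Cexp (gamma0 beta (P t) * u)) (fun u => sinf (u - zpt (P t) k) (om t) * cprod (idx_but k) (fun j => psigma (P t) (u - zpt (P t) j)))). apply logd_Cexp.
    apply (logd_mult (fun u => sinf (u - zpt (P t) k) (om t)) (fun u => cprod (idx_but k) (fun j => psigma (P t) (u - zpt (P t) j)))). apply logd_sinf_0.
    apply (cderiv_cprod (idx_but k) (fun j u => psigma (P t) (u - zpt (P t) j))).
    intros j Hj. apply in_idx_but in Hj. destruct Hj as [Hj Hjk].
    apply (logd_sg (zk j)). apply zpt_distinct; auto.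
  - apply (logd_mult (fun u => psigma (P t) (u - zpole (P t)) ^ 2) (fun u => psigma (P t) (u - Cconj (zpole (P t))) ^ 2)).
    apply (logd_pow2 (fun u => psigma (P t) (u - zpole (P t)))). apply (logd_sg z0); auto.
    apply (logd_pow2 (fun u => psigma (P t) (u - Cconj (zpole (P t))))). apply (logd_sg (Cconj z0)); auto.
Qed.

(* [u zeta u], extended by its value 1 at [u = 0]. *)
Definition uzeta (u : C) : C := 1 + u * (d_fst sinf u w0 / sinf u w0).

Lemma uzeta_eq (u : C) : ~ Lat u -> uzeta u = u * zeta u.
Proof.
  intros Hu. assert (Hs : sg u <> 0) by (rewrite sg_0_iff; auto).
  assert (E : sg u = u * sinf u w0) by reflexivity.
  assert (Hu0 : u <> 0) by (intros E0; apply Hs; rewrite E, E0; ring).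
  assert (Hsi : sinf u w0 <> 0) by (intros E0; apply Hs; rewrite E, E0; ring).
  unfold uzeta, zeta. rewrite wzeta_eq, d_sig2_sinf by auto. fold (sg u). rewrite E. field. auto.
Qed.

Lemma holo_dsinf (U : C -> Prop) : isopen U -> holo U (fun u => d_fst sinf u w0).
Proof.
  intros HU. eapply holo_sub; [|apply (an_fst _ (analytic2_d_fst _ analytic2_sinf) w0 Hw0)].
  intros; exact Logic.I.
Qed.
Lemma holo_sinf (U : C -> Prop) : isopen U -> holo U (fun u => sinf u w0).
Proof.
  intros HU. eapply holo_sub; [|apply (an_fst _ analytic2_sinf w0 Hw0)].
  intros; exact Logic.I.
Qed.

Lemma sinf_near_0 : near 0 (fun u => sinf u w0 <> 0).
Proof.
  apply (tends_neq (near 0) (fun u => sinf u w0) (sinf 0 w0)).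
  apply (holo_cts everywhere (fun u => sinf u w0) 0). apply holo_sinf, everywhere_open. exact Logic.I.
  rewrite sinf_0 by auto. intros E; apply RtoC_inj in E; lra.
Qed.

Lemma cderiv_uzeta_0 : cderiv uzeta 0 0.
Proof.
  assert (Hs := near_self _ _ sinf_near_0). simpl in Hs.
  unfold uzeta. eapply cderiv_eq. apply cderiv_plus. apply cderiv_const.
  apply cderiv_mult. apply cderiv_id. apply cderiv_div; auto.
  apply (an_fst _ (analytic2_d_fst _ analytic2_sinf) w0 Hw0 0 Logic.I).
  apply cderiv_sinf; auto. cbv beta. rewrite d_sinf_0 by auto. unfold Cdiv. ring.
Qed.

Lemma notlat_open (a p : C) : ~ Lat (p - a) -> near p (fun z => ~ Lat (z - a)).
Proof.
  intros Hp. assert (Hs : sg (p - a) <> 0) by (rewrite sg_0_iff; auto).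
  generalize (tends_neq (near p) _ _ (cts_sig2_shift beta (P t) Hok a p) Hs).
  apply filter_imp. intros z Hz. rewrite <- sg_0_iff. exact Hz.
Qed.

Lemma near_all (p : C) (l : list nat) (Q : nat -> C -> Prop) :
  (forall k, In k l -> near p (Q k)) -> near p (fun z => forall k, In k l -> Q k z).
Proof.
  induction l as [|k l IH]; intros H.
  - apply filter_forall. intros z k [].
  - generalize (filter_and (F := near p) _ _ (H k (or_introl eq_refl))
      (IH (fun j Hj => H j (or_intror Hj)))). apply filter_imp.
    intros z [K1 K2] j [<-|Hj]; auto.
Qed.

(** Multiplied by z - z_k, h minus its polar part becomes [fd / Gf - gk k * uzeta]. It vanishes at
    z_k since [gk k] is fd(z_k) / D_k, so it can be divided by z - z_k again, and the value there is
    its derivative: [- zptd k] comes from fd', and [- gk k * Llog k] from 1 / [Gf]. *)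
Lemma extends_zk (k : nat) : In k idx -> exists r g, (0 < r)%R /\ holo (Ball (zk k) r) g /\
  (forall z, Ball (zk k) r z -> z <> zk k -> g z = Rf z) /\
  g (zk k) = - zptd k - gk k * Llog k
     - csum (idx_but k) (fun j => gk j * (zeta (zk k - zk j) - h1 * zk k)) + gk k * h1 * zk k.
Proof.
  intros Hk. set (p := zk k).
  assert (Hp : nonpole (P t) p) by (apply zpt_nonpole; auto).
  assert (HD := Dcoef_neq_0 k Hk). assert (HG := Gf_Dcoef k). fold p in HG.
  assert (HGn : Gf k t p <> 0) by (rewrite HG; auto).
  assert (HN : near p (fun z => (nonpole (P t) z /\ Gf k t z <> 0) /\ sinf (z - p) w0 <> 0 /\
     (forall j, In j (idx_but k) -> ~ Lat (z - zk j)) /\ (z <> p -> regular z))).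
  { apply filter_and; apply filter_and; [| |  |apply filter_and].
    - apply nonpole_open_t; auto.
    - apply (tends_neq (near p) (Gf k t) (Gf k t p)); auto.
      eapply holo_cts. apply (holo_Gf k t Ht). auto.
    - apply (tends_neq (near p) (fun z => sinf (z - p) w0) (sinf (p - p) w0)).
      apply (holo_cts everywhere (fun z => sinf (z - p) w0)).
      apply (holo_sinf_shift everywhere t p everywhere_open Ht). exact Logic.I.
      replace (p - p) with (RtoC 0) by ring. apply (near_self _ _ sinf_near_0).
    - apply (near_all p (idx_but k) (fun j z => ~ Lat (z - zk j))). intros j Hj.
      apply in_idx_but in Hj. destruct Hj as [Hj Hjk]. apply notlat_open. apply zpt_distinct; auto.
    - apply punctured_regular. }
  destruct HN as [r [Hr HB]].
  set (N := fun z => fd z / Gf k t z - gk k * uzeta (z - p)).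
  assert (HNh : holo (Ball p r) N).
  { unfold N. apply holo_minus; auto using Ball_open.
    - apply holo_div; auto using Ball_open. intros z Hz; exact (proj2 (proj1 (HB z Hz))).
      eapply holo_sub; [|apply holo_fd]. intros z Hz; exact (proj1 (proj1 (HB z Hz))).
      eapply holo_sub; [|apply (holo_Gf k t Ht)]. intros z Hz; exact (proj1 (proj1 (HB z Hz))).
    - apply holo_mult; auto using Ball_open, holo_const.
      assert (Hsh : holo (Ball p r) (fun z => z - p))
        by (apply holo_minus; auto using Ball_open, holo_id, holo_const).
      unfold uzeta. apply holo_plus; auto using Ball_open, holo_const.
      apply holo_mult; auto using Ball_open. apply holo_div; auto using Ball_open.
      + intros z Hz; exact (proj1 (proj2 (HB z Hz))).
      + apply holo_comp with (V := everywhere) (f := fun u => d_fst sinf u w0); auto using Ball_open.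
        intros; exact Logic.I. apply holo_dsinf, everywhere_open.
      + apply holo_comp with (V := everywhere) (f := fun u => sinf u w0); auto using Ball_open.
        intros; exact Logic.I. apply holo_sinf, everywhere_open. }
  destruct (holo_divide N p r Hr HNh) as [n [Hn [Hnp En]]].
  assert (DN : C_derive N p = - zptd k - gk k * Llog k).
  { apply cderiv_C_derive. unfold N. eapply cderiv_eq. apply cderiv_minus.
    - apply cderiv_div; auto. apply (holo_fd p Hp). apply (cderiv_Gf k Hk).
    - apply cderiv_mult. apply cderiv_const.
      apply (cderiv_comp uzeta (fun z => z - p) p 0 (1 - 0)).
      replace (p - p) with (RtoC 0) by ring. apply cderiv_uzeta_0.
      apply cderiv_minus. apply cderiv_id. apply cderiv_const.
    - cbv beta. unfold p. rewrite (d_fd_zk k Hk), (gk_fd k Hk). fold p. rewrite HG. field. auto. }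
  assert (N0 : N p = 0).
  { unfold N. rewrite HG, (gk_fd k Hk). fold p. replace (p - p) with (RtoC 0) by ring.
    unfold uzeta. field. auto. split; auto. apply (near_self _ _ sinf_near_0). }
  exists r, (fun z => n z - csum (idx_but k) (fun j => gk j * (zeta (z - zk j) - h1 * z)) + gk k * h1 * z).
  split; auto. split; [|split].
  - apply holo_plus; auto using Ball_open. apply holo_minus; auto using Ball_open.
    apply holo_csum_zeta; auto using Ball_open. intros j z Hj Hz.
    exact (proj1 (proj2 (proj2 (HB z Hz))) j Hj).
    apply holo_mult; auto using Ball_open, holo_const, holo_id.
  - intros z Hz Hzp. destruct (HB z Hz) as [[B1 B2] [B3 [B4 B5]]]. specialize (B5 Hzp).
    assert (Hd : z - p <> 0) by (apply Csub_neq_0; auto).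
    assert (HL : ~ Lat (z - p)) by exact (proj2 B5 k Hk).
    specialize (En z Hz). rewrite N0 in En.
    assert (En' : n z = N z / (z - p)) by (rewrite En; field; auto).
    unfold Rf, zsum. rewrite (csum_but k) by auto. fold p.
    rewrite En'. unfold N. rewrite uzeta_eq by auto.
    unfold q. rewrite (fprime_Gf k) by auto. fold (zk k). fold p. field. auto.
  - rewrite Hnp, DN. auto.
Qed.

(** * Behaviour at the pole z0 *)

Definition Uf (s : R) : C -> C := Ufun beta (P s).

Definition Udom (s : R) (u : C) : Prop :=
  sinf (u - zpole (P s)) (om s) <> 0 /\ psigma (P s) (u - Cconj (zpole (P s))) <> 0.

Lemma fprime_Uf (s : R) (u : C) : u - zpole (P s) <> 0 -> Udom s u ->
  fprime beta (P s) u = Uf s u / ((u - zpole (P s)) * (u - zpole (P s))).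
Proof.
  intros Hu [H1 H2]. unfold fprime, integrand, Uf, Ufun.
  replace (psigma (P s) (u - zpole (P s))) with ((u - zpole (P s)) * sinf (u - zpole (P s)) (om s))
    by reflexivity.
  fold (om s). field. auto.
Qed.

Lemma Udom_open (s : R) : I s -> isopen (Udom s).
Proof.
  intros Hs p [H1 H2]. apply filter_and.
  - apply (tends_neq (near p) (fun u => sinf (u - zpole (P s)) (om s)) (sinf (p - zpole (P s)) (om s))); auto.
    apply (holo_cts everywhere (fun u => sinf (u - zpole (P s)) (om s))).
    apply holo_sinf_shift; auto using everywhere_open. exact Logic.I.
  - apply (tends_neq (near p) (fun u => psigma (P s) (u - Cconj (zpole (P s))))
      (psigma (P s) (p - Cconj (zpole (P s))))); auto.
    apply (holo_cts everywhere (fun u => psigma (P s) (u - Cconj (zpole (P s))))).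
    apply holo_psigma_shift; auto using everywhere_open. exact Logic.I.
Qed.

Lemma holo_Uf (s : R) : I s -> holo (Udom s) (Uf s).
Proof.
  intros Hs. assert (HO := Udom_open s Hs). unfold Uf, Ufun.
  apply holo_mult; auto using holo_const. apply holo_div; auto.
  - intros z [H1 H2]. apply Cmult_neq_0; apply Cpow_2_neq_0; auto.
  - apply holo_mult; auto using holo_Cexp_gamma.
    apply (holo_cprod _ _ (fun j u => psigma (P s) (u - zpt (P s) j))); auto using holo_psigma_shift.
  - apply holo_mult; auto; apply holo_pow_2; auto.
    apply (holo_sinf_shift (Udom s) s); auto. apply holo_psigma_shift; auto.
Qed.

Lemma ejd_Uf (u : C) : Udom t u -> ejd (fun u s => Uf s u) u.
Proof.
  intros [H1 H2]. unfold Uf, Ufun. apply (ejd_mult (fun _ s => pc (P s))).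
  { eexists; apply (jd_time I t (fun s => pc (P s))). apply dq_c. }
  apply ejd_div.
  - apply Cmult_neq_0; apply Cpow_2_neq_0; auto.
  - apply ejd_mult. apply ejd_Cexp.
    apply (ejd_cprod idx (fun k u s => psigma (P s) (u - zpt (P s) k))).
    intros j Hj. eapply (ejd_psigma (fun s => zpt (P s) j)). apply jd_zpt; auto.
  - apply ejd_mult; apply ejd_pow2.
    + eapply (ejd_an2 sinf (fun s => zpole (P s))). apply analytic2_sinf. apply jd_zpole.
    + eapply (ejd_psigma (fun s => Cconj (zpole (P s)))). apply jd_zpole_conj.
Qed.

Lemma Udom_joint (z : C) : Udom t z ->
  filter_prod (near z) (tnear I t) (fun x => I (snd x) /\ Udom (snd x) (fst x)).
Proof.
  intros [H1 H2].
  destruct (ejd_an2 sinf (fun s => zpole (P s)) z _ analytic2_sinf (jd_zpole z)) as [l1 L1].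
  destruct (ejd_psigma (fun s => Cconj (zpole (P s))) z _ (jd_zpole_conj z)) as [l2 L2].
  assert (N1 := tends_neq _ _ _ (jd_tends I t HI Ht _ _ _ L1) H1).
  assert (N2 := tends_neq _ _ _ (jd_tends I t HI Ht _ _ _ L2) H2).
  generalize (filter_and (F := filter_prod (near z) (tnear I t)) _ _
    (filter_and (F := filter_prod (near z) (tnear I t)) _ _ N1 N2)
    (near_snd (near z) (tnear I t) _ (tnear_I I t))).
  apply filter_imp. intros [u s] [[K1 K2] [K3 _]]. cbn [fst snd] in *. split; auto. split; auto.
Qed.

Lemma zpole_conj_notin (s : R) : I s -> ~ in_lattice (om s) (zpole (P s) - Cconj (zpole (P s))).
Proof.
  intros Hs. unfold om. rewrite in_lattice_omega2. intros [j [k E]].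
  apply (f_equal Im) in E. unfold zpole in E. simpl in E.
  assert (Hy := ok_y0 _ _ (Hparams s Hs)).
  assert (E1 : (py0 (P s) = IZR k * pm (P s))%R) by lra.
  destruct (Z_lt_le_dec k 1) as [L|L].
  - assert (L' : (k <= 0)%Z) by lia. apply IZR_le in L'.
    assert (0 <= - IZR k * pm (P s))%R by (apply Rmult_le_pos; lra). lra.
  - apply IZR_le in L. assert (1 * pm (P s) <= IZR k * pm (P s))%R
      by (apply Rmult_le_compat_r; lra). lra.
Qed.

Lemma Udom_zpole (s : R) : I s -> Udom s (zpole (P s)).
Proof.
  intros Hs. split.
  - replace (zpole (P s) - zpole (P s)) with (RtoC 0) by ring. rewrite sinf_0 by (apply om_upper; auto).
    intros E; apply RtoC_inj in E; lra.
  - apply sig2_nonzero. apply om_upper; auto. apply zpole_conj_notin; auto.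
Qed.

Lemma Uf_residue (s : R) : I s -> residue beta (P s) = - Uf s (zpole (P s)).
Proof.
  intros Hs. assert (H2 := proj2 (Udom_zpole s Hs)). unfold residue, Uf, Ufun. fold (om s).
  replace (zpole (P s) - zpole (P s)) with (RtoC 0) by ring. rewrite sinf_0 by (apply om_upper; auto).
  field. auto.
Qed.

Definition Ud (u : C) : C := epsilon (inhabits (RtoC 0)) (fun l => jd I t (fun u s => Uf s u) u l).

Lemma jd_Uf (u : C) : Udom t u -> jd I t (fun u s => Uf s u) u (Ud u).
Proof. intros Hu. unfold Ud. apply epsilon_spec. apply ejd_Uf; auto. Qed.

Lemma Ud_local : exists r, (0 < r)%R /\ (forall u, Ball z0 r u -> Udom t u) /\ holo (Ball z0 r) Ud /\
  jd I t (fun u s => C_derive (Uf s) u) z0 (C_derive Ud z0).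
Proof.
  assert (Hz : Udom t z0) by (apply Udom_zpole; auto).
  destruct (Udom_joint z0 Hz) as [Q1 Q2 HQ1 HQ2 HQ].
  destruct (filter_and _ _ HQ1 (Udom_open t Ht z0 Hz)) as [r [Hr HB]].
  exists r. split; auto. split. intros u Hu; exact (proj2 (HB u Hu)).
  assert (Hs : tnear I t (fun s => holo (Ball z0 r) (Uf s))).
  { revert HQ2. apply filter_imp. intros s Hs2. eapply holo_sub; [|apply (holo_Uf s)].
    - intros u Hu. destruct (HB u Hu) as [K1 _]. apply (HQ u s K1 Hs2).
    - destruct (HB z0 (Ball_center z0 r Hr)) as [K1 _]. apply (HQ z0 s K1 Hs2). }
  destruct (jd_holo_limit I t HI Ht (fun u s => Uf s u) Ud z0 r) as [W1 W2]; auto.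
  - intros u Hu. apply jd_Uf. exact (proj2 (HB u Hu)).
  - eapply holo_sub; [|apply (holo_Uf t Ht)]. intros u Hu. exact (proj2 (HB u Hu)).
  - split; auto. apply W2. apply Ball_center; auto.
Qed.

Lemma cderiv_Uf_zpole (s : R) : I s -> cderiv (Uf s) (zpole (P s)) 0.
Proof.
  intros Hs. apply (cderiv_Ufun_zpole beta (P s)); auto.
  - intros k Hk. assert (N := zpt_nonpole s k Hs Hk).
    unfold nonpole in N. rewrite is_pole_iff in N.
    apply notin_lattice_sym. tauto.
  - apply (zpole_conj_notin s Hs).
Qed.

Lemma Uf_z0_neq_0 : Uf t z0 <> 0.
Proof.
  destruct (Udom_zpole t Ht) as [H1 H2]. unfold Uf, Ufun.
  apply Cmult_neq_0; [apply c_neq_0|]. apply Cmult_neq_0.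
  - apply Cmult_neq_0; [apply Cexp_neq_0|]. apply cprod_neq_0. intros k Hk E.
    apply sg_0_iff in E. apply notin_lattice_sym in E; auto. apply zpt_zpole_notin; auto.
  - apply Cinv_nonzero. apply Cmult_neq_0; apply Cpow_2_neq_0; auto.
Qed.

Lemma dq_zpole : tends (tnear I t) (dquot (fun s => zpole (P s)) t) z0d.
Proof. apply (jd_at I t HI Ht (fun _ s => zpole (P s)) 0). apply jd_zpole. Qed.

Lemma holo_Uf_near (r : R) : (forall u, Ball z0 r u -> Udom t u) -> holo (Ball z0 r) (Uf t).
Proof. intros H. eapply holo_sub; [exact H|apply holo_Uf; auto]. Qed.

(** U_s'(zpole(s)) = 0 holds at all times s; this is its total derivative along the moving pole. *)
Lemma residue_derivative : C_derive Ud z0 + C_derive (C_derive (Uf t)) z0 * z0d = 0.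
Proof.
  destruct Ud_local as [r [Hr [HU [_ HJ]]]].
  apply (tends_unique (tnear I t) (dquot (fun s => C_derive (Uf s) (zpole (P s))) t)).
  - apply (jd_move I t HI Ht (fun u s => C_derive (Uf s) u) (fun s => zpole (P s))); auto.
    + apply (holo_derive (Ball z0 r) (Uf t)); auto using Ball_open, holo_Uf_near, Ball_center.
    + apply dq_zpole.
  - apply tends_ext with (fun _ => RtoC 0). typeclasses eauto. 2: apply tends_const; typeclasses eauto.
    generalize (tnear_I I t). apply filter_imp. intros s [Hs _]. unfold dquot.
    rewrite (cderiv_C_derive _ _ _ (cderiv_Uf_zpole s Hs)), (cderiv_C_derive _ _ _ (cderiv_Uf_zpole t Ht)).
    unfold Cdiv. ring.
Qed.

(** The time derivative of f' = U / (z - z0)^2 at fixed z; the second term is due to the motion of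
    z0. *)
Lemma fd_derive_near_z0 (z : C) : nonpole (P t) z -> Udom t z -> z <> z0 ->
  C_derive fd z = Ud z / ((z - z0) * (z - z0)) +
     2 * Uf t z * z0d / ((z - z0) * (z - z0) * (z - z0)).
Proof.
  intros Hz HU Hn. assert (Hd : z - z0 <> 0) by (apply Csub_neq_0; auto).
  apply (jd_unique I t HI Ht (fun u s => fprime beta (P s) u) z).
  - apply jd_fprime; auto.
  - assert (J1 := jd_shift (fun s => zpole (P s)) z z0d (jd_zpole z)).
    assert (J2 := jd_mult I t HI Ht _ _ _ _ _ J1 J1).
    assert (J3 := jd_div I t HI Ht _ _ _ _ _ (Cmult_neq_0 _ _ Hd Hd) (jd_Uf z HU) J2).
    cbv beta in J3.
    eapply jd_eq. eapply jd_ext_loc; [exact HI|exact Ht| | |exact J3].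
    + assert (HN : near z (fun u => u <> z0)).
      { apply (tends_neq (near z) (fun u => u - z0) (z - z0)) in Hd.
        revert Hd. apply filter_imp. intros u Hu E. apply Hu. rewrite E. ring.
        apply cts_minus. apply cts_id. apply cts_const. }
      generalize (filter_and (F := near z) _ _ HN (Udom_open t Ht z HU)). apply filter_imp.
      intros u [Hu1 Hu2]. symmetry. apply fprime_Uf; auto. apply Csub_neq_0. exact Hu1.
    + assert (HN := tends_neq _ _ _ (jd_tends I t HI Ht _ _ _ J1) Hd).
      generalize (filter_and (F := filter_prod (near z) (tnear I t)) _ _ HN (Udom_joint z HU)).
      apply filter_imp. intros [u s] [Hu1 [Hu2 Hu3]]. cbn [fst snd] in *. symmetry.
      apply fprime_Uf; auto.
    + fold z0. field. auto.
Qed.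

(* With [w = z - z0]: since [U'(z0) = 0], also after differentiation in t, the derivative of [fd] has
   no residue at [z0], and integrating it gives [fd = - Ud(z0) / w - z0d U(z0) / w^2 + holomorphic]. *)
Lemma h_at_z0 : exists r H, (0 < r)%R /\ holo (Ball z0 r) H /\
  (forall z, Ball z0 r z -> z <> z0 -> H z = fd z / q z) /\
  H z0 = - z0d /\ C_derive H z0 = - (Ud z0 / Uf t z0).
Proof.
  destruct Ud_local as [r1 [Hr1 [HU1 [HUd1 _]]]].
  assert (HU0 := Uf_z0_neq_0).
  assert (HN : near z0 (fun z => Ball z0 r1 z /\ Uf t z <> 0 /\ (z <> z0 -> regular z))).
  { apply filter_and; [|apply filter_and].
    - apply Ball_open. apply Ball_center; auto.
    - apply (tends_neq (near z0) (Uf t) (Uf t z0)); auto.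
      eapply holo_cts. apply (holo_Uf t Ht). apply Udom_zpole; auto.
    - apply punctured_regular. }
  destruct HN as [r [Hr HB]].
  assert (HBU : forall u, Ball z0 r u -> Udom t u) by (intros u Hu; apply HU1; exact (proj1 (HB u Hu))).
  assert (hU := holo_Uf_near r HBU).
  assert (hUd : holo (Ball z0 r) Ud).
  { eapply holo_sub; [|exact HUd1]. intros u Hu; exact (proj1 (HB u Hu)). }
  assert (hw : holo (Ball z0 r) (fun z => z - z0))
    by (apply holo_minus; auto using Ball_open, holo_id, holo_const).
  assert (HC := Ball_center z0 r Hr).
  set (U := Uf t) in *.
  (* Two divisions give U = U(z0) + (z - z0)^2 b, as U'(z0) = 0; then b(z0) = U''(z0) / 2. *)
  destruct (holo_divide U z0 r Hr hU) as [a1 [ha1 [Ea1 Ea]]].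
  assert (U'0 : C_derive U z0 = 0) by (apply cderiv_C_derive; apply (cderiv_Uf_zpole t Ht)).
  destruct (holo_divide a1 z0 r Hr ha1) as [b [hb [Eb1 Eb]]].
  rewrite Ea1, U'0 in Eb.
  assert (EU : forall z, Ball z0 r z -> U z = U z0 + (z - z0) * ((z - z0) * b z)).
  { intros z Hz. rewrite (Ea z Hz), (Eb z Hz). ring. }
  assert (U''0 : C_derive (C_derive U) z0 = 2 * b z0).
  { apply cderiv_C_derive.
    apply cderiv_ext with (fun z => 2 * (z - z0) * b z + (z - z0) * (z - z0) * C_derive b z).
    - generalize (Ball_open z0 r z0 HC). apply filter_imp. intros z Hz. symmetry.
      apply cderiv_C_derive.
      apply cderiv_ext with (fun z => U z0 + (z - z0) * ((z - z0) * b z)).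
      + generalize (Ball_open z0 r z Hz). apply filter_imp. intros u Hu. symmetry; auto.
      + assert (Dw : cderiv (fun u => u - z0) z (1 - 0))
          by (apply cderiv_minus; [apply cderiv_id|apply cderiv_const]).
        eapply cderiv_eq. apply cderiv_plus. apply cderiv_const.
        apply cderiv_mult. exact Dw. apply cderiv_mult. exact Dw. apply hb; auto. cbv beta. ring.
    - assert (Dw : cderiv (fun u => u - z0) z0 (1 - 0))
          by (apply cderiv_minus; [apply cderiv_id|apply cderiv_const]).
      assert (hb' := holo_derive _ _ (Ball_open z0 r) hb).
      eapply cderiv_eq. apply cderiv_plus.
      apply cderiv_mult. apply cderiv_mult. apply cderiv_const. exact Dw. apply hb; auto.
      apply cderiv_mult. apply cderiv_mult. exact Dw. exact Dw. apply hb'; auto.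
      cbv beta. ring. }
  destruct (holo_divide Ud z0 r Hr hUd) as [e [he [Ee1 Ee]]].
  assert (HR := residue_derivative). fold U in HR. rewrite U''0, <- Ee1 in HR.
  (* m / (z - z0) is what remains of fd' after its explicit terms of order -2 and -3. By
     [residue_derivative] m vanishes at z0, so this remainder is holomorphic and has a primitive
     [Th]. *)
  set (m := fun z => e z + 2 * b z * z0d).
  assert (hm : holo (Ball z0 r) m).
  { unfold m. apply holo_plus; auto using Ball_open. apply holo_mult; auto using Ball_open, holo_const.
    apply holo_mult; auto using Ball_open, holo_const. }
  assert (m0 : m z0 = 0) by exact HR.
  destruct (holo_divide m z0 r Hr hm) as [k [hk [_ Ek]]]. rewrite m0 in Ek.
  destruct (holo_primitive k z0 r hk) as [Th [hTh DTh]].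
  (* fd minus the explicit primitive of fd': its derivative is 0 on the punctured disc, hence it is
     constant there. *)
  set (Phi := fun z => fd z + Ud z0 / (z - z0) + U z0 * z0d / ((z - z0) * (z - z0)) - Th z).
  assert (Hreg : forall z, Ball z0 r z -> z <> z0 -> regular z).
  { intros z Hz Hn. exact (proj2 (proj2 (HB z Hz)) Hn). }
  assert (HPhi : forall z, Ball z0 r z -> z <> z0 -> cderiv Phi z 0).
  { intros z Hz Hn. assert (Hd : z - z0 <> 0) by (apply Csub_neq_0; auto).
    assert (Hnp := proj1 (Hreg z Hz Hn)).
    assert (Dw : cderiv (fun u => u - z0) z (1 - 0))
      by (apply cderiv_minus; [apply cderiv_id|apply cderiv_const]).
    unfold Phi. eapply cderiv_eq. apply cderiv_minus; [|apply DTh; auto].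
    apply cderiv_plus. apply cderiv_plus. apply (holo_fd z Hnp).
    apply (cderiv_div (fun _ => Ud z0) (fun z => z - z0)). exact Hd. apply cderiv_const. exact Dw.
    apply (cderiv_div (fun _ => U z0 * z0d) (fun z => (z - z0) * (z - z0))).
    apply Cmult_neq_0; exact Hd. apply cderiv_const.
    apply (cderiv_mult (fun z => z - z0) (fun z => z - z0)); exact Dw.
    cbv beta. rewrite (fd_derive_near_z0 z Hnp (HBU z Hz) Hn). fold U.
    rewrite (EU z Hz), (Ee z Hz).
    assert (Ekz : k z = m z / (z - z0)) by (rewrite (Ek z Hz); field; auto).
    rewrite Ekz. unfold m. field. auto. }
  set (p0 := z0 + RtoC (r / 2)).
  assert (Hp0 : Ball z0 r p0).
  { unfold Ball, p0. replace (z0 + (r / 2)%R - z0) with (RtoC (r / 2)) by ring.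
    rewrite Cmod_R, Rabs_pos_eq; lra. }
  assert (Hp0n : p0 <> z0).
  { intros E0. assert (E1 : RtoC (r / 2) = RtoC 0).
    { replace (RtoC (r / 2)) with (p0 - z0) by (unfold p0; ring). rewrite E0; ring. }
    apply RtoC_inj in E1. lra. }
  set (K0 := Phi p0).
  assert (Efd : forall z, Ball z0 r z -> z <> z0 ->
    fd z = K0 + Th z - Ud z0 / (z - z0) - U z0 * z0d / ((z - z0) * (z - z0))).
  { intros z Hz Hn. assert (E0 : Phi z = K0) by (apply (punctured_const Phi z0 z p0 r); auto).
    rewrite <- E0. unfold Phi. ring. }
  (* fd / f' with numerator and denominator multiplied by (z - z0)^2, which leaves U in the
     denominator. *)
  set (H := fun z => ((z - z0) * (z - z0) * (K0 + Th z) - Ud z0 * (z - z0) - U z0 * z0d) / U z).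
  assert (HUn : forall z, Ball z0 r z -> U z <> 0) by (intros z Hz; exact (proj1 (proj2 (HB z Hz)))).
  exists r, H. split; auto. split; [|split; [|split]].
  - unfold H. apply holo_div; auto using Ball_open.
    apply holo_minus; auto using Ball_open, holo_const. apply holo_minus; auto using Ball_open.
    apply holo_mult; auto using Ball_open. apply holo_mult; auto using Ball_open.
    apply holo_plus; auto using Ball_open, holo_const.
    apply holo_mult; auto using Ball_open, holo_const.
  - intros z Hz Hn. assert (Hd : z - z0 <> 0) by (apply Csub_neq_0; auto).
    rewrite (Efd z Hz Hn). unfold q. rewrite fprime_Uf by auto. fold z0. fold U. unfold H.
    assert (Hu := HUn z Hz). field. auto.
  - unfold H. field. apply HUn; auto.
  - apply cderiv_C_derive. unfold H.
    assert (Dw : cderiv (fun u => u - z0) z0 (1 - 0))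
      by (apply cderiv_minus; [apply cderiv_id|apply cderiv_const]).
    eapply cderiv_eq. apply cderiv_div. apply HUn; auto.
    apply cderiv_minus. apply cderiv_minus. apply cderiv_mult. apply cderiv_mult; exact Dw.
    apply cderiv_plus. apply cderiv_const. apply DTh; auto.
    apply cderiv_mult. apply cderiv_const. exact Dw. apply cderiv_const.
    apply hU; auto.
    cbv beta. rewrite U'0. field. apply HUn; auto.
Qed.

Lemma zpole_zpt_notin (k : nat) : In k idx -> ~ Lat (z0 - zk k).
Proof. intros Hk. apply notin_lattice_sym. apply zpt_zpole_notin; auto. Qed.

Lemma holo_zsum (p : C) : (forall k, In k idx -> ~ Lat (p - zk k)) ->
  exists r, (0 < r)%R /\ holo (Ball p r) zsum.
Proof.
  intros Hp.
  destruct (near_all p idx (fun k z => ~ Lat (z - zk k))) as [r [Hr HB]].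
  { intros k Hk. apply notlat_open; auto. }
  exists r. split; auto. apply holo_csum_zeta. apply Ball_open.
  intros k z Hk Hz. apply (HB z Hz); auto.
Qed.

Lemma extends_of_h (p : C) (r : R) (H : C -> C) : (0 < r)%R -> holo (Ball p r) H ->
  (forall z, Ball p r z -> z <> p -> H z = fd z / q z) ->
  (forall k, In k idx -> ~ Lat (p - zk k)) -> extends_at p.
Proof.
  intros Hr HH E Hp. destruct (holo_zsum p Hp) as [r' [Hr' Hz]].
  exists (Rmin r r'), (fun z => H z - zsum z). split; [apply Rmin_pos; auto|].
  assert (B1 : forall z, Ball p (Rmin r r') z -> Ball p r z)
    by (intros z K; unfold Ball in *; eapply Rlt_le_trans; [exact K|apply Rmin_l]).
  assert (B2 : forall z, Ball p (Rmin r r') z -> Ball p r' z)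
    by (intros z K; unfold Ball in *; eapply Rlt_le_trans; [exact K|apply Rmin_r]).
  split.
  - apply holo_minus; auto using Ball_open.
    exact (holo_sub _ _ _ B1 HH). exact (holo_sub _ _ _ B2 Hz).
  - intros z Kz Kn. unfold Rf. rewrite E by auto. auto.
Qed.

Lemma extends_z0 : extends_at z0.
Proof.
  destruct h_at_z0 as [r [H [Hr [HH [E _]]]]]. apply (extends_of_h z0 r H); auto using zpole_zpt_notin.
Qed.

Lemma conj_Ball (p z : C) (r : R) : Ball (Cconj p) r z -> Ball p r (Cconj z).
Proof. unfold Ball. rewrite <- (Cmod_conj (Cconj z - p)), Cminus_conj, Cconj_conj. auto. Qed.

(** The reflection factor exp(2 i theta) is common to fd and f' and cancels in h, so the extension
    at z0 can be reflected. *)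
Lemma extends_z0_conj : extends_at (Cconj z0).
Proof.
  destruct h_at_z0 as [r [H [Hr [HH [E _]]]]].
  destruct (punctured_regular z0) as [r' [Hr' Hreg]].
  apply (extends_of_h (Cconj z0) (Rmin r r') (fun z => Cconj (H (Cconj z)))).
  - apply Rmin_pos; auto.
  - eapply holo_sub; [|apply (holo_reflect (Ball z0 r) H (Ball_open z0 r) HH)].
    intros z Hz. apply conj_Ball. unfold Ball in *. eapply Rlt_le_trans; [exact Hz|apply Rmin_l].
  - intros z Hz Hn.
    assert (Hz' : Ball z0 r (Cconj z)).
    { apply conj_Ball. unfold Ball in *. eapply Rlt_le_trans; [exact Hz|apply Rmin_l]. }
    assert (Hn' : Cconj z <> z0) by (intros E'; apply Hn; rewrite <- E', Cconj_conj; auto).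
    assert (Hrg : regular (Cconj z)).
    { apply Hreg; auto. apply (conj_Ball z0 z r'). unfold Ball in *.
      eapply Rlt_le_trans; [exact Hz|apply Rmin_r]. }
    rewrite (E _ Hz' Hn').
    rewrite Cdiv_conj by (apply regular_q; auto).
    assert (E1 := fd_reflect _ (proj1 Hrg)). assert (E2 := q_reflect _ (proj1 Hrg)).
    rewrite Cconj_conj in E1, E2. rewrite E1, E2.
    assert (Hq : Cconj (q (Cconj z)) <> 0).
    { intros E0. apply (regular_q _ Hrg). rewrite <- (Cconj_conj (q (Cconj z))), E0.
      unfold Cconj, RtoC; simpl; f_equal; ring. }
    assert (He := Cexp_neq_0 (Ci * (2 * theta))). field. auto.
  - intros k Hk. apply notin_lattice_sym. apply zpt_zpole_notin; auto.
Qed.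

(** * The entire extension and its constancy *)

Lemma extends_everywhere (p : C) : extends_at p.
Proof.
  destruct (classic (Lat (p - z0))) as [H|H0].
  { replace p with (z0 + (p - z0)) by ring. apply extends_lattice; auto. apply extends_z0. }
  destruct (classic (Lat (p - Cconj z0))) as [H|H1].
  { replace p with (Cconj z0 + (p - Cconj z0)) by ring. apply extends_lattice; auto.
    apply extends_z0_conj. }
  destruct (classic (exists k, In k idx /\ Lat (p - zk k))) as [[k [Hk H]]|H2].
  { replace p with (zk k + (p - zk k)) by ring. apply extends_lattice; auto.
    destruct (extends_zk k Hk) as [r [g [Hr [Hg [E _]]]]]. exists r, g. auto. }
  apply extends_regular. split. apply nonpole_lat; auto.
  intros k Hk HL. apply H2. exists k; auto.
Qed.

(** The value at p of some local extension; by [Rt_spec] all extensions give the same value. *)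
Definition Rt (p : C) : C :=
  epsilon (inhabits (RtoC 0)) (fun v => exists r g, (0 < r)%R /\ holo (Ball p r) g /\
    (forall z, Ball p r z -> z <> p -> g z = Rf z) /\ g p = v).

Lemma Rt_spec (p : C) (r : R) (g : C -> C) : (0 < r)%R -> holo (Ball p r) g ->
  (forall z, Ball p r z -> z <> p -> g z = Rf z) -> Rt p = g p.
Proof.
  intros Hr Hg E. unfold Rt.
  match goal with |- epsilon ?i ?Q = _ => assert (K : Q (epsilon i Q)) end.
  { apply epsilon_spec. exists (g p), r, g. auto. }
  destruct K as [r' [g' [Hr' [Hg' [E' <-]]]]].
  apply cts_punctured_eq.
  - eapply holo_cts; [exact Hg'|]. apply Ball_center; auto.
  - eapply holo_cts; [exact Hg|]. apply Ball_center; auto.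
  - generalize (filter_and (F := pnear p) _ _ (filter_and (F := pnear p) _ _
      (pnear_of_near p _ (near_ball p r Hr)) (pnear_of_near p _ (near_ball p r' Hr'))) (pnear_neq p)).
    apply filter_imp. intros z [[K1 K2] K3]. rewrite E, E'; auto.
Qed.

Lemma Rt_local (p : C) : exists r g, (0 < r)%R /\ holo (Ball p r) g /\
  (forall z, Ball p r z -> z <> p -> g z = Rf z) /\ (forall z, Ball p r z -> Rt z = g z).
Proof.
  destruct (extends_everywhere p) as [r [g [Hr [Hg E]]]]. exists r, g. repeat (split; auto).
  intros z Hz. destruct (Ceq_dec z p) as [->|N]. apply Rt_spec with r; auto.
  assert (HN : near z (fun u => Ball p r u /\ u <> p)).
  { apply filter_and. apply Ball_open; auto.
    assert (Hd : z - p <> 0) by (apply Csub_neq_0; auto).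
    apply (tends_neq (near z) (fun u => u - p) (z - p)) in Hd.
    revert Hd. apply filter_imp. intros u Hu E'. apply Hu. rewrite E'. ring.
    apply cts_minus. apply cts_id. apply cts_const. }
  destruct HN as [d [Hd HB]]. apply Rt_spec with d; auto.
  - eapply holo_sub; [|exact Hg]. intros u Hu; apply (HB u Hu).
  - intros u Hu _. apply E; apply (HB u Hu).
Qed.

Lemma Rt_punctured (p : C) : pnear p (fun z => Rt z = Rf z).
Proof.
  destruct (Rt_local p) as [r [g [Hr [Hg [E1 E2]]]]]. exists r. split; auto.
  intros z Hz Hn. rewrite E2, E1; auto.
Qed.

Lemma holo_Rt : holo everywhere Rt.
Proof.
  intros p _. destruct (Rt_local p) as [r [g [Hr [Hg [E1 E2]]]]].
  apply (holo_ext (Ball p r) g Rt (Ball_open p r)); auto.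
  intros z Hz; symmetry; auto. apply Ball_center; auto.
Qed.

Lemma Rt_shift (tau c : C) : (forall z, regular z -> Rf (z + tau) = Rf z + c) ->
  forall p, Rt (p + tau) = Rt p + c.
Proof.
  intros HR p.
  apply (cts_punctured_eq (fun z => Rt (z + tau)) (fun z => Rt z + c) p).
  - apply (holo_cts everywhere (fun z => Rt (z + tau))). apply holo_shift. apply holo_Rt. exact Logic.I.
  - apply cts_plus. eapply holo_cts. apply holo_Rt. exact Logic.I. apply cts_const.
  - assert (K := Rt_punctured (p + tau)). destruct K as [d [Hd HK]].
    assert (K2 := punctured_regular p).
    generalize (filter_and (F := pnear p) _ _ (filter_and (F := pnear p) _ _ (Rt_punctured p)
       (pnear_of_near p _ K2)) (filter_and (F := pnear p) _ _ (pnear_of_near p _ (near_ball p d Hd)) (pnear_neq p))).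
    apply filter_imp. intros z [[A B] [D E]].
    rewrite HK. rewrite HR by auto. rewrite A. auto.
    replace (z + tau - (p + tau)) with (z - p) by ring. auto.
    intros E'. apply E. replace z with (z + tau - tau) by ring. rewrite E'. ring.
Qed.

(** [Rt] gains the constant [Rper] along w0, so Liouville's theorem is applied to its derivative,
    which is doubly periodic. Hence [Rt] has second derivative 0 and is affine, and 1-periodicity
    removes the slope. *)
Lemma Rt_const (p : C) : Rt p = Rt 0.
Proof.
  assert (S1 := Rt_shift 1 0).
  assert (P1 : forall z, Rt (z + 1) = Rt z).
  { intros z. rewrite S1. ring. intros u Hu. rewrite Rf_period_1 by auto. ring. }
  assert (PW := Rt_shift w0 Rper Rf_period_w).
  assert (HR := holo_Rt). assert (HdR := holo_derive _ _ everywhere_open HR).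
  assert (D0 : forall z, C_derive (C_derive Rt) z = 0).
  { apply (liouville_doubly_periodic (C_derive Rt) (2 * pm (P t))); auto.
    - assert (Hm := ok_m _ _ Hok). lra.
    - intros z. apply C_derive_periodic; auto.
    - intros z. replace (Ci * (2 * pm (P t))%R) with w0
        by (unfold w0, om, omega2; rewrite RtoC_mult; ring).
      rewrite <- (C_derive_shift Rt) by auto. apply cderiv_C_derive.
      apply cderiv_ext with (fun u => Rt u + Rper). apply filter_forall. intros; symmetry; apply PW.
      eapply cderiv_eq. apply cderiv_plus. apply (HR z Logic.I). apply cderiv_const. ring. }
  assert (Dc : forall z, C_derive Rt z = C_derive Rt 0).
  { intros z. symmetry. apply (segment_const (C_derive Rt) 0 z). intros s _.
    eapply cderiv_eq. apply (HdR _ Logic.I). apply D0. }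
  assert (L : forall a b, Rt b - C_derive Rt 0 * b = Rt a - C_derive Rt 0 * a).
  { intros a b. symmetry. apply (segment_const (fun z => Rt z - C_derive Rt 0 * z) a b). intros s _.
    eapply cderiv_eq. apply cderiv_minus. apply (HR _ Logic.I). apply cderiv_mult.
    apply cderiv_const. apply cderiv_id. cbv beta. rewrite Dc. ring. }
  assert (Z : C_derive Rt 0 = 0).
  { assert (K := L 0 1). assert (K1 := P1 0). replace (0 + 1) with (RtoC 1) in K1 by ring.
    rewrite K1 in K.
    replace (C_derive Rt 0) with (Rt 0 - C_derive Rt 0 * 0 - (Rt 0 - C_derive Rt 0 * 1)) by ring.
    rewrite <- K. ring. }
  assert (K := L 0 p). rewrite Z in K. replace (Rt p) with (Rt p - 0 * p) by ring. rewrite K. ring.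
Qed.

(** * The differential equations *)

Lemma extension_at_zpt (k : nat) : In k idx ->
  Rt 0 = - zptd k - gk k * Llog k
     - csum (idx_but k) (fun j => gk j * (zeta (zk k - zk j) - h1 * zk k)) + gk k * h1 * zk k.
Proof.
  intros Hk. destruct (extends_zk k Hk) as [r [g [Hr [Hg [E V]]]]].
  rewrite <- V, <- (Rt_const (zk k)). apply Rt_spec with r; auto.
Qed.

Lemma h_identity : exists r H, (0 < r)%R /\ holo (Ball z0 r) H /\
  (forall z, Ball z0 r z -> H z = Rt 0 + zsum z) /\
  H z0 = - z0d /\ C_derive H z0 = - (Ud z0 / Uf t z0).
Proof.
  destruct h_at_z0 as [r [H [Hr [HH [E [V1 V2]]]]]].
  destruct (holo_zsum z0 zpole_zpt_notin) as [r' [Hr' Hz]].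
  destruct (Rt_punctured z0) as [d [Hd Hp]].
  set (r1 := Rmin r (Rmin r' d)).
  assert (Hr1 : (0 < r1)%R) by (repeat apply Rmin_pos; auto).
  assert (B : forall z, Ball z0 r1 z -> Ball z0 r z /\ Ball z0 r' z /\ Ball z0 d z).
  { intros z K. unfold Ball in *. unfold r1 in K. repeat split.
    eapply Rlt_le_trans; [exact K|apply Rmin_l].
    eapply Rlt_le_trans; [exact K|]. eapply Rle_trans; [apply Rmin_r|apply Rmin_l].
    eapply Rlt_le_trans; [exact K|]. eapply Rle_trans; [apply Rmin_r|apply Rmin_r]. }
  exists r1, H. split; auto. split. { eapply holo_sub; [|exact HH]. intros z Kz; apply (B z Kz). }
  assert (Ep : forall z, Ball z0 r1 z -> z <> z0 -> H z = Rt 0 + zsum z).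
  { intros z Kz Kn. destruct (B z Kz) as [B1 [B2 B3]]. rewrite (E z B1 Kn).
    rewrite <- (Rt_const z). rewrite (Hp z B3 Kn). unfold Rf. ring. }
  split; auto. intros z Kz. destruct (Ceq_dec z z0) as [->|N]; auto.
  apply (cts_punctured_eq H (fun z => Rt 0 + zsum z)).
  - eapply holo_cts; [exact HH|]. apply Ball_center; auto.
  - apply cts_plus. apply cts_const. eapply holo_cts; [exact Hz|]. apply Ball_center; auto.
  - exists r1. split; auto.
Qed.

Lemma extension_at_zpole : - z0d = Rt 0 + zsum z0.
Proof.
  destruct h_identity as [r [H [Hr [_ [E [V _]]]]]]. rewrite <- V. apply E. apply Ball_center; auto.
Qed.

Lemma cderiv_zsum (z : C) : (forall k, In k idx -> ~ Lat (z - zk k)) ->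
  cderiv zsum z (- csum idx (fun k => gk k * (pwp (P t) (z - zk k) + h1))).
Proof.
  intros Hz. 
  assert (K : forall l, (forall k, In k l -> ~ Lat (z - zk k)) ->
    cderiv (fun z => csum l (fun k => gk k * (zeta (z - zk k) - h1 * z))) z
     (- csum l (fun k => gk k * (pwp (P t) (z - zk k) + h1)))).
  { induction l as [|k l IH]; intros H.
    - eapply cderiv_eq. apply (cderiv_const 0). unfold csum; simpl. ring.
    - eapply cderiv_eq.
      apply (cderiv_plus (fun z => gk k * (zeta (z - zk k) - h1 * z))
        (fun z => csum l (fun k => gk k * (zeta (z - zk k) - h1 * z)))).
      + apply cderiv_mult. apply cderiv_const. apply cderiv_minus.
        * apply (cderiv_comp zeta (fun z => z - zk k)).
          apply (cderiv_wzeta w0 (z - zk k) Hw0). apply H; left; auto.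
          apply cderiv_minus. apply cderiv_id. apply cderiv_const.
        * apply cderiv_mult. apply cderiv_const. apply cderiv_id.
      + apply IH. intros; apply H; right; auto.
      + change (csum (k :: l) (fun k => gk k * (pwp (P t) (z - zk k) + h1))) with
          (gk k * (pwp (P t) (z - zk k) + h1) + csum l (fun k => gk k * (pwp (P t) (z - zk k) + h1))).
        unfold pwp at 2, wp. change (omega2 (P t)) with w0.
        rewrite (cderiv_C_derive _ _ _ (cderiv_wzeta w0 (z - zk k) Hw0 (H k (or_introl eq_refl)))).
        generalize ((d_fst (d_fst sig2) (z - zk k) w0 * sig2 (z - zk k) w0 - d_fst sig2 (z - zk k) w0 * d_fst sig2 (z - zk k) w0) /
    (sig2 (z - zk k) w0 * sig2 (z - zk k) w0)).
        intros X. ring. }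
  apply K. exact Hz.
Qed.

(** Both expressions for h, the local one at z0 and the constant plus [zsum], are differentiated at
    z0. *)
Lemma log_residue_ode : Ud z0 / Uf t z0 = csum idx (fun k => gk k * (pwp (P t) (z0 - zk k) + h1)).
Proof.
  destruct h_identity as [r [H [Hr [HH [E [_ V]]]]]].
  assert (D : C_derive H z0 = - csum idx (fun k => gk k * (pwp (P t) (z0 - zk k) + h1))).
  { apply cderiv_C_derive. apply cderiv_ext with (fun z => Rt 0 + zsum z).
    - generalize (near_ball z0 r Hr). apply filter_imp. intros z Hz. symmetry. apply E. exact Hz.
    - eapply cderiv_eq. apply cderiv_plus. apply cderiv_const. apply cderiv_zsum.
      intros; apply zpole_zpt_notin; auto. ring. }
  rewrite V in D.
  replace (Ud z0 / Uf t z0) with (- - (Ud z0 / Uf t z0)) by ring. rewrite D. ring.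
Qed.

(** The residue is -U(z0). Since U'(z0) = 0, the motion of z0 does not contribute to its time
    derivative, and division by the residue gives the derivative of the logarithm. *)
Lemma dot_log_residue (a : R -> C) : smoothC I a -> (forall s, I s -> Cexp (a s) = residue beta (P s)) ->
  dotC I a t = Ud z0 / Uf t z0.
Proof.
  intros Ha Hr. assert (Da := smoothC_tends I a t HI Ht Ha).
  destruct Ud_local as [r [Hr0 [HU _]]].
  assert (HU0 : Udom t z0) by (apply Udom_zpole; auto).
  assert (L : tends (tnear I t) (dquot (fun s => Cexp (a s)) t) (0 + Cexp (a t) * dotC I a t)).
  { apply (jd_move I t HI Ht (fun u _ => Cexp u) a); auto.
    apply jd_space; auto. apply cts_Cexp. apply cderiv_Cexp. }
  assert (L2 : tends (tnear I t) (dquot (fun s => Uf s (zpole (P s))) t) (Ud z0 + 0 * z0d)).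
  { apply (jd_move I t HI Ht (fun u s => Uf s u) (fun s => zpole (P s))).
    apply jd_Uf; auto. apply cderiv_Uf_zpole; auto. apply dq_zpole. }
  assert (E : 0 + Cexp (a t) * dotC I a t = - (Ud z0 + 0 * z0d)).
  { apply (tends_unique (tnear I t) (dquot (fun s => Cexp (a s)) t)); auto.
    eapply tends_ext; [typeclasses eauto| |apply tends_opp; [typeclasses eauto|exact L2]].
    generalize (tnear_I I t). apply filter_imp. intros s [Hs _]. unfold dquot.
    rewrite !Hr, !Uf_residue by auto. unfold Cdiv. ring. }
  rewrite Hr, Uf_residue in E by auto. fold z0 in E.
  assert (HUn := Uf_z0_neq_0).
  replace (dotC I a t) with (- (0 + - Uf t z0 * dotC I a t) / Uf t z0) by (field; auto).
  rewrite E. field. auto.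
Qed.

Lemma dotC_zpt (k : nat) : In k idx -> dotC I (fun s => zpt (P s) k) t = zptd k.
Proof.
  intros Hk. apply dotC_eq; auto. apply (jd_at I t HI Ht (fun _ s => zpt (P s) k) 0).
  apply jd_zpt; auto.
Qed.

Lemma dotC_zpole : dotC I (fun s => zpole (P s)) t = z0d.
Proof. apply dotC_eq; auto. apply dq_zpole. Qed.

(** The constant [Rt 0] is eliminated between its expressions at z_l and at z0. The term zeta(z0 -
    z_l) from z0, rewritten by oddness, lowers the coefficient 2 of zeta(z_l - z0) in [Llog] to
    1. *)
Lemma zpt_ode (l : nat) : In l idx ->
  dotC I (fun s => zpt (P s) l) t = dotC I (fun s => zpole (P s)) t
    - csum (idx_but l) (fun j => gk j * (zeta (zk l - zk j) - zeta (z0 - zk j) - h1 * (zk l - z0)))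
    - gk l * (csum (idx_but l) (fun s => zeta (zk l - zk s)) + gma - h1 * (zk l - z0)
       - zeta (zk l - z0) - 2 * zeta (zk l - Cconj z0)).
Proof.
  intros Hl. rewrite dotC_zpt, dotC_zpole by auto.
  assert (E1 := extension_at_zpt l Hl). assert (E2 := extension_at_zpole). unfold zsum in E2. rewrite (csum_but l) in E2 by auto.
  assert (Hodd : zeta (z0 - zk l) = - zeta (zk l - z0)).
  { replace (z0 - zk l) with (- (zk l - z0)) by ring. apply wzeta_odd; auto. apply zpt_zpole_notin; auto. }
  assert (E3 : csum (idx_but l) (fun j => gk j * (zeta (zk l - zk j) - zeta (z0 - zk j) - h1 * (zk l - z0)))
    = csum (idx_but l) (fun j => gk j * (zeta (zk l - zk j) - h1 * zk l)) -
      csum (idx_but l) (fun k => gk k * (zeta (z0 - zk k) - h1 * z0))).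
  { transitivity (csum (idx_but l) (fun j => gk j * (zeta (zk l - zk j) - h1 * zk l) +
      (-(1)) * (gk j * (zeta (z0 - zk j) - h1 * z0)))).
    apply csum_ext. intros; ring. rewrite csum_plus, csum_scal. ring. }
  rewrite E3. unfold Llog in E1. rewrite Hodd in E2.
  set (S1 := csum (idx_but l) (fun j => gk j * (zeta (zk l - zk j) - h1 * zk l))) in *.
  set (S2 := csum (idx_but l) (fun k => gk k * (zeta (z0 - zk k) - h1 * z0))) in *.
  set (S3 := csum (idx_but l) (fun j => zeta (zk l - zk j))) in *.
  replace (zptd l) with (- (Rt 0) - gk l * (gma + S3 - 2 * zeta (zk l - z0) - 2 * zeta (zk l - Cconj z0))
     - S1 + gk l * h1 * zk l) by (rewrite E1; ring).
  replace z0d with (- (- z0d)) by ring. rewrite E2. ring.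
Qed.

(** The left side of [ok_res] vanishes at all times, so its time derivative is 0; conj z0 = - z0
    moves with velocity [- z0d], and zeta is differentiated both in its argument and in the
    period. *)
Lemma residue_condition_derivative :
  (beta / PI)%R * (2 * (pdzeta (P t) (1 / 2) * omd)) +
  csum idx (fun k => - pwp (P t) (z0 - zk k) * (z0d - zptd k) + pdzeta (P t) (z0 - zk k) * omd) -
  2 * (- pwp (P t) (z0 - Cconj z0) * (z0d - - z0d) + pdzeta (P t) (z0 - Cconj z0) * omd) = 0.
Proof.
  set (G := fun (_ : C) s => gamma0 beta (P s) + csum idx (fun k => pzeta (P s) (zpole (P s) - zpt (P s) k))
           - 2 * pzeta (P s) (zpole (P s) - Cconj (zpole (P s)))).
  apply (jd_unique I t HI Ht G 0).
  - unfold G. apply (jd_minus I t HI Ht (fun (_ : C) s => gamma0 beta (P s) +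
      csum idx (fun k => pzeta (P s) (zpole (P s) - zpt (P s) k)))).
    + apply (jd_plus I t HI Ht (fun (_ : C) s => gamma0 beta (P s))). apply jd_gamma0.
      assert (K : forall l, (forall k, In k l -> In k idx) ->
        jd I t (fun _ s => csum l (fun k => pzeta (P s) (zpole (P s) - zpt (P s) k))) 0
         (csum l (fun k => - pwp (P t) (z0 - zk k) * (z0d - zptd k) + pdzeta (P t) (z0 - zk k) * omd))).
      { induction l as [|k l IH]; intros H. apply (jd_const I t HI Ht 0).
        apply (jd_plus I t HI Ht (fun _ s => pzeta (P s) (zpole (P s) - zpt (P s) k))
          (fun _ s => csum l (fun k => pzeta (P s) (zpole (P s) - zpt (P s) k)))).
        - apply (jd_pzeta (fun _ s => zpole (P s) - zpt (P s) k)).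
          apply zpole_zpt_notin. apply H; left; auto.
          apply (jd_minus I t HI Ht (fun _ s => zpole (P s)) (fun _ s => zpt (P s) k)).
          apply jd_zpole. apply jd_zpt. apply H; left; auto.
        - apply IH. intros; apply H; right; auto. }
      apply K. auto.
    + apply (jd_scal I t HI Ht (fun _ s => pzeta (P s) (zpole (P s) - Cconj (zpole (P s))))).
      apply (jd_pzeta (fun _ s => zpole (P s) - Cconj (zpole (P s)))).
      apply (zpole_conj_notin t Ht).
      apply (jd_minus I t HI Ht (fun _ s => zpole (P s)) (fun _ s => Cconj (zpole (P s)))).
      apply jd_zpole. apply jd_zpole_conj.
  - split. apply cts_const.
    apply tends_ext with (fun _ => RtoC 0). typeclasses eauto. 2: apply tends_const; typeclasses eauto.
    generalize (near_snd (near 0) (tnear I t) _ (tnear_I I t)). apply filter_imp.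
    intros [u s] [Hs _]. cbn [fst snd]. unfold G.
    rewrite (ok_res _ _ (Hparams s Hs)), (ok_res _ _ (Hparams t Ht)). unfold Cdiv. ring.
Qed.

(** The differentiated residue condition is linear in [yd] with coefficient i Delta. After division
    the x-velocities carry a factor i, and since [yd] is real, taking real parts turns them into
    minus the imaginary parts. *)
Lemma y0_ode : Delta_P (P t) <> 0 ->
  yd = (- rsum idx (fun k => Im (pwp (P t) (z0 - zk k) / Delta_P (P t))%C * xd k)
     + Re ((4 * pdzeta (P t) (z0 - Cconj z0) - (4 * beta / PI)%R * pdzeta (P t) (1 / 2)
             - 2 * csum idx (fun k => pdzeta (P t) (z0 - zk k))
             - pwp (P t) (z0 - zk 3%nat) + pwp (P t) (z0 - zk 4%nat)) / Delta_P (P t))%C * md)%R.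
Proof.
  intros HD. assert (E := residue_condition_derivative).
  unfold Delta_P in *. fold z0 in HD |- *. change (zpt (P t)) with zk in HD |- *.
  unfold csum, rsum, idx in E, HD |- *. cbn [map fold_right zptd] in E, HD |- *.
  set (p1 := pwp (P t) (z0 - zk 1)) in E, HD |- *. set (p2 := pwp (P t) (z0 - zk 2)) in E, HD |- *.
  set (p3 := pwp (P t) (z0 - zk 3)) in E, HD |- *. set (p4 := pwp (P t) (z0 - zk 4)) in E, HD |- *.
  set (p0 := pwp (P t) (z0 - Cconj z0)) in E, HD |- *.
  set (d1 := pdzeta (P t) (z0 - zk 1)) in E, HD |- *. set (d2 := pdzeta (P t) (z0 - zk 2)) in E, HD |- *.
  set (d3 := pdzeta (P t) (z0 - zk 3)) in E, HD |- *. set (d4 := pdzeta (P t) (z0 - zk 4)) in E, HD |- *.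
  set (d0 := pdzeta (P t) (z0 - Cconj z0)) in E, HD |- *. set (dh := pdzeta (P t) (1 / 2)) in E, HD |- *.
  set (D := 4 * p0 - (p1 + (p2 + (p3 + (p4 + 0))))) in *.
  replace (4 * beta / PI)%R with (4 * (beta / PI))%R by (field; apply PI_neq0).
  rewrite RtoC_mult. set (b := RtoC (beta / PI)) in *.
  set (B := 4 * d0 - 4 * b * dh - 2 * (d1 + (d2 + (d3 + (d4 + 0)))) - p3 + p4).
  unfold omd, z0d in E.
  assert (HCi : Ci <> 0) by (intros K; apply (f_equal Im) in K; simpl in K; lra).
  assert (HCi2 : Ci * Ci = - (1)) by (unfold Ci, Cmult, Copp, RtoC; simpl; f_equal; ring).
  (* The terms [- p3 + p4] inside [B] come from the velocities i md and - i md that z_3 and z_4 have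
     besides those of x_3 and x_4. *)
  assert (Ey : RtoC yd = Ci * (p1 / D * xd 1 + p2 / D * xd 2 + p3 / D * xd 3 + p4 / D * xd 4) + B / D * md).
  { set (X := RtoC yd - (Ci * (p1 / D * xd 1 + p2 / D * xd 2 + p3 / D * xd 3 + p4 / D * xd 4) + B / D * md)).
    assert (EX : X * (Ci * D) = 0).
    { rewrite <- E. unfold X. 
      replace ((yd - (Ci * (p1 / D * xd 1 + p2 / D * xd 2 + p3 / D * xd 3 + p4 / D * xd 4) + B / D * md)) * (Ci * D))
        with (yd * Ci * D - (Ci * Ci) * (p1 * xd 1 + p2 * xd 2 + p3 * xd 3 + p4 * xd 4) - B * md * Ci)
        by (field; auto).
      rewrite HCi2. unfold B, D. ring. }
    assert (X0 : X = 0).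
    { replace X with (X * (Ci * D) / (Ci * D)) by (field; auto). rewrite EX. unfold Cdiv; ring. }
    replace (RtoC yd) with (X + (Ci * (p1 / D * xd 1 + p2 / D * xd 2 + p3 / D * xd 3 + p4 / D * xd 4) + B / D * md))
      by (unfold X; ring).
    rewrite X0. ring. }
  clear E. apply (f_equal Re) in Ey.
  set (q1 := p1 / D) in *. set (q2 := p2 / D) in *. set (q3 := p3 / D) in *. set (q4 := p4 / D) in *.
  set (qB := B / D) in *. clearbody q1 q2 q3 q4 qB. destruct q1, q2, q3, q4, qB. cbn in Ey |- *. lra.
Qed.
End Family.

Theorem theorem4 (I : R -> Prop) (theta beta : R) (P : R -> params)
    (f : R -> C -> sphere) (a : R -> C)
    (HI : is_interval I)
    (Hbeta : (0 < beta < 2 * PI)%R)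
    (Hsmooth : smooth_params I P)
    (Hparams : forall t, I t -> params_ok beta (P t))
    (Hf : forall t, I t ->
       exists p1 q1 p2 q2 : R, slit_map theta beta (P t) (f t) p1 q1 p2 q2)
    (Ha_smooth : smoothC I a)
    (Ha : forall t, I t -> Cexp (a t) = residue beta (P t))
    (t : R) (Ht : I t) :
  let z0 := zpole (P t) in
  let z := zpt (P t) in
  let ze := pzeta (P t) in
  let pe := pwp (P t) in
  let dze := pdzeta (P t) in
  let h1 := eta1 (P t) in
  let g := fun k => gam I beta P f k t in
  let D := Delta_P (P t) in
  (forall l : nat, (1 <= l <= 4)%nat ->
     dotC I (fun s => zpt (P s) l) t =
       dotC I (fun s => zpole (P s)) t
       - csum (idx_but l)
           (fun j => g j * (ze (z l - z j) - ze (z0 - z j) - h1 * (z l - z0)))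
       - g l * (csum (idx_but l) (fun s => ze (z l - z s))
                + gamma0 beta (P t) - h1 * (z l - z0)
                - ze (z l - z0) - 2 * ze (z l - Cconj z0)))
  /\
  dotC I a t = csum idx (fun j => g j * (pe (z0 - z j) + h1))
  /\
  (D <> 0 ->
   dotR I (fun s => py0 (P s)) t =
     (- rsum idx (fun k =>
          Im (pe (z0 - z k) / D)%C * dotR I (fun s => px (P s) k) t)
      + Re ((4 * dze (z0 - Cconj z0)
             - (4 * beta / PI)%R * dze (1 / 2)
             - 2 * csum idx (fun k => dze (z0 - z k))
             - pe (z0 - z 3%nat) + pe (z0 - z 4%nat)) / D)%C
        * dotR I (fun s => pm (P s)) t)%R).
Proof.
  intros z0 z ze pe dze h1 g D.
  split; [|split].
  - intros l Hl.
    apply (zpt_ode I theta beta P f HI Hsmooth Hparams Hf t Ht l).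
    unfold idx; simpl. lia.
  - rewrite (dot_log_residue I beta P HI Hsmooth Hparams t Ht a Ha_smooth Ha).
    apply (log_residue_ode I theta beta P f HI Hsmooth Hparams Hf t Ht).
  - intros HD. apply (y0_ode I beta P HI Hsmooth Hparams t Ht HD).
Qed.
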